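(* Let $M$ be any one of the eight Archimedean tilings of the Euclidean plane, namely $3.3.3.3.6$, $3.3.3.4.4$, $3.3.4.3.4$, $3.6.3.6$, $3.12.12$, $4.6.12$, $4.8.8$ or $3.4.6.4$, viewed as a map on $\mathbb{E}^2$. Then the surface underlying the minimal regular cover of $M$ is homeomorphic to the Loch Ness monster.
   Context: Archimedean tilings. These are the tessellations of $\mathbb{E}^2$ by (geometrically) regular convex polygons whose symmetry group is transitive on vertices, other than the three regular tessellations (by equilateral triangles, squares, regular hexagons). Each is determined by its vertex symbol, the cyclic sequence of the numbers of edges of the faces around a vertex. Maps. A map $M$ is an embedding of a locally finite graph in a surface $S$ with vertices going to a discrete set of points, edges to non-self-intersecting arcs meeting only in common vertices, and complementary components (faces) homeomorphic to open discs. Flags and monodromy group. A flag of $M$ is an incident triple $(v,e,F)$ of vertex, edge and face (thought of as a triangle with corners $v$, the midpoint of $e$, and a fixed interior point of $F$). $\mathcal{F}(M)$ is the set of flags. For $i\in\{0,1,2\}$, each flag $\Phi$ has a unique $i$-adjacent flag $\Phi^i$ that differs from $\Phi$ precisely in the vertex ($i=0$), the edge ($i=1$) or the face ($i=2$). Let $r_i$ be the permutation $\Phi\mapsto\Phi^i$ of $\mathcal{F}(M)$. The monodromy group is $\mathrm{Mon}(M)=\langle r_0,r_1,r_2\rangle\le \mathrm{Sym}(\mathcal{F}(M))$, acting on flags on the right. Minimal regular cover. A map is regular if its automorphism group acts transitively on flags. The minimal regular cover $\widetilde{M}$ of $M$, on the surface $\widetilde{S}$, is the regular map with $\mathrm{Aut}(\widetilde{M})\cong\mathrm{Mon}(M)$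 constructed as follows: take one triangle $t_g$ with sides labelled $0,1,2$ for each $g\in\mathrm{Mon}(M)$, and identify the side labelled $i$ of $t_{g_1}$ with the side labelled $i$ of $t_{g_2}$ whenever $g_1=g_2r_i$. The triangles are the flags of $\widetilde{M}$; the corners of $t_g$ opposite to sides $0,1,2$ are respectively a vertex, an edge midpoint and a face centre. Loch Ness monster. Surfaces are connected, orientable 2-manifolds without boundary, not necessarily compact. An end of a space $X$ is a function $E$ assigning to each compact $K\subset X$ one connected component $E(K)$ of $X\setminus K$, with $E(K)\supset E(L)$ whenever $K\subset L$. A subsurface is a closed region whose boundary consists of finitely many disjoint simple closed curves; a compact bordered surface with Euler characteristic $\chi$ and $q$ boundary curves has genus $1-\frac12(\chi+q)$; the genus of a surface is the maximum of the genera of its compact subsurfaces (infinite if unbounded). The Loch Ness monster is the surface, unique up to homeomorphism, of infinite genus with exactly one end. *)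

(* Defs.v *)
From HB Require Import structures.
From Stdlib Require Import Relation_Operators.
From mathcomp Require Import all_boot all_order all_algebra.
From mathcomp Require Import all_classical all_reals all_analysis.

Set Implicit Arguments.
Unset Strict Implicit.
Unset Printing Implicit Defensive.

Import Order.TTheory GRing.Theory Num.Theory.
Import numFieldNormedType.Exports.

Local Open Scope classical_set_scope.
Local Open Scope quotient_scope.
Local Open Scope ring_scope.

(** * Euclidean spaces *)

(* The library norm on ['rV[R]_n] is the sup norm; it induces the usual topology
   but not the Euclidean metric. *)
Definition enorm (R : realType) (n : nat) (x : 'rV[R]_n) : R :=
  Num.sqrt (\sum_(i < n) x ord0 i ^+ 2).

Definition closed_disc (R : realType) (n : nat) : set 'rV[R]_n :=
  [set x | enorm x <= 1].
Definition open_disc (R : realType) (n : nat) : set 'rV[R]_n :=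
  [set x | enorm x < 1].
Definition unit_sphere (R : realType) (n : nat) : set 'rV[R]_n :=
  [set x | enorm x = 1].

Arguments closed_disc R n _ : clear implicits.
Arguments open_disc R n _ : clear implicits.
Arguments unit_sphere R n _ : clear implicits.

Notation plane R := 'rV[R]_2.

Definition polar (R : realType) (r t : R) : plane R :=
  \row_(i < 2) (if i == ord0 then r * cos t else r * sin t).

Definition plane_isometry (R : realType) (f : plane R -> plane R) : Prop :=
  forall x y, enorm (f x - f y) = enorm (x - y).

(** * Flags, monodromy group and minimal regular cover *)

(* Faces are recorded as closed sets, so that incidence is containment. *)
Record cells (S : Type) := Cells {
  vertices : set S ;
  edges : set (set S) ;
  faces : set (set S) }.

Definition flags (S : Type) (M : cells S) : set (S * set S * set S) :=
  [set Phi | [/\ vertices M Phi.1.1, edges M Phi.1.2, faces M Phi.2,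
                 Phi.1.2 Phi.1.1 & Phi.1.2 `<=` Phi.2]].

Definition flag_adjacent (S : Type) (M : cells S) (i : 'I_3)
    (Phi Psi : flags M) : Prop :=
  let: (v, e, F) := \val Phi in
  let: (v', e', F') := \val Psi in
  [/\ (v' = v <-> i <> 0%N :> nat),
      (e' = e <-> i <> 1%N :> nat)
    & (F' = F <-> i <> 2%N :> nat)].

(* In a map the [i]-adjacent flag exists and is unique; the default value [Phi]
   only serves to make the function total. *)
Definition flag_swap (S : choiceType) (M : cells S) (i : 'I_3) (Phi : flags M) :
    flags M :=
  xget Phi [set Psi | flag_adjacent i Phi Psi].

Definition is_perm_group (F : Type) (H : set (F -> F)) : Prop :=
  [/\ H id,
      forall g h, H g -> H h -> H (h \o g)
    & forall g, H g -> exists2 h, H h & cancel g h /\ cancel h g].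

Definition Mon (S : choiceType) (M : cells S) : set (flags M -> flags M) :=
  smallest (@is_perm_group (flags M)) (range (@flag_swap S M)).
Arguments Mon {S} M _.

(* The model triangle in barycentric coordinates; its side [i], opposite to
   corner [i], is where coordinate [i] vanishes. *)
Definition triangle (R : realType) : set 'rV[R]_3 :=
  [set x | (forall i, 0 <= x ord0 i) /\ \sum_(i < 3) x ord0 i = 1].
Arguments triangle R _ : clear implicits.

Section MinimalRegularCover.
Variables (R : realType) (S : choiceType) (M : cells S).

Definition triangles : topologicalType :=
  (discrete_topology (Mon M) * triangle R)%type.

(* Permutations act on the right, so that the product [g2 r_i] is the function
   [flag_swap i \o g2]. *)
Definition glue_step (p q : triangles) : Prop :=
  exists i : 'I_3,
    [/\ \val (p.1 : Mon M) = flag_swap i \o \val (q.1 : Mon M),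
        p.2 = q.2 & \val p.2 ord0 i = 0].

Definition glued (p q : triangles) : bool :=
  `[< clos_refl_sym_trans _ glue_step p q >].

Lemma glued_refl : reflexive glued.
Proof. by move=> p; apply/asboolP; exact: rst_refl. Qed.

Lemma glued_sym : symmetric glued.
Proof.
by move=> p q; apply/idP/idP => /asboolP pq; apply/asboolP; exact: rst_sym.
Qed.

Lemma glued_trans : transitive glued.
Proof.
by move=> q p r /asboolP pq /asboolP qr; apply/asboolP; exact: rst_trans pq qr.
Qed.

Definition glued_equiv : equiv_rel triangles :=
  EquivRel glued glued_refl glued_sym glued_trans.

Definition minimal_regular_cover : topologicalType :=
  quotient_topology {eq_quot glued_equiv}.

End MinimalRegularCover.

(** * Archimedean tilings *)

Section Tilings.
Variable R : realType.

Definition ngon_corner (n : nat) (c : plane R) (rho theta : R) (k : nat) :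
    plane R :=
  c + polar rho (theta + 2 * pi * k%:R / n%:R).

Definition convex_hull (n : nat) (p : 'I_n -> plane R) : set (plane R) :=
  [set x | exists w : 'I_n -> R, [/\ forall i, 0 <= w i, \sum_(i < n) w i = 1
                                   & x = \sum_(i < n) w i *: p i]].

Definition segment (a b : plane R) : set (plane R) :=
  [set (1 - t) *: a + t *: b | t in `[0, 1]].

Definition ngon (n : nat) (c : plane R) (rho theta : R) : set (plane R) :=
  convex_hull (fun k : 'I_n => ngon_corner n c rho theta k).

Definition regular_polygon (n : nat) (P : set (plane R)) : Prop :=
  exists c rho theta, [/\ (3 <= n)%N, 0 < rho & P = ngon n c rho theta].

Definition corner (P : set (plane R)) (v : plane R) : Prop :=
  exists n c rho theta k, [/\ (3 <= n)%N, 0 < rho, P = ngon n c rho theta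
                            & v = ngon_corner n c rho theta k].

Definition side (P e : set (plane R)) : Prop :=
  exists n c rho theta k, [/\ (3 <= n)%N, 0 < rho, P = ngon n c rho theta
    & e = segment (ngon_corner n c rho theta k)
                  (ngon_corner n c rho theta k.+1)].

(* The last clause (tiles meet edge to edge) entails that distinct tiles have
   disjoint interiors. *)
Definition tessellation (T : set (set (plane R))) : Prop :=
  [/\ forall P, T P -> exists n, regular_polygon n P,
      \bigcup_(P in T) P = setT,
      forall x : plane R, exists2 U, nbhs x U &
        finite_set [set P | T P /\ P `&` U !=set0]
    & forall P Q, T P -> T Q -> P <> Q ->
        [\/ P `&` Q = set0,
            exists v, [/\ corner P v, corner Q v & P `&` Q = [set v]]
          | side P (P `&` Q) /\ side Q (P `&` Q)]].

Definition tiling_map (T : set (set (plane R))) : cells (plane R) := {|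
  vertices := [set v | exists2 P, T P & corner P v] ;
  edges := [set e | exists2 P, T P & side P e] ;
  faces := T |}.

Definition tiling_symmetry (T : set (set (plane R))) (f : plane R -> plane R) :
    Prop :=
  plane_isometry f /\ forall P, T P <-> T (f @` P).

Definition vertex_transitive (T : set (set (plane R))) : Prop :=
  forall v w, vertices (tiling_map T) v -> vertices (tiling_map T) w ->
    exists2 f, tiling_symmetry T f & f v = w.

(* [ordS] is the cyclic successor: consecutive tiles around [v] share an edge
   at [v]. *)
Definition vertex_symbol (T : set (set (plane R))) (v : plane R) (s : seq nat) :
    Prop :=
  exists P : 'I_(size s) -> set (plane R),
    [/\ injective P,
        range P = [set Q | T Q /\ Q v],
        forall i : 'I_(size s), regular_polygon (nth 0%N s i) (P i)
      & forall i : 'I_(size s), exists e,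
          [/\ side (P i) e, side (P (ordS i)) e & e v]].

Definition archimedean_tiling (T : set (set (plane R))) : Prop :=
  [/\ tessellation T,
      vertex_transitive T
    & ~ exists2 n, n \in [:: 3; 4; 6]%N & forall P, T P -> regular_polygon n P].

Definition archimedean_symbols : seq (seq nat) :=
  [:: [:: 3; 3; 3; 3; 6]; [:: 3; 3; 3; 4; 4]; [:: 3; 3; 4; 3; 4];
      [:: 3; 6; 3; 6]; [:: 3; 12; 12]; [:: 4; 6; 12]; [:: 4; 8; 8];
      [:: 3; 4; 6; 4]]%N.

End Tilings.

(** * Surfaces *)

Definition homeomorphic (X Y : topologicalType) : Prop :=
  exists (f : X -> Y) (g : Y -> X),
    [/\ continuous f, continuous g, cancel f g & cancel g f].

Section Surfaces.
Variables (R : realType) (X : topologicalType).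

Record chart := Chart {
  chart_dom : set X ;
  chart_map : X -> plane R ;
  chart_inv : plane R -> X ;
  chart_dom_open : open chart_dom ;
  chart_image_open : open (chart_map @` chart_dom) ;
  chart_mapK : forall x, chart_dom x -> chart_inv (chart_map x) = x ;
  chart_map_continuous : {within chart_dom, continuous chart_map} ;
  chart_inv_continuous :
    {within chart_map @` chart_dom, continuous chart_inv} }.

Definition two_manifold : Prop :=
  [/\ hausdorff_space X, @second_countable X
    & forall x, exists c : chart, chart_dom c x].

(* [h] maps every small circle around [p] to a loop with winding number 1
   around [h p]; [theta] is a continuous argument along that loop. *)
Definition orientation_preserving_at (h : plane R -> plane R) (p : plane R) :
    Prop :=
  \forall r \near (0 : R)^'+, exists rho theta : R -> R,
    [/\ continuous theta,
        forall t, theta (t + 2 * pi) = theta t + 2 * pi,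
        forall t, 0 < rho t
      & forall t, h (p + polar r t) = h p + polar (rho t) (theta t)].

Definition orientable : Prop :=
  exists A : set chart,
    (forall x, exists2 c, A c & chart_dom c x) /\
    (forall c d, A c -> A d -> forall x, chart_dom c x -> chart_dom d x ->
      orientation_preserving_at (chart_map d \o chart_inv c) (chart_map c x)).

Definition surface : Prop :=
  [/\ [set: X] !=set0, connected [set: X], two_manifold & orientable].

Definition simple_closed_curve (C : set X) : Prop :=
  exists f : plane R -> X,
    [/\ {within unit_sphere R 2, continuous f},
        {in unit_sphere R 2 &, injective f}
      & C = f @` unit_sphere R 2].

(* A region is the closure of a nonempty connected open set. *)
Definition subsurface (K : set X) (q : nat) : Prop :=
  (exists U, [/\ open U, U !=set0, connected U & K = closure U]) /\
  exists C : 'I_q -> set X,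
    [/\ forall i, simple_closed_curve (C i),
        forall i j, i <> j -> C i `&` C j = set0
      & K `\` K° = \bigcup_i C i].

(* [chi] is the alternating number of cells of a finite CW decomposition of the
   compact set [K]; cell [i] has dimension [d i] and characteristic map [phi i]. *)
Definition euler_characteristic (K : set X) (chi : int) : Prop :=
  exists (I : finType) (d : I -> nat) (phi : forall i, 'rV[R]_(d i) -> X),
    [/\ forall i, {within closed_disc R (d i), continuous (phi i)},
        forall i, {in open_disc R (d i) &, injective (phi i)},
        trivIset setT (fun i => phi i @` open_disc R (d i)) /\
        K = \bigcup_i (phi i @` open_disc R (d i)),
        forall i, phi i @` unit_sphere R (d i) `<=`
          \bigcup_(j in [set j | (d j < d i)%N]) (phi j @` open_disc R (d j))
      & chi = \sum_(i : I) (-1) ^+ d i].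

Definition bordered_genus (chi : int) (q : nat) : rat :=
  1 - (chi%:~R + q%:R) / 2.

Definition infinite_genus : Prop :=
  forall n : nat, exists (K : set X) (q : nat) (chi : int),
    [/\ compact K, subsurface K q, euler_characteristic K chi
      & n%:R <= bordered_genus chi q].

Definition is_component (A C : set X) : Prop :=
  exists2 x, A x & C = connected_component A x.

(* Only the values of [E] on compact sets are meaningful. *)
Definition is_end (E : set X -> set X) : Prop :=
  (forall K, compact K -> is_component (~` K) (E K)) /\
  (forall K L, compact K -> compact L -> K `<=` L -> E L `<=` E K).

Definition one_end : Prop :=
  exists2 E, is_end E &
    forall E', is_end E' -> forall K, compact K -> E' K = E K.

Definition loch_ness_monster : Prop :=
  [/\ surface, infinite_genus & one_end].

End Surfaces.

(* By the classification of noncompact surfaces, any two spaces [L] satisfying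
   [loch_ness_monster] are homeomorphic. *)
Definition homeomorphic_to_loch_ness_monster (R : realType)
    (X : topologicalType) : Prop :=
  exists2 L : topologicalType, loch_ness_monster R L & homeomorphic X L.

(* Main.v *)
(** The monodromy group [G] acts simply transitively on the triangles of the
    cover, and its three corner types have valences [size s], [2] and the least
    common multiple [l] of [s].  Around each corner the triangles form a cyclic
    fan, which gives star charts; the orientation of flags in the plane gives a
    2-colouring of the triangles, hence an orientation.

    Since edges have only 24 directions and the tiling is vertex-transitive,
    two symmetries often differ by a translation, so the flags form finitely
    many orbits of a group Z^2 of translations commuting with [G].  An element of
    [G] is determined by its values on the orbit representatives, which it moves
    by at most a linear function of its word length: [G] has polynomial growth.
    Its elements acting as translations on every flag form an abelian subgroup
    of finite index containing Z^2, so its Cayley graph has one end.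

    Polynomial growth gives connected Folner sets [B].  Take the union [K] of the
    cells, of the cell structure dual to the triangulation, that belong to
    corners of triangles in [B].  It is a compact bordered surface with about
    [|B|] vertices, [3|B|/2] edges and [|B|(1/size s + 1/2 + 1/l)/2] faces, up to
    a small multiple of [|B|].  As [1/size s + 1/2 + 1/l < 1] for all eight
    symbols, the genus of [K] is unbounded. *)

Require Import Defs.
From Stdlib Require Import Relation_Operators.
From mathcomp Require Import all_boot all_order all_algebra.
From mathcomp Require Import all_classical all_reals all_analysis.
From mathcomp Require Import zify ring lra.

Set Implicit Arguments.
Unset Strict Implicit.
Unset Printing Implicit Defensive.

Import Order.TTheory GRing.Theory Num.Theory.
Import numFieldNormedType.Exports.

Local Open Scope classical_set_scope.
Local Open Scope quotient_scope.
Local Open Scope ring_scope.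

(** * Pasting and plane geometry *)

(** The cover is an abstract quotient without a planar picture. Two devices replace one. A point is
    addressed by a triangle and barycentric coordinates, and two addresses agree exactly when the
    coordinates do and the triangles are joined by crossing sides on which the point lies. Maps from
    discs and circles are pasted from equal angular sectors; inverse charts, 2-cells and boundary
    curves all arise in this way. Orientability is made explicit: between charts around corners of
    different types the transition map is, in suitable frames, a shear, and the argument of the
    image of a small circle is a formula with an arctangent. The lattice of translations does not
    have to act by symmetries of the tiling. It only has to carry flags to flags and commute with
    the swaps. Two symmetries that send the base flag to flags with parallel equally directed sides
    are compared along words of swaps; face sizes agree on both sides because both flags are images
    of the same flag. The number 24 is the least common multiple of the face sizes 3, 4, 6, 8, 12,
    so every turn at a corner is a multiple of a 24th of a full turn. *)

Section Pasting.

(** Compact sets in a Hausdorff space are closed, so the finitely many [e i] together form a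
    quotient map onto their image. They may overlap and need not be injective. *)
Lemma within_pasting (I : finType) (C Y Z : topologicalType) (K : set C)
    (e : I -> C -> Y) (f : Y -> Z) :
  compact K -> hausdorff_space Y ->
  (forall i, {within K, continuous (e i)}) ->
  (forall i, {within K, continuous (f \o e i)}) ->
  {within \bigcup_i e i @` K, continuous f}.
Proof.
move=> cK hY ce cfe; apply/continuous_closedP => A cA; apply/closed_subspaceP.
exists (\bigcup_i e i @` (K `&` (f \o e i) @^-1` A)).
  apply: closed_bigcup => [|i _]; first exact: finite_finset.
  apply: compact_closed => //; apply: continuous_compact.
    by apply: continuous_subspaceW (ce i) => x [].
  have /continuous_closedP/(_ _ cA)/closed_subspaceP[V cV VK] := cfe i.
  by rewrite setIC -VK setIC; exact: compact_closedI.
apply/seteqP; split => y /=.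
  by case=> -[i _ [x [Kx Ax] <-]] De; split.
by case=> Ay [i _ [x Kx xy]]; split; exists i => //; exists x; rewrite /= ?xy.
Qed.

Lemma within_comp (A B C : topologicalType) (D : set A) (E : set B)
    (f : A -> B) (g : B -> C) :
  (forall x, D x -> E (f x)) -> {within D, continuous f} ->
  {within E, continuous g} -> {within D, continuous (g \o f)}.
Proof.
move=> DE cf cg; apply/continuous_closedP => V cV; apply/closed_subspaceP.
have /continuous_closedP/(_ _ cV)/closed_subspaceP[V1 cV1 VE] := cg.
have /continuous_closedP/(_ _ cV1)/closed_subspaceP[V2 cV2 VD] := cf.
exists V2 => //; rewrite VD; apply/seteqP; split => x /= [h Dx]; split => //.
  by have [] : (g @^-1` V `&` E) (f x) by rewrite -VE; split => //; exact: DE.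
by have [] : (V1 `&` E) (f x) by rewrite VE; split => //; exact: DE.
Qed.

Lemma within_ext (A B : topologicalType) (D : set A) (f g : A -> B) :
  (forall x, D x -> f x = g x) -> {within D, continuous f} ->
  {within D, continuous g}.
Proof.
move=> fg cf; apply/continuous_closedP => V cV; apply/closed_subspaceP.
have /continuous_closedP/(_ _ cV)/closed_subspaceP[V1 cV1 VE] := cf.
exists V1 => //; rewrite VE; apply/seteqP; split => x /= [h Dx]; split => //.
  by rewrite /from_subspace -fg.
by rewrite /from_subspace fg.
Qed.

End Pasting.

Section RealContinuity.
Variables (R : realType) (T : topologicalType).
Implicit Types f g : T -> R.

Lemma contC (c : R) : continuous (fun _ : T => c).
Proof. by move=> x; exact: cvg_cst. Qed.

Lemma contD f g : continuous f -> continuous g -> continuous (fun x => f x + g x).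
Proof. by move=> fc gc x; exact: (cvgD (fc x) (gc x)). Qed.

Lemma contN f : continuous f -> continuous (fun x => - f x).
Proof. by move=> fc x; exact: (cvgN (fc x)). Qed.

Lemma contM f g : continuous f -> continuous g -> continuous (fun x => f x * g x).
Proof. by move=> fc gc x; exact: (cvgM (fc x) (gc x)). Qed.

Lemma contV f : continuous f -> (forall x, f x != 0) -> continuous (fun x => (f x)^-1).
Proof. by move=> fc f0 x; exact: (cvgV (f0 x) (fc x)). Qed.

Lemma contX f n : continuous f -> continuous (fun x => f x ^+ n).
Proof.
by move=> fc x; exact: (continuous_comp (fc x) (@exprn_continuous R n (f x))).
Qed.

Lemma cont_norm f : continuous f -> continuous (fun x => `|f x|).
Proof. by move=> fc x; exact: (cvg_norm (fc x)). Qed.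

Lemma cont_sum (I : Type) (s : seq I) (P : pred I) (F : I -> T -> R) :
  (forall i, continuous (F i)) -> continuous (fun x => \sum_(i <- s | P i) F i x).
Proof.
move=> Fc; elim: s => [|i s IH].
  by under eq_fun do rewrite big_nil; exact: contC.
under eq_fun do rewrite big_cons; case: (P i) => //; exact: contD.
Qed.

End RealContinuity.

(** * Polar and sector coordinates in the plane *)

Section Plane.
Variable R : realType.
Implicit Types (z w : plane R) (a b s t tau : R).

Definition vec2 a b : plane R := \row_(i < 2) (if i == ord0 then a else b).
Definition px z := z ord0 ord0.
Definition py z := z ord0 ord_max.

Lemma plane_eqP z w : z = w <-> px z = px w /\ py z = py w.
Proof.
split=> [-> //|[hx hy]]; apply/rowP => i.
case: i => [[|[|//]]] h.
  by rewrite (_ : Ordinal h = ord0) //; exact: val_inj.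
by rewrite (_ : Ordinal h = ord_max) //; exact: val_inj.
Qed.

Lemma px_vec2 a b : px (vec2 a b) = a. Proof. by rewrite /px mxE. Qed.
Lemma py_vec2 a b : py (vec2 a b) = b. Proof. by rewrite /py mxE. Qed.
Lemma px_polar s t : px (polar s t) = s * cos t.
Proof. by rewrite /px mxE. Qed.
Lemma py_polar s t : py (polar s t) = s * sin t.
Proof. by rewrite /py mxE. Qed.
Lemma pxD z w : px (z + w) = px z + px w. Proof. by rewrite /px mxE. Qed.
Lemma pyD z w : py (z + w) = py z + py w. Proof. by rewrite /py mxE. Qed.
Lemma pxN z : px (- z) = - px z. Proof. by rewrite /px mxE. Qed.
Lemma pyN z : py (- z) = - py z. Proof. by rewrite /py mxE. Qed.
Lemma pxZ a z : px (a *: z) = a * px z. Proof. by rewrite /px mxE. Qed.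
Lemma pyZ a z : py (a *: z) = a * py z. Proof. by rewrite /py mxE. Qed.
Lemma px0 : px 0 = 0. Proof. by rewrite /px mxE. Qed.
Lemma py0 : py 0 = 0. Proof. by rewrite /py mxE. Qed.
Definition pxy := (px_vec2, py_vec2, px_polar, py_polar, pxD, pyD, pxN, pyN,
  pxZ, pyZ, px0, py0).

Lemma px_continuous : continuous px.
Proof. by move=> z; exact: coord_continuous. Qed.
Lemma py_continuous : continuous py.
Proof. by move=> z; exact: coord_continuous. Qed.

Lemma row_continuous (T : topologicalType) n (f : T -> 'rV[R]_n) :
  (forall i, continuous (fun x => f x ord0 i)) -> continuous f.
Proof.
move=> fc x A [P Pn PA].
apply: (@filterS _ (nbhs x) _ [set y | forall i, P ord0 i (f y ord0 i)]).
  by move=> y Py; apply: PA => i j; rewrite (ord1 i); exact: Py.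
apply: filter_forall => i; apply: (fc i x); exact: Pn.
Qed.

Lemma vec2_continuous (T : topologicalType) (f g : T -> R) :
  continuous f -> continuous g -> continuous (fun x => vec2 (f x) (g x)).
Proof.
move=> fc gc; apply: row_continuous => i; rewrite /vec2.
have [->|i0] := eqVneq i ord0.
  by rewrite (_ : (fun x => _) = f) //; apply/funext => x; rewrite mxE.
by rewrite (_ : (fun x => _) = g) //; apply/funext => x; rewrite mxE (negbTE i0).
Qed.

Lemma enormE z : enorm z = Num.sqrt (px z ^+ 2 + py z ^+ 2).
Proof.
rewrite /enorm big_ord_recl big_ord1 /px /py; congr (Num.sqrt (_ + _ ^+ 2)).
by congr (z _ _); exact: val_inj.
Qed.

Lemma enorm_ge0 z : 0 <= enorm z. Proof. exact: sqrtr_ge0. Qed.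

Lemma enorm_sq z : enorm z ^+ 2 = px z ^+ 2 + py z ^+ 2.
Proof. by rewrite enormE sqr_sqrtr // addr_ge0 // sqr_ge0. Qed.

Lemma enorm_polar s t : enorm (polar s t) = `|s|.
Proof.
rewrite enormE !pxy -sqrtr_sqr; congr Num.sqrt.
by rewrite !exprMn -mulrDr cos2Dsin2 mulr1.
Qed.

Lemma enorm0_eq0 z : enorm z = 0 -> z = 0.
Proof.
move=> z0; have /eqP := enorm_sq z.
rewrite z0 expr0n /= eq_sym paddr_eq0 ?sqr_ge0 // !sqrf_eq0 => /andP[/eqP a /eqP b].
by apply/plane_eqP; rewrite a b !pxy.
Qed.

Lemma enorm_continuous : continuous (@enorm R 2).
Proof.
rewrite (_ : @enorm R 2 = fun z => Num.sqrt (px z ^+ 2 + py z ^+ 2)); last first.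
  by apply/funext => z; exact: enormE.
move=> z; apply: (@continuous_comp _ _ _ (fun z => px z ^+ 2 + py z ^+ 2)).
  have c (f : plane R -> R) : continuous f -> f x ^+ 2 @[x --> z] --> f z ^+ 2.
    by move=> fc; exact: (@continuousM _ _ f f z (fc z) (fc z)).
  exact: (cvgD (c _ px_continuous) (c _ py_continuous)).
exact: sqrt_continuous.
Qed.

Lemma polar_exists z : exists s t,
  [/\ 0 <= s, 0 <= t < 2 * pi & z = polar s t].
Proof.
have p0 := pi_gt0 R.
have [z0|z0] := eqVneq (enorm z) 0.
  exists 0, 0; split; rewrite ?lexx ?mulr_gt0 //.
  by rewrite (enorm0_eq0 z0); apply/plane_eqP; rewrite !pxy !mul0r.
have e0 : 0 < enorm z by rewrite lt_neqAle eq_sym z0 enorm_ge0.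
pose c := px z / enorm z; pose d := py z / enorm z.
have cd : c ^+ 2 + d ^+ 2 = 1.
  by rewrite /c /d !exprMn -mulrDl -enorm_sq -exprMn divff // expr1n.
have c1 : -1 <= c <= 1.
  rewrite -ler_norml -(@ler_sqr _ `|c| 1) ?nnegrE ?normr_ge0 //.
  by rewrite real_normK ?num_real // expr1n -cd lerDl sqr_ge0.
have sd : Num.sqrt (1 - c ^+ 2) = `|d|.
  by rewrite -cd addrAC subrr add0r sqrtr_sqr.
have zc : enorm z * c = px z by rewrite /c mulrC divfK.
have zd : enorm z * d = py z by rewrite /d mulrC divfK.
exists (enorm z).
have [d0|d0] := leP 0 d.
  exists (acos c); split; first exact: enorm_ge0.
    rewrite acos_ge0 //=; apply: (le_lt_trans (acos_lepi c1)).
    by rewrite -[ltLHS]mul1r ltr_pM2r // ltr1n.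
  apply/plane_eqP; rewrite !pxy acosK ?in_itv //= sin_acos // sd ger0_norm //.
have c2 : -1 < c <= 1.
  rewrite (andP c1).2 andbT lt_neqAle (andP c1).1 andbT.
  apply/eqP => cN; move: cd; rewrite -cN sqrrN expr1n => /eqP.
  by rewrite addrC eq_sym -subr_eq subrr eq_sym sqrf_eq0 => /eqP d00; rewrite d00 ltxx in d0.
have c3 : -1 <= c < 1.
  rewrite (andP c1).1 /= lt_neqAle (andP c1).2 andbT.
  apply/eqP => cN; move: cd; rewrite cN expr1n => /eqP.
  by rewrite addrC eq_sym -subr_eq subrr eq_sym sqrf_eq0 => /eqP d00; rewrite d00 ltxx in d0.
exists (2 * pi - acos c); split; first exact: enorm_ge0.
  have := acos_gt0 c3; have := acos_lepi c1; lra.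
have e1 : 2 * pi = pi *+ 2 :> R by rewrite mulr_natl.
apply/plane_eqP; rewrite !pxy cosB sinB e1 cos2pi sin2pi !mul0r !mul1r addr0 sub0r.
by rewrite acosK ?in_itv //= sin_acos // sd ltr0_norm // opprK.
Qed.

(** By the half-angle formula [sin (t / 2)] vanishes, and it has only one zero in the open range. *)
Lemma cos_eq1 t : - (2 * pi) < t < 2 * pi -> cos t = 1 -> t = 0.
Proof.
move=> /andP[t1 t2] ct; have p0 := pi_gt0 R.
have e : cos t = 1 - sin (t / 2) ^+ 2 *+ 2.
  rewrite {1}(_ : t = (t / 2) *+ 2); last by rewrite mulr2n; lra.
  by rewrite cos_mulr2n cos2sin2 !mulr2n; lra.
have /eqP : sin (t / 2) ^+ 2 = 0 by move: e; rewrite ct mulr2n; lra.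
rewrite sqrf_eq0 => /eqP s0; case: (ltrgtP t 0) => // h.
  have : 0 < sin (- (t / 2)) by apply: sin_gt0_pi; lra.
  by rewrite sinN s0 oppr0 ltxx.
have : 0 < sin (t / 2) by apply: sin_gt0_pi; lra.
by rewrite s0 ltxx.
Qed.

Lemma polar_inj s t s' t' : 0 <= s -> 0 <= s' -> 
  0 <= t <= 2 * pi -> 0 <= t' <= 2 * pi -> polar s t = polar s' t' ->
  s = s' /\ (s = 0 \/ t = t' \/ (t = 0 /\ t' = 2 * pi) \/ (t = 2 * pi /\ t' = 0)).
Proof.
move=> s0 s'0 t0 t'0 e.
have ss : s = s'.
  by have := enorm_polar s t; rewrite e enorm_polar !ger0_norm.
split=> //; have [->|sn] := eqVneq s 0; [by left|right].
have /plane_eqP[] := e; rewrite !pxy -ss => /(mulfI sn) c1 /(mulfI sn) c2.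
have c3 : cos (t - t') = 1.
  by rewrite cosB c1 c2 -!expr2 cos2Dsin2.
have [h|h] := boolP (- (2 * pi) < t - t' < 2 * pi).
  by have := cos_eq1 h c3; left; lra.
right; move: h; rewrite negb_and -!leNgt => /orP[] h; [left|right]; lra.
Qed.

(** Sector coordinates: the full turn is cut into [N] equal sectors, [n] counts sectors and [tau] in
    [0, 1] is the fraction swept of the current one. *)
Definition ang (N n : nat) tau : R := 2 * pi * (n%:R + tau) / N%:R.

Lemma ang_in N n tau : (n < N)%N -> 0 <= tau <= 1 -> 0 <= ang N n tau <= 2 * pi.
Proof.
move=> nN t01; have N0 : 0 < N%:R :> R by rewrite ltr0n (leq_trans _ nN).
have p0 := pi_gt0 R; have n0 : 0 <= n%:R :> R by [].
have n1 : n%:R + 1 <= N%:R :> R by rewrite natr1 ler_nat.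
rewrite /ang; apply/andP; split.
  by rewrite divr_ge0 ?mulr_ge0 ?ler0n ?(ltW p0) //; lra.
by rewrite ler_pdivrMr // ler_pM2l ?mulr_gt0 //; lra.
Qed.

Lemma sector_exists N z : (0 < N)%N -> exists n s tau,
  [/\ (n < N)%N, 0 <= s, 0 <= tau <= 1 & z = polar s (ang N n tau)].
Proof.
move=> N0; have [s [t [s0 t0 ->]]] := polar_exists z.
have p0 := pi_gt0 R; have NR : 0 < N%:R :> R by rewrite ltr0n.
pose y := t * N%:R / (2 * pi).
have y0 : 0 <= y by rewrite /y !mulr_ge0 ?invr_ge0 ?mulr_ge0 ?(ltW p0) //; lra.
have yN : y < N%:R.
  by rewrite /y ltr_pdivrMr ?mulr_gt0 // mulrC ltr_pM2l //; lra.
have /andP[f1 f2] := truncn_itv y0.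
exists (Num.truncn y), s, (y - (Num.truncn y)%:R); split => //.
- by rewrite -(ltr_nat R); apply: le_lt_trans yN.
- by rewrite subr_ge0 f1 /=; move: f2; rewrite -natr1; lra.
congr polar; rewrite /ang addrC subrK /y [2 * pi * _]mulrC divfK ?mulfK ?gt_eqF //.
by rewrite mulr_gt0.
Qed.

Lemma sector_inj N n n' s s' tau tau' : (n < N)%N -> (n' < N)%N ->
  0 <= s -> 0 <= s' -> 0 <= tau <= 1 -> 0 <= tau' <= 1 ->
  polar s (ang N n tau) = polar s' (ang N n' tau') ->
  s = s' /\ [\/ s = 0, n = n' /\ tau = tau',
     [/\ n' = (n.+1 %% N)%N, tau = 1 & tau' = 0]
   | [/\ n = (n'.+1 %% N)%N, tau = 0 & tau' = 1]].
Proof.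
move=> nN n'N s0 s'0 t0 t'0 e.
have NR : 0 < N%:R :> R by rewrite ltr0n (leq_trans _ nN).
have p0 := pi_gt0 R; have p20 : 0 < 2 * pi :> R by rewrite mulr_gt0.
have key (u v : R) : 2 * pi * u / N%:R = 2 * pi * v / N%:R -> u = v.
  have k0 : 2 * pi / N%:R != 0 :> R by rewrite gt_eqF // divr_gt0.
  by move=> h; apply: (mulfI k0); rewrite mulrAC h mulrAC.
have [ss h] := polar_inj s0 s'0 (ang_in nN t0) (ang_in n'N t'0) e.
split=> //; case: h => [h|[h|[[h1 h2]|[h1 h2]]]]; first by constructor 1.
- move: h => /key h.
  have [lt|gt|eq] := ltngtP n n'.
  + have h1 : n%:R + 1 <= n'%:R :> R by rewrite natr1 ler_nat.
    have h2 : n'%:R = n%:R + 1 :> R by lra.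
    constructor 3; split; [|lra|lra].
    move: h2; rewrite natr1 => /eqP; rewrite eqr_nat => /eqP nn.
    by rewrite -nn modn_small.
  + have h1 : n'%:R + 1 <= n%:R :> R by rewrite natr1 ler_nat.
    have h2 : n%:R = n'%:R + 1 :> R by lra.
    constructor 4; split; [|lra|lra].
    move: h2; rewrite natr1 => /eqP; rewrite eqr_nat => /eqP nn.
    by rewrite -nn modn_small.
  + by constructor 2; split => //; move: h; rewrite eq => /addrI.
- have n0 : 0 <= n%:R :> R by [].
  have n'1 : n'%:R + 1 <= N%:R :> R by rewrite natr1 ler_nat.
  have e1 : n%:R + tau = 0.
    by apply: key; rewrite -/(ang N n tau) h1 mulr0 mul0r.
  have e2 : n'%:R + tau' = N%:R.
    by apply: key; rewrite -/(ang N n' tau') h2 mulfK ?gt_eqF.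
  constructor 4; split; [|lra|lra].
  have : n%:R = 0 :> R by lra.
  move/eqP; rewrite pnatr_eq0 => /eqP ->.
  have : n'%:R + 1 = N%:R :> R by lra.
  by rewrite natr1 => /eqP; rewrite eqr_nat => /eqP ->; rewrite modnn.
- have n0 : 0 <= n'%:R :> R by [].
  have n'1 : n%:R + 1 <= N%:R :> R by rewrite natr1 ler_nat.
  have e1 : n'%:R + tau' = 0.
    by apply: key; rewrite -/(ang N n' tau') h2 mulr0 mul0r.
  have e2 : n%:R + tau = N%:R.
    by apply: key; rewrite -/(ang N n tau) h1 mulfK ?gt_eqF.
  constructor 3; split; [|lra|lra].
  have : n'%:R = 0 :> R by lra.
  move/eqP; rewrite pnatr_eq0 => /eqP ->.
  have : n%:R + 1 = N%:R :> R by lra.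
  by rewrite natr1 => /eqP; rewrite eqr_nat => /eqP ->; rewrite modnn.
Qed.

Lemma plane_hausdorff : hausdorff_space (plane R).
Proof. exact: norm_hausdorff. Qed.

Lemma polar_continuous (T : topologicalType) (f g : T -> R) :
  continuous f -> continuous g -> continuous (fun x => polar (f x) (g x)).
Proof.
move=> fc gc; apply: vec2_continuous => x; apply: cvgM; try exact: fc.
  by apply: continuous_comp; [exact: gc|exact: continuous_cos].
by apply: continuous_comp; [exact: gc|exact: continuous_sin].
Qed.

(** The set [S] of radii is an interval from 0 for discs and the single value 1 for the circles that
    parametrize boundary curves; only in the first case does the condition at the origin matter. *)
Lemma polar_pasting (Z : topologicalType) N (S : set R) (F : nat -> R -> R -> Z) :
  (0 < N)%N -> compact S -> (forall s, S s -> 0 <= s) ->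
  (forall n, (n < N)%N ->
    {within S `*` `[0, 1], continuous (fun p : R * R => F n p.1 p.2)}) ->
  (forall n s, (n < N)%N -> S s -> F n s 1 = F (n.+1 %% N)%N s 0) ->
  (S 0 -> forall n n' tau tau', F n 0 tau = F n' 0 tau') ->
  exists f : plane R -> Z,
    {within [set z | S (enorm z)], continuous f} /\
    forall n s tau, (n < N)%N -> S s -> 0 <= tau <= 1 ->
      f (polar s (ang N n tau)) = F n s tau.
Proof.
move=> N0 cS S0 Fc Fg Fz.
(* Any choice of sector coordinates gives the same value: [Fg] and [Fz] settle the ambiguities
   listed by [sector_inj]. *)
pose P z (q : nat * R * R) := [/\ (q.1.1 < N)%N, 0 <= q.1.2, 0 <= q.2 <= 1
   & z = polar q.1.2 (ang N q.1.1 q.2)].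
have exq z : exists q, P z q.
  by have [n [s [tau h]]] := sector_exists z N0; exists ((n, s), tau).
pose ch z := projT1 (cid (exq z)).
have chP z : P z (ch z) by rewrite /ch; case: cid.
pose f z := F (ch z).1.1 (ch z).1.2 (ch z).2.
have fE n s tau : (n < N)%N -> S s -> 0 <= tau <= 1 ->
    f (polar s (ang N n tau)) = F n s tau.
  move=> nN Ss t01; have := chP (polar s (ang N n tau)).
  rewrite /f; case: (ch _) => -[n' s'] tau' /= [/= n'N s'0 t'01 e].
  have [ss [h|[-> ->]|[-> -> ->]|[-> -> ->]]] := sector_inj nN n'N (S0 _ Ss) s'0 t01 t'01 e.
  + by rewrite -ss h; apply: Fz; rewrite -h.
  + by rewrite ss.
  + by rewrite -ss Fg.
  + by rewrite -ss Fg.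
exists f; split => //.
pose e (i : 'I_N) (p : R * R) := polar p.1 (ang N i p.2).
have ce i : continuous (e i).
  apply: polar_continuous; first by move=> x; exact: cvg_fst.
  rewrite /ang => x; apply: cvgMl; apply: cvgMr; apply: cvgD; first exact: cvg_cst.
  exact: cvg_snd.
apply: (@continuous_subspaceW _ _ _ (\bigcup_i e i @` (S `*` `[0, 1]))).
  move=> z /= Sz; have [n [s [tau [nN s0 t01 zE]]]] := sector_exists z N0.
  exists (Ordinal nN) => //; exists (s, tau); last by rewrite /e /= -zE.
  by split => //=; move: Sz; rewrite zE enorm_polar ger0_norm.
apply: within_pasting.
- by apply: compact_setX => //; exact: segment_compact.
- exact: plane_hausdorff.
- by move=> i; exact: continuous_subspaceT.
- move=> i; apply: (within_ext _ (Fc i (ltn_ord i))) => -[s tau] /= [Ss] /=.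
  by rewrite in_itv /= => t01; rewrite /e /= fE.
Qed.

End Plane.

(** * The cover of a flag graph *)

Section FlagGraph.
Variable G : Type.
Variable r : 'I_3 -> G -> G.

Definition side1 (i : 'I_3) : 'I_3 := i + 1.
Definition side2 (i : 'I_3) : 'I_3 := i + 2%:R.

(* Alternate crossings of the two sides that meet in corner [i]. *)
Definition crossing (i : 'I_3) (n : nat) : 'I_3 :=
  if odd n then side2 i else side1 i.

Fixpoint walk (i : 'I_3) (g : G) (n : nat) : G :=
  if n is n'.+1 then r (crossing i n') (walk i g n') else g.

(** The orbit relation of the crossings in [Z]. When [Z] consists of the sides on which a point
    lies, an orbit is the set of triangles that contain that point. *)
Definition reach (Z : pred 'I_3) : G -> G -> Prop :=
  clos_refl_sym_trans G (fun h k => exists2 l, Z l & k = r l h).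

End FlagGraph.

(* [parity] is the two-colouring of the triangles by orientation, and
   [2 * valence i] is the number of triangles around a corner of type [i]. *)
Record flag_graph (S : choiceType) (M : cells S) := FlagGraph {
  cross :> 'I_3 -> Mon M -> Mon M ;
  crossE : forall i g, \val (cross i g) = flag_swap i \o \val g ;
  crossK : forall i, involutive (cross i) ;
  parity : Mon M -> bool ;
  parity_cross : forall i g, parity (cross i g) = ~~ parity g ;
  valence : 'I_3 -> nat ;
  valence_gt1 : forall i, (1 < valence i)%N ;
  walk_period : forall i g, walk cross i g (2 * valence i) = g ;
  walk_inj : forall i g n n', (n < 2 * valence i)%N -> (n' < 2 * valence i)%N ->
    walk cross i g n = walk cross i g n' -> n = n' ;
  reach_all : forall g h, reach cross xpredT g h }.

Section I3.

Lemma I3P (i j : 'I_3) : [\/ j = i, j = side1 i | j = side2 i].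
Proof.
case: i => [[|[|[|//]]] hi]; case: j => [[|[|[|//]]] hj];
  by [constructor 1; exact: val_inj | constructor 2; exact: val_inj
     | constructor 3; exact: val_inj].
Qed.

Lemma side1K i : side1 (side1 i) = side2 i.
Proof. by rewrite /side1 /side2 -addrA. Qed.
Lemma side12 i : side1 (side2 i) = i.
Proof. by apply: val_inj; case: i => [[|[|[|//]]] hi]. Qed.
Lemma side21 i : side2 (side1 i) = i.
Proof. by apply: val_inj; case: i => [[|[|[|//]]] hi]. Qed.
Lemma side2K i : side2 (side2 i) = side1 i.
Proof. by apply: val_inj; case: i => [[|[|[|//]]] hi]. Qed.
Lemma side1_neq i : (side1 i == i) = false.
Proof. by case: i => [[|[|[|//]]] hi]. Qed.
Lemma side2_neq i : (side2 i == i) = false.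
Proof. by case: i => [[|[|[|//]]] hi]. Qed.
Lemma side12_neq i : (side1 i == side2 i) = false.
Proof. by case: i => [[|[|[|//]]] hi]. Qed.
Lemma side21_neq i : (side2 i == side1 i) = false.
Proof. by rewrite eq_sym side12_neq. Qed.
Lemma neq_side1 i : (i == side1 i) = false.
Proof. by rewrite eq_sym side1_neq. Qed.
Lemma neq_side2 i : (i == side2 i) = false.
Proof. by rewrite eq_sym side2_neq. Qed.
Definition sideE := (side1K, side12, side21, side2K, side1_neq, side2_neq,
  side12_neq, side21_neq, neq_side1, neq_side2, eqxx).

Lemma sum_I3 (V : nmodType) (F : 'I_3 -> V) i :
  \sum_l F l = F i + F (side1 i) + F (side2 i).
Proof.
rewrite (bigD1 i) //= (bigD1 (side1 i)) ?sideE //= (bigD1 (side2 i)) ?sideE //=.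
rewrite big1 ?addr0 ?addrA // => j; case: (I3P i j) => ->; by rewrite !sideE.
Qed.

End I3.

(** * Topology of the glued triangles *)

Section CoverBasics.
Variables (R : realType) (S : choiceType) (M : cells S) (r : flag_graph M).
Local Notation G := (Mon M).
Local Notation X := (minimal_regular_cover R M).
Implicit Types (g h k : G) (v w : 'rV[R]_3) (i l : 'I_3).

Lemma reach_sub (Z Z' : pred 'I_3) h k :
  (forall l, Z l -> Z' l) -> reach r Z h k -> reach r Z' h k.
Proof.
move=> ZZ'; elim=> {h k} [h k [l Zl ->]|h|h k _ H|h k l _ H1 _ H2].
- by apply: rst_step; exists l => //; exact: ZZ'.
- exact: rst_refl.
- exact: rst_sym.
- exact: rst_trans H1 H2.
Qed.

(** Closure of [P] in one direction is enough because every crossing is its own inverse. *)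
Lemma reach_ind (Z : pred 'I_3) (P : G -> Prop) h k :
  (forall g l, Z l -> P g -> P (r l g)) -> reach r Z h k -> P h -> P k.
Proof.
move=> Pr hk; suff: P h <-> P k by case.
elim: hk => {h k} [h k [l Zl ->]|h|h k _ H|h k g _ H1 _ H2]; try tauto.
by split; [exact: Pr|move/(Pr _ _ Zl); rewrite crossK].
Qed.

Lemma reach_step (Z : pred 'I_3) h l : Z l -> reach r Z h (r l h).
Proof. by move=> Zl; apply: rst_step; exists l. Qed.

Lemma walk_addp i h n : walk r i h (n + 2 * valence r i) = walk r i h n.
Proof.
elim: n => [|n IH]; first exact: walk_period.
rewrite addSn /= IH; congr (r _ _).
by rewrite /crossing oddD oddM /= addbF.
Qed.

Lemma walk_mod i h n : walk r i h (n %% (2 * valence r i)) = walk r i h n.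
Proof.
rewrite [in RHS](divn_eq n (2 * valence r i)).
elim: (n %/ _)%N => [|q IH]; first by rewrite mul0n add0n.
by rewrite IH mulSn -addnA [in RHS]addnC walk_addp.
Qed.

Lemma walk_back i h n : r (crossing i n) (walk r i h n.+1) = walk r i h n.
Proof. by rewrite /= crossK. Qed.

Lemma crossing_neq i n : (crossing i n == i) = false.
Proof. by rewrite /crossing; case: odd; rewrite sideE. Qed.

Lemma valence_gt0 i : (0 < 2 * valence r i)%N.
Proof. by have := valence_gt1 r i; lia. Qed.

(** The two crossings at a corner generate a dihedral group, whose orbit is traversed by the
    alternating walk. *)
Lemma reach_coset i h k : reach r (predC1 i) h k <->
  exists2 n, (n < 2 * valence r i)%N & k = walk r i h n.
Proof.
split=> [hk|[n _ ->]]; last first.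
  elim: n => [|n IH]; first exact: rst_refl.
  by apply: rst_trans IH _; apply: reach_step; rewrite /= crossing_neq.
suff [n ->] : exists n, k = walk r i h n.
  exists (n %% (2 * valence r i))%N; first by rewrite ltn_mod valence_gt0.
  by rewrite walk_mod.
apply: (reach_ind (P := fun k => exists n, k = walk r i h n) _ hk); last by exists 0%N.
move=> g l /= li [n ->].
have [->|lc] := eqVneq l (crossing i n); first by exists n.+1.
(* The other side at the corner leads back to the previous triangle; a full period is added first so
   that a predecessor exists. *)
exists (n + 2 * valence r i).-1.
rewrite -(walk_addp _ _ n); have : (0 < n + 2 * valence r i)%N.
  by have := valence_gt0 i; lia.
have : odd (n + 2 * valence r i) = odd n by rewrite oddD oddM /= addbF.
case: (n + _)%N => // N /= on _.
have -> : l = crossing i N; last by rewrite crossK.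
move: lc li; rewrite /crossing -on /=; case: (odd N) => /=;
  case: (I3P i l) => ->; by rewrite ?sideE.
Qed.

Lemma reach_edge l h k : reach r (pred1 l) h k <-> k = h \/ k = r l h.
Proof.
split=> [|[->|->]]; [|exact: rst_refl|by apply: reach_step => /=].
move/(@reach_ind _ (fun k => k = h \/ k = r l h)); apply; last by left.
by move=> g j /eqP -> [->|->]; rewrite ?crossK; [right|left].
Qed.

Lemma reach_none (Z : pred 'I_3) h k :
  (forall l, ~~ Z l) -> reach r Z h k -> k = h.
Proof.
move=> Z0 hk; apply: (reach_ind (P := fun k => k = h) _ hk) => // g l Zl.
by have := Z0 l; rewrite Zl.
Qed.

Definition bary : 'rV[R]_3 := const_mx (3%:R^-1).

Lemma bary_triangle : triangle R bary.
Proof.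
split=> [i|]; first by rewrite mxE invr_ge0.
rewrite (eq_bigr (fun=> 3%:R^-1)) => [|i _]; last by rewrite mxE.
by rewrite (sum_I3 _ ord0); lra.
Qed.

(** The default value makes [pt] total on row vectors, so that maps into the cover can be written by
    formulas without subtypes. *)
Definition to_triangle v : triangle R :=
  if pselect (triangle R v) is left tv then SigSub (mem_set tv)
  else SigSub (mem_set bary_triangle).

Lemma to_triangleK v : triangle R v -> \val (to_triangle v) = v.
Proof. by rewrite /to_triangle; case: pselect. Qed.

Lemma val_to_triangle (x : triangle R) : to_triangle (\val x) = x.
Proof. by apply: val_inj; rewrite to_triangleK //; exact: set_valP. Qed.

Definition pt h v : X := \pi_X ((h, to_triangle v) : triangles R M).

Definition zeros v : pred 'I_3 := fun l => v ord0 l == 0.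

(** A gluing step keeps the barycentric coordinates, so a chain of gluings only changes the
    triangle, across sides that contain the point. *)
Lemma glued_reach (p q : triangles R M) :
  glued p q <-> p.2 = q.2 /\ reach r (zeros (\val p.2)) p.1 q.1.
Proof.
split.
  move=> /asboolP; elim=> {p q} [p q [i [e1 e2 e3]]|p|p q _ [e H]|p q s _ [e1 H1] _ [e2 H2]].
  - split=> //; apply: rst_sym; apply: rst_step; exists i; first by rewrite /zeros e3.
    by apply: val_inj; rewrite e1 crossE.
  - by split => //; exact: rst_refl.
  - by split => //; apply: rst_sym; rewrite -e.
  - by split; [rewrite e1|apply: rst_trans H1 _; rewrite e1].
case: p q => [h x] [k y] /= [<- {y}] hk; apply/asboolP.
elim: hk => {h k} [h k [l Zl ->]|h|h k _ H|h k g _ H1 _ H2].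
- apply: rst_sym; apply: rst_step; exists l; split => //=; first exact: crossE.
  exact/eqP.
- exact: rst_refl.
- exact: rst_sym.
- exact: rst_trans H1 H2.
Qed.

Lemma pt_eq h k v w : triangle R v -> triangle R w ->
  pt h v = pt k w <-> v = w /\ reach r (zeros v) h k.
Proof.
move=> tv tw; split.
  move=> /eqmodP /glued_reach /= [] e; rewrite to_triangleK // => H; split => //.
  by rewrite -(to_triangleK tv) e to_triangleK.
case=> vw H; apply/eqmodP/glued_reach => /=; rewrite to_triangleK //; split=> //.
by rewrite vw.
Qed.

Lemma pt_cross l h v : triangle R v -> v ord0 l = 0 -> pt (r l h) v = pt h v.
Proof.
move=> tv v0; apply/pt_eq => //; split=> //; apply: rst_sym; apply: reach_step.
by rewrite /zeros v0.
Qed.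

Lemma ptP (x : X) : exists h v, triangle R v /\ x = pt h v.
Proof.
have : exists hx : triangles R M, x = \pi_X hx by exists (repr x); rewrite reprK.
case=> -[h y] ->; exists h, (\val y); split; first exact: set_valP.
by rewrite /pt val_to_triangle.
Qed.

(** The first factor of [triangles] is discrete, so openness in the quotient is tested on each
    triangle separately. *)
Lemma open_pt (U : set X) : open U <-> forall h,
  exists2 W : set 'rV[R]_3, open W & forall v, triangle R v -> (U (pt h v) <-> W v).
Proof.
split=> [oU h|H].
  have /continuousP/(_ _ oU) oU' : continuous (fun x : triangle R => \pi_X ((h, x) : triangles R M)).
    move=> x; apply: (@continuous_comp _ _ _ (fun x : triangle R => ((h, x) : triangles R M))).
      move=> A /= [[P Q] /= [Ph Qx] PQ]; apply: filterS Qx => y Qy.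
      by apply: PQ; split => //=; exact: nbhs_singleton Ph.
    exact: pi_continuous.
  have [W oW WU] := oU'.
  exists W => // v tv; have /= := congr1 (fun A => A (to_triangle v)) WU.
  have -> : set_val (to_triangle v) = v := to_triangleK tv.
  by rewrite /pt => ->.
rewrite /open /= /quotient_open openE => -[h x] /= Ux.
have [W oW WU] := H h.
exists ([set h], [set y | W (\val y)]) => /=; last first.
  move=> [k y] [/= -> Wy]; have ty : triangle R (\val y) by exact: set_valP.
  by move: Wy => /(WU _ ty); rewrite /pt val_to_triangle.
split; first by rewrite /nbhs /=.
have tx : triangle R (\val x) by exact: set_valP.
have Wx : W (\val x) by apply/(WU _ tx); rewrite /pt val_to_triangle.
apply: (@initial_continuous _ _ (set_val : triangle R -> _) x).
exact: open_nbhs_nbhs.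
Qed.

Lemma closed_pt (A : set X) : closed A <-> forall h,
  exists2 W : set 'rV[R]_3, closed W & forall v, triangle R v -> (A (pt h v) <-> W v).
Proof.
rewrite -openC open_pt; split=> H h; have [W cW HW] := H h; exists (~` W).
- by rewrite closedC.
- move=> v tv; have := HW v tv; rewrite /setC /=.
  by case: (pselect (A (pt h v))); case: (pselect (W v)); tauto.
- by rewrite openC.
- by move=> v tv; have := HW v tv; rewrite /setC /=; tauto.
Qed.

Lemma pt_continuous h : {within triangle R, continuous (pt h)}.
Proof.
apply/continuous_closedP => A /closed_pt/(_ h) [W cW HW].
apply/closed_subspaceP; exists W => //; apply/seteqP.
by split=> v /= [H tv]; split => //; apply/HW.
Qed.

Lemma coord_cont3 i : continuous (fun v : 'rV[R]_3 => v ord0 i).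
Proof. by move=> v; exact: coord_continuous. Qed.

Lemma closed_coord_ge (f g : 'rV[R]_3 -> R) : continuous f -> continuous g ->
  closed [set v | f v <= g v].
Proof.
move=> cf cg; rewrite (_ : mkset _ = (fun v => g v - f v) @^-1` [set x | 0 <= x]).
  apply: preimage_closed; last exact: closed_ge.
  by move=> v _; exact: (contD cg (contN cf)).
by apply/seteqP; split => v /=; rewrite subr_ge0.
Qed.

Lemma open_coord_gt (f g : 'rV[R]_3 -> R) : continuous f -> continuous g ->
  open [set v | f v < g v].
Proof.
move=> cf cg; rewrite -closedC.
rewrite (_ : ~` _ = [set v | g v <= f v]); first exact: closed_coord_ge.
by apply/seteqP; split => v /=; [move/negP; rewrite -leNgt|move=> H; apply/negP; rewrite -leNgt].
Qed.

Lemma triangle_ge0 v i : triangle R v -> 0 <= v ord0 i. Proof. by case. Qed.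

Lemma triangle_sum v i : triangle R v ->
  v ord0 i + v ord0 (side1 i) + v ord0 (side2 i) = 1.
Proof. by case=> _; rewrite (sum_I3 _ i). Qed.

Lemma triangle_le1 v i : triangle R v -> v ord0 i <= 1.
Proof.
move=> tv; have := triangle_sum i tv.
by have := triangle_ge0 (side1 i) tv; have := triangle_ge0 (side2 i) tv; lra.
Qed.

Lemma triangle_closed : closed (triangle R).
Proof.
rewrite (_ : triangle R = (\bigcap_(i in [set: 'I_3]) [set v | 0 <= v ord0 i]) `&`
  ([set v | \sum_(i < 3) v ord0 i <= 1] `&` [set v | 1 <= \sum_(i < 3) v ord0 i])).
  have c0 (x : R) : continuous (fun _ : 'rV[R]_3 => x) by exact: contC.
  have cs : continuous (fun v : 'rV[R]_3 => \sum_(i < 3) v ord0 i).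
    by apply: cont_sum => i; exact: coord_cont3.
  apply: closedI; [|apply: closedI].
  - apply: closed_bigI => i _; apply: closed_coord_ge => //; exact: coord_cont3.
  - exact: closed_coord_ge.
  - exact: closed_coord_ge.
apply/seteqP; split=> v.
  by case=> v0 v1; split; [move=> i _; exact: v0|rewrite /= v1].
case=> v0 [/= h1 h2]; split; first by move=> i; exact: v0.
by apply/eqP; rewrite eq_le h1 h2.
Qed.

Lemma triangle_compact : compact (triangle R).
Proof.
apply: bounded_closed_compact; last exact: triangle_closed.
exists 1; split; first exact: num_real.
move=> B B1 v tv /=; apply: le_trans (ltW B1).
rewrite /Num.norm /= mx_normrE; apply: bigmax_le.
  exact: ler01.
by move=> [a b] _ /=; rewrite (ord1 a) ger0_norm ?triangle_ge0 //; exact: triangle_le1.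
Qed.

Lemma tri_compact h : compact (pt h @` triangle R).
Proof. by apply: continuous_compact; [exact: pt_continuous|exact: triangle_compact]. Qed.

(** The open star, in the triangulation, of the open simplex that contains [pt h v]; only the set of
    vanishing coordinates of [v] matters. *)
Definition star v h : set X := [set x | exists k w,
  [/\ triangle R w, x = pt k w, forall l, 0 < v ord0 l -> 0 < w ord0 l & reach r (zeros v) h k]].

Lemma star_pt v h k w : triangle R v -> triangle R w ->
  star v h (pt k w) <-> (forall l, 0 < v ord0 l -> 0 < w ord0 l) /\ reach r (zeros v) h k.
Proof.
move=> tv tw; split; last by case=> H1 H2; exists k, w.
case=> k' [w' [tw' /(pt_eq k k' tw tw') [e H] pos hk]]; subst w'; split=> //.
apply: rst_trans hk _; apply: rst_sym; apply: reach_sub H => l.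
rewrite /zeros => /eqP wl; rewrite eq_le (triangle_ge0 l tv) andbT leNgt.
by apply/negP => /pos; rewrite wl ltxx.
Qed.

Lemma star_open v h : triangle R v -> open (star v h).
Proof.
move=> tv; apply/open_pt => k.
have [hk|hk] := pselect (reach r (zeros v) h k); last first.
  by exists set0; [exact: open0|move=> w tw; split => //; move/(star_pt _ _ tv tw) => []].
exists [set w : 'rV[R]_3 | forall l, 0 < v ord0 l -> 0 < w ord0 l].
  rewrite openE => w /= Hw.
  suff : \forall u \near (w : 'rV[R]_3), forall l, 0 < v ord0 l -> 0 < (u : 'rV[R]_3) ord0 l by [].
  apply: (@filter_forall _ _ (fun l (u : 'rV[R]_3) => 0 < v ord0 l -> 0 < u ord0 l) (nbhs w) (nbhs_filter w)) => l.
  have [vl|vl] := ltP 0 (v ord0 l); last by apply: filterE => u.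
  have : open [set w : 'rV[R]_3 | 0 < w ord0 l].
    by apply: open_coord_gt; [exact: contC|exact: coord_cont3].
  by rewrite openE => /(_ w (Hw _ vl)); apply: filterS => u + _.
by move=> w tw; rewrite star_pt //; split => [[]|].
Qed.

Lemma star_self v h : triangle R v -> star v h (pt h v).
Proof. by move=> tv; apply/star_pt => //; split => //; exact: rst_refl. Qed.

(** Points with different coordinates are separated by a barycentric coordinate, which is a
    well-defined function on the cover. Points with equal coordinates have disjoint stars, since
    [reach] is an equivalence. *)
Lemma cover_hausdorff : hausdorff_space X.
Proof.
rewrite open_hausdorff => x y xy.
have [h [v [tv ex]]] := ptP x; have [k [w [tw ey]]] := ptP y.
have [vw|vw] := eqVneq v w.
  exists (star v h, star v k); first by rewrite ex ey -vw; split; apply/mem_set; exact: star_self.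
  split; [exact: star_open|exact: star_open|].
  apply/eqP/seteqP; split => // z /= [].
  have [g [u [tu ->]]] := ptP z.
  move=> /(star_pt _ _ tv tu) [_ H1] /(star_pt _ _ tv tu) [_ H2].
  move/eqP: xy; apply; rewrite ex ey -vw; apply/pt_eq => //; split => //.
  by apply: rst_trans H1 _; apply: rst_sym.
have /existsNP[l vwl] : ~ forall l, v ord0 l = w ord0 l.
  by move=> H; move/eqP: vw; apply; apply/rowP.
have gen (a b : R) : a != b -> exists A B : set R, [/\ open A, open B, A a, B b & A `&` B = set0].
  move=> ab; have := @Rhausdorff R; rewrite open_hausdorff => /(_ _ _ ab) [[A B] /=].
  by case=> /set_mem Aa /set_mem Bb [oA oB /eqP AB]; exists A, B.
have [A [B [oA oB Aa Bb AB]]] := gen _ _ (introN eqP vwl).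
pose U (C : set R) : set X := [set z | exists g u, [/\ triangle R u, z = pt g u & C (u ord0 l)]].
have Up C g u : triangle R u -> U C (pt g u) <-> C (u ord0 l).
  move=> tu; split; last by move=> H; exists g, u.
  by case=> g' [u' [tu' /(pt_eq g g' tu tu') [<-]]].
have oU C : open C -> open (U C).
  move=> oC; apply/open_pt => g; exists [set u : 'rV[R]_3 | C (u ord0 l)]; last by move=> u tu; exact: Up.
  exact: (@open_comp _ _ (fun u : 'rV[R]_3 => u ord0 l) C (fun x _ => @coord_cont3 l x) oC).
exists (U A, U B); first by rewrite ex ey; split; apply/mem_set/Up.
split; [exact: oU|exact: oU|].
apply/eqP/seteqP; split => // z /= [].
have [g [u [tu ->]]] := ptP z; move=> /(Up _ _ _ tu) H1 /(Up _ _ _ tu) H2.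
by have : (A `&` B) (u ord0 l) by []; rewrite AB.
Qed.

Lemma descend (Y : Type) (f : G -> 'rV[R]_3 -> Y) :
  (forall h l v, triangle R v -> v ord0 l = 0 -> f (r l h) v = f h v) ->
  exists F : X -> Y, forall h v, triangle R v -> F (pt h v) = f h v.
Proof.
move=> fr; exists (fun x => f (repr x).1 (\val (repr x).2)) => h v tv.
have : pt h v = pt (repr (pt h v)).1 (\val (repr (pt h v)).2).
  rewrite {2}/pt val_to_triangle.
  by case E : (repr (pt h v)) => [a b]; rewrite /= -E reprK.
case: (repr _) => a b /=.
have tb : triangle R (\val b) by exact: set_valP.
move/(pt_eq _ _ tv tb) => [<- H].
elim: H => {h a b tb} [h k [l Zl ->]|h|h k _ H|h k g _ H1 _ H2] //.
- by rewrite fr //; exact/eqP.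
- by rewrite H2.
Qed.

(** The formulas [f h] describe [F] only inside [U]. This form suits [star_map], which is set to 0
    off a star and is continuous only inside it. *)
Lemma within_open_cont (Y : topologicalType) (U : set X) (F : X -> Y)
    (f : G -> 'rV[R]_3 -> Y) : open U ->
  (forall h v, triangle R v -> U (pt h v) -> F (pt h v) = f h v) ->
  (forall h, exists2 W : set 'rV[R]_3, open W &
     (forall v, triangle R v -> (U (pt h v) <-> W v)) /\ {within W, continuous (f h)}) ->
  {within U, continuous F}.
Proof.
move=> oU FE H; apply/continuousP => A oA.
rewrite -open_setIS //; apply/open_pt => h; have [W oW [UW cf]] := H h.
exists (W `&` f h @^-1` A).
  by rewrite setIC open_setIS //; move/continuousP: cf; apply.
move=> v tv; rewrite /from_subspace; split.
  by case=> /= FA Uv; split; [exact/UW|rewrite /preimage /= -FE].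
by case=> /(UW _ tv) Uv fA; split => //; rewrite /preimage /= FE.
Qed.

Definition lerp (a : R) v w : 'rV[R]_3 := (1 - a) *: v + a *: w.

Lemma lerpE a v w l : lerp a v w ord0 l = (1 - a) * v ord0 l + a * w ord0 l.
Proof. by rewrite !mxE. Qed.

Lemma lerp_triangle a v w : 0 <= a <= 1 -> triangle R v -> triangle R w ->
  triangle R (lerp a v w).
Proof.
move=> a01 [v0 v1] [w0 w1]; split=> [l|].
  by rewrite lerpE addr_ge0 // mulr_ge0 //; lra.
rewrite (eq_bigr _ (fun l _ => lerpE a v w l)) big_split /= -!mulr_sumr v1 w1; lra.
Qed.

Lemma lerp_continuous v w : continuous (fun a => lerp a v w).
Proof.
apply: row_continuous => l; rewrite (_ : (fun a => _) = fun a => (1 - a) * v ord0 l + a * w ord0 l).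
  by move=> a; apply: cvgD; apply: cvgMl; [apply: cvgB; [exact: cvg_cst|exact: cvg_id]|exact: cvg_id].
by apply/funext => a; rewrite lerpE.
Qed.

Lemma component_lerp (A : set X) h v w : triangle R v -> triangle R w ->
  (forall a, 0 <= a <= 1 -> A (pt h (lerp a v w))) ->
  connected_component A (pt h v) (pt h w).
Proof.
move=> tv tw HA.
have e0 : lerp 0 v w = v by rewrite /lerp subr0 scale1r scale0r addr0.
have e1 : lerp 1 v w = w by rewrite /lerp subrr scale1r scale0r add0r.
apply: (@connected_component_max _ _ ((fun a => pt h (lerp a v w)) @` `[0, 1])).
- by exists 0; rewrite /= ?e0 // in_itv /= lexx ler01.
- by move=> x [a]; rewrite /= in_itv /= => a01 <-; exact: HA.
- apply: connected_continuous_connected; first exact: segment_connected.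
  apply: (within_comp (E := triangle R)) (pt_continuous (h := h)).
    by move=> a; rewrite /= in_itv /= => a01; exact: lerp_triangle.
  by apply: continuous_subspaceT; exact: lerp_continuous.
by exists 1; rewrite /= ?e1 // in_itv /= lexx ler01.
Qed.

Lemma component_tri (A : set X) h v w : triangle R v -> triangle R w ->
  pt h @` triangle R `<=` A -> connected_component A (pt h v) (pt h w).
Proof.
move=> tv tw hA; apply: component_lerp => // a a01; apply: hA.
by exists (lerp a v w) => //; exact: lerp_triangle.
Qed.

Definition mid l : 'rV[R]_3 := \row_j (if j == l then 0 else 2%:R^-1).

Lemma midE l j : mid l ord0 j = if j == l then 0 else 2%:R^-1.
Proof. by rewrite mxE. Qed.

Lemma mid_triangle l : triangle R (mid l).
Proof.
split=> [j|]; first by rewrite midE; case: ifP; rewrite ?invr_ge0.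
by rewrite (sum_I3 _ l) !midE !sideE; lra.
Qed.

Definition apex i : 'rV[R]_3 := \row_j (if j == i then 1 else 0).

Lemma apexE i j : apex i ord0 j = if j == i then 1 else 0.
Proof. by rewrite mxE. Qed.

Lemma apex_triangle i : triangle R (apex i).
Proof.
split=> [j|]; first by rewrite apexE; case: ifP.
by rewrite (sum_I3 _ i) !apexE !sideE; lra.
Qed.

Lemma zeros_apex i : zeros (apex i) = predC1 i.
Proof.
apply/funext => l; rewrite /zeros apexE /=.
by case: ifP => _; rewrite ?oner_eq0 ?eqxx.
Qed.

Lemma component_cross (A : set X) h l v w : triangle R v -> triangle R w ->
  pt h @` triangle R `<=` A -> pt (r l h) @` triangle R `<=` A ->
  connected_component A (pt h v) (pt (r l h) w).
Proof.
move=> tv tw h1 h2.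
apply: (@connected_component_trans _ _ (pt h (mid l))).
  by apply: component_tri => //; exact: mid_triangle.
rewrite -(pt_cross (l := l)) ?midE ?eqxx //; last exact: mid_triangle.
by apply: component_tri => //; exact: mid_triangle.
Qed.

Lemma Mon_idP : Mon M id.
Proof. by move=> A [[]]. Qed.

Definition Mon_id : G := SigSub (mem_set Mon_idP).

Lemma cover_nonempty : [set: X] !=set0.
Proof. by exists (pt Mon_id bary). Qed.

Lemma cover_connected : connected [set: X].
Proof.
suff H : forall x y : X, connected_component setT x y.
  have [x0 _] := cover_nonempty.
  rewrite (_ : [set: X] = connected_component setT x0); first exact: component_connected.
  by apply/seteqP; split => x _ //; exact: H.
move=> x y; have [h [v [tv ->]]] := ptP x; have [k [w [tw ->]]] := ptP y.
apply: (reach_ind (P := fun k => forall w, triangle R w ->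
  connected_component [set: X] (pt h v) (pt k w)) _ (reach_all r h k)) => //.
  move=> g l _ IH u tu; apply: (connected_component_trans (IH _ tu)).
  exact: component_cross.
by move=> u tu; exact: component_tri.
Qed.

End CoverBasics.

(** * Star charts *)

Section StarCharts.
Variables (R : realType) (S : choiceType) (M : cells S) (r : flag_graph M).
Local Notation G := (Mon M).
Local Notation X := (minimal_regular_cover R M).
Implicit Types (g h k : G) (v w : 'rV[R]_3) (i l : 'I_3) (a b s tau : R).

Definition nsec i : nat := (2 * valence r i)%N.

Lemma nsec_gt0 i : (0 < nsec i)%N. Proof. exact: valence_gt0. Qed.

Lemma reach_walk i g n : reach r (predC1 i) g (walk r i g n).
Proof.
apply/reach_coset; exists (n %% nsec i)%N; first by rewrite ltn_mod nsec_gt0.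
by rewrite walk_mod.
Qed.

Definition beta i : R := 2 * pi / (nsec i)%:R.

Lemma angE i n tau : ang (nsec i) n tau = (n%:R + tau) * beta i.
Proof. by rewrite /ang /beta mulrAC mulrC. Qed.

Lemma nsecR i : 4 <= (nsec i)%:R :> R.
Proof. by rewrite (ler_nat R 4) /nsec; have := valence_gt1 r i; lia. Qed.

Lemma beta_gt0 i : 0 < beta i.
Proof.
have := nsecR i; have := pi_gt0 R => p0 n4.
by rewrite /beta divr_gt0 ?mulr_gt0 //; lra.
Qed.

(** Valence at least 2 means at least four sectors. Hence [cos (beta i)] is nonnegative, on which
    the norm estimates for the charts rest. *)
Lemma beta_le i : beta i <= pi / 2.
Proof.
have n4 := nsecR i; have p0 := pi_gt0 R.
rewrite /beta ler_pdivrMr; last by lra.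
have : pi * 4 <= pi * (nsec i)%:R :> R by rewrite ler_pM2l.
lra.
Qed.

Lemma sin_beta_gt0 i : 0 < sin (beta i).
Proof.
by have := beta_gt0 i; have := beta_le i; have := pi_gt0 R => *; apply: sin_gt0_pi; lra.
Qed.

Lemma cos_beta_ge0 i : 0 <= cos (beta i).
Proof.
have h := beta_gt0 i; have h' := beta_le i; have p0 := pi_gt0 R.
have [->|ne] := eqVneq (beta i) (pi / 2); first by rewrite cos_pihalf.
apply/ltW/cos_gt0_pihalf; apply/andP; split; first by lra.
by rewrite lt_neqAle ne.
Qed.

Definition ray i (n : nat) : plane R := polar 1 (n%:R * beta i).

Lemma nsec_beta i : (nsec i)%:R * beta i = pi *+ 2.
Proof. by rewrite /beta mulrC divfK ?mulr_natl // gt_eqF // ltr0n nsec_gt0. Qed.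

Lemma ray_add i n : ray i (n + nsec i) = ray i n.
Proof.
apply/plane_eqP; rewrite !pxy natrD mulrDl nsec_beta.
by rewrite (periodicn (@cosD2pi R) 1) (periodicn (@sinD2pi R) 1).
Qed.

Lemma ray_mod i n : ray i (n %% nsec i) = ray i n.
Proof.
rewrite [in RHS](divn_eq n (nsec i)).
elim: (n %/ _)%N => [|q IH]; first by rewrite mul0n add0n.
by rewrite IH mulSn -addnA [in RHS]addnC ray_add.
Qed.

Lemma crossing_mod i n : crossing i (n %% nsec i) = crossing i n.
Proof. by rewrite /crossing odd_mod // /nsec oddM. Qed.

Lemma crossingSS i n : crossing i n.+2 = crossing i n.
Proof. by rewrite /crossing /= negbK. Qed.

Lemma crossingP i n l : [\/ l = i, l = crossing i n | l = crossing i n.+1].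
Proof.
by rewrite /crossing /=; case: odd; case: (I3P i l) => ->;
  by [constructor 1|constructor 2|constructor 3].
Qed.

Lemma crossingS_neq i n : (crossing i n.+1 == crossing i n) = false.
Proof. by rewrite /crossing /=; case: odd; rewrite sideE. Qed.

Lemma sum_crossing i n (F : 'I_3 -> R) :
  \sum_l F l = F i + F (crossing i n) + F (crossing i n.+1).
Proof.
by rewrite (sum_I3 _ i) /crossing /=; case: odd => //=; rewrite addrAC.
Qed.

(** Lays the [n]-th triangle of the fan flat: corner [i] goes to the origin and the two other
    corners to consecutive unit vectors. *)
Definition sector_pt i n v : plane R :=
  v ord0 (crossing i n) *: ray i n + v ord0 (crossing i n.+1) *: ray i n.+1.

Lemma sector_pt_mod i n v : sector_pt i (n %% nsec i) v = sector_pt i n v.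
Proof.
rewrite /sector_pt crossing_mod ray_mod -(ray_mod i n.+1) -(ray_mod i (n %% _).+1).
have -> : crossing i (n %% nsec i).+1 = crossing i n.+1.
  by rewrite -crossing_mod -(addn1 (n %% _)) modnDml addn1 crossing_mod.
by rewrite -(addn1 (n %% _)) modnDml addn1.
Qed.

Lemma sector_ptS i n v : v ord0 (crossing i n) = 0 ->
  sector_pt i n.+1 v = sector_pt i n v.
Proof. by rewrite /sector_pt crossingSS => ->; rewrite !scale0r add0r addr0. Qed.

Lemma sector_pt_continuous i n : continuous (sector_pt i n).
Proof.
rewrite (_ : sector_pt i n = fun v => vec2 (px (sector_pt i n v)) (py (sector_pt i n v))).
  apply: vec2_continuous; rewrite /sector_pt.
    under eq_fun do rewrite !pxy.
    by apply: contD; apply: contM; (exact: coord_cont3 || exact: contC).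
  under eq_fun do rewrite !pxy.
  by apply: contD; apply: contM; (exact: coord_cont3 || exact: contC).
by apply/funext => v; apply/plane_eqP; rewrite px_vec2 py_vec2.
Qed.

(** The default [nsec i] is out of range and marks the triangles that do not belong to the fan. *)
Definition sector_index i g h : nat :=
  xget (nsec i) [set n | (n < nsec i)%N /\ h = walk r i g n].

Lemma sector_index_walk i g n : sector_index i g (walk r i g n) = (n %% nsec i)%N.
Proof.
rewrite /sector_index; case: xgetP => [m -> [m1 m2]|/(_ (n %% nsec i)%N) []].
  by apply: (@walk_inj _ _ r i g) => //; rewrite ?ltn_mod ?nsec_gt0 // -m2 walk_mod.
by split; [rewrite ltn_mod nsec_gt0|rewrite walk_mod].
Qed.

(** The value 0 off the open star makes the function compatible with all gluings, including those
    across side [i], which leave the fan; so [descend] applies. *)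
Definition star_fun i g h v : plane R :=
  if (sector_index i g h < nsec i)%N && (v ord0 i != 0)
  then sector_pt i (sector_index i g h) v else 0.

Lemma star_fun_walk i g n v : v ord0 i != 0 ->
  star_fun i g (walk r i g n) v = sector_pt i n v.
Proof.
by move=> vi; rewrite /star_fun sector_index_walk ltn_mod nsec_gt0 vi sector_pt_mod.
Qed.

Lemma sector_index_lt i g h : (sector_index i g h < nsec i)%N ->
  h = walk r i g (sector_index i g h).
Proof.
by rewrite /sector_index; case: xgetP => [m -> []|_] //; rewrite ltnn.
Qed.

Lemma star_fun_cross i g h l v : triangle R v -> v ord0 l = 0 ->
  star_fun i g (r l h) v = star_fun i g h v.
Proof.
move=> tv v0; have [vi|vi] := eqVneq (v ord0 i) 0.
  by rewrite /star_fun vi eqxx !andbF.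
have key h' l' : v ord0 l' = 0 -> (sector_index i g h' < nsec i)%N ->
    star_fun i g (r l' h') v = star_fun i g h' v.
  move=> v'0 /sector_index_lt ->; set n := sector_index _ _ _.
  case: (crossingP i n l') => el; first by move: vi; rewrite -el v'0 eqxx.
    by rewrite el -[r _ _]/(walk r i g n.+1) !star_fun_walk // sector_ptS // -el.
  rewrite -(walk_addp _ _ _ n).
  have : (0 < n + 2 * valence r i)%N by have := valence_gt0 r i; lia.
  have : odd (n + 2 * valence r i) = odd n by rewrite oddD oddM /= addbF.
  case E : (n + _)%N => [|N] // /= on _.
  have eN : crossing i N = l' by rewrite el /crossing /= -on negbK.
  have -> : r (crossing i N) (walk r i g N) = walk r i g N.+1 by [].
  by rewrite -{1}eN walk_back !star_fun_walk // sector_ptS // eN.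
have [h1|h1] := boolP (sector_index i g h < nsec i)%N; first exact: key.
have [h2|h2] := boolP (sector_index i g (r l h) < nsec i)%N.
  by have := key _ _ v0 h2; rewrite crossK.
by rewrite /star_fun (negbTE h1) (negbTE h2).
Qed.

Lemma star_map_ex i g : exists F : X -> plane R,
  forall h v, triangle R v -> F (pt h v) = star_fun i g h v.
Proof. by apply: descend => h l v; exact: star_fun_cross. Qed.

Definition star_map i g : X -> plane R := projT1 (cid (star_map_ex i g)).

Lemma star_mapE i g n v : triangle R v -> 0 < v ord0 i ->
  star_map i g (pt (walk r i g n) v) = sector_pt i n v.
Proof.
move=> tv vi; rewrite /star_map; case: cid => F /= ->//.
by rewrite star_fun_walk // gt_eqF.
Qed.

Definition corner_star i g : set X := star r (apex R i) g.

Lemma corner_starP i g x : corner_star i g x <-> exists n v,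
  [/\ (n < nsec i)%N, triangle R v, 0 < v ord0 i & x = pt (walk r i g n) v].
Proof.
split.
  case=> k [w [tw -> pos]]; rewrite zeros_apex => /reach_coset [n nN kE].
  exists n, w; split; rewrite -?kE //; apply: pos; rewrite apexE eqxx; exact: ltr01.
case=> n [v [nN tv vi ->]]; exists (walk r i g n), v; split => //.
  by move=> l; rewrite apexE; case: eqP => [->|]; rewrite ?ltxx.
by rewrite zeros_apex; apply/reach_coset; exists n.
Qed.

Lemma corner_star_open i g : open (corner_star i g).
Proof. by apply: star_open; exact: apex_triangle. Qed.

Lemma star_map_continuous i g : {within corner_star i g, continuous (star_map i g)}.
Proof.
apply: (within_open_cont (f := fun h v => sector_pt i (sector_index i g h) v)).
- exact: corner_star_open.
- move=> h v tv /corner_starP [n [w [nN tw wi /(pt_eq r _ _ tv tw) [e H]]]].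
  subst w; have : reach r (predC1 i) g h.
    apply: (rst_trans _ _ _ (walk r i g n)); first by apply/reach_coset; exists n.
    apply: rst_sym; apply: reach_sub H => l; rewrite /zeros /=.
    by apply: contraTneq => ->; rewrite gt_eqF.
  case/reach_coset => m mN ->.
  by rewrite star_mapE // sector_index_walk sector_pt_mod.
move=> h; have [hg|hg] := pselect (reach r (predC1 i) g h).
  exists [set v | 0 < v ord0 i].
    by apply: open_coord_gt; [exact: contC|exact: coord_cont3].
  split; last by apply: continuous_subspaceT; exact: sector_pt_continuous.
  move=> v tv; rewrite /corner_star star_pt ?zeros_apex //; last exact: apex_triangle.
  split=> [[+ _]|vi]; first by move/(_ i); rewrite apexE eqxx; apply; exact: ltr01.
  by split=> // l; rewrite apexE; case: eqP => [->|]; rewrite ?ltxx.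
exists set0; first exact: open0.
split; last by apply: continuous_subspaceT; exact: sector_pt_continuous.
move=> v tv; rewrite /corner_star star_pt ?zeros_apex //; last exact: apex_triangle.
by split=> // -[].
Qed.

(** Law of sines: the coefficients resolve a vector of length [s] along two unit vectors at angle
    [beta i]. *)
Lemma sector_pt_polar i n s tau v :
  v ord0 (crossing i n) = s * sin ((1 - tau) * beta i) / sin (beta i) ->
  v ord0 (crossing i n.+1) = s * sin (tau * beta i) / sin (beta i) ->
  sector_pt i n v = polar s (ang (nsec i) n tau).
Proof.
move=> e1 e2; rewrite /sector_pt e1 e2 /ray angE.
have s0 : sin (beta i) != 0 by rewrite gt_eqF ?sin_beta_gt0.
have -> : n.+1%:R * beta i = n%:R * beta i + beta i by rewrite -natr1 mulrDl mul1r.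
have -> : (n%:R + tau) * beta i = n%:R * beta i + tau * beta i by rewrite mulrDl.
have -> : (1 - tau) * beta i = beta i - tau * beta i by rewrite mulrBl mul1r.
move: (n%:R * _) (tau * _) s0 => A B; move: (beta i) => C s0.
by apply/plane_eqP; rewrite !pxy !mul1r !(cosD, sinD, cosN, sinN); split; field.
Qed.

(** Converse of the law of sines; the last clause is the law of cosines for the resulting length. *)
Lemma cone_polar i a b : 0 <= a -> 0 <= b -> exists s tau,
  [/\ 0 <= s, 0 <= tau <= 1, a = s * sin ((1 - tau) * beta i) / sin (beta i),
      b = s * sin (tau * beta i) / sin (beta i)
    & s ^+ 2 = a ^+ 2 + b ^+ 2 + 2 * a * b * cos (beta i)].
Proof.
move=> a0 b0; have sb := sin_beta_gt0 i; have cb := cos_beta_ge0 i.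
have b1 := beta_gt0 i; have b2 := beta_le i; have p0 := pi_gt0 R.
have cs := cos2Dsin2 (beta i).
have q0 : 0 <= a ^+ 2 + b ^+ 2 + 2 * a * b * cos (beta i).
  by rewrite !addr_ge0 ?sqr_ge0 ?mulr_ge0.
pose s := Num.sqrt (a ^+ 2 + b ^+ 2 + 2 * a * b * cos (beta i)).
have s0 : 0 <= s by exact: sqrtr_ge0.
have s2 : s ^+ 2 = a ^+ 2 + b ^+ 2 + 2 * a * b * cos (beta i) by rewrite sqr_sqrtr.
have [sz|sz] := eqVneq s 0.
  move: s2; rewrite sz expr0n /= => s2.
  have az : a = 0.
    apply/eqP; rewrite -sqrf_eq0 eq_le sqr_ge0 andbT.
    have h : 0 <= 2 * a * b * cos (beta i) by rewrite !mulr_ge0.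
    by have := sqr_ge0 b; lra.
  have bz : b = 0.
    apply/eqP; rewrite -sqrf_eq0 eq_le sqr_ge0 andbT.
    by move: s2; rewrite az; lra.
  exists 0, 0; split; rewrite ?lexx ?ler01 ?az ?bz ?mul0r //.
  by rewrite expr0n mulr0 mul0r !addr0 /=.
have sp : 0 < s by rewrite lt_neqAle eq_sym sz.
(* The normalized vector in the frame of the first ray, so that [acos c] is its angle from that
   ray. *)
pose c := (a + b * cos (beta i)) / s; pose d := b * sin (beta i) / s.
have c0 : 0 <= c by rewrite /c divr_ge0 // addr_ge0 // mulr_ge0.
have d0 : 0 <= d by rewrite /d divr_ge0 // mulr_ge0 // ltW.
have cd : c ^+ 2 + d ^+ 2 = 1.
  rewrite /c /d !expr_div_n -mulrDl s2.
  rewrite (_ : _ + _ = s ^+ 2) ?s2 ?divff -?s2 ?expf_neq0 //.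
  rewrite s2 exprMn (_ : sin (beta i) ^+ 2 = 1 - cos (beta i) ^+ 2); first by ring.
  by rewrite -cs addrAC subrr add0r.
have c1 : -1 <= c <= 1.
  rewrite -ler_norml -(@ler_sqr _ `|c| 1) ?nnegrE ?normr_ge0 //.
  by rewrite real_normK ?num_real // expr1n -cd lerDl sqr_ge0.
have sd : Num.sqrt (1 - c ^+ 2) = d by rewrite -cd addrAC subrr add0r sqrtr_sqr ger0_norm.
pose t := acos c.
have ct : cos t = c by rewrite /t acosK // in_itv.
have st : sin t = d by rewrite /t sin_acos.
have t0 : 0 <= t by exact: acos_ge0.
have t1 : t <= pi by exact: acos_lepi.
have ss : sin (beta i - t) = a * sin (beta i) / s.
  by rewrite sinB ct st /c /d; field.
(* The vector stays inside the sector because [sin (beta i - t)] has the sign of [a]. *)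
have tb : t <= beta i.
  rewrite leNgt; apply/negP => bt.
  have : 0 < sin (t - beta i) by apply: sin_gt0_pi; lra.
  rewrite -opprB sinN ss oppr_gt0 ltNge; apply/negP/negPn.
  by rewrite divr_ge0 // mulr_ge0 // ltW.
exists s, (t / beta i).
have bz : beta i != 0 by rewrite gt_eqF.
have sbz : sin (beta i) != 0 by rewrite gt_eqF.
split => //.
- by rewrite divr_ge0 ?(ltW b1) //= ler_pdivrMr ?mul1r.
- rewrite mulrBl mul1r divfK // ss; field; exact/andP.
- rewrite divfK // st /d; field; exact/andP.
Qed.

Definition sector_vec i n a b : 'rV[R]_3 := \row_l
  (if l == crossing i n then a else if l == crossing i n.+1 then b else 1 - a - b).

Lemma sector_vecE i n a b :
  [/\ sector_vec i n a b ord0 (crossing i n) = a,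
      sector_vec i n a b ord0 (crossing i n.+1) = b
    & sector_vec i n a b ord0 i = 1 - a - b].
Proof.
by split; rewrite mxE ?eqxx ?crossingS_neq // !(eq_sym i) !crossing_neq.
Qed.

Lemma sector_vec_triangle i n a b : 0 <= a -> 0 <= b -> a + b <= 1 ->
  triangle R (sector_vec i n a b).
Proof.
move=> a0 b0 ab; have [e1 e2 e3] := sector_vecE i n a b; split; last first.
  by rewrite (sum_crossing i n) e1 e2 e3; lra.
by move=> l; case: (crossingP i n l) => ->; rewrite ?e1 ?e2 ?e3 //; lra.
Qed.

Lemma triangle_sector_vec i n v : triangle R v ->
  v = sector_vec i n (v ord0 (crossing i n)) (v ord0 (crossing i n.+1)).
Proof.
move=> [_ v1]; move: (v1); rewrite (sum_crossing i n) => v1'.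
apply/rowP => l; have [e1 e2 e3] := sector_vecE i n (v ord0 (crossing i n)) (v ord0 (crossing i n.+1)).
by case: (crossingP i n l) => ->; rewrite ?e1 ?e2 ?e3 //; lra.
Qed.

Lemma sector_vec0 i n : sector_vec i n 0 0 = apex R i.
Proof.
have [e1 e2 e3] := sector_vecE i n 0 0; apply/rowP => l; rewrite [RHS]apexE.
by case: (crossingP i n l) => ->; rewrite ?e1 ?e2 ?e3 ?crossing_neq ?eqxx // !subr0.
Qed.

Lemma ang_wrap N n s : (n < N)%N ->
  polar s (ang N n 1) = polar s (ang N (n.+1 %% N) 0).
Proof.
move=> nN; have [nN'|nN'] := ltnP n.+1 N.
  by rewrite modn_small // /ang natr1 addr0.
have -> : N = n.+1 by apply/eqP; rewrite eqn_leq nN nN'.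
rewrite modnn /ang natr1 addr0 mulr0 mul0r mulfK ?pnatr_eq0 //.
by apply/plane_eqP; rewrite !pxy mulr_natl cos2pi sin2pi cos0 sin0.
Qed.

(** At [tau = 1] the point lies on the side that the walk crosses next, so neighbouring sectors
    agree by gluing; at radius 0 all sectors give the common corner. *)
Lemma sector_pasting i g (S0 : set R) (a b : R -> R -> R) :
  compact S0 -> (forall s, S0 s -> 0 <= s) ->
  continuous (fun p : R * R => a p.1 p.2) -> continuous (fun p : R * R => b p.1 p.2) ->
  (forall s tau, S0 s -> 0 <= tau <= 1 -> [/\ 0 <= a s tau, 0 <= b s tau & a s tau + b s tau <= 1]) ->
  (forall s, [/\ a s 1 = 0, b s 0 = 0 & a s 0 = b s 1]) ->
  (forall tau, a 0 tau = 0 /\ b 0 tau = 0) ->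
  exists f : plane R -> X,
    {within [set z | S0 (enorm z)], continuous f} /\
    forall n s tau, (n < nsec i)%N -> S0 s -> 0 <= tau <= 1 ->
      f (polar s (ang (nsec i) n tau)) =
      pt (walk r i g n) (sector_vec i n (a s tau) (b s tau)).
Proof.
move=> cS S0ge ca cb ab abw ab0.
apply: (polar_pasting (F := fun n s tau => pt (walk r i g n) (sector_vec i n (a s tau) (b s tau)))) => //.
- exact: nsec_gt0.
- move=> n nN; apply: (within_comp (E := triangle R)) (pt_continuous (h := _)).
    move=> [s tau] [/= Ss]; rewrite in_itv /= => t01.
    by have [a0 b0 ab1] := ab _ _ Ss t01; exact: sector_vec_triangle.
  apply: continuous_subspaceT; apply: row_continuous => l.
  case: (crossingP i n l) => ->.
  + rewrite (_ : (fun x : R * R => _) = fun p : R * R => 1 - a p.1 p.2 - b p.1 p.2).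
      by apply: contD; [apply: contD; [exact: contC|exact: contN]|exact: contN].
    by apply/funext => p; case: (sector_vecE i n (a p.1 p.2) (b p.1 p.2)).
  + rewrite (_ : (fun x : R * R => _) = fun p : R * R => a p.1 p.2) //.
    by apply/funext => p; case: (sector_vecE i n (a p.1 p.2) (b p.1 p.2)).
  + rewrite (_ : (fun x : R * R => _) = fun p : R * R => b p.1 p.2) //.
    by apply/funext => p; case: (sector_vecE i n (a p.1 p.2) (b p.1 p.2)).
- move=> n s nN Ss; rewrite (walk_mod r i g n.+1); have [e1 e2 e3] := abw s.
  have -> : sector_vec i (n.+1 %% nsec i) (a s 0) (b s 0) = sector_vec i n (a s 1) (b s 1).
    have c1 : crossing i (n.+1 %% nsec i) = crossing i n.+1 by exact: crossing_mod.
    have c2 : crossing i (n.+1 %% nsec i).+1 = crossing i n.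
      by rewrite /crossing /= odd_mod ?negbK // /nsec oddM.
    apply/rowP => l; rewrite !mxE c1 c2 e1 e2 e3.
    have [->|] := eqVneq l (crossing i n.+1); first by rewrite crossingS_neq.
    by case: eqP => // _ _; rewrite !subr0.
  have [a0 b0 ab1] := ab s 1 Ss (introT andP (conj ler01 (lexx 1))).
  have t1 := sector_vec_triangle i n a0 b0 ab1.
  rewrite -[walk r i g n.+1]/(r (crossing i n) (walk r i g n)) pt_cross //.
  by have [-> _ _] := sector_vecE i n (a s 1) (b s 1).
- move=> _ n n' tau tau'; rewrite !(ab0 _).1 !(ab0 _).2 !sector_vec0.
  apply/pt_eq; [exact: apex_triangle|exact: apex_triangle|split=> //].
  rewrite zeros_apex; apply: (rst_trans _ _ _ g).
    by apply: rst_sym; exact: reach_walk.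
  exact: reach_walk.
Qed.

(** Any number strictly between 2/3 and the square root of 1/2 serves. Below the latter, points of
    the disc have [a + b < 1] and so stay inside the star. Above 2/3, the disc contains the points
    whose coordinate at the corner is at least 1/3, so the charts cover the surface. *)
Definition ball_radius : R := 7 / 10.

Lemma cone_small i a b s : 0 <= a -> 0 <= b -> s <= ball_radius -> 0 <= s ->
  s ^+ 2 = a ^+ 2 + b ^+ 2 + 2 * a * b * cos (beta i) -> a + b < 1.
Proof.
move=> a0 b0 sb s0 s2; have cb := cos_beta_ge0 i.
have : 0 <= 2 * a * b * cos (beta i) by rewrite !mulr_ge0.
have : s ^+ 2 <= ball_radius ^+ 2 by rewrite ler_sqr ?nnegrE // /ball_radius; lra.
rewrite s2 /ball_radius => h1 h2; rewrite ltNge; apply/negP => h3.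
have := sqr_ge0 (a - b); nra.
Qed.

Lemma cone_large i a b s : 0 <= a -> 0 <= b -> a + b <= 2 / 3 -> 0 <= s ->
  s ^+ 2 = a ^+ 2 + b ^+ 2 + 2 * a * b * cos (beta i) -> s < ball_radius.
Proof.
move=> a0 b0 ab s0 s2; have c1 := cos_le1 (beta i).
have h : 0 <= 2 * a * b * (1 - cos (beta i)) by rewrite !mulr_ge0 // subr_ge0.
have : s ^+ 2 <= (2 / 3) ^+ 2.
  by rewrite s2; apply: (@le_trans _ _ ((a + b) ^+ 2)); [nra|rewrite ler_sqr ?nnegrE //; lra].
have h23 : 0 <= 2 / 3 :> R by lra.
by rewrite ler_sqr ?nnegrE // /ball_radius; lra.
Qed.

Definition chart_ball i g : set X :=
  corner_star i g `&` [set x | enorm (star_map i g x) < ball_radius].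

Lemma chart_ball_open i g : open (chart_ball i g).
Proof.
rewrite /chart_ball setIC.
have /continuousP/(_ [set z | enorm z < ball_radius]) := star_map_continuous (i := i) (g := g).
rewrite -open_setIS; last exact: corner_star_open.
apply; rewrite (_ : mkset _ = (@enorm R 2) @^-1` [set x | x < ball_radius]) //.
apply: open_comp; last exact: open_lt.
by move=> z _; exact: enorm_continuous.
Qed.

(** The whole star would map to a polygonal region; cutting it down to a round disc lets the inverse
    be pasted in polar coordinates. *)
Lemma star_chart_ex i g : exists c : chart R X,
  [/\ chart_dom c = chart_ball i g, chart_map c = star_map i g
    & chart_map c @` chart_dom c = [set z | enorm z < ball_radius]].
Proof.
have sb := sin_beta_gt0 i; have b0 := beta_gt0 i; have b2 := beta_le i; have p0 := pi_gt0 R.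
pose a s tau := s * sin ((1 - tau) * beta i) / sin (beta i).
pose b s tau := s * sin (tau * beta i) / sin (beta i).
pose F n s tau := pt (walk r i g n) (sector_vec i n (a s tau) (b s tau)).
have sin_t0 tau : 0 <= tau <= 1 -> 0 <= sin (tau * beta i).
  move=> t01; apply: sin_ge0_pi; apply/andP; split; first by rewrite mulr_ge0 // ?(ltW b0); lra.
  have h : tau * beta i <= 1 * beta i by rewrite ler_pM2r //; lra.
  lra.
have ge0 s tau : 0 <= s -> 0 <= tau <= 1 -> 0 <= a s tau /\ 0 <= b s tau.
  by move=> s0 t01; rewrite /a /b; split; rewrite divr_ge0 ?(ltW sb) // mulr_ge0 //; apply: sin_t0; lra.
have ab s tau : 0 <= s -> 0 <= tau <= 1 ->
    s ^+ 2 = a s tau ^+ 2 + b s tau ^+ 2 + 2 * a s tau * b s tau * cos (beta i).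
  move=> s0 t01; have [e1 e2 _] := sector_vecE i 0 (a s tau) (b s tau).
  have := enorm_sq (polar s (ang (nsec i) 0 tau)).
  rewrite -(sector_pt_polar e1 e2) (sector_pt_polar e1 e2) enorm_polar.
  rewrite real_normK ?num_real // -(sector_pt_polar e1 e2) /sector_pt e1 e2 /ray !pxy.
  rewrite !mul1r mul0r cos0 sin0 => ->.
  have := cos2Dsin2 (beta i); move: (cos _) (sin _) => C D CD.
  move: (a s tau) (b s tau) => A B.
  by transitivity (A ^+ 2 + 2 * A * B * C + B ^+ 2 * (C ^+ 2 + D ^+ 2)); [ring|rewrite CD; ring].
have tri n s tau : 0 <= s <= ball_radius -> 0 <= tau <= 1 ->
    triangle R (sector_vec i n (a s tau) (b s tau)) /\
    0 < sector_vec i n (a s tau) (b s tau) ord0 i.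
  move=> /andP[s0 sr] t01; have [a0 b'0] := ge0 _ _ s0 t01.
  have lt1 := cone_small a0 b'0 sr s0 (ab _ _ s0 t01).
  have [_ _ ->] := sector_vecE i n (a s tau) (b s tau).
  by split; [apply: sector_vec_triangle => //; exact: ltW|lra].
have ca : continuous (fun p : R * R => a p.1 p.2).
  apply: contM; last exact: contC.
  apply: contM; first by move=> p; exact: cvg_fst.
  move=> p; apply: continuous_comp; last exact: continuous_sin.
  apply: contM; last exact: contC.
  by apply: contD; [exact: contC|apply: contN => p'; exact: cvg_snd].
have cb : continuous (fun p : R * R => b p.1 p.2).
  apply: contM; last exact: contC.
  apply: contM; first by move=> p; exact: cvg_fst.
  move=> p; apply: continuous_comp; last exact: continuous_sin.
  by apply: contM; [move=> p'; exact: cvg_snd|exact: contC].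
(* The inverse is built on the closed disc, as pasting requires a compact set of radii. *)
have [Psi [cPsi PsiE]] : exists f : plane R -> X,
    {within [set z | `[0, ball_radius]%classic (enorm z)], continuous f} /\
    forall n s tau, (n < nsec i)%N -> `[0, ball_radius]%classic s -> 0 <= tau <= 1 ->
      f (polar s (ang (nsec i) n tau)) = F n s tau.
  apply: sector_pasting => //.
  - exact: segment_compact.
  - by move=> s /=; rewrite in_itv /= => /andP[].
  - move=> s tau /=; rewrite in_itv /= => /andP[s0 sr] t01.
    have [a0 b'0] := ge0 _ _ s0 t01; split=> //.
    by apply/ltW/(cone_small a0 b'0 sr s0); exact: ab.
  - move=> s; rewrite /a /b subrr subr0 !mul0r !mul1r sin0 !mulr0 !mul0r.
    by split.
  - by move=> tau; rewrite /a /b !mul0r.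
have PhiPsi z : enorm z < ball_radius -> chart_ball i g (Psi z) /\ star_map i g (Psi z) = z.
  have [n [s [tau [nN s0 t01 ->]]]] := sector_exists z (nsec_gt0 i).
  rewrite enorm_polar ger0_norm // => sr.
  have sr' : 0 <= s <= ball_radius by rewrite s0 ltW.
  rewrite PsiE //.
  have [t1 v0] := tri n s tau sr' t01.
  have [e1 e2 _] := sector_vecE i n (a s tau) (b s tau).
  have e : star_map i g (F n s tau) = polar s (ang (nsec i) n tau).
    by rewrite /F star_mapE // (sector_pt_polar e1 e2).
  split=> //; split; first by apply/corner_starP; exists n, (sector_vec i n (a s tau) (b s tau)).
  by rewrite /= e enorm_polar ger0_norm.
have PsiPhi x : chart_ball i g x -> Psi (star_map i g x) = x.
  case=> /corner_starP [n [v [nN tv vi ->]]] /=; rewrite star_mapE //.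
  have [s [tau [s0 t01 ea eb s2]]] := cone_polar i (triangle_ge0 (crossing i n) tv) (triangle_ge0 (crossing i n.+1) tv).
  rewrite (sector_pt_polar ea eb) enorm_polar ger0_norm // => sr.
  rewrite (PsiE _ _ _ nN _ t01); last by rewrite /= in_itv /= s0 ltW.
  by rewrite /F /a /b -ea -eb -triangle_sector_vec.
have im : star_map i g @` chart_ball i g = [set z | enorm z < ball_radius].
  apply/seteqP; split => [z [x [_ xb] <-] //|z zb].
  by have [h1 h2] := PhiPsi z zb; exists (Psi z).
have oim : open (star_map i g @` chart_ball i g).
  rewrite im (_ : mkset _ = (@enorm R 2) @^-1` [set x | x < ball_radius]) //.
  apply: open_comp; last exact: open_lt.
  by move=> z _; exact: enorm_continuous.
have c1 : {within chart_ball i g, continuous (star_map i g)}.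
  by apply: continuous_subspaceW (star_map_continuous (i := i) (g := g)) => x [].
have c2 : {within star_map i g @` chart_ball i g, continuous Psi}.
  rewrite im; apply: continuous_subspaceW cPsi => z /= zb.
  by rewrite in_itv /= enorm_ge0 ltW.
have o1 : open (chart_ball i g) by exact: chart_ball_open.
by exists (Chart o1 oim PsiPhi c1 c2).
Qed.

End StarCharts.

(** * Winding number of a shear *)

Section Orientation.
Variable R : realType.
Implicit Types (al be t : R) (z p : plane R).

Definition coordX al z : R := px z * cos al + py z * sin al.
Definition coordY al z : R := py z * cos al - px z * sin al.
Definition frame al (x y : R) : plane R :=
  vec2 (x * cos al - y * sin al) (x * sin al + y * cos al).

Lemma frameK al x y : coordX al (frame al x y) = x /\ coordY al (frame al x y) = y.
Proof.
rewrite /coordX /coordY /frame !pxy; have := cos2Dsin2 al.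
move: (cos al) (sin al) => C D CD; split.
  by transitivity (x * (C ^+ 2 + D ^+ 2)); [ring|rewrite CD mulr1].
by transitivity (y * (C ^+ 2 + D ^+ 2)); [ring|rewrite CD mulr1].
Qed.

Lemma near_polar (P : set (plane R)) p : nbhs p P ->
  \forall e \near (0 : R)^'+, 0 < e /\ forall t, P (p + polar e t).
Proof.
move=> /nbhs_ballP[e /= e0 PB]; near=> d.
have d0 : 0 < d by near: d; exact: nbhs_right_gt.
have de : d < e by near: d; exact: nbhs_right_lt.
split=> // t; apply: PB; split=> // i j; rewrite (ord1 i) /ball /= mxE opprD addrA subrr sub0r normrN.
rewrite mxE; have ct := cos_max t; have st := sin_max t.
by case: ifP => _; rewrite normrM (gtr0_norm d0); apply: le_lt_trans de;
  rewrite -[leRHS]mulr1 ler_pM2l.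
Unshelve. all: by end_near. Qed.

(** In frames turned by [al] and [be] the map is [(x, y) -> (x + b y, d y)] with [d] increasing.
    Along a circle the image displacement is never opposite to the original one, so the angle
    between them has a continuous periodic choice. *)
Lemma orientation_shear (h : plane R -> plane R) p al be (q : plane R)
    (b d : R -> R) :
  continuous b -> continuous d -> (forall x y, x < y -> d x < d y) ->
  nbhs p [set z | h z = q + frame be (coordX al z + b (coordY al z)) (d (coordY al z))] ->
  orientation_preserving_at h p.
Proof.
move=> cb cd dlt hp; have hpp := nbhs_singleton hp.
have := near_polar hp; apply: filterS => r [r0 hr].
set Y0 := coordY al p.
pose s t := t - al.
pose U t := r * cos (s t) + (b (Y0 + r * sin (s t)) - b Y0).
pose V t := d (Y0 + r * sin (s t)) - d Y0.
have cs : continuous s by apply: contD => [x|]; [exact: cvg_id|exact: contC].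
have ccos : continuous (fun t => cos (s t)).
  by move=> t; apply: continuous_comp; [exact: cs|exact: continuous_cos].
have csin : continuous (fun t => sin (s t)).
  by move=> t; apply: continuous_comp; [exact: cs|exact: continuous_sin].
have cY : continuous (fun t => Y0 + r * sin (s t)).
  by apply: contD; [exact: contC|apply: contM => //; exact: contC].
have cU : continuous U.
  apply: contD; first by apply: contM => //; exact: contC.
  apply: contD; last exact: contC.
  by move=> t; apply: continuous_comp; [exact: cY|exact: cb].
have cV : continuous V.
  apply: contD; last exact: contC.
  by move=> t; apply: continuous_comp; [exact: cY|exact: cd].
have hE t : h (p + polar r t) = h p + frame be (U t) (V t).
  rewrite hr hpp.
  have -> : coordY al (p + polar r t) = Y0 + r * sin (s t).
    by rewrite /Y0 /coordY /s !pxy sinB; ring.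
  have -> : coordX al (p + polar r t) = coordX al p + r * cos (s t).
    by rewrite /coordX /s !pxy cosB; ring.
  by apply/plane_eqP; rewrite /frame /U /V -/Y0 !pxy; split; ring.
(* [(C, D)] is the image displacement [(U, V)] turned back by the angle [s t] of the original
   one. *)
pose C t := U t * cos (s t) + V t * sin (s t).
pose D t := V t * cos (s t) - U t * sin (s t).
pose rho t := Num.sqrt (C t ^+ 2 + D t ^+ 2).
have rho2 t : rho t ^+ 2 = C t ^+ 2 + D t ^+ 2.
  by rewrite sqr_sqrtr // addr_ge0 // sqr_ge0.
have VS t : sin (s t) != 0 -> 0 < V t * sin (s t).
  move=> sn; have [sp|sp|e] := ltgtP 0 (sin (s t)); last by rewrite -e eqxx in sn.
    by rewrite mulr_gt0 // subr_gt0; apply: dlt; rewrite ltrDl mulr_gt0.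
  by rewrite nmulr_rgt0 // subr_lt0; apply: dlt; rewrite gtrDl pmulr_rlt0.
(* [(C, D)] avoids the negative half-axis. Otherwise [(U, V)] would be a nonpositive multiple of the
   original direction: if [sin (s t)] is nonzero this contradicts the sign of [V], and if it is zero
   then [U] is [r * cos (s t)]. *)
have CD t : 0 < rho t + C t.
  have rr : `|C t| <= rho t.
    by rewrite -(@ler_sqr _ `|C t|) ?nnegrE ?sqrtr_ge0 // real_normK ?num_real // rho2 lerDl sqr_ge0.
  rewrite lt_neqAle; apply/andP; split; last first.
    have h1 : - C t <= `|C t| by rewrite -normrN ler_norm.
    lra.
  apply/eqP => e0.
  have rC : rho t = - C t by lra.
  have D0 : D t = 0.
    have h2 := rho2 t; rewrite rC sqrrN in h2.
    by apply/eqP; rewrite -sqrf_eq0; apply/eqP; lra.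
  have rge : 0 <= rho t by exact: sqrtr_ge0.
  have C0 : C t <= 0 by lra.
  have k := cos2Dsin2 (s t).
  have Ue : U t = C t * cos (s t).
    move: D0 k; rewrite /C /D; move: (cos _) (sin _) (U t) (V t) => c d' u v D0 k.
    have e1 : v * c = u * d' by lra.
    transitivity (u * (c ^+ 2 + d' ^+ 2)); first by rewrite k mulr1.
    by transitivity (u * c ^+ 2 + u * d' * d'); [ring|rewrite -e1; ring].
  have Ve : V t = C t * sin (s t).
    move: D0 k; rewrite /C /D; move: (cos _) (sin _) (U t) (V t) => c d' u v D0 k.
    have e1 : v * c = u * d' by lra.
    transitivity (v * (c ^+ 2 + d' ^+ 2)); first by rewrite k mulr1.
    by transitivity (v * c * c + v * d' ^+ 2); [ring|rewrite e1; ring].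
  have [s0|/VS] := eqVneq (sin (s t)) 0; last first.
    by rewrite Ve -mulrA -expr2 ltNge mulr_le0_ge0 ?sqr_ge0.
  move: Ue; rewrite /U s0 mulr0 addr0 subrr addr0.
  have c0 : cos (s t) != 0.
    by apply/eqP => c0; move: k; rewrite c0 s0 !expr0n /= addr0 => /eqP; rewrite eq_sym oner_eq0.
  by move/(mulIf c0) => rc; move: r0 C0; rewrite rc; lra.
have rho0 t : 0 < rho t.
  rewrite lt_neqAle sqrtr_ge0 andbT eq_sym; apply/eqP => r00.
  have := rho2 t; rewrite r00 expr0n /= => /esym/eqP.
  rewrite paddr_eq0 ?sqr_ge0 // !sqrf_eq0 => /andP[/eqP c0 _].
  by have := CD t; rewrite r00 c0 addr0 ltxx.
(* Half-angle formula: off the negative half-axis the argument of [(C, D)] is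
   [2 * atan (D / (rho + C))]. *)
pose y t := D t / (rho t + C t).
exists rho, (fun t => s t + be + 2 * atan (y t)).
have cC : continuous C by apply: contD; apply: contM.
have cD : continuous D by apply: contD; [apply: contM|apply: contN; apply: contM].
have crho : continuous rho.
  move=> t; apply: continuous_comp; last exact: sqrt_continuous.
  by apply: contD; exact: contX.
have cy : continuous y.
  by apply: contM => //; apply: contV; [exact: contD|move=> t; rewrite gt_eqF].
split => //.
- apply: contD; first by apply: contD => //; exact: contC.
  apply: contM; first exact: contC.
  by move=> t; apply: continuous_comp; [exact: cy|exact: continuous_atan].
- move=> t.
  have sE : s (t + 2 * pi) = s t + pi *+ 2 by rewrite /s mulr2n; lra.
  have UE : U (t + 2 * pi) = U t by rewrite /U sE cosD2pi sinD2pi.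
  have VE : V (t + 2 * pi) = V t by rewrite /V sE sinD2pi.
  have -> : y (t + 2 * pi) = y t by rewrite /y /rho /C /D UE VE sE cosD2pi sinD2pi.
  by rewrite sE mulr2n; lra.
- move=> t; rewrite hE; congr (_ + _).
  have a1 : cos (atan (y t)) ^+ 2 = (1 + y t ^+ 2)^-1.
    by rewrite cos_atan exprVn sqr_sqrtr // addr_ge0 // sqr_ge0.
  have y1 : 1 + y t ^+ 2 != 0 by rewrite gt_eqF // ltr_wpDr ?sqr_ge0.
  have a3 : cos (atan (y t)) != 0 by rewrite -sqrf_eq0 a1 invr_eq0.
  have a2 : sin (atan (y t)) = y t * cos (atan (y t)).
    have e : tan (atan (y t)) = y t by exact: atanK.
    by rewrite -[X in X * _]e /tan divfK.
  have e2 : 2 * atan (y t) = atan (y t) *+ 2 by rewrite mulr_natl.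
  have yd : 1 + y t ^+ 2 = 2 * rho t / (rho t + C t).
    rewrite /y expr_div_n; have n0 : rho t + C t != 0 by rewrite gt_eqF.
    have -> : D t ^+ 2 = rho t ^+ 2 - C t ^+ 2 by rewrite rho2 addrAC subrr add0r.
    by field.
  have n0 : rho t + C t != 0 by rewrite gt_eqF.
  have n1 : rho t != 0 by rewrite gt_eqF.
  have cosd : rho t * cos (2 * atan (y t)) = C t.
    rewrite e2 cos_mulr2n a1 yd mulr2n; field; exact/andP.
  have sind : rho t * sin (2 * atan (y t)) = D t.
    rewrite e2 sin_mulr2n a2 mulr2n.
    have -> : cos (atan (y t)) * (y t * cos (atan (y t))) = y t * cos (atan (y t)) ^+ 2 by ring.
    rewrite a1 yd /y; field; exact/andP.
  have k := cos2Dsin2 (s t).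
  have Uk : U t = U t * (cos (s t) ^+ 2 + sin (s t) ^+ 2) by rewrite k mulr1.
  have Vk : V t = V t * (cos (s t) ^+ 2 + sin (s t) ^+ 2) by rewrite k mulr1.
  have cE : rho t * cos (s t + be + 2 * atan (y t)) =
      cos (s t + be) * C t - sin (s t + be) * D t.
    by rewrite cosD -cosd -sind; ring.
  have sE : rho t * sin (s t + be + 2 * atan (y t)) =
      sin (s t + be) * C t + cos (s t + be) * D t.
    by rewrite sinD -cosd -sind; ring.
  apply/plane_eqP; rewrite /frame !pxy cE sE cosD sinD /C /D.
  rewrite [in LHS]Uk [in LHS]Vk; split; first by ring.
  by rewrite [in LHS]Uk [in LHS]Vk; ring.
Qed.

End Orientation.

(** * Atlas, orientation and countability of the cover *)

Section SurfaceStructure.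
Variables (R : realType) (S : choiceType) (M : cells S) (r : flag_graph M).
Local Notation G := (Mon M).
Local Notation X := (minimal_regular_cover R M).
Implicit Types (g h k : G) (v w : 'rV[R]_3) (i l : 'I_3).

(* Canonical representatives make two charts around the same cell coincide. *)
Definition base i h : G := xget (Mon_id M) [set g | parity r g /\ reach r (predC1 i) h g].

Lemma baseP i h : parity r (base i h) /\ reach r (predC1 i) h (base i h).
Proof.
rewrite /base; case: xgetP => [g -> //|].
have [hp|hp] := boolP (parity r h); first by move/(_ h) => []; split => //; exact: rst_refl.
move/(_ (r (side1 i) h)) => []; split; first by rewrite parity_cross hp.
by apply: reach_step; rewrite /= sideE.
Qed.

Lemma base_eq i h k : reach r (predC1 i) h k -> base i h = base i k.
Proof.
move=> hk; rewrite /base; congr (xget _ _); apply/seteqP; split=> g [pg H]; split=> //.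
  by apply: rst_trans H; apply: rst_sym.
exact: rst_trans hk H.
Qed.

Definition star_chart i h : chart R X := projT1 (cid (star_chart_ex R r i (base i h))).

Lemma star_chartP i h : [/\ chart_dom (star_chart i h) = chart_ball r i (base i h),
  chart_map (star_chart i h) = star_map r i (base i h)
  & chart_map (star_chart i h) @` chart_dom (star_chart i h) = [set z | enorm z < ball_radius R]].
Proof. by rewrite /star_chart; case: cid. Qed.

Lemma star_chart_eq i h k : reach r (predC1 i) h k -> star_chart i h = star_chart i k.
Proof. by move=> hk; rewrite /star_chart (base_eq hk). Qed.

Lemma star_chart_cover (x : X) : exists i h, chart_dom (star_chart i h) x.
Proof.
have [h [v [tv ->]]] := ptP x.
have [i vi] : exists i, 1 / 3 <= v ord0 i.
  have := triangle_sum ord0 tv.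
  have [|a] := leP (1 / 3) (v ord0 ord0); first by exists ord0.
  have [|b] := leP (1 / 3) (v ord0 (side1 ord0)); first by exists (side1 ord0).
  have [|c] := leP (1 / 3) (v ord0 (side2 ord0)); first by exists (side2 ord0).
  lra.
exists i, h; have [-> _ _] := star_chartP i h.
have [pb hb] := baseP i h.
have vi0 : 0 < v ord0 i by lra.
have /reach_coset [n nN hE] : reach r (predC1 i) (base i h) h by exact: rst_sym.
split; first by apply/corner_starP; exists n, v; rewrite -hE.
rewrite /= {2}hE star_mapE //.
have [s [tau [s0 t01 ea eb s2]]] :=
  cone_polar r i (triangle_ge0 (crossing i n) tv) (triangle_ge0 (crossing i n.+1) tv).
rewrite (sector_pt_polar ea eb) enorm_polar ger0_norm //.
apply: (cone_large (r := r) (i := i) _ _ _ s0 s2); try exact: triangle_ge0.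
by have := tv.2; rewrite (sum_crossing i n); lra.
Qed.

Lemma chart_near (c : chart R X) (x : X) (V : set X) : chart_dom c x -> nbhs x V ->
  nbhs (chart_map c x) [set z | exists2 y, chart_dom c y & chart_map c y = z /\ V y].
Proof.
move=> cx; rewrite nbhsE => -[U [oU Ux] UV].
have := @chart_inv_continuous _ _ c; move/continuousP/(_ _ oU).
rewrite -open_setIS; last exact: chart_image_open.
move=> oW; rewrite nbhsE; exists ((chart_map c @` chart_dom c) `&` chart_inv c @^-1` U).
  by split; [rewrite setIC|split => /=; [exists x|rewrite chart_mapK]].
move=> z [[y cy <-]] /=; rewrite chart_mapK // => Uy.
by exists y => //; split => //; exact: UV.
Qed.

(** The frame has its first axis along [ray i n]; [sector_ptSE] uses [ray i n.+1] instead. Together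
    they put two triangles with a common side into one frame. *)
Lemma sector_ptE i n v : sector_pt r i n v =
  frame (n%:R * beta R r i)
    (v ord0 (crossing i n) + v ord0 (crossing i n.+1) * cos (beta R r i))
    (v ord0 (crossing i n.+1) * sin (beta R r i)).
Proof.
rewrite /sector_pt /ray /frame.
have -> : n.+1%:R * beta R r i = n%:R * beta R r i + beta R r i by rewrite -natr1 mulrDl mul1r.
by apply/plane_eqP; rewrite !pxy !mul1r cosD sinD; split; ring.
Qed.

Lemma sector_ptSE i n v : sector_pt r i n v =
  frame (n.+1%:R * beta R r i)
    (v ord0 (crossing i n.+1) + v ord0 (crossing i n) * cos (beta R r i))
    (- (v ord0 (crossing i n) * sin (beta R r i))).
Proof.
rewrite /sector_pt /ray /frame.
have -> : n%:R * beta R r i = n.+1%:R * beta R r i - beta R r i by rewrite -natr1 mulrDl mul1r addrK.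
by apply/plane_eqP; rewrite !pxy !mul1r cosB sinB; split; ring.
Qed.

Lemma parity_walk i g n : parity r (walk r i g n) = odd n (+) parity r g.
Proof. by elim: n => //= n IH; rewrite parity_cross IH -addNb. Qed.

Lemma star_frame1 i g h : parity r g -> parity r h -> reach r (predC1 i) g h ->
  exists al, forall w, triangle R w -> 0 < w ord0 i ->
    star_map r i g (pt h w) = frame al
      (w ord0 (side1 i) + w ord0 (side2 i) * cos (beta R r i))
      (w ord0 (side2 i) * sin (beta R r i)) /\
    star_map r i g (pt (r (side2 i) h) w) = frame al
      (w ord0 (side1 i) + w ord0 (side2 i) * cos (beta R r i))
      (- (w ord0 (side2 i) * sin (beta R r i))).
Proof.
move=> pg ph /reach_coset [n nN hE].
have on : ~~ odd n by move: ph; rewrite hE parity_walk pg; case: odd.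
exists ((n + 2 * valence r i)%:R * beta R r i) => w tw wi.
rewrite hE -(walk_addp r i g n).
have : (0 < n + 2 * valence r i)%N by have := valence_gt0 r i; lia.
have : ~~ odd (n + 2 * valence r i) by rewrite oddD oddM /= addbF.
case: (n + _)%N => // N /= oN _; split.
  rewrite -[r _ _]/(walk r i g N.+1) star_mapE // sector_ptE.
  by rewrite /crossing /=; move: oN; case: odd.
have -> : crossing i N = side2 i by rewrite /crossing; move: oN; case: odd.
rewrite crossK star_mapE // sector_ptSE /crossing /=.
by move: oN; case: odd.
Qed.

Lemma star_frame2 i g h : parity r g -> parity r h -> reach r (predC1 i) g h ->
  exists al, forall w, triangle R w -> 0 < w ord0 i ->
    star_map r i g (pt h w) = frame al
      (w ord0 (side2 i) + w ord0 (side1 i) * cos (beta R r i))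
      (- (w ord0 (side1 i) * sin (beta R r i))) /\
    star_map r i g (pt (r (side1 i) h) w) = frame al
      (w ord0 (side2 i) + w ord0 (side1 i) * cos (beta R r i))
      (w ord0 (side1 i) * sin (beta R r i)).
Proof.
move=> pg ph /reach_coset [n nN hE].
have on : ~~ odd n by move: ph; rewrite hE parity_walk pg; case: odd.
exists (n.+1%:R * beta R r i) => w tw wi; rewrite hE; split.
  by rewrite star_mapE // sector_ptSE /crossing /= (negbTE on).
have -> : r (side1 i) (walk r i g n) = walk r i g n.+1.
  by rewrite /= /crossing (negbTE on).
by rewrite star_mapE // sector_ptE /crossing /= (negbTE on).
Qed.

(** The first axis of the frame runs along the side [l], from corner [i] towards [i']. The two
    triangles at that side differ in the sign of the second coordinate, and for the even one this
    sign depends only on the cyclic order of [i] and [i']. *)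
Lemma star_frame i i' l g h : l != i -> l != i' -> i != i' ->
  parity r g -> parity r h -> reach r (predC1 i) g h ->
  exists al, forall w, triangle R w -> 0 < w ord0 i ->
    let e := (if i' == side1 i then 1 else -1) * (w ord0 l * sin (beta R r i)) in
    star_map r i g (pt h w) = frame al
      (w ord0 i' + w ord0 l * cos (beta R r i)) e /\
    star_map r i g (pt (r l h) w) = frame al
      (w ord0 i' + w ord0 l * cos (beta R r i)) (- e).
Proof.
move=> li li' ii' pg ph gh.
case: (I3P i i') ii' li' => ->; rewrite ?sideE // => _ li'.
  have -> : l = side2 i by case: (I3P i l) li li' => ->; rewrite ?sideE.
  have [al H] := star_frame1 pg ph gh; exists al => w tw wi /=.
  by rewrite mul1r; exact: H.
have -> : l = side1 i by case: (I3P i l) li li' => ->; rewrite ?sideE.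
have [al H] := star_frame2 pg ph gh; exists al => w tw wi /=.
by rewrite mulN1r opprK; exact: H.
Qed.

Lemma transition_same i h (x : X) : chart_dom (star_chart i h) x ->
  orientation_preserving_at (chart_map (star_chart i h) \o chart_inv (star_chart i h))
    (chart_map (star_chart i h) x).
Proof.
move=> cx; apply: (@orientation_shear _ _ _ 0 0 0 (fun=> 0) id).
- exact: contC.
- by move=> y; exact: cvg_id.
- by [].
apply: filterS (chart_near cx (filterT : nbhs x setT)) => z /= [y cy [<- _]].
rewrite chart_mapK // add0r addr0 /frame /coordX /coordY.
by apply/plane_eqP; rewrite !pxy !(cos0, sin0) !(mulr1, mulr0, addr0, subr0, add0r).
Qed.

Lemma transition_diff i i' h h' (x : X) : i != i' ->
  chart_dom (star_chart i h) x -> chart_dom (star_chart i' h') x ->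
  orientation_preserving_at (chart_map (star_chart i' h') \o chart_inv (star_chart i h))
    (chart_map (star_chart i h) x).
Proof.
move=> ii' cx cx'.
have [l [li li']] : exists l, l != i /\ l != i'.
  case: (I3P i i') ii' => ->; rewrite ?sideE // => _.
    by exists (side2 i); rewrite !sideE.
  by exists (side1 i); rewrite !sideE.
have [dE mE _] := star_chartP i h; have [dE' mE' _] := star_chartP i' h'.
have [pb _] := baseP i h; have [pb' _] := baseP i' h'.
set g := base i h in dE mE pb; set g' := base i' h' in dE' mE' pb'.
have [k [v [tv xE]]] := ptP x.
have lpt (j : 'I_3) (f : G) : l != j -> corner_star r j f x -> 0 < v ord0 j /\ reach r (predC1 j) f k.
  move=> lj; rewrite xE /corner_star star_pt ?zeros_apex //; last exact: apex_triangle.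
  by case=> H ?; split=> //; apply: H; rewrite apexE eqxx ltr01.
have [vi gk] : 0 < v ord0 i /\ reach r (predC1 i) g k.
  by apply: lpt => //; move: cx; rewrite dE => -[].
have [vi' gk'] : 0 < v ord0 i' /\ reach r (predC1 i') g' k.
  by apply: lpt => //; move: cx'; rewrite dE' => -[].
pose kp := if parity r k then k else r l k.
have pk : parity r kp by rewrite /kp; case E : (parity r k); rewrite ?parity_cross ?E.
have kkp : k = kp \/ k = r l kp.
  by rewrite /kp; case: (parity r k); [left|right; rewrite crossK].
have stepl j f : l != j -> reach r (predC1 j) f k -> reach r (predC1 j) f kp.
  move=> lj fk; apply: rst_trans fk _; rewrite /kp; case: (parity r k).
    exact: rst_refl.
  by apply: reach_step.
have [al H] := star_frame li li' ii' pb pk (stepl _ _ li gk).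
have i'i : i' != i by rewrite eq_sym.
have [al' H'] := star_frame li' li i'i pb' pk (stepl _ _ li' gk').
have eps : (if i == side1 i' then 1 else -1) = - (if i' == side1 i then 1 else -1) :> R.
  by case: (I3P i i') ii' => ->; rewrite ?sideE //= ?opprK.
set ep : R := if i' == side1 i then 1 else -1 in H eps.
have ep2 : `|ep| = 1 by rewrite /ep; case: ifP; rewrite ?normrN normr1.
set B := beta R r i in H; set B' := beta R r i' in H'.
have sB : 0 < sin B := sin_beta_gt0 R r i.
have sB' : 0 < sin B' := sin_beta_gt0 R r i'.
(* The axes of the two frames along the side point at each other, hence the extra [pi]. The shear
   follows by eliminating the coordinate at [i] from the sum 1 and writing [|y| / sin B] for the
   coordinate at [l]. The opposite signs in [eps] cancel against the turn by [pi], which makes the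
   second function increasing. *)
apply: (@orientation_shear _ _ _ al (al' + pi) 0
  (fun y => `|y| * ((1 - cos B - cos B') / sin B) - 1) (fun y => y * (sin B' / sin B))).
- apply: contD; last exact: contC.
  by apply: contM; [apply: cont_norm => y; exact: cvg_id|exact: contC].
- by apply: contM; [move=> y; exact: cvg_id|exact: contC].
- by move=> y y' yy'; rewrite ltr_pM2r // divr_gt0.
have tm := mid_triangle R l.
have zm : zeros (mid R l) = pred1 l.
  apply/funext => j; rewrite /zeros midE /=; 
  by case: (j == l); rewrite ?eqxx // invr_eq0 pnatr_eq0.
(* Near [x] only the two triangles at the side [l] occur, whether or not [x] lies on that side. *)
have nx : nbhs x (star r (mid R l) kp `&` chart_dom (star_chart i' h')).
  apply: filterI; last by apply: open_nbhs_nbhs; split => //; exact: chart_dom_open.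
  apply: open_nbhs_nbhs; split; first exact: star_open.
  rewrite xE star_pt // zm; split.
    move=> j; rewrite midE; have [->|jl _] := eqVneq j l; first by rewrite ltxx.
    have [->//|ji] := eqVneq j i; have [->//|ji'] := eqVneq j i'.
    by move: jl ji ji' li li' ii'; case: (I3P i j) => ->; case: (I3P i l) => ->; case: (I3P i i') => ->; rewrite ?sideE.
  by apply/reach_edge.
apply: filterS (chart_near cx nx) => z /= [y cy [<- [ys cy']]].
rewrite chart_mapK // mE mE' add0r.
have [k' [w [tw yE]]] := ptP y.
move: ys; rewrite yE star_pt // zm => -[wpos /reach_edge kk'].
have wi : 0 < w ord0 i by apply: wpos; rewrite midE eq_sym (negbTE li) invr_gt0.
have wi' : 0 < w ord0 i' by apply: wpos; rewrite midE eq_sym (negbTE li') invr_gt0.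
have w0 : 0 <= w ord0 l by exact: triangle_ge0.
have ws : w ord0 i + w ord0 i' + w ord0 l = 1.
  have := tw.2; rewrite (sum_I3 _ i).
  by move: li li' ii'; case: (I3P i l) => ->; case: (I3P i i') => ->; rewrite ?sideE // => _ _ _ <-; ring.
have [e1 e2] := H w tw wi; have [e1' e2'] := H' w tw wi'.
have fpi x1 y1 : frame al' x1 y1 = frame (al' + pi) (- x1) (- y1).
  rewrite /frame cosDpi sinDpi; congr vec2; ring.
have an : `|w ord0 l * sin B| = w ord0 l * sin B by rewrite ger0_norm // mulr_ge0 // ltW.
have sBn : sin B != 0 by rewrite gt_eqF.
have wsi : w ord0 i = 1 - w ord0 i' - w ord0 l by rewrite -ws; ring.
case: kk' => ->; rewrite ?e1 ?e2 ?e1' ?e2' (frameK _ _ _).1 (frameK _ _ _).2 fpi;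
  rewrite ?normrN normrM ep2 mul1r an eps wsi; congr frame; field; exact: sBn.
Qed.

Lemma cover_orientable : orientable R X.
Proof.
exists [set c | exists i h, c = star_chart i h]; split.
  by move=> x; have [i [h cx]] := star_chart_cover x; exists (star_chart i h) => //; exists i, h.
move=> _ _ [i [h ->]] [i' [h' ->]] x cx cx'.
have [ii'|ii'] := eqVneq i i'; last exact: transition_diff.
subst i'; suff -> : star_chart i h' = star_chart i h by exact: transition_same.
have [pb hb] := baseP i h; have [pb' hb'] := baseP i h'.
move: cx cx'; have [-> _ _] := star_chartP i h; have [-> _ _] := star_chartP i h'.
have [k [v [tv ->]]] := ptP x.
rewrite /chart_ball /corner_star => -[+ _] [+ _].
rewrite !star_pt ?zeros_apex //; try exact: apex_triangle.
move=> [_ H1] [_ H2]; apply: star_chart_eq.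
apply: rst_trans hb' _; apply: rst_trans H2 _; apply: rst_sym.
exact: rst_trans hb H1.
Qed.

Definition word_act (w : seq 'I_3) : G := foldr (fun l g => r l g) (Mon_id M) w.

Lemma word_act_surj g : exists u, word_act u = g.
Proof.
apply: (reach_ind (P := fun g => exists u, word_act u = g) _ (reach_all r (Mon_id M) g)).
  by move=> h l _ [u <-]; exists (l :: u).
by exists [::].
Qed.

Lemma plane_box (p : plane R) (W : set (plane R)) : nbhs p W ->
  exists q : rat * rat * (rat * rat),
    let U := [set z : plane R | [/\ ratr q.1.1 < px z < ratr q.1.2 & ratr q.2.1 < py z < ratr q.2.2]] in
    U p /\ U `<=` W.
Proof.
move=> /nbhs_ballP[e /= e0 PB].
have key (a : R) : exists q : rat * rat, a - e < ratr q.1 < a /\ a < ratr q.2 < a + e.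
  have h1 : a - e < a by lra.
  have h2 : a < a + e by lra.
  have [q1 k1] := rat_in_itvoo h1; have [q2 k2] := rat_in_itvoo h2.
  by exists (q1, q2); move: k1 k2; rewrite !in_itv.
have [q1 [h1 h2]] := key (px p); have [q2 [h3 h4]] := key (py p).
exists (q1, q2) => /=; split; first by split; lra.
move=> z [/= k1 k2]; apply: PB; split=> // i j; rewrite (ord1 i) /ball /=.
case: j => [[|[|//]]] hj.
  rewrite (_ : Ordinal hj = ord0) //; last exact: val_inj.
  rewrite -/(px p) -/(px z) ltr_norml; lra.
rewrite (_ : Ordinal hj = ord_max) //; last exact: val_inj.
rewrite -/(py p) -/(py z) ltr_norml; lra.
Qed.

(** Every triangle is reached by a word in three letters, so countably many charts suffice; each
    contributes the preimages of rational boxes. *)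
Lemma cover_second_countable : @second_countable X.
Proof.
pose idx : Type := ('I_3 * seq 'I_3 * (rat * rat * (rat * rat)))%type.
pose box (q : rat * rat * (rat * rat)) := [set z : plane R |
  [/\ ratr q.1.1 < px z < ratr q.1.2 & ratr q.2.1 < py z < ratr q.2.2]].
pose B (a : idx) : set X := let c := star_chart a.1.1 (word_act a.1.2) in
  chart_dom c `&` chart_map c @^-1` box a.2.
have obox q : open (box q).
  have o (f : plane R -> R) (a b : R) : continuous f -> open [set z | a < f z < b].
    move=> cf; rewrite (_ : mkset _ = f @^-1` `]a, b[%classic); last first.
      by apply/seteqP; split => z /=; rewrite in_itv.
    by apply: open_comp; [move=> z _; exact: cf|exact: interval_open].
  rewrite (_ : box q = [set z | ratr q.1.1 < px z < ratr q.1.2] `&` [set z | ratr q.2.1 < py z < ratr q.2.2]).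
    by apply: openI; apply: o; [exact: px_continuous|exact: py_continuous].
  by apply/seteqP; split => z /= [].
exists (range B).
  have : countable [set: 'I_3 * seq 'I_3 * (rat * rat * (rat * rat))] by exact: countableP.
  by apply: card_le_trans; exact: card_image_le.
split.
  move=> _ [a _ <-]; rewrite /B /= setIC.
  have /continuousP/(_ _ (obox a.2)) := @chart_map_continuous _ _ (star_chart a.1.1 (word_act a.1.2)).
  by rewrite -open_setIS; last exact: chart_dom_open.
move=> x V xV; have [i [h cx]] := star_chart_cover x.
have [u wh] := word_act_surj h.
have [q [qx qV]] := plane_box (chart_near cx xV).
exists (B (i, u, q)).
  by split; [exists (i, u, q)|rewrite /B /= wh].
rewrite /B /= wh => y [cy /qV [y' cy' [yy' Vy']]].
by rewrite -(chart_mapK cy) -yy' chart_mapK.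
Qed.

Lemma cover_surface : surface R X.
Proof.
split.
- exact: cover_nonempty.
- exact: (@cover_connected R S M r).
- split; [exact: (@cover_hausdorff R S M r)|exact: cover_second_countable|].
  by move=> x; have [i [h cx]] := star_chart_cover x; exists (star_chart i h).
- exact: cover_orientable.
Qed.

End SurfaceStructure.

(** * Ends *)

Section OneEnd.
Variables (R : realType) (S : choiceType) (M : cells S) (r : flag_graph M).
Local Notation G := (Mon M).
Local Notation X := (minimal_regular_cover R M).
Implicit Types (g h k : G) (v w : 'rV[R]_3) (i l : 'I_3) (F : seq G).

Definition avoids F : G -> G -> Prop :=
  clos_refl_sym_trans G (fun h k => [/\ h \notin F, k \notin F & exists l, k = r l h]).

Definition one_ended_graph := forall F, exists F', {subset F <= F'} /\
  forall g h, g \notin F' -> h \notin F' -> avoids F g h.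

Definition tris F : set X := [set x | exists h v, [/\ h \in F, triangle R v & x = pt h v]].

Lemma tris_compact F : compact (tris F).
Proof.
elim: F => [|h F IH].
  rewrite (_ : tris [::] = set0); first exact: compact0.
  by apply/seteqP; split => // x [h [v []]].
rewrite (_ : tris (h :: F) = pt h @` triangle R `|` tris F).
  by apply: compactU => //; exact: tri_compact.
apply/seteqP; split => x.
  case=> k [v [/[!inE] /orP[/eqP ->|kF] tv ->]]; first by left; exists v.
  by right; exists k, v.
case=> [[v tv <-]|[k [v [kF tv ->]]]].
  by exists h, v; rewrite inE eqxx.
by exists k, v; rewrite inE kF orbT.
Qed.

Lemma tris_sub F F' : {subset F <= F'} -> tris F `<=` tris F'.
Proof. by move=> FF' x [h [v [hF tv ->]]]; exists h, v; split => //; exact: FF'. Qed.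

Definition coset_seq i h : seq G := [seq walk r i h n | n <- iota 0 (nsec r i)].

Lemma coset_seqP i h k : reflect (reach r (predC1 i) h k) (k \in coset_seq i h).
Proof.
apply: (iffP mapP) => [[n]|].
  by rewrite mem_iota add0n => /andP[_ nN] ->; apply/reach_coset; exists n.
by case/reach_coset => n nN ->; exists n => //; rewrite mem_iota.
Qed.

Lemma corner_star_tris i h : corner_star r i h `<=` tris (coset_seq i h).
Proof.
move=> x /corner_starP [n [v [nN tv vi ->]]]; exists (walk r i h n), v; split => //.
by apply/coset_seqP; exact: reach_walk.
Qed.

Lemma positive_corner v : triangle R v -> exists i, 0 < v ord0 i.
Proof.
move=> tv; have := triangle_sum ord0 tv.
have [a|] := leP (v ord0 ord0) 0; last by exists ord0.
have [b|] := leP (v ord0 (side1 ord0)) 0; last by exists (side1 ord0).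
have [c|] := leP (v ord0 (side2 ord0)) 0; last by exists (side2 ord0).
lra.
Qed.

Lemma corner_star_pt i h v : triangle R v -> 0 < v ord0 i -> corner_star r i h (pt h v).
Proof.
move=> tv vi; apply/star_pt => //; first exact: apex_triangle.
split; last exact: rst_refl.
by move=> l; rewrite apexE; case: eqP => [->|]; rewrite ?ltxx.
Qed.

(** The corner stars are open, cover the surface and each lie in finitely many triangles. *)
Lemma compact_tris (K : set X) : compact K -> exists F, K `<=` tris F.
Proof.
move=> /compact_near_coveringP cK.
(* The filter of finite lists directed by inclusion; compactness merges the local lists into one. *)
pose FF : set_system (seq G) := filter_from setT (fun F => [set F' : seq G | {subset F <= F'}]).
have FFf : Filter FF.
  apply: filter_from_filter; first by exists [::].
  move=> F F' _ _; exists (F ++ F') => //.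
  move=> F'' /= H; split => x xF; apply: H; by rewrite mem_cat xF ?orbT.
have : \forall F \near FF, K `<=` (fun x => tris F x).
  apply: cK => x Kx; have [h [v [tv xE]]] := ptP x.
  have [i vi] := positive_corner tv.
  exists (corner_star r i h, [set F' : seq G | {subset coset_seq i h <= F'}]); first split.
  - apply: open_nbhs_nbhs; split; first exact: corner_star_open.
    by rewrite xE; exact: corner_star_pt.
  - by exists (coset_seq i h).
  - by move=> [y F] /= [ys FF']; apply: tris_sub FF' _ _; exact: corner_star_tris.
by case=> F _ FK; exists F; apply: FK => /= x.
Qed.

(** All triangles that share a corner with one of [F]. A triangle outside this list is disjoint from
    [tris F], not merely different from its members. *)
Definition thicken F : seq G := flatten [seq flatten [seq coset_seq i h | h <- F] | i <- enum 'I_3].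

Lemma tris_disjoint F g v : g \notin thicken F -> triangle R v -> ~ tris F (pt g v).
Proof.
move=> gF tv [h [w [hF tw /(pt_eq r _ _ tv tw) [e H]]]]; move/negP: gF; apply.
have [i vi] := positive_corner tv.
apply/flattenP; exists (flatten [seq coset_seq i h | h <- F]).
  by apply/mapP; exists i => //; rewrite mem_enum.
apply/flattenP; exists (coset_seq i h); first by apply/mapP; exists h.
apply/coset_seqP; apply: rst_sym; apply: reach_sub H => l.
by rewrite /zeros /=; apply: contraTneq => ->; rewrite gt_eqF.
Qed.

Hypothesis infinite : forall F, exists g, g \notin F.
Hypothesis one_ended : one_ended_graph.

Lemma cover_noncompact (K : set X) : compact K -> exists x, ~ K x.
Proof.
move=> /compact_tris [F FK]; have [g gF] := infinite (thicken F).
exists (pt g (bary R)) => /FK; exact: (tris_disjoint gF (bary_triangle R)).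
Qed.

(** A path of triangles avoiding [thicken F] is a path in the surface that avoids the compact set,
    so one-endedness of the graph passes to the cover. *)
Lemma compact_complement (K : set X) : compact K -> exists L, [/\ compact L, K `<=` L &
  forall x y, ~ L x -> ~ L y -> connected_component (~` K) x y].
Proof.
move=> /compact_tris [F FK]; have [F' [FF' conn]] := one_ended (thicken F).
have off g v : g \notin thicken F -> triangle R v -> (~` K) (pt g v).
  by move=> gF tv /FK; exact: tris_disjoint.
exists (tris (F' ++ F)); split; first exact: tris_compact.
  by move=> x /FK; apply: tris_sub => h hF; rewrite mem_cat hF orbT.
move=> x y; have [g [v [tv ->]]] := ptP x; have [h [w [tw ->]]] := ptP y.
move=> xL yL.
have gF : g \notin F' by apply/negP => gF; apply: xL; exists g, v; rewrite mem_cat gF.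
have hF : h \notin F' by apply/negP => hF; apply: yL; exists h, w; rewrite mem_cat hF.
have gt : g \notin thicken F by apply: contra gF; exact: FF'.
have ht : h \notin thicken F by apply: contra hF; exact: FF'.
have sub k : k \notin thicken F -> pt k @` triangle R `<=` ~` K.
  by move=> kF z [u tu <-]; exact: off.
suff : connected_component (~` K) (pt g (bary R)) (pt h (bary R)).
  move=> H; apply: (connected_component_trans (y := pt g (bary R))).
    by apply: component_tri => //; [exact: bary_triangle|exact: sub].
  apply: (connected_component_trans H).
  by apply: component_tri => //; [exact: bary_triangle|exact: sub].
have tb := bary_triangle R.
have bK k : k \notin thicken F -> connected_component (~` K) (pt k (bary R)) (pt k (bary R)).
  by move=> kF; apply: connected_component_refl; exact: off.
(* Equality of the two membership conditions is carried along so that the induction passes through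
   symmetry and transitivity. *)
suff H : (g \notin thicken F) = (h \notin thicken F) /\ (g \notin thicken F ->
    connected_component (~` K) (pt g (bary R)) (pt h (bary R))) by exact: H.2.
elim: (conn _ _ gF hF) => {g h v w tv tw gF hF gt ht xL yL}.
- move=> g h [gF hF [l hE]]; split; first by rewrite gF hF.
  by move=> _; rewrite hE; apply: component_cross => //; [exact: sub|rewrite -hE; exact: sub].
- by move=> g; split => // ?; exact: bK.
- by move=> g h _ [e H]; split => // gF; apply: connected_component_sym; apply: H; rewrite e.
- move=> g h k _ [e1 H1] _ [e2 H2]; split; first by rewrite e1.
  by move=> gF; apply: (connected_component_trans (H1 gF)); apply: H2; rewrite -e1.
Qed.

(** The end selects the component of the complement that contains everything outside some larger
    compact set; such points exist by noncompactness. *)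
Lemma cover_one_end : one_end X.
Proof.
pose big (K : set X) x := exists L, [/\ compact L, K `<=` L, ~ L x &
  forall y, ~ L y -> connected_component (~` K) x y].
have bigP (K : set X) : compact K -> exists x, big K x.
  move=> cK; have [L [cL KL H]] := compact_complement cK.
  have [x xL] := cover_noncompact cL; exists x, L; split => // y; exact: H.
have [x0 _] := @cover_nonempty R S M.
pose E K := connected_component (~` K) (xget x0 (big K)).
have EP (K : set X) : compact K -> exists L, [/\ compact L, K `<=` L,
    ~ L (xget x0 (big K)) & forall y, ~ L y -> E K y].
  by move=> /bigP [x bx]; rewrite /E; case: xgetP => [y -> //|/(_ x)].
have eqK (K : set X) x y : connected_component (~` K) x y ->
    connected_component (~` K) x = connected_component (~` K) y.
  move=> xy; apply/seteqP; split => z; last exact: connected_component_trans.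
  by apply: connected_component_trans; exact: connected_component_sym.
have subK (K : set X) x y : connected_component (~` K) x y -> ~ K y.
  by case=> B [Bx BK _] By; exact: (BK _ By).
exists E.
  split=> [K cK|K L cK cL KL].
    have [L [cL KL xL _]] := EP _ cK; exists (xget x0 (big K)) => //.
    by move=> /KL.
  have [K1 [cK1 _ _ H1]] := EP _ cK; have [L1 [cL1 _ _ H2]] := EP _ cL.
  have [z /not_orP [zK zL]] := cover_noncompact (compactU cK1 cL1).
  have Kz := H1 _ zK; have Lz := H2 _ zL.
  rewrite /E (eqK _ _ _ Kz); apply: connected_component_max => //.
    by move=> y /subK nL Ky; apply: nL; exact: KL.
  exact: component_connected.
move=> E' [E'c E'm] K cK.
(* A point of [E' K1] lies off [K1], hence in [E K]; by monotonicity it also lies in [E' K]. *)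
have [K1 [cK1 KK1 _ H1]] := EP _ cK.
have [z zK1 E'z] := E'c _ cK1.
have E'Kz : E' K z.
  by apply: (E'm _ _ cK cK1 KK1); rewrite E'z; exact: connected_component_refl.
have [y yK E'y] := E'c _ cK; move: E'Kz; rewrite E'y => yz.
by rewrite (eqK _ _ _ yz) /E (eqK _ _ _ (H1 _ zK1)).
Qed.

End OneEnd.

(** * Compact subsurfaces and genus *)

Section Subsurface.
Variables (R : realType) (S : choiceType) (M : cells S) (r : flag_graph M).
Local Notation G := (Mon M).
Local Notation X := (minimal_regular_cover R M).
Implicit Types (g h k : G) (v w : 'rV[R]_3) (i j l : 'I_3) (U : set X).

(* The triangles are cut into three quadrilaterals according to which
   barycentric coordinate is largest.  The resulting cell structure, with one
   2-cell per vertex, edge and face of the map, has only trivalent vertices, so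
   that any finite union of 2-cells is a bordered surface. *)
Definition top v i : bool := [forall j, v ord0 j <= v ord0 i].

Lemma topP v i : reflect (forall j, v ord0 j <= v ord0 i) (top v i).
Proof. exact: forallP. Qed.

Lemma top_ex v : exists i, top v i.
Proof.
have [i _ H] := @arg_maxP _ _ _ ord0 predT (fun i => v ord0 i) erefl.
by exists i; apply/topP => j; exact: H.
Qed.

Lemma top_ge v i : triangle R v -> top v i -> 3%:R^-1 <= v ord0 i.
Proof.
move=> tv /topP t; have := triangle_sum i tv.
by have := t (side1 i); have := t (side2 i); lra.
Qed.

Lemma closed_top i : closed [set v : 'rV[R]_3 | top v i].
Proof.
rewrite (_ : mkset _ = \bigcap_(j in [set: 'I_3]) [set v : 'rV[R]_3 | v ord0 j <= v ord0 i]).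
  by apply: closed_bigI => j _; apply: closed_coord_ge; exact: coord_cont3.
apply/seteqP; split => v /=; first by move=> /topP t j _; exact: t.
by move=> t; apply/topP => j; exact: t.
Qed.

(** [a h i] says that the 2-cell around corner [i] of triangle [h] is selected. Crossing a side
    other than [i] keeps that corner, so the answer must not change. *)
Definition cell_selection (a : G -> 'I_3 -> bool) :=
  forall h i l, l != i -> a (r l h) i = a h i.

Definition cells_of (a : G -> 'I_3 -> bool) : set X :=
  [set x | exists h v i, [/\ triangle R v, x = pt h v, top v i & a h i]].

Section Selection.
Variable a : G -> 'I_3 -> bool.
Hypothesis aC : cell_selection a.

Lemma selection_reach (Z : pred 'I_3) h k i : ~~ Z i -> reach r Z h k -> a k i = a h i.
Proof.
move=> Zi hk; apply: (reach_ind (P := fun k => a k i = a h i) _ hk) => // g l Zl <-.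
by apply: aC; apply: contraNneq Zi => <-.
Qed.

Lemma cells_of_pt h v : triangle R v -> cells_of a (pt h v) <-> exists2 i, top v i & a h i.
Proof.
move=> tv; split; last by case=> i ti ai; exists h, v, i.
case=> k [w [i [tw /(pt_eq r _ _ tv tw) [e H] ti ai]]]; subst w.
exists i => //; rewrite -(selection_reach _ H) // /zeros.
by rewrite gt_eqF // (lt_le_trans _ (top_ge tv ti)) // invr_gt0.
Qed.

Lemma cells_of_closed : closed (cells_of a).
Proof.
apply/closed_pt => h; exists (\bigcup_(i in [set i | a h i]) [set v : 'rV[R]_3 | top v i]).
  by apply: closed_bigcup => [|i _]; [exact: finite_finset|exact: closed_top].
move=> v tv; rewrite cells_of_pt //; split; first by case=> i ti ai; exists i.
by case=> i /= ai ti; exists i.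
Qed.

End Selection.

(** An arbitrarily small move towards the apex makes [i] the only largest coordinate ([top_apex]).
    Interiors and closures of unions of 2-cells are computed with it. *)
Lemma push_apex h v i U : triangle R v -> nbhs (pt h v) U ->
  exists e, [/\ 0 < e, e <= 1 & U (pt h (lerp e v (apex R i)))].
Proof.
move=> tv; rewrite nbhsE => -[U' [oU' Up] UU].
have [W oW WU] := (open_pt U').1 oU' h.
have e0 : lerp 0 v (apex R i) = v by rewrite /lerp subr0 scale1r scale0r addr0.
have n0 : nbhs (0 : R) [set e | W (lerp e v (apex R i))].
  apply: open_nbhs_nbhs; split; last by rewrite /= e0; apply/WU.
  apply: (@open_comp _ _ (fun e => lerp e v (apex R i)) W) => // x _.
  exact: lerp_continuous.
move/nbhs_ballP : n0 => [d /= d0 dW].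
exists (Num.min (d / 2) 1).
have m0 : 0 < Num.min (d / 2) 1 by rewrite lt_min divr_gt0 // ltr01.
have m1 : Num.min (d / 2) 1 <= 1 by rewrite ge_min lexx orbT.
split=> //; apply: UU; apply/WU.
  by apply: lerp_triangle => //; [rewrite (ltW m0)|exact: apex_triangle].
apply: dW; rewrite /ball /= sub0r normrN gtr0_norm //.
apply: (@le_lt_trans _ _ (d / 2)); first by rewrite ge_min lexx.
by rewrite ltr_pdivrMr // mulr_natr mulr2n ltrDl.
Qed.

Lemma top_apex e v i j : triangle R v -> top v i -> 0 < e -> e <= 1 ->
  top (lerp e v (apex R i)) j = (j == i).
Proof.
move=> tv /topP t e0 e1; have [->|ji] := eqVneq j i.
  apply/topP => l; rewrite !lerpE !apexE eqxx.
  have := t l; case: eqP => _ tl.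
    have h : (1 - e) * v ord0 l <= (1 - e) * v ord0 i by rewrite ler_wpM2l //; lra.
    lra.
  have h : (1 - e) * v ord0 l <= (1 - e) * v ord0 i by rewrite ler_wpM2l //; lra.
  lra.
apply/negbTE/topP => /(_ i); rewrite !lerpE !apexE eqxx (negbTE ji).
have h : (1 - e) * v ord0 j <= (1 - e) * v ord0 i by rewrite ler_wpM2l ?t //; lra.
lra.
Qed.

Variable B : seq G.
Variable g0 : G.
Hypothesis g0B : g0 \in B.
Hypothesis B_connected : forall g, g \in B ->
  clos_refl_sym_trans G (fun h k => [/\ h \in B, k \in B & exists l, k = r l h]) g0 g.

(** Corner [i] of [h] is also a corner of some triangle in [B]; this selects the 2-cells that make
    up [K]. *)
Definition meets h i : bool := has (fun g => g \in coset_seq r i h) B.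

Lemma meetsP h i : reflect (exists2 g, g \in B & reach r (predC1 i) h g) (meets h i).
Proof.
apply: (iffP hasP) => -[g gB hg]; exists g => //; exact/coset_seqP.
Qed.

Lemma meetsC : cell_selection meets.
Proof.
move=> h i l li; have hl : reach r (predC1 i) h (r l h) by exact: reach_step.
apply/meetsP/meetsP => -[g gB H]; exists g => //; first exact: rst_trans hl H.
by apply: rst_trans H; exact: rst_sym.
Qed.

Lemma meets_notC : cell_selection (fun h i => ~~ meets h i).
Proof. by move=> h i l li; rewrite meetsC. Qed.

Lemma meets_mem g i : g \in B -> meets g i.
Proof. by move=> gB; apply/meetsP; exists g => //; exact: rst_refl. Qed.

Definition support : seq G := undup (thicken r B).

Lemma supportP h : reflect (exists i, meets h i) (h \in support).
Proof.
rewrite mem_undup; apply: (iffP flattenP) => [[_ /mapP[i _ ->] /flattenP[_ /mapP[g gB ->]]]|[i]].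
  by move=> /coset_seqP gh; exists i; apply/meetsP; exists g => //; exact: rst_sym.
move=> /meetsP [g gB hg]; exists (flatten [seq coset_seq r i h | h <- B]).
  by apply/mapP; exists i => //; rewrite mem_enum.
apply/flattenP; exists (coset_seq r i g); first by apply/mapP; exists g.
by apply/coset_seqP; exact: rst_sym.
Qed.

Definition K : set X := cells_of meets.
Definition K0 : set X := ~` cells_of (fun h i => ~~ meets h i).

Lemma K_pt h v : triangle R v -> K (pt h v) <-> exists2 i, top v i & meets h i.
Proof. by move=> tv; apply: cells_of_pt => //; exact: meetsC. Qed.

Lemma K0_pt h v : triangle R v -> K0 (pt h v) <-> forall i, top v i -> meets h i.
Proof.
move=> tv; rewrite /K0 /setC /=; rewrite cells_of_pt //; last exact: meets_notC.
split=> [H i ti|H [i ti]]; last by rewrite H.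
by apply/negPn/negP => ai; apply: H; exists i.
Qed.

Lemma K_closed : closed K. Proof. by apply: cells_of_closed; exact: meetsC. Qed.

Lemma K0_open : open K0.
Proof. by rewrite openC; apply: cells_of_closed; exact: meets_notC. Qed.

Lemma K_compact : compact K.
Proof.
have tc : compact (tris support : set X) by exact: tris_compact.
have Kc := K_closed; apply: (subclosed_compact Kc tc) => x.
case=> h [v [i [tv -> ti ai]]]; exists h, v; split => //.
by apply/supportP; exists i.
Qed.

Lemma K0_sub : K0 `<=` K.
Proof.
move=> x; have [h [v [tv ->]]] := ptP x; rewrite K0_pt // K_pt // => H.
by have [i ti] := top_ex v; exists i => //; exact: H.
Qed.

Lemma K_interior : K° = K0.
Proof.
apply/seteqP; split => x.
  have [h [v [tv ->]]] := ptP x; rewrite K0_pt // => H i ti.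
  have [e [e0 e1]] := push_apex i tv H.
  have tl : triangle R (lerp e v (apex R i)).
    by apply: lerp_triangle => //; [rewrite (ltW e0)|exact: apex_triangle].
  by rewrite K_pt // => -[j]; rewrite top_apex // => /eqP ->.
move=> Kx; apply: filterS K0_sub _; apply: open_nbhs_nbhs; split => //.
exact: K0_open.
Qed.

Lemma K_closure : K = closure K0.
Proof.
apply/seteqP; split => x; last first.
  by move=> H; apply: K_closed; apply: closure_subset H; exact: K0_sub.
have [h [v [tv ->]]] := ptP x; rewrite K_pt // => -[i ti ai] U nU.
have [e [e0 e1 Ue]] := push_apex i tv nU.
have tl : triangle R (lerp e v (apex R i)).
  by apply: lerp_triangle => //; [rewrite (ltW e0)|exact: apex_triangle].
exists (pt h (lerp e v (apex R i))); split => //.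
by rewrite K0_pt // => j; rewrite top_apex // => /eqP ->.
Qed.

Lemma bary_coord i : bary R ord0 i = 3%:R^-1. Proof. by rewrite mxE. Qed.

Lemma lerp_mid u l i : lerp u (bary R) (mid R l) ord0 i =
  (1 - u) / 3 + (if i == l then 0 else u / 2).
Proof. by rewrite lerpE bary_coord midE; case: ifP => _; rewrite ?mulr0. Qed.

(** From any point one moves inside its cell to the apex, which is also a corner of a triangle of
    [B]. Triangles of [B] are joined through midpoints of sides, and they lie in [K0] entirely. *)
Lemma K0_connected : connected K0.
Proof.
have tb := bary_triangle R; have c0 g : g \in B -> K0 (pt g (bary R)).
  by move=> gB; rewrite K0_pt // => i _; exact: meets_mem.
suff H x : K0 x -> connected_component K0 (pt g0 (bary R)) x.
  rewrite (_ : K0 = connected_component K0 (pt g0 (bary R))); first exact: component_connected.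
  by apply/seteqP; split => x; [exact: H|case=> C [_ CK _]; exact: CK].
have apexb g i : g \in B -> connected_component K0 (pt g (bary R)) (pt g (apex R i)).
  move=> gB; apply: component_lerp => //; first exact: apex_triangle.
  move=> e e01; rewrite K0_pt; last by apply: lerp_triangle => //; exact: apex_triangle.
  by move=> j _; exact: meets_mem.
have chain g : g \in B -> connected_component K0 (pt g0 (bary R)) (pt g (bary R)).
  move=> gB; suff H : (g0 \in B) = (g \in B) /\ (g0 \in B ->
      connected_component K0 (pt g0 (bary R)) (pt g (bary R))) by exact: H.2.
  elim: (B_connected gB) => {g gB}.
  - move=> h k [hB kB [l kE]]; split; first by rewrite hB kB.
    move=> _; apply: (connected_component_trans (y := pt h (mid R l))).
      apply: component_lerp => //; first exact: mid_triangle.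
      move=> e e01; rewrite K0_pt; last by apply: lerp_triangle => //; exact: mid_triangle.
      by move=> j _; exact: meets_mem.
    rewrite -(pt_cross r (l := l)); last 2 first.
    - exact: mid_triangle.
    - by rewrite midE eqxx.
    rewrite -kE; apply: connected_component_sym; apply: component_lerp => //; first exact: mid_triangle.
    move=> e e01; rewrite K0_pt; last by apply: lerp_triangle => //; exact: mid_triangle.
    by move=> j _; exact: meets_mem.
  - by move=> h; split => // hB; apply: connected_component_refl; exact: c0.
  - by move=> h k _ [e H]; split => // kB; apply: connected_component_sym; apply: H; rewrite e.
  - move=> h k l _ [e1 H1] _ [e2 H2]; split; first by rewrite e1.
    by move=> hB; apply: (connected_component_trans (H1 hB)); apply: H2; rewrite -e1.
have [h [v [tv ->]]] := ptP x; rewrite K0_pt // => Kv.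
have [i ti] := top_ex v; have ai := Kv _ ti.
have [g gB hg] := elimT (meetsP _ _) ai.
apply: (connected_component_trans (chain _ gB)).
apply: (connected_component_trans (apexb _ i gB)).
have -> : pt g (apex R i) = pt h (apex R i) :> X.
  apply/(pt_eq r); [exact: apex_triangle|exact: apex_triangle|split => //].
  by rewrite zeros_apex; exact: rst_sym.
apply: connected_component_sym; apply: component_lerp => //; first exact: apex_triangle.
move=> e /andP[e0 e1]; rewrite K0_pt; last by apply: lerp_triangle; [rewrite e0|exact: tv|exact: apex_triangle].
move=> j; move: e0; rewrite le_eqVlt => /orP[/eqP <-|e0].
  by rewrite /lerp subr0 scale1r scale0r addr0; exact: Kv.
by rewrite top_apex // => /eqP ->.
Qed.

(** The barycentre of [h] lies on the boundary of [K] exactly in this case. *)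
Definition mixed h : bool := [exists i, meets h i] && [exists i, ~~ meets h i].

Lemma mixedP h : reflect ((exists i, meets h i) /\ exists i, ~~ meets h i) (mixed h).
Proof.
apply: (iffP andP) => -[H1 H2]; split; by [exact/existsP|apply/existsP].
Qed.

(* Boundary edges are oriented so that the selected cells lie on one side;
   [parity] tells the two orientations of the triangles apart. *)
Definition leaving (b : bool) h l : bool :=
  (meets h (side1 l) == ~~ b) && (meets h (side2 l) == b).

(** A nonconstant two-colouring of a 3-cycle changes exactly once in each direction; hence the
    boundary enters and leaves a mixed triangle once. *)
Lemma cyclic_change (f : 'I_3 -> bool) b : (exists i, f i) -> (exists i, ~~ f i) ->
  exists l, f (side1 l) = ~~ b /\ f (side2 l) = b.
Proof.
move=> [i0 fi0] [j0 fj0].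
have [i fi] : exists i, f i = ~~ b.
  by case: b; [exists j0; exact: negbTE|exists i0].
have [j fj] : exists j, f j = b.
  by case: b {i fi}; [exists i0|exists j0; exact: negbTE].
have neg (x : bool) : x != b -> x = ~~ b by case: x; case: (b).
have [f1|f1] := eqVneq (f (side1 i)) b; first by exists (side2 i); rewrite side12 side2K.
have [f2|f2] := eqVneq (f (side2 i)) b.
  by exists i; split => //; exact: neg.
case: (I3P i j) fj => -> fj; last 2 first.
- by rewrite fj eqxx in f1.
- by rewrite fj eqxx in f2.
by move: fj; rewrite fi; case: (b).
Qed.

Lemma cyclic_change_uniq (f : 'I_3 -> bool) b l l' :
  f (side1 l) = ~~ b -> f (side2 l) = b -> f (side1 l') = ~~ b -> f (side2 l') = b -> l = l'.
Proof.
move=> h1 h2; case: (I3P l l') => -> //; rewrite ?side1K ?side12 ?side21 ?side2K.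
  by rewrite h2; case: (b).
by rewrite h1 => _; case: (b).
Qed.

Lemma leaving_mixed b h l : leaving b h l -> mixed h.
Proof.
rewrite /leaving => /andP[/eqP h1 /eqP h2]; apply/mixedP.
case: b h1 h2 => h1 h2; split.
- by exists (side2 l); rewrite h2.
- by exists (side1 l); rewrite h1.
- by exists (side1 l); rewrite h1.
- by exists (side2 l); rewrite h2.
Qed.

Lemma leaving_uniq b h l l' : leaving b h l -> leaving b h l' -> l = l'.
Proof.
by move=> /andP[/eqP h1 /eqP h2] /andP[/eqP h3 /eqP h4]; exact: cyclic_change_uniq h1 h2 h3 h4.
Qed.

Definition side_of b h : 'I_3 := odflt ord0 [pick l | leaving b h l].

Lemma side_ofP b h : mixed h -> leaving b h (side_of b h).
Proof.
move=> /mixedP [H1 H2]; rewrite /side_of; case: pickP => //= nl.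
have [l [h1 h2]] := cyclic_change b H1 H2.
by have := nl l; rewrite /leaving h1 h2 !eqxx.
Qed.

Lemma side_of_eq b h l : leaving b h l -> side_of b h = l.
Proof.
by move=> hl; apply: (leaving_uniq _ hl); exact: side_ofP (leaving_mixed hl).
Qed.

(** A crossing preserves the colours at both ends of the side and reverses the parity. Hence the
    direction of travel is consistent, and [prev] inverts [next]. *)
Definition side_out h := side_of (parity r h) h.
Definition next h : G := r (side_out h) h.
Definition prev h : G := r (side_of (~~ parity r h) h) h.

Lemma leaving_cross b h l : leaving b (r l h) l = leaving b h l.
Proof. by rewrite /leaving !meetsC // ?neq_side1 ?neq_side2. Qed.

Lemma next_mixed h : mixed h -> mixed (next h).
Proof.
move=> hm; apply: (@leaving_mixed (parity r h) _ (side_out h)).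
by rewrite leaving_cross; exact: side_ofP.
Qed.

Lemma prev_mixed h : mixed h -> mixed (prev h).
Proof.
move=> hm; apply: (@leaving_mixed (~~ parity r h) _ (side_of (~~ parity r h) h)).
by rewrite leaving_cross; exact: side_ofP.
Qed.

Lemma nextK h : mixed h -> prev (next h) = h.
Proof.
move=> hm; rewrite /prev {1 2}/next parity_cross negbK.
have -> : side_of (parity r h) (r (side_out h) h) = side_out h.
  by apply: side_of_eq; rewrite leaving_cross; exact: side_ofP.
by rewrite crossK.
Qed.

Lemma prevK h : mixed h -> next (prev h) = h.
Proof.
move=> hm; rewrite /next /side_out {1 2}/prev parity_cross.
set l := side_of _ h.
have -> : side_of (~~ parity r h) (prev h) = l.
  by apply: side_of_eq; rewrite leaving_cross; exact: side_ofP.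
by rewrite crossK.
Qed.

Lemma side_out_next h : mixed h -> side_out (next h) != side_out h.
Proof.
move=> hm; apply/eqP => e.
have /andP[/eqP h1 /eqP h2] := side_ofP (parity r (next h)) (next_mixed hm).
have := side_ofP (parity r h) hm; rewrite -/(side_out h) -leaving_cross -/(next h) -e.
rewrite -/(side_out _) in h1 h2.
by rewrite /leaving h1 h2 /next parity_cross; case: (parity r h).
Qed.

(** A tent function: an edge runs from one barycentre to the midpoint of a side and then to the
    barycentre beyond it. *)
Definition fold (tau : R) : R := 1 - `|2 * tau - 1|.

Definition boundary_edge h (tau : R) : X :=
  pt (if tau <= 2^-1 then h else next h) (lerp (fold tau) (bary R) (mid R (side_out h))).

Lemma fold_in tau : 0 <= tau <= 1 -> 0 <= fold tau <= 1.
Proof.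
move=> t01; rewrite /fold; have := normr_ge0 (2 * tau - 1).
have : `|2 * tau - 1| <= 1 by rewrite ler_norml; lra.
lra.
Qed.

Lemma lerp_mid_triangle u l : 0 <= u <= 1 -> triangle R (lerp u (bary R) (mid R l)).
Proof. by move=> u01; apply: lerp_triangle => //; [exact: bary_triangle|exact: mid_triangle]. Qed.

Definition edge_path h l (tau : R) : X :=
  pt (if tau <= 2^-1 then h else r l h) (lerp (fold tau) (bary R) (mid R l)).

Lemma edge_path_continuous h l : {within `[0, 1], continuous (edge_path h l)}.
Proof.
have -> : `[0, 1]%classic = `[0, 2^-1]%classic `|` `[2^-1, 1]%classic :> set R.
  apply/seteqP; split => x /=; rewrite !in_itv /=.
    by move=> x01; have [h1|h1] := leP x 2^-1; [left|right]; lra.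
  by case; lra.
have cf : continuous fold.
  apply: contD; first exact: contC.
  apply: contN; apply: cont_norm; apply: contD; last exact: contC.
  by apply: contM; [exact: contC|move=> x; exact: cvg_id].
have key (k : G) (D : set R) : (forall x, D x -> 0 <= x <= 1) ->
    {within D, continuous (fun tau => pt k (lerp (fold tau) (bary R) (mid R l)) : X)}.
  move=> D01; apply: (within_comp (E := triangle R)) (pt_continuous (h := k)).
    by move=> x /D01 x01; apply: lerp_mid_triangle; exact: fold_in.
  apply: continuous_subspaceT => x.
  apply: (@continuous_comp _ _ _ fold (fun u => lerp u (bary R) (mid R l))); first exact: cf.
  exact: lerp_continuous.
apply: withinU_continuous; [exact: interval_closed|exact: interval_closed| |].
  apply: (within_ext _ (key h _ _)).
    by move=> x /=; rewrite in_itv /= /edge_path => /andP[_ ->].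
  by move=> x /=; rewrite in_itv /=; lra.
apply: (within_ext _ (key (r l h) _ _)); last first.
  by move=> x /=; rewrite in_itv /=; lra.
move=> x /=; rewrite in_itv /= /edge_path => /andP[x1 x2].
case: ifP => // x3; have -> : x = 2^-1 by lra.
have e1 : fold 2^-1 = 1 by rewrite /fold divff // subrr normr0 subr0.
rewrite e1 pt_cross //; first by apply: lerp_mid_triangle; lra.
by rewrite lerp_mid eqxx; lra.
Qed.

Lemma boundary_edge_continuous h : {within `[0, 1], continuous (boundary_edge h)}.
Proof. exact: edge_path_continuous. Qed.

Lemma boundary_edge0 h : boundary_edge h 0 = pt h (bary R).
Proof.
rewrite /boundary_edge /fold mulr0 sub0r normrN normr1 subrr.
by rewrite invr_ge0 ler0n /lerp subr0 scale1r scale0r addr0.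
Qed.

Lemma boundary_edge1 h : boundary_edge h 1 = pt (next h) (bary R).
Proof.
rewrite /boundary_edge /fold mulr1 (_ : 2 - 1 = 1 :> R); last by lra.
rewrite normr1 subrr ifF; last by apply/negbTE; rewrite -ltNge; lra.
by rewrite /lerp subr0 scale1r scale0r addr0.
Qed.

Lemma boundary_edge_inj h k tau tau' : mixed h -> mixed k ->
  0 <= tau <= 1 -> 0 <= tau' <= 1 -> boundary_edge h tau = boundary_edge k tau' ->
  [\/ h = k /\ tau = tau', [/\ k = next h, tau = 1 & tau' = 0]
    | [/\ h = next k, tau = 0 & tau' = 1]].
Proof.
move=> hm km t01 t'01; rewrite /boundary_edge.
have u01 := fold_in t01; have u'01 := fold_in t'01.
set l := side_out h; set l' := side_out k.
move=> /(pt_eq r _ _ (lerp_mid_triangle l u01) (lerp_mid_triangle l' u'01)) [e H].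
have hk : next h = next k -> h = k by move=> nhk; rewrite -(nextK hm) nhk nextK.
have c j : lerp (fold tau) (bary R) (mid R l) ord0 j = lerp (fold tau') (bary R) (mid R l') ord0 j by rewrite e.
(* The coordinates at [l] and [l'] alone tell barycentres from other points and, away from them,
   determine the side and the parameter. *)
have uu : (fold tau = 0 /\ fold tau' = 0) \/ (l = l' /\ fold tau = fold tau').
  have := c l; have := c l'; rewrite !lerp_mid !eqxx (eq_sym l').
  by have [ll|ll] := eqVneq l l' => c1 c2; [right|left]; split => //; lra.
have f0 x : 0 <= x <= 1 -> fold x = 0 -> x = 0 \/ x = 1.
  move=> x01; rewrite /fold; have [h0|h0] := leP 0 (2 * x - 1).
    by rewrite ger0_norm //; right; lra.
  by rewrite ltr0_norm //; left; lra.
case: uu => [[z z']|[ll uu]].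
  have : (if tau' <= 2^-1 then k else next k) = (if tau <= 2^-1 then h else next h).
    apply: (reach_none _ H) => j; rewrite /zeros lerp_mid z.
    by apply/eqP; case: ifP => _; lra.
  have l0 : (0 <= 2^-1 :> R) = true by rewrite invr_ge0 ler0n.
  have l1 : (1 <= 2^-1 :> R) = false by apply/negbTE; rewrite -ltNge; lra.
  case: (f0 _ t01 z) => ->; case: (f0 _ t'01 z') => ->; rewrite ?l0 ?l1.
  - by move=> ->; constructor 1.
  - by move=> <-; constructor 3.
  - by move=> ->; constructor 2.
  - by move/esym/hk => ->; constructor 1.
(* Two neighbouring triangles cannot both leave through their common side, since the boundary does
   not turn back. *)
have lt' : ~ (k = r l h).
  by move=> kE; have := side_out_next hm; rewrite /next -/l -kE -/l' ll eqxx.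
have lt'' : ~ (h = r l k).
  by move=> hE; have := side_out_next km; rewrite /next -/l' -ll -hE -/l ll eqxx.
have /reach_edge : reach r (pred1 l) (if tau <= 2^-1 then h else next h) (if tau' <= 2^-1 then k else next k).
  apply: reach_sub H => j; rewrite /zeros lerp_mid /=; have [_ //|jl] := eqVneq j l.
  by move=> /eqP z0; exfalso; lra.
have small x : x <= 2^-1 -> fold x = 2 * x.
  by move=> xh; rewrite /fold ler0_norm; lra.
have large x : 2^-1 < x -> fold x = 2 - 2 * x.
  by move=> xh; rewrite /fold ger0_norm; lra.
have nz : fold tau != 1 -> (if tau' <= 2^-1 then k else next k) = (if tau <= 2^-1 then h else next h).
  move=> /eqP u1; apply: (reach_none _ H) => j; rewrite /zeros lerp_mid.
  by apply/eqP; case: ifP => _; lra.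
move: nz; case: leP => h1; case: leP => h2; rewrite /next -/l -/l' -ll => nz.
- move: uu; rewrite !small // => uu [kh|/lt' //]; constructor 1; split => //; lra.
- by case: lt'; apply: nz; rewrite large //; apply/eqP; lra.
- by case: lt''; rewrite nz // uu large //; apply/eqP; lra.
- move: uu; rewrite !large // => uu [/(can_inj (crossK r l)) kh|].
    by constructor 1; split => //; lra.
  by rewrite crossK => e1; case: lt''.
Qed.

Definition rim : seq G := [seq h <- support | mixed h].

Lemma rimP h : (h \in rim) = mixed h.
Proof.
rewrite mem_filter andb_idr // => /mixedP [hi _]; exact/supportP.
Qed.

Lemma rim_next (x : seq_sub rim) : next (ssval x) \in rim.
Proof. by rewrite rimP next_mixed // -rimP; exact: ssvalP. Qed.

(** A permutation of the finite set of mixed triangles; its orbits are the boundary curves of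
    [K]. *)
Definition rim_succ (x : seq_sub rim) : seq_sub rim := SeqSub (rim_next x).

Lemma ssval_mixed (x : seq_sub rim) : mixed (ssval x).
Proof. by rewrite -rimP; exact: ssvalP. Qed.

Lemma rim_succ_inj : injective rim_succ.
Proof.
move=> x y /(congr1 (@ssval _ _)) /= e; apply: val_inj => /=.
by rewrite -(nextK (ssval_mixed x)) e nextK //; exact: ssval_mixed.
Qed.

Definition rim_curve (x : seq_sub rim) : set X := [set p | exists y tau,
  [/\ fconnect rim_succ x y, 0 <= tau <= 1 & p = boundary_edge (ssval y) tau]].

(** The circle is cut into as many arcs as the orbit has elements, and the [n]-th arc runs along the
    [n]-th boundary edge. *)
Lemma rim_curve_simple x : simple_closed_curve R (rim_curve x).
Proof.
pose N := order rim_succ x; have N0 : (0 < N)%N by exact: order_gt0.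
pose y n := iter n rim_succ x.
have yN n : y (n %% N)%N = y n.
  rewrite [in RHS](divn_eq n N) /y; elim: (n %/ N)%N => [|m IH]; first by rewrite mul0n.
  have e : iter N rim_succ x = x by rewrite /N iter_order //; exact: rim_succ_inj.
  by rewrite IH mulSn -addnA [in RHS]addnC [in RHS]iterD e.
have y_inj n n' : (n < N)%N -> (n' < N)%N -> y n = y n' -> n = n'.
  move=> nN n'N e; rewrite -(findex_iter nN) -(findex_iter n'N).
  by congr findex.
have [f [cf fE]] : exists f : plane R -> X,
    {within [set z | [set (1 : R)] (enorm z)], continuous f} /\
    forall n s tau, (n < N)%N -> [set (1 : R)] s -> 0 <= tau <= 1 ->
      f (polar s (ang N n tau)) = boundary_edge (ssval (y n)) tau.
  apply: (polar_pasting (F := fun n _ tau => boundary_edge (ssval (y n)) tau)) => //.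
  - exact: compact_set1.
  - by move=> s ->; exact: ler01.
  - move=> n nN.
    have cb : {within `[0, 1], continuous (boundary_edge (ssval (y n)))}.
      exact: boundary_edge_continuous.
    have cs : {within [set (1 : R)] `*` `[0, 1], continuous (fun p : R * R => p.2)}.
      by apply: continuous_subspaceT => p; exact: cvg_snd.
    by have := within_comp _ cs cb; apply => -[s tau] [].
  - move=> n s nN _; rewrite boundary_edge1 boundary_edge0 yN.
    by rewrite /y iterS.
  - by move=> /= /eqP; rewrite eq_sym oner_eq0.
have par (z : plane R) : enorm z = 1 -> exists n tau, [/\ (n < N)%N, 0 <= tau <= 1 & z = polar 1 (ang N n tau)].
  move=> z1; have [n [s [tau [nN s0 t01 zE]]]] := sector_exists z N0.
  move: z1; rewrite {1}zE enorm_polar ger0_norm // => s1.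
  by exists n, tau; split => //; rewrite zE s1.
exists f; split; first exact: cf.
- move=> z z' /set_mem /par [n [tau [nN t01 ->]]] /set_mem /par [n' [tau' [n'N t'01 ->]]].
  rewrite !fE // => /boundary_edge_inj []; try exact: ssval_mixed; try by [].
  + by move=> [/val_inj/y_inj -> // ->].
  + move=> [e -> ->]; rewrite ang_wrap //; congr (polar _ (ang _ _ _)).
    apply: y_inj => //; first by rewrite ltn_mod.
    by rewrite yN; apply: val_inj; rewrite /= e.
  + move=> [e -> ->]; rewrite [RHS]ang_wrap //; congr (polar _ (ang _ _ _)).
    apply: y_inj => //; first by rewrite ltn_mod.
    by rewrite yN; apply: val_inj; rewrite /= e.
apply/seteqP; split => p.
  case=> z [tau [xz t01 ->]]; have nN : (findex rim_succ x z < N)%N by exact: findex_max.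
  exists (polar 1 (ang N (findex rim_succ x z) tau)).
    by rewrite /unit_sphere /= enorm_polar normr1.
  by rewrite fE // /y iter_findex.
case=> z /par [n [tau [nN t01 ->]]] <-; rewrite fE //.
by exists (y n), tau; split => //; exact: fconnect_iter.
Qed.

Lemma rim_curve_disjoint x x' p : rim_curve x p -> rim_curve x' p -> fconnect rim_succ x x'.
Proof.
move=> [y [tau [xy t01 ->]]] [y' [tau' [xy' t'01]]].
have sym := fconnect_sym rim_succ_inj.
have step z : fconnect rim_succ z (rim_succ z) by exact: fconnect1.
move/boundary_edge_inj; case; try exact: ssval_mixed; try by [].
- by move=> [/val_inj yy _]; rewrite (connect_trans xy) // yy sym.
- move=> [e _ _]; have {}e : y' = rim_succ y by exact: val_inj.
  by rewrite (connect_trans xy) // (connect_trans (step _)) // -e sym.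
- move=> [e _ _]; have {}e : y = rim_succ y' by exact: val_inj.
  by rewrite (connect_trans xy) // e sym (connect_trans xy').
Qed.

Lemma top_two l v : triangle R v -> top v (side1 l) -> top v (side2 l) ->
  exists2 u, 0 <= u <= 1 & v = lerp u (bary R) (mid R l).
Proof.
move=> tv /topP t1 /topP t2; have s := triangle_sum l tv.
have := t1 (side2 l); have := t2 (side1 l); have := t1 l; have v0 := triangle_ge0 l tv.
move=> h1 h2 h3; exists (1 - 3 * v ord0 l); first by lra.
apply/rowP => j; rewrite lerp_mid.
by case: (I3P l j) => ->; rewrite ?sideE; lra.
Qed.

(** A frontier point has a selected and an unselected largest coordinate. So it lies on a segment
    from the barycentre to the midpoint of a side whose ends have different colours. *)
Lemma frontier_rim : K `\` K° = \bigcup_x rim_curve x.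
Proof.
rewrite K_interior; apply/seteqP; split => p; last first.
  move=> [x _ [y [tau [_ t01 ->]]]]; have ym := ssval_mixed y.
  have lt := lerp_mid_triangle (side_out (ssval y)) (fold_in t01).
  have key b h l : 0 <= fold tau <= 1 -> leaving b h l -> (K `\` K0) (pt h (lerp (fold tau) (bary R) (mid R l))).
    move=> u01 /andP[/eqP h1 /eqP h2].
    have tr := lerp_mid_triangle l u01.
    have tj j : j != l -> top (lerp (fold tau) (bary R) (mid R l)) j.
      by move=> jl; apply/topP => i; rewrite !lerp_mid (negbTE jl); case: ifP => _; lra.
    have t1 : top (lerp (fold tau) (bary R) (mid R l)) (side1 l) by apply: tj; rewrite sideE.
    have t2 : top (lerp (fold tau) (bary R) (mid R l)) (side2 l) by apply: tj; rewrite sideE.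
    split; first by rewrite K_pt //; case: b h1 h2 => h1 h2; [exists (side2 l)|exists (side1 l)]; rewrite ?h1 ?h2.
    rewrite K0_pt // => H; have := H _ t1; have := H _ t2.
    by rewrite h1 h2; case: (b).
  have l1 := side_ofP (parity r (ssval y)) ym.
  rewrite /boundary_edge; case: ifP => _; first by apply: key (fold_in t01) l1.
  by apply: key (fold_in t01) _; rewrite leaving_cross; exact: l1.
have [h [v [tv ->]]] := ptP p; case; rewrite K_pt // => -[i ti ai].
rewrite K0_pt // => /existsNP[j /not_implyP [tj /negP aj]].
have hm : mixed h by apply/mixedP; split; [exists i|exists j].
have ij : i <> j by move=> e; rewrite -e ai in aj.
have [l [b lb [t1 t2]]] : exists l, exists2 b, leaving b h l & top v (side1 l) /\ top v (side2 l).
  case: (I3P i j) ij aj tj => -> // _ /negbTE aj tj.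
    by exists (side2 i), false; rewrite /leaving side12 side2K ?ai ?aj.
  by exists (side1 i), true; rewrite /leaving side21 side1K ?ai ?aj.
have [u u01 ->] := top_two tv t1 t2.
have [tau t01 [ft th]] : exists2 tau, 0 <= tau <= 1 & fold tau = u /\ tau <= 2^-1.
  by exists (u / 2); [lra|split; [rewrite /fold ler0_norm; lra|lra]].
(* According to the direction of the colour change the point lies on the first half of the edge
   leaving [h], or on the second half of the edge that arrives from [prev h]; the latter explains
   [1 - tau]. *)
have [eb|eb] := eqVneq b (parity r h).
  have hr : h \in rim by rewrite rimP.
  exists (SeqSub hr) => //; exists (SeqSub hr), tau; split => //.
  by rewrite /boundary_edge th ft /= /side_out -eb (side_of_eq lb).
have nb : b = ~~ parity r h by move: eb; case: (b); case: (parity r h).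
have hr : prev h \in rim by rewrite rimP prev_mixed.
have so : side_out (prev h) = l.
  apply: side_of_eq; rewrite {2}/prev -nb (side_of_eq lb) leaving_cross.
  by rewrite /prev parity_cross -nb.
exists (SeqSub hr) => //; exists (SeqSub hr), (1 - tau); split => //; first by lra.
rewrite /boundary_edge /= so.
have -> : fold (1 - tau) = u by rewrite -ft /fold -normrN; congr (1 - `|_|); lra.
case: ifP => [th'|_]; last by rewrite prevK.
have u1 : u = 1 by rewrite -ft /fold ger0_norm; lra.
have pE : prev h = r l h by rewrite /prev -nb (side_of_eq lb).
rewrite pE pt_cross //; first exact: lerp_mid_triangle.
by rewrite lerp_mid eqxx u1; lra.
Qed.

Lemma K_subsurface : subsurface R K #|froots rim_succ|.
Proof.
split.
  exists K0; split; [exact: K0_open| |exact: K0_connected|exact: K_closure].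
  exists (pt g0 (bary R)); rewrite K0_pt; last exact: bary_triangle.
  by move=> i _; exact: meets_mem.
exists (fun i : 'I_#|froots rim_succ| => rim_curve (enum_val i)); split.
- by move=> i; exact: rim_curve_simple.
- move=> i j ij; apply/seteqP; split => // p [h1 h2]; apply: ij.
  apply: enum_val_inj; have := rim_curve_disjoint h1 h2.
  rewrite -(root_connect (fconnect_sym rim_succ_inj)).
  have /eqP ri : froot rim_succ (enum_val i) == enum_val i := enum_valP i.
  have /eqP rj : froot rim_succ (enum_val j) == enum_val j := enum_valP j.
  by rewrite ri rj => /eqP.
rewrite frontier_rim; apply/seteqP; split => p [x _ H].
  have rx : froot rim_succ x \in froots rim_succ by exact: roots_root (fconnect_sym rim_succ_inj) _.
  exists (enum_rank_in rx (froot rim_succ x)) => //.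
  rewrite enum_rankK_in //; case: H => y [tau [xy t01 ->]]; exists y, tau; split => //.
  rewrite (connect_trans _ xy) // (fconnect_sym rim_succ_inj).
  exact: connect_root.
by exists (enum_val x).
Qed.

End Subsurface.

Lemma within_cst (Y Z : topologicalType) (A : set Y) (c : Z) :
  {within A, continuous (fun _ : Y => c)}.
Proof. by apply: continuous_subspaceT => x; exact: cst_continuous. Qed.

(** * Cell decomposition of the subsurface and counting of cells *)

Section EulerCharacteristic.
Variables (R : realType) (S : choiceType) (M : cells S) (r : flag_graph M).
Local Notation G := (Mon M).
Local Notation X := (minimal_regular_cover R M).
Implicit Types (g h k : G) (v w : 'rV[R]_3) (i j l : 'I_3).

(* Radial coordinates on the 2-cells: [s] is 1 exactly on the boundary, where
   the largest coordinate is attained twice. *)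
Definition mu (tau : R) : R := (3 + `|2 * tau - 1|) / 2.

Lemma mu_ge tau : 3 / 2 <= mu tau.
Proof. by rewrite /mu; have := normr_ge0 (2 * tau - 1); lra. Qed.

Lemma mu_max tau : mu tau - 1 = Num.max tau (1 - tau).
Proof.
rewrite /mu; have [h|h] := leP tau (1 - tau).
  by rewrite ler0_norm; lra.
by rewrite ger0_norm; lra.
Qed.

Definition radial_a (s tau : R) : R := s * (1 - tau) / mu tau.
Definition radial_b (s tau : R) : R := s * tau / mu tau.

(** Since [mu tau] is [1 + max (tau, 1 - tau)], the third clause holds; it says that the coordinate
    at the corner exceeds the larger of the other two by [1 - s]. *)
Lemma radial_facts s tau : 0 <= s -> 0 <= tau <= 1 ->
  [/\ 0 <= radial_a s tau, 0 <= radial_b s tau,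
      radial_a s tau + radial_b s tau + Num.max (radial_b s tau) (radial_a s tau) = s
    & radial_b s tau = tau * (radial_a s tau + radial_b s tau)].
Proof.
move=> s0 t01; have m0 := mu_ge tau; have mp : 0 < mu tau by lra.
have mn : mu tau != 0 by rewrite gt_eqF.
rewrite /radial_a /radial_b; split.
- by rewrite divr_ge0 ?mulr_ge0 //; lra.
- by rewrite divr_ge0 ?mulr_ge0 //; lra.
- have -> : Num.max (s * tau / mu tau) (s * (1 - tau) / mu tau) = (mu tau - 1) * (s / mu tau).
    rewrite mu_max maxr_pMl; last by rewrite divr_ge0 //; lra.
    by congr Num.max; ring.
  by field.
- by field.
Qed.

Lemma radial_ex a b : 0 <= a -> 0 <= b -> exists s tau,
  [/\ 0 <= s, 0 <= tau <= 1, a = radial_a s tau, b = radial_b s tau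
    & s = a + b + Num.max b a].
Proof.
move=> a0 b0; have [ab|ab] := eqVneq (a + b) 0.
  have az : a = 0 by lra.
  have bz : b = 0 by lra.
  exists 0, 0; rewrite az bz /radial_a /radial_b !mul0r maxxx !addr0; split => //.
  by rewrite lexx ler01.
have abp : 0 < a + b by rewrite lt_neqAle eq_sym ab addr_ge0.
have t01 : 0 <= b / (a + b) <= 1.
  by apply/andP; split; [rewrite divr_ge0 // ltW|rewrite ler_pdivrMr // mul1r; lra].
exists (a + b + Num.max b a), (b / (a + b)).
have m0 := mu_ge (b / (a + b)); have mn : mu (b / (a + b)) != 0 by rewrite gt_eqF //; lra.
have mE : a + b + Num.max b a = (a + b) * mu (b / (a + b)).
  have := mu_max (b / (a + b)).
  have -> : 1 - b / (a + b) = a / (a + b) by field.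
  rewrite -maxr_pMl; last by rewrite invr_ge0 ltW.
  move=> e; have -> : mu (b / (a + b)) = Num.max b a / (a + b) + 1 by lra.
  by field.
split=> //.
- by rewrite !addr_ge0 // le_max b0.
- by rewrite /radial_a mE; field; apply/andP.
- by rewrite /radial_b mE; field; apply/andP.
Qed.

Lemma face_map_ex i g : exists f : plane R -> X,
  {within [set z | `[0, 1]%classic (enorm z)], continuous f} /\
  forall n s tau, (n < nsec r i)%N -> `[0, 1]%classic s -> 0 <= tau <= 1 ->
    f (polar s (ang (nsec r i) n tau)) =
    pt (walk r i g n) (sector_vec i n (radial_a s tau) (radial_b s tau)).
Proof.
have cmu : continuous (fun p : R * R => (mu p.2)^-1).
  apply: contV; last by move=> p; have := mu_ge p.2; move=> *; rewrite gt_eqF //; lra.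
  apply: contM; last exact: contC.
  apply: contD; first exact: contC.
  apply: cont_norm; apply: contD; last exact: contC.
  by apply: contM; [exact: contC|move=> p; exact: cvg_snd].
have c1 : continuous (fun p : R * R => p.1) by move=> p; exact: cvg_fst.
have c2 : continuous (fun p : R * R => p.2) by move=> p; exact: cvg_snd.
apply: sector_pasting.
- exact: segment_compact.
- by move=> s /=; rewrite in_itv /= => /andP[].
- apply: contM => //; apply: contM => //; apply: contD; first exact: contC.
  exact: contN.
- by apply: contM => //; exact: contM.
- move=> s tau; rewrite /= in_itv /= => /andP[s0 s1] t01.
  have [a0 b0 e _] := radial_facts s0 t01; split => //.
  have h : 0 <= Num.max (radial_b s tau) (radial_a s tau) by rewrite le_max b0.
  lra.
- move=> s; rewrite /radial_a /radial_b subrr subr0 !mulr0 !mul0r !mulr1; split => //.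
  by congr (_ / _); rewrite /mu mulr0 mulr1 sub0r normrN normr1 (_ : 2 - 1 = 1 :> R) ?normr1 //; lra.
- by move=> tau; rewrite /radial_a /radial_b !mul0r.
Qed.

Definition face_map i g : plane R -> X := projT1 (cid (face_map_ex i g)).

Lemma face_map_continuous i g : {within closed_disc R 2, continuous (face_map i g)}.
Proof.
rewrite /face_map; case: cid => f /= [cf _]; apply: continuous_subspaceW cf => z.
by rewrite /closed_disc /= in_itv /= enorm_ge0.
Qed.

Lemma face_mapE i g n s tau : (n < nsec r i)%N -> 0 <= s <= 1 -> 0 <= tau <= 1 ->
  face_map i g (polar s (ang (nsec r i) n tau)) =
  pt (walk r i g n) (sector_vec i n (radial_a s tau) (radial_b s tau)).
Proof.
by move=> nN s01 t01; rewrite /face_map; case: cid => f /= [_ ->] //; rewrite /= in_itv.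
Qed.

Lemma radial_vec i n s tau (v := sector_vec i n (radial_a s tau) (radial_b s tau)) :
  0 <= s <= 1 -> 0 <= tau <= 1 ->
  [/\ triangle R v, 0 < v ord0 i &
     v ord0 i - Num.max (v ord0 (crossing i n.+1)) (v ord0 (crossing i n)) = 1 - s].
Proof.
move=> /andP[s0 s1] t01; have [a0 b0 e _] := radial_facts s0 t01.
have m0 : 0 <= Num.max (radial_b s tau) (radial_a s tau) by rewrite le_max b0.
have ma : radial_a s tau <= Num.max (radial_b s tau) (radial_a s tau) by rewrite le_max lexx orbT.
have mb : radial_b s tau <= Num.max (radial_b s tau) (radial_a s tau) by rewrite le_max lexx.
have [e1 e2 e3] := sector_vecE i n (radial_a s tau) (radial_b s tau).
rewrite /v e1 e2 e3; split; [by apply: sector_vec_triangle => //; lra|lra|lra].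
Qed.

Lemma face_point i g k v : triangle R v -> top v i -> reach r (predC1 i) g k ->
  exists n s tau, [/\ (n < nsec r i)%N, 0 <= s <= 1, 0 <= tau <= 1,
    pt k v = face_map i g (polar s (ang (nsec r i) n tau))
    & v ord0 i - Num.max (v ord0 (crossing i n.+1)) (v ord0 (crossing i n)) = 1 - s].
Proof.
move=> tv /topP ti /reach_coset [n nN ->].
have [s [tau [s0 t01 ea eb sE]]] :=
  radial_ex (triangle_ge0 (crossing i n) tv) (triangle_ge0 (crossing i n.+1) tv).
have s1 : v ord0 i - Num.max (v ord0 (crossing i n.+1)) (v ord0 (crossing i n)) = 1 - s.
  by have := tv.2; rewrite (sum_crossing i n) sE; lra.
have mx : Num.max (v ord0 (crossing i n.+1)) (v ord0 (crossing i n)) <= v ord0 i.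
  by rewrite ge_max !ti.
have s01 : 0 <= s <= 1 by rewrite s0 /=; lra.
by exists n, s, tau; split => //; rewrite face_mapE // -ea -eb -triangle_sector_vec.
Qed.

(** Applying the star chart at the same corner turns an equality of image points into an equality of
    sector coordinates, to which [sector_inj] applies. The rest converts these coordinates back to
    radial ones. *)
Lemma face_map_inj i g : {in open_disc R 2 &, injective (face_map i g)}.
Proof.
have N0 := nsec_gt0 r i.
move=> z z'; have [n [s [tau [nN s0 t01 ->]]]] := sector_exists z N0.
have [n' [s' [tau' [n'N s'0 t'01 ->]]]] := sector_exists z' N0.
rewrite !inE /open_disc /= !enorm_polar !ger0_norm // => s1 s'1.
have s01 : 0 <= s <= 1 by rewrite s0 ltW.
have s'01 : 0 <= s' <= 1 by rewrite s'0 ltW.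
rewrite !face_mapE //.
have [tv vi _] := radial_vec i n s01 t01; have [tv' vi' _] := radial_vec i n' s'01 t'01.
have [a0 b0 sE tE] := radial_facts s0 t01; have [a'0 b'0 s'E t'E] := radial_facts s'0 t'01.
set v := sector_vec i n _ _ in tv vi *; set v' := sector_vec i n' _ _ in tv' vi' *.
have [e1 e2 e3] := sector_vecE i n (radial_a s tau) (radial_b s tau).
have [e1' e2' e3'] := sector_vecE i n' (radial_a s' tau') (radial_b s' tau').
move=> E; have := congr1 (star_map r i g) E; rewrite !star_mapE //.
have /(pt_eq r) [//|//|vv _] := E.
have [s2 [t2 [s20 t201 ea eb _]]] := cone_polar r i a0 b0.
have [s2' [t2' [s20' t201' ea' eb' _]]] := cone_polar r i a'0 b'0.
rewrite (@sector_pt_polar _ _ _ r i n s2 t2) ?e1 ?e2 //.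
rewrite (@sector_pt_polar _ _ _ r i n' s2' t2') ?e1' ?e2' // => P.
have sb := sin_beta_gt0 R r i; have sbn : sin (beta R r i) != 0 by rewrite gt_eqF.
have zero x y : radial_a x y = 0 -> radial_b x y = 0 -> 0 <= x -> 0 <= y <= 1 -> x = 0.
  by move=> xa xb x0 y0; have [_ _ <- _] := radial_facts x0 y0; rewrite xa xb maxxx !addr0.
case: (sector_inj nN n'N s20 s20' t201 t201' P) => ss [sz|[nn tt]|[nn t1 t0]|[nn t0 t1]].
- have -> : s = 0 by apply: (zero s tau) => //; rewrite ?ea ?eb sz !mul0r.
  have -> : s' = 0 by apply: (zero s' tau') => //; rewrite ?ea' ?eb' -ss sz !mul0r.
  by apply/plane_eqP; rewrite !pxy !mul0r.
- have ea2 : radial_a s tau = radial_a s' tau' by rewrite ea ea' ss tt.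
  have eb2 : radial_b s tau = radial_b s' tau' by rewrite eb eb' ss tt.
  have s_s' : s = s' by rewrite -sE -s'E ea2 eb2.
  have [z0|z0] := eqVneq (radial_a s tau + radial_b s tau) 0.
    have sz : s = 0 by apply: (zero s tau) => //; lra.
    by rewrite -s_s' sz; apply/plane_eqP; rewrite !pxy !mul0r.
  rewrite nn s_s'; congr (polar _ (ang _ _ _)).
  by apply: (mulIf z0); rewrite -tE ea2 eb2 -t'E.
- have az : radial_a s tau = 0 by rewrite ea t1 subrr mul0r sin0 mulr0 mul0r.
  have bz : radial_b s' tau' = 0 by rewrite eb' t0 mul0r sin0 mulr0 mul0r.
  have ab : radial_b s tau = radial_a s' tau'.
    by rewrite eb ea' t1 t0 subr0 ss.
  have s_s' : s = s' by rewrite -sE -s'E az bz ab add0r addr0 maxC.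
  have [z0|z0] := eqVneq (radial_b s tau) 0.
    have sz : s = 0 by exact: (zero s tau).
    by rewrite -s_s' sz; apply/plane_eqP; rewrite !pxy !mul0r.
  have -> : tau = 1 by apply: (mulIf z0); rewrite mul1r {2}tE az add0r.
  have -> : tau' = 0.
    by apply/eqP; move: t'E; rewrite bz addr0 => /esym/eqP; rewrite mulf_eq0 -ab (negbTE z0) orbF.
  by rewrite s_s' nn ang_wrap.
- have az : radial_a s' tau' = 0 by rewrite ea' t1 subrr mul0r sin0 mulr0 mul0r.
  have bz : radial_b s tau = 0 by rewrite eb t0 mul0r sin0 mulr0 mul0r.
  have ab : radial_b s' tau' = radial_a s tau.
    by rewrite eb' ea t1 t0 subr0 ss.
  have s_s' : s = s' by rewrite -sE -s'E az bz ab add0r addr0 maxC.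
  have [z0|z0] := eqVneq (radial_b s' tau') 0.
    have sz : s' = 0 by exact: (zero s' tau').
    by rewrite s_s' sz; apply/plane_eqP; rewrite !pxy !mul0r.
  have -> : tau' = 1 by apply: (mulIf z0); rewrite mul1r {2}t'E az add0r.
  have -> : tau = 0.
    by apply/eqP; move: tE; rewrite bz addr0 => /esym/eqP; rewrite mulf_eq0 -ab (negbTE z0) orbF.
  by rewrite s_s' nn ang_wrap.
Qed.

(** [None] is the vertex at the barycentre, [Some (l, false)] the edge across side [l], and
    [Some (i, true)] the 2-cell around corner [i]. *)
Definition code : Type := option ('I_3 * bool).

Definition dim (c : code) : nat :=
  match c with None => 0 | Some (_, false) => 1 | Some (_, true) => 2 end.

Definition cell_map h (c : code) : 'rV[R]_(dim c) -> X :=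
  match c with
  | None => fun _ => pt h (bary R)
  | Some (l, false) => fun x : 'rV[R]_1 => edge_path r h l ((x ord0 ord0 + 1) / 2)
  | Some (i, true) => fun x : 'rV[R]_2 => face_map i h x
  end.

(** Open cells by the order pattern of the coordinates: all equal, two tied for the largest, or a
    single largest one. *)
Definition in_cell h (c : code) k v : Prop :=
  match c with
  | None => v = bary R /\ k = h
  | Some (l, false) => [/\ v ord0 (side1 l) = v ord0 (side2 l), v ord0 l < v ord0 (side1 l)
                         & k = h \/ k = r l h]
  | Some (i, true) => [/\ v ord0 (side1 i) < v ord0 i, v ord0 (side2 i) < v ord0 i
                         & reach r (predC1 i) h k]
  end.

Lemma enorm1 (x : 'rV[R]_1) : enorm x = `|x ord0 ord0|.
Proof. by rewrite /enorm big_ord1 sqrtr_sqr. Qed.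

Lemma enorm0 (x : 'rV[R]_0) : enorm x = 0.
Proof. by rewrite /enorm big_ord0 sqrtr0. Qed.

Lemma lt_crossing i n v (t : R) : v ord0 (side1 i) < t -> v ord0 (side2 i) < t ->
  Num.max (v ord0 (crossing i n.+1)) (v ord0 (crossing i n)) < t.
Proof. by move=> h1 h2; rewrite gt_max /crossing /=; case: odd; rewrite h1 h2. Qed.

Lemma cell_image h c k v : triangle R v ->
  (cell_map (c := c) h @` open_disc R (dim c)) (pt k v) <-> in_cell h c k v.
Proof.
move=> tv; case: c => [[l []]|] /=; last first.
- split; last by case=> -> ->; exists 0; rewrite // /open_disc /= enorm0 ltr01.
  case=> x _ /(pt_eq r _ _ (bary_triangle R) tv) [e H].
  split=> //; apply: (reach_none _ H) => j; rewrite /zeros bary_coord.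
  by rewrite invr_eq0 pnatr_eq0.
- split.
    case=> x; rewrite /open_disc /= enorm1 ltr_norml => /andP[x1 x2].
    set tau := (_ + _) / 2; have t0 : 0 < tau < 1 by rewrite /tau; lra.
    have t01 : 0 <= tau <= 1 by lra.
    have u0 : 0 < fold tau <= 1.
      rewrite /fold; have [h1|h1] := leP tau 2^-1.
        by rewrite ler0_norm; lra.
      by rewrite ger0_norm; lra.
    have lt := lerp_mid_triangle l (fold_in t01).
    move=> /(pt_eq r _ _ lt tv) [e H]; rewrite -e !lerp_mid !sideE; split; [by []|lra|].
    have /reach_edge : reach r (pred1 l) (if tau <= 2^-1 then h else r l h) k.
      apply: reach_sub H => j; rewrite /zeros lerp_mid /=; have [_ //|jl] := eqVneq j l.
      by move=> /eqP z0; exfalso; lra.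
    by case: ifP => _ [->|->]; rewrite ?crossK; [left|right|right|left].
  case=> e lt kh; have s := triangle_sum l tv; have v0 := triangle_ge0 l tv.
  pose u := 1 - 3 * v ord0 l; have u01 : 0 < u <= 1 by rewrite /u; lra.
  have vE : v = lerp u (bary R) (mid R l).
    by apply/rowP => j; rewrite lerp_mid /u; case: (I3P l j) => ->; rewrite ?sideE; lra.
  have step tau : 0 < tau < 1 -> fold tau = u -> (if tau <= 2^-1 then h else r l h) = k ->
      (cell_map (c := Some (l, false)) h @` open_disc R 1) (pt k v).
    move=> t01 ft kE; exists (const_mx (2 * tau - 1)).
      by rewrite /open_disc /= enorm1 mxE ltr_norml; lra.
    rewrite /= mxE (_ : (2 * tau - 1 + 1) / 2 = tau); last by lra.
    by rewrite /edge_path ft kE -vE.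
  case: kh => kE.
    apply: (step (u / 2)); first by lra.
      by rewrite /fold ler0_norm; lra.
    by rewrite ifT //; lra.
  have [u1|u1] := eqVneq u 1.
    have vl : v ord0 l = 0 by move: u1; rewrite /u; lra.
    rewrite kE pt_cross //.
    exists (const_mx 0); first by rewrite /open_disc /= enorm1 mxE normr0 ltr01.
    rewrite /= mxE add0r mul1r /edge_path lexx vE u1 /fold divff ?pnatr_eq0 //.
    by rewrite subrr normr0 subr0.
  have u2 : u < 1 by rewrite lt_neqAle u1; lra.
  apply: (step (1 - u / 2)); first by lra.
    by rewrite /fold ger0_norm; lra.
  by rewrite ifF //; apply/negbTE; rewrite -ltNge; lra.
- split.
    case=> z; have [n [s [tau [nN s0 t01 ->]]]] := sector_exists z (nsec_gt0 r l).
    rewrite /open_disc /= enorm_polar ger0_norm // => s1.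
    have s01 : 0 <= s <= 1 by rewrite s0 ltW.
    rewrite face_mapE //; have [tw wi ws] := radial_vec l n s01 t01.
    move=> /(pt_eq r _ _ tw tv) [e H]; rewrite e in ws wi.
    have : Num.max (v ord0 (crossing l n.+1)) (v ord0 (crossing l n)) < v ord0 l by lra.
    rewrite gt_max => /andP[h1 h2].
    have [h3 h4] : v ord0 (side1 l) < v ord0 l /\ v ord0 (side2 l) < v ord0 l.
      by move: h1 h2; rewrite /crossing /=; case: odd.
    split=> //; apply: (rst_trans _ _ _ (walk r l h n)); first exact: reach_walk.
    apply: reach_sub H => j; rewrite /zeros e /=.
    by apply: contraTneq => ->; rewrite gt_eqF.
  case=> h1 h2 hk.
  have ti : top v l.
    by apply/topP => j; case: (I3P l j) => ->; rewrite ?lexx ?ltW.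
  have [n [s [tau [nN s01 t01 -> sE]]]] := face_point tv ti hk.
  exists (polar s (ang (nsec r l) n tau)) => //.
  rewrite /open_disc /= enorm_polar ger0_norm ?(andP s01).1 //.
  have := lt_crossing n h1 h2; lra.
Qed.

Variable B : seq G.

Local Notation meets := (meets r B).
Local Notation support := (support r B).

(** The edge across side [l] separates the cells around the two ends of that side, and belongs to
    [K] when one of them does. *)
Definition selected_edge (x : G * 'I_3) : bool :=
  meets x.1 (side1 x.2) || meets x.1 (side2 x.2).

Definition pairs : seq (G * 'I_3) := [seq (h, l) | h <- support, l <- enum 'I_3].
(** Each edge is seen from two triangles and each 2-cell from a whole fan; parity and the
    representative [base] count them once. *)
Definition edge_list := [seq x <- pairs | selected_edge x && parity r x.1].
Definition face_list := [seq x <- pairs | meets x.1 x.2 && (x.1 == base r x.2 x.1)].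

Definition cell_list : seq (G * option ('I_3 * bool)) :=
  [seq (h, None) | h <- support] ++ [seq (x.1, Some (x.2, false)) | x <- edge_list] ++
  [seq (x.1, Some (x.2, true)) | x <- face_list].

Lemma pairsP x : (x \in pairs) = (x.1 \in support).
Proof.
case: x => h l; apply/allpairsP/idP => [[[a b] [ha _ [-> _]]] //|hs].
by exists (h, l); rewrite mem_enum.
Qed.

Lemma pairs_uniq : uniq pairs.
Proof.
by apply: allpairs_uniq; [exact: undup_uniq|exact: enum_uniq|move=> [a b] [c d]].
Qed.

Lemma cell_list_vertex h : ((h, None) \in cell_list) = (h \in support).
Proof.
rewrite !mem_cat; apply/or3P/idP => [[/mapP[k hk [->]] //|/mapP[x _] //|/mapP[x _] //]|hs].
by constructor 1; apply/mapP; exists h.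
Qed.

Lemma edge_listP x : (x \in edge_list) = selected_edge x && parity r x.1.
Proof.
rewrite mem_filter pairsP andb_idr // => /andP[/orP[] m _]; apply/supportP.
  by exists (side1 x.2).
by exists (side2 x.2).
Qed.

Lemma face_listP x : (x \in face_list) = meets x.1 x.2 && (x.1 == base r x.2 x.1).
Proof.
by rewrite mem_filter pairsP andb_idr // => /andP[m _]; apply/supportP; exists x.2.
Qed.

Lemma cell_list_edge h l : ((h, Some (l, false)) \in cell_list) = selected_edge (h, l) && parity r h.
Proof.
rewrite -(edge_listP (h, l)) !mem_cat; apply/or3P/idP => [[/mapP[k _] //|/mapP[[a b] xE [-> ->]] //|/mapP[x _] //]|hs].
by constructor 2; apply/mapP; exists (h, l).
Qed.

Lemma cell_list_face h i : ((h, Some (i, true)) \in cell_list) = meets h i && (h == base r i h).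
Proof.
rewrite -(face_listP (h, i)) !mem_cat; apply/or3P/idP => [[/mapP[k _] //|/mapP[x _] //|/mapP[[a b] xE [-> ->]] //]|hs].
by constructor 3; apply/mapP; exists (h, i).
Qed.

Lemma cell_list_uniq : uniq cell_list.
Proof.
rewrite !cat_uniq; apply/and3P; split.
- by rewrite map_inj_uniq ?undup_uniq // => h k [].
- apply/hasPn => x; rewrite mem_cat => /orP[/mapP[y _ ->]|/mapP[y _ ->]];
    by apply/negP => /mapP[].
apply/and3P; split.
- by rewrite map_inj_uniq ?filter_uniq ?pairs_uniq // => -[a b] [c d] [-> ->].
- by apply/hasPn => x /mapP[y _ ->]; apply/negP => /mapP[].
- by rewrite map_inj_uniq ?filter_uniq ?pairs_uniq // => -[a b] [c d] [-> ->].
Qed.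

Lemma meets_reach i h k : reach r (predC1 i) h k -> meets k i = meets h i.
Proof. by apply: (selection_reach (a := meets)); [exact: meetsC|rewrite /= eqxx]. Qed.

Lemma cell_cover k v : triangle R v -> K r B (pt k v) <->
  exists2 x, x \in cell_list & in_cell x.1 x.2 k v.
Proof.
move=> tv; rewrite K_pt //; split; last first.
  case=> -[h [[l []]|]] /=.
  - rewrite cell_list_face => /andP[m _] [h1 h2 hk]; exists l; last by rewrite (meets_reach hk).
    by apply/topP => j; case: (I3P l j) => ->; rewrite ?lexx ?ltW.
  - rewrite cell_list_edge => /andP[/= m _] [e h1 hk].
    have t1 : top v (side1 l) by apply/topP => j; case: (I3P l j) => ->; rewrite -?e ?lexx ?ltW.
    have t2 : top v (side2 l) by apply/topP => j; case: (I3P l j) => ->; rewrite -?e ?lexx ?ltW.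
    have mm i : i != l -> meets k i = meets h i.
      by move=> il; case: hk => -> //; rewrite meetsC // eq_sym.
    by case/orP: m => m; [exists (side1 l)|exists (side2 l)]; rewrite ?mm ?sideE.
  - rewrite cell_list_vertex => /supportP[i m] [-> ->]; exists i => //.
    by apply/topP => j; rewrite !bary_coord.
case=> i ti m; have /topP t := ti.
have := t (side1 i); have := t (side2 i); rewrite !le_eqVlt.
have s := triangle_sum i tv.
have vertex : v ord0 (side1 i) = v ord0 i -> v ord0 (side2 i) = v ord0 i ->
    exists2 x, x \in cell_list & in_cell x.1 x.2 k v.
  move=> e1 e2; exists (k, None); first by rewrite cell_list_vertex; apply/supportP; exists i.
  split=> //; apply/rowP => j; rewrite bary_coord.
  by case: (I3P i j) => ->; lra.
have edge l : v ord0 (side1 l) = v ord0 (side2 l) -> v ord0 l < v ord0 (side1 l) ->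
    selected_edge (k, l) -> exists2 x, x \in cell_list & in_cell x.1 x.2 k v.
  move=> e lt sel; have [pk|pk] := boolP (parity r k).
    by exists (k, Some (l, false)); [rewrite cell_list_edge sel|split => //; left].
  exists (r l k, Some (l, false)); last by split => //; right; rewrite crossK.
  rewrite cell_list_edge parity_cross pk andbT; move: sel; rewrite /selected_edge /=.
  by rewrite !meetsC // ?neq_side1 ?neq_side2.
move=> /orP[/eqP e2|l2] /orP[/eqP e1|l1].
- exact: vertex.
- by apply: (edge (side1 i)); rewrite /selected_edge /= ?side1K ?side21 ?e2 ?m ?orbT.
- by apply: (edge (side2 i)); rewrite /selected_edge /= ?side12 ?side2K ?e1 ?m.
- exists (base r i k, Some (i, true)); last by split => //; apply: rst_sym; exact: (baseP r i k).2.
  rewrite cell_list_face (meets_reach (baseP r i k).2) m /=.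
  by rewrite -(base_eq (baseP r i k).2).
Qed.

Lemma cell_unique x y k v : triangle R v -> x \in cell_list -> y \in cell_list ->
  in_cell x.1 x.2 k v -> in_cell y.1 y.2 k v -> x = y.
Proof.
move=> tv; case: x => h [[i []]|]; case: y => h' [[j []]|] /=;
  rewrite ?cell_list_face ?cell_list_edge ?cell_list_vertex.
- move=> /andP[_ /eqP hE] /andP[_ /eqP hE'] [a1 a2 H] [b1 b2 H'].
  have ij : i = j.
    clear hE hE'.
    by case: (I3P i j) a1 a2 b1 b2 => -> //; rewrite ?sideE => *; exfalso; lra.
  subst j; congr (_, _); rewrite hE hE'; apply: base_eq.
  by apply: rst_trans H _; exact: rst_sym.
- move=> _ _ [a1 a2 _] [b1 b2 _]; exfalso.
  by case: (I3P i j) a1 a2 b1 b2 => ->; rewrite ?sideE => *; lra.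
- by move=> _ _ [a1 a2 _] [b1 _]; exfalso; move: a1; rewrite b1 !bary_coord; lra.
- move=> _ _ [b1 b2 _] [a1 a2 _]; exfalso.
  by case: (I3P i j) a1 a2 b1 b2 => ->; rewrite ?sideE => *; lra.
- move=> /andP[_ ph] /andP[_ ph'] [a1 a2 H] [b1 b2 H'].
  have ij : i = j.
    clear H H'.
    by case: (I3P i j) a1 a2 b1 b2 => -> //; rewrite ?sideE => *; exfalso; lra.
  subst j; congr (_, _).
  case: H => kh; case: H' => kh'; rewrite kh in kh' => //.
  + by move: ph; rewrite kh' parity_cross ph'.
  + by move: ph'; rewrite -kh' parity_cross ph.
  + exact: (can_inj (crossK r i)).
- by move=> _ _ [a1 a2 _] [b1 _]; exfalso; move: a2; rewrite b1 !bary_coord; lra.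
- by move=> _ _ [b1 _] [a1 a2 _]; exfalso; move: a1; rewrite b1 !bary_coord; lra.
- by move=> _ _ [b1 _] [a1 a2 _]; exfalso; move: a2; rewrite b1 !bary_coord; lra.
- by move=> _ _ [_ <-] [_ <-].
Qed.

(** Ends of edges are barycentres. A boundary point of a 2-cell lies in [K], hence in some open
    cell, and its tie for the largest coordinate excludes dimension 2. *)
Lemma cell_boundary x p : x \in cell_list -> (cell_map (c := x.2) x.1 @` unit_sphere R (dim x.2)) p ->
  exists2 y, y \in cell_list & (dim y.2 < dim x.2)%N /\ (cell_map (c := y.2) y.1 @` open_disc R (dim y.2)) p.
Proof.
case: x => h [[i []]|] /=; last first.
- by move=> _ [z]; rewrite /unit_sphere /= enorm0 => /eqP; rewrite eq_sym oner_eq0.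
- rewrite cell_list_edge => /andP[/= sel ph] [z]; rewrite /unit_sphere /= enorm1 => z1.
  have hs k : (k = h \/ k = r i h) -> k \in support.
    move=> kh; apply/supportP; case/orP: sel => m; [exists (side1 i)|exists (side2 i)];
    by case: kh => ->; rewrite // meetsC // ?neq_side1 ?neq_side2.
  suff [k kh ->] : exists2 k, (k = h \/ k = r i h) & edge_path r h i ((z ord0 ord0 + 1) / 2) = pt k (bary R) :> X.
    move=> <-; exists (k, None); first by rewrite cell_list_vertex hs.
    by split => //; exists 0; rewrite // /open_disc /= enorm0 ltr01.
  have e0 : lerp 0 (bary R) (mid R i) = bary R by rewrite /lerp subr0 scale1r scale0r addr0.
  have [z0|z0] := leP 0 (z ord0 ord0).
    exists (r i h); first by right.
    rewrite ger0_norm // in z1; rewrite z1 (_ : (1 + 1) / 2 = 1 :> R); last by lra.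
    rewrite /edge_path ifF; last by apply/negbTE; rewrite -ltNge; lra.
    by rewrite /fold mulr1 (_ : 2 - 1 = 1 :> R) ?normr1 ?subrr ?e0 //; lra.
  exists h; first by left.
  rewrite ltr0_norm // in z1; have -> : z ord0 ord0 = -1 by lra.
  rewrite addNr mul0r /edge_path ifT; last by lra.
  by rewrite /fold mulr0 sub0r normrN normr1 subrr e0.
- rewrite cell_list_face => /andP[m _] [z].
  have [n [s [tau [nN s0 t01 ->]]]] := sector_exists z (nsec_gt0 r i).
  rewrite /unit_sphere /= enorm_polar ger0_norm // => s1; rewrite s1.
  have s01 : 0 <= (1 : R) <= 1 by rewrite ler01 lexx.
  rewrite face_mapE // => pE; have [tw wi ws] := radial_vec i n s01 t01.
  set w := sector_vec _ _ _ _ in pE tw wi ws; set k := walk r i h n in pE.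
  have ti : top w i.
    apply/topP => j; have : Num.max (w ord0 (crossing i n.+1)) (w ord0 (crossing i n)) = w ord0 i by lra.
    case: (crossingP i n j) => -> // <-; by rewrite le_max lexx ?orbT.
  have Kp : K r B (pt k w).
    by rewrite K_pt //; exists i; rewrite // (meets_reach (reach_walk r i h n)).
  have [[h' c] yl yk] := (cell_cover k tw).1 Kp.
  exists (h', c) => //; rewrite -pE; split; last by apply/cell_image.
  case: c yl yk => [[j []]|] //= _ [b1 b2 _]; exfalso.
  have ij : i = j.
    have /topP t := ti; case: (I3P i j) b1 b2 (t j) => -> //; rewrite ?sideE => *; exfalso; lra.
  subst j; have := lt_crossing n b1 b2; lra.
Qed.

Lemma big_seq_sub (T : choiceType) (V : nmodType) (s : seq T) (F : T -> V) : uniq s ->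
  \sum_(x : seq_sub s) F (ssval x) = \sum_(x <- s) F x.
Proof.
move=> us; rewrite -(big_map (fun x : seq_sub s => ssval x) xpredT F); apply: perm_big.
apply: uniq_perm => //; first by rewrite map_inj_uniq ?index_enum_uniq //; exact: val_inj.
move=> x; apply/mapP/idP => [[y _ ->]|xs]; first exact: ssvalP.
by exists (SeqSub xs); rewrite // mem_index_enum.
Qed.

Lemma K_euler : euler_characteristic R (K r B : set X)
  ((size support)%:Z - (size edge_list)%:Z + (size face_list)%:Z).
Proof.
exists (seq_sub cell_list), (fun x => dim (ssval x).2),
  (fun x => cell_map (c := (ssval x).2) (ssval x).1); split.
- move=> [[h [[i []]|]] hx] /=.
  + exact: face_map_continuous.
  + have ce : {within `[0, 1], continuous (edge_path r h i : R -> X)} by exact: edge_path_continuous.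
  have cs : {within closed_disc R 1, continuous (fun x : 'rV[R]_1 => (x ord0 ord0 + 1) / 2)}.
    apply: continuous_subspaceT; apply: contM; last exact: contC.
    by apply: contD; [move=> x; exact: coord_continuous|exact: contC].
  have := within_comp _ cs ce; apply => x; rewrite /closed_disc /= enorm1 in_itv /= ler_norml; lra.
  + exact: within_cst.
- move=> [[h [[i []]|]] hx] /=; first exact: face_map_inj.
    2: by move=> x y _ _ _; apply/rowP => -[].
  move: hx; rewrite cell_list_edge => /andP[_ ph] x y.
  rewrite !inE /open_disc /= !enorm1 !ltr_norml => x1 y1.
  set a := (_ + _) / 2; set b := (_ + 1) / 2.
  have a01 : 0 <= a <= 1 by rewrite /a; lra.
  have b01 : 0 <= b <= 1 by rewrite /b; lra.
  move=> /(pt_eq r _ _ (lerp_mid_triangle i (fold_in a01)) (lerp_mid_triangle i (fold_in b01))) [e H].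
  have fe : fold a = fold b.
    have := congr1 (fun u : 'rV[R]_3 => u ord0 i) e; rewrite /= !lerp_mid eqxx; lra.
  have small (t : R) : t <= 2^-1 -> fold t = 2 * t by move=> ?; rewrite /fold ler0_norm; lra.
  have large (t : R) : 2^-1 < t -> fold t = 2 - 2 * t by move=> ?; rewrite /fold ger0_norm; lra.
  have ab : a = b.
    have nr : r i h <> h by move=> /(congr1 (parity r)); rewrite parity_cross; case: (parity r h).
    have nz : fold a < 1 -> (if b <= 2^-1 then h else r i h) = (if a <= 2^-1 then h else r i h).
      move=> a1; apply: (reach_none _ H) => j; rewrite /zeros lerp_mid.
      have := fold_in a01 => f0; by apply/eqP; case: ifP => _; lra.
    move: nz; have [h1|h1] := leP a 2^-1; have [h2|h2] := leP b 2^-1 => nz.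
    + by move: fe; rewrite !small //; lra.
    + by case: nr; rewrite nz // fe large //; lra.
    + by case: nr; rewrite -nz // large //; lra.
    + by move: fe; rewrite !large //; lra.
  by apply/rowP => j; rewrite (ord1 j); move: ab; rewrite /a /b; lra.
- split.
    move=> x y _ _ [p [hx hy]]; apply: val_inj; rewrite /=.
    have [k [v [tv pE]]] := ptP p; rewrite pE in hx hy.
    move: hx hy => /(cell_image _ _ _ tv) hx /(cell_image _ _ _ tv) hy.
    exact: (cell_unique tv (ssvalP x) (ssvalP y) hx hy).
  apply/seteqP; split => p; have [k [v [tv ->]]] := ptP p.
    by move=> /(cell_cover k tv) [x xl xk]; exists (SeqSub xl) => //; exact/(cell_image _ _ _ tv).
  by case=> x _ /(cell_image _ _ _ tv) H; apply/cell_cover => //; exists (ssval x); [exact: ssvalP|].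
- move=> x p /(cell_boundary (ssvalP x)) [y yl [yd yp]].
  by exists (SeqSub yl).
rewrite (big_seq_sub (fun x => (-1) ^+ dim x.2)); last exact: cell_list_uniq.
rewrite /cell_list !big_cat !big_map /=.
have iterE (n : nat) (c : int) : iter n (+%R c) 0 = c *+ n.
  by elim: n => //= n ->; rewrite mulrS.
by rewrite !big_const_seq !count_predT !iterE expr0 expr1 expr2 mulrNN mulr1 mulNrn !pmulrn; ring.
Qed.

(** The graph is trivalent: a triangle in the support has three selected edges, or at least two if
    it is mixed, and each edge is seen from two triangles. *)
Lemma edge_count : (3 * size support <= 2 * size edge_list + size (rim r B))%N.
Proof.
pose all_edges := [seq x <- pairs | selected_edge x].
have h1 : (size all_edges <= 2 * size edge_list)%N.
  rewrite mul2n -addnn.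
  have -> : size all_edges = (size edge_list + size [seq x <- pairs | selected_edge x && ~~ parity r x.1])%N.
    rewrite !size_filter; elim: pairs => //= x s ->.
    by case: (selected_edge x); case: (parity r x.1) => /=; lia.
  rewrite leq_add2l.
  (* Crossing the side matches the odd triangle of each edge with the even one. *)
  pose f (x : G * 'I_3) := (r x.2 x.1, x.2).
  rewrite -(size_map f); apply: uniq_leq_size.
    rewrite map_inj_uniq ?filter_uniq ?pairs_uniq // => -[a b] [c d] [e1 e2].
    by move: e1; rewrite /= e2 => /(can_inj (crossK r d)) ->.
  move=> y /mapP[x]; rewrite mem_filter => /andP[/andP[sel px] _] ->.
  rewrite edge_listP /f /selected_edge /= parity_cross px andbT.
  by rewrite !meetsC // ?neq_side1 ?neq_side2.
apply: (@leq_trans (size all_edges + size (rim r B))); last by rewrite leq_add2r.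
have -> : size all_edges =
    (\sum_(h <- support) count (fun l => selected_edge (h, l)) (enum 'I_3))%N.
  rewrite size_filter /pairs /allpairs_dep; elim: support => [|h s IH]; first by rewrite big_nil.
  by rewrite big_cons /= count_cat IH count_map.
have -> : size (rim r B) = (\sum_(h <- support) mixed r B h)%N.
  by rewrite size_filter -sum1_count big_mkcond; apply: eq_bigr => h _; case: mixed.
rewrite -big_split /= -sum1_size big_distrr /= big_seq [X in (_ <= X)%N]big_seq.
apply: leq_sum => h /supportP [i mi]; rewrite muln1.
have -> : count (fun l => selected_edge (h, l)) (enum 'I_3) =
    (\sum_l selected_edge (h, l))%N.
  by rewrite -sum1_count big_mkcond big_enum.
rewrite (bigD1 i) //= (bigD1 (side1 i)) ?sideE //= (bigD1 (side2 i)) ?sideE //=.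
rewrite /selected_edge /= side1K side21 side12 side2K mi ?orbT /= ?orbT.
have [m1|m1] := boolP (meets h (side1 i)); first by lia.
have -> : mixed r B h by apply/mixedP; split; [exists i|exists (side1 i)].
by case: (meets h (side2 i)); lia.
Qed.

(** The fans of different 2-cells of one type are disjoint, and all their triangles lie in the
    support. *)
Lemma face_count i : (size [seq x <- face_list | x.2 == i] * (2 * valence r i) <= size support)%N.
Proof.
set L := [seq x <- face_list | x.2 == i].
rewrite -(size_iota 0 (2 * valence r i)) -(size_allpairs (fun x n => walk r i x.1 n)).
apply: uniq_leq_size.
  apply: allpairs_uniq; rewrite ?filter_uniq ?pairs_uniq ?iota_uniq //.
  move=> _ _ /allpairsP[[[h j] n] /= [+ + ->]] /allpairsP[[[h' j'] n'] /= [+ + ->]].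
  rewrite !mem_iota !add0n !mem_filter /= !pairsP /=.
  move=> /andP[/eqP -> /andP[/andP[_ /eqP b1] _]] n1 /andP[/eqP -> /andP[/andP[_ /eqP b2] _]] n2 e.
  have hh : h = h'.
    rewrite b1 b2; apply: base_eq; apply: (rst_trans _ _ _ (walk r i h n)).
      exact: reach_walk.
    by rewrite e; apply: rst_sym; exact: reach_walk.
  by subst h'; congr (_, _); apply: (@walk_inj _ _ r i h).
move=> y /allpairsP[[x n] /= [xL _ ->]].
move: xL; rewrite mem_filter => /andP[/eqP xi]; rewrite face_listP => /andP[m _].
by apply/supportP; exists i; rewrite (meets_reach (reach_walk r i _ n)) -[in meets _ i]xi.
Qed.

Lemma face_list_sum :
  size face_list = (\sum_(i < 3) size [seq x <- face_list | x.2 == i])%N.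
Proof.
elim: face_list => [|x s IH]; first by rewrite big1.
rewrite [LHS]/= {}IH.
have E (i : 'I_3) : size [seq y <- x :: s | y.2 == i] = ((x.2 == i) + size [seq y <- s | y.2 == i])%N.
  by rewrite /=; case: eqP.
rewrite [RHS](eq_bigr _ (fun i _ => E i)) big_split /= [X in (X + _)%N](bigD1 x.2) //= eqxx.
by rewrite [X in (_ + X + _)%N]big1 ?addn0 // => i; rewrite eq_sym => /negbTE ->.
Qed.

(** Every cell of a triangle in [B] is selected, so none of these triangles is mixed. *)
Lemma rim_count : uniq B -> (size (rim r B) + size B <= size support)%N.
Proof.
move=> uB; rewrite -size_cat; apply: uniq_leq_size.
  rewrite cat_uniq uB andbT filter_uniq ?undup_uniq //=.
  apply/hasPn => g gB; rewrite rimP; apply/mixedP => -[_ [i]].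
  by rewrite meets_mem.
move=> h; rewrite mem_cat => /orP[|hB]; first by rewrite mem_filter => /andP[].
by apply/supportP; exists ord0; exact: meets_mem.
Qed.

End EulerCharacteristic.

(** * Genus from isoperimetry *)

Section InfiniteGenus.
Variables (R : realType) (S : choiceType) (M : cells S) (r : flag_graph M).
Local Notation G := (Mon M).
Local Notation X := (minimal_regular_cover R M).

Definition folner_graph := forall c n : nat, exists (B : seq G) (g0 : G),
  [/\ uniq B, g0 \in B,
      forall g, g \in B -> clos_refl_sym_trans G
        (fun h k => [/\ h \in B, k \in B & exists l, k = r l h]) g0 g
    & (c * (size (support r B) - size B) + n <= size B)%N].

(** With [V] triangles in the support and [W] mixed ones, the counts give chi at most
    [W / 2 - kap * V], and there are at most [W] boundary curves. So the genus is unbounded once [W]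
    is small against [V]. *)
Lemma cover_infinite_genus : \sum_i (valence r i)%:R^-1 < 1 :> rat ->
  folner_graph -> infinite_genus R X.
Proof.
set sg := \sum_i _ => hyp folner n; pose kap : rat := (1 - sg) / 2.
have kap0 : 0 < kap by rewrite /kap; lra.
have [C hC] : exists C : nat, kap^-1 < C%:R by exists (Num.truncn kap^-1).+1; exact: truncnS_gt.
(* As [kap * C > 1], these constants give [2 * n + 2 * W <= kap * V], which absorbs the boundary
   terms and leaves genus at least [n]. *)
have [B [g0 [uB g0B cB big]]] := folner (2 * C)%N (2 * n * C)%N.
exists (K r B), #|froots (@rim_succ _ M r B)|,
  ((size (support r B))%:Z - (size (edge_list r B))%:Z + (size (face_list r B))%:Z).
split; [exact: K_compact|exact: (K_subsurface R g0B cB)|exact: K_euler|].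
have q_rim : (#|froots (@rim_succ _ M r B)| <= size (rim r B))%N.
  apply: leq_trans (max_card _) _; rewrite card_seq_sub ?filter_uniq ?undup_uniq //.
have := edge_count r B; have := rim_count r uB.
have := face_list_sum r B; have fc := face_count r B.
move: q_rim; set q := #|_|; set V := size (support r B) in big fc *.
set b := size B in big *; set W := size (rim r B).
set E := size (edge_list r B); set F := size (face_list r B) => qW FE Wb Ec.
have FV : F%:R <= V%:R / 2 * sg.
  rewrite FE natr_sum /sg mulr_sumr; apply: ler_sum => i _.
  have m0 : (0 < valence r i)%N by apply: ltnW; exact: valence_gt1.
  rewrite ler_pdivlMr ?ltr0n // ler_pdivlMr //.
  by rewrite -!natrM ler_nat -mulnA [(_ * 2)%N]mulnC.
have m1 : 2 * n%:R + 2 * W%:R <= kap * V%:R.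
  have : (2 * C * W + 2 * n * C <= V)%N by nia.
  rewrite -(ler_nat rat) !natrD !natrM => h.
  have : kap * (2 * C%:R * W%:R + 2 * n%:R * C%:R) <= kap * V%:R by rewrite ler_pM2l.
  have : 1 <= kap * C%:R.
    by rewrite mulrC -ler_pdivrMr // div1r ltW.
  have w0 : 0 <= W%:R :> rat by [].
  have n0 : 0 <= n%:R :> rat by [].
  move=> h1 h2; apply: le_trans h2.
  have -> : kap * (2 * C%:R * W%:R + 2 * n%:R * C%:R) = kap * C%:R * (2 * n%:R + 2 * W%:R) by ring.
  by rewrite ler_peMl // addr_ge0 // mulr_ge0.
move: Ec qW; rewrite -!(ler_nat rat) natrD !natrM => Ec qW.
rewrite /bordered_genus rmorphD rmorphB /= -!pmulrn.
have w0 : 0 <= W%:R :> rat by [].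
have {}m1 : 2 * n%:R + 2 * W%:R <= V%:R / 2 - V%:R / 2 * sg by move: m1; rewrite /kap mulrAC mulrBl mulrBl mul1r [sg * _]mulrC mulrAC.
move: m1 FV; move: (_ / 2 * sg) => y m1 FV; lra.
Qed.

End InfiniteGenus.

(** * Growth and ends of the monodromy group *)

Section Growth.

(** For [m.+1] a power of 2 the left side is at most a power of 2, and only exponents remain to be
    compared. *)
Lemma exp_beats_poly q d : exists m, ((q * m.+1) ^ d < 2 ^ m)%N.
Proof.
pose u := ((q + 1) * d + 2 * d + 1)%N; pose t := (2 * u)%N; exists (2 ^ t).-1.
rewrite prednK ?expn_gt0 //.
have qb : (q < 2 ^ q)%N by exact: ltn_expl.
have h1 : (q * 2 ^ t <= 2 ^ (q + t))%N by rewrite expnD leq_mul2r ltnW ?orbT.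
apply: (@leq_ltn_trans (2 ^ ((q + t) * d))).
  by rewrite [X in (_ <= X)%N]expnM; case: d @u @t h1 => // d *; rewrite leq_exp2r.
rewrite ltn_exp2l //.
have ub : (u < 2 ^ u)%N by exact: ltn_expl.
have : (u.+1 * u.+1 <= 2 ^ t)%N by rewrite /t mul2n -addnn expnD leq_mul.
rewrite /t; move: (2 ^ (2 * u))%N => e he.
have : ((q + 2 * u) * d + 1 < u.+1 * u.+1)%N by rewrite /u; nia.
lia.
Qed.

(* Otherwise [f] would grow exponentially along an arithmetic progression. *)
Lemma poly_growth_folner (f : nat -> nat) (q d D c n0 : nat) :
  (forall n m, (n <= m)%N -> (f n <= f m)%N) ->
  (forall n, (f n <= (q * n.+1) ^ d)%N) -> (forall n, exists m, (n <= f m)%N) ->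
  exists n, (c * (f (n + D) - f n) + n0 <= f n)%N.
Proof.
move=> fm fp fu; apply: contrapT => /forallNP H.
have {}H n : (f n < c.+1 * (f (n + D) - f n) + n0)%N.
  by have /negP := H n; rewrite -ltnNge mulSn; lia.
(* From [k0] on the constant [n0] is less than half of [f], so it costs only a factor 2 in the
   growth rate below. *)
have [k0 hk] := fu (2 * n0 + 1)%N.
pose g j := f (k0 + j * D)%N.
have gm i j : (i <= j)%N -> (g i <= g j)%N by move=> ij; apply: fm; rewrite leq_add2l leq_mul2r ij orbT.
have step j : (2 * c.+1 * g j + g j <= 2 * c.+1 * g j.+1)%N.
  have := H (k0 + j * D)%N; rewrite -addnA [(_ * D + _)%N]addnC -mulSn -/(g j) -/(g j.+1).
  have := gm j j.+1 (leqnSn _); have := gm 0%N j isT.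
  by rewrite {1}/g mul0n addn0; nia.
have lin j i : (2 * c.+1 * g j + i * g j <= 2 * c.+1 * g (j + i))%N.
  elim: i => [|i IH]; first by rewrite mul0n !addn0.
  have := step (j + i)%N; have := gm j (j + i)%N (leq_addr _ _).
  by rewrite addnS mulSn; lia.
(* Each step adds at least a fraction [1 / (2 * c.+1)] of the current value, so [2 * c.+1] steps
   double it. *)
have dbl j : (2 * g j <= g (j + 2 * c.+1))%N.
  by have := lin j (2 * c.+1)%N; rewrite -mulnDr leq_pmul2l // addnn -!mul2n.
have pow m : (2 ^ m <= g (2 * c.+1 * m))%N.
  elim: m => [|m IH]; first by rewrite muln0 /g mul0n addn0; lia.
  by rewrite expnS mulnS addnC; apply: leq_trans (dbl _); rewrite leq_mul2l IH.
have [m hm] := exp_beats_poly (q * (k0 + 2 * c.+1 * D + 1)) d.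
have := leq_trans (pow m) (fp _); rewrite leqNgt => /negP; apply.
apply: leq_ltn_trans hm; case: d fp => // d fp; rewrite leq_exp2r //.
by rewrite -[leqRHS]mulnA leq_mul2l; apply/orP; right; nia.
Qed.

Lemma seq_bound (T : eqType) (P : T -> nat -> Prop) (s : seq T) :
  (forall x n m, (n <= m)%N -> P x n -> P x m) ->
  (forall x, x \in s -> exists n, P x n) -> exists n, forall x, x \in s -> P x n.
Proof.
move=> mono; elim: s => [|x s IH] H; first by exists 0%N.
have [n hn] := H x (mem_head _ _); have [|m hm] := IH.
  by move=> y ys; apply: H; rewrite inE ys orbT.
exists (maxn n m) => y /[!inE] /orP[/eqP ->|ys]; first by apply: mono hn; rewrite leq_maxl.
by apply: mono (hm y ys); rewrite leq_maxr.
Qed.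

End Growth.

(** [domain] may repeat orbits; it expresses that there are finitely many. Commuting with the swaps
    makes the shifts commute with the whole monodromy group. *)
Record flag_lattice (S : choiceType) (M : cells S) := FlagLattice {
  shift : int -> int -> flags M -> flags M ;
  shift0 : forall Phi, shift 0 0 Phi = Phi ;
  shiftD : forall a b c d Phi, shift a b (shift c d Phi) = shift (a + c) (b + d) Phi ;
  shift_swap : forall a b i Phi, flag_swap i (shift a b Phi) = shift a b (flag_swap i Phi) ;
  shift_free : forall a b Phi, shift a b Phi = Phi -> a = 0 /\ b = 0 ;
  domain : seq (flags M) ;
  domain_cover : forall Phi, exists2 Psi, Psi \in domain & exists a b, Phi = shift a b Psi }.

(** * Monodromy group as an extension of an abelian group *)

Section Cayley.
Variables (S : choiceType) (M : cells S) (r : flag_graph M).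
Local Notation G := (Mon M).
Implicit Types (g h x y : G) (F : seq G) (w : seq 'I_3) (Phi Psi : flags M).

Definition act w g : G := foldr (fun l g => r l g) g w.

Lemma actK w g : act (rev w) (act w g) = g.
Proof.
by elim: w g => //= l w IH g; rewrite rev_cons -cats1 /act foldr_cat /= crossK; exact: IH.
Qed.

Lemma actVK w g : act w (act (rev w) g) = g.
Proof. by rewrite -{1}(revK w) actK. Qed.

Lemma val_act w g Phi : \val (act w g) Phi = \val (act w (Mon_id M)) (\val g Phi).
Proof. by elim: w => //= l w IH; rewrite !crossE /= IH. Qed.

Lemma Mon_eq g h : (forall Phi, \val g Phi = \val h Phi) -> g = h.
Proof. by move=> gh; apply: val_inj; apply/funext. Qed.

Definition word g : seq 'I_3 := projT1 (cid (word_act_surj r g)).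

Lemma wordK g : act (word g) (Mon_id M) = g.
Proof. exact: projT2 (cid (word_act_surj r g)). Qed.

(** The product of the right action, first [g] and then [h]: a word for [h] is carried out starting
    from [g]. *)
Definition mul g h : G := act (word h) g.
Definition inv g : G := act (rev (word g)) (Mon_id M).

Lemma mulE g h Phi : \val (mul g h) Phi = \val h (\val g Phi).
Proof. by rewrite /mul val_act wordK. Qed.

Lemma invK g Phi : \val (inv g) (\val g Phi) = Phi.
Proof. by rewrite /inv -val_act -{2}(wordK g) actK. Qed.

Lemma invVK g Phi : \val g (\val (inv g) Phi) = Phi.
Proof. by rewrite -{1}(wordK g) /inv -val_act actVK. Qed.

Lemma mulK g h : mul (mul g h) (inv h) = g.
Proof. by apply: Mon_eq => Phi; rewrite !mulE invK. Qed.

(** The starting points from which the path spelled by [w] meets [F]; it is finite, and elsewhere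
    the path avoids [F] ([back_avoids]). *)
Fixpoint back F w : seq G :=
  if w is l :: w' then [seq act (rev w) f | f <- F] ++ back F w' else F.

Lemma back_end F w g : g \notin back F w -> act w g \notin F.
Proof.
case: w => [|l w] //; apply: contra => gF; rewrite mem_cat; apply/orP; left.
by apply/mapP; exists (act (l :: w) g) => //; rewrite actK.
Qed.

Lemma back_avoids F w g : g \notin back F w -> avoids r F g (act w g).
Proof.
elim: w => [|l w IH] hg; first exact: rst_refl.
have h2 := back_end hg; move: hg; rewrite mem_cat negb_or => /andP[_ hg].
apply: rst_trans (IH hg) _; apply: rst_step; split => //; first exact: back_end.
by exists l.
Qed.

Lemma avoids_sub F F' g h : {subset F <= F'} -> avoids r F' g h -> avoids r F g h.
Proof.
move=> FF'; elim=> {g h} [g h [gF hF e]|g|g h _|g h k _ H1 _ H2].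
- by apply: rst_step; split => //; apply: contra (FF' _) _.
- exact: rst_refl.
- exact: rst_sym.
- exact: rst_trans H1 H2.
Qed.

Variable L : flag_lattice M.
Local Notation shift := (shift L).

Lemma shift_act g a b Phi : \val g (shift a b Phi) = shift a b (\val g Phi).
Proof.
rewrite -(wordK g); elim: (word g) => //= l w IH.
by rewrite !crossE /= IH shift_swap.
Qed.

Lemma shift_inj a b c d Phi : shift a b Phi = shift c d Phi -> a = c /\ b = d.
Proof.
move=> /(congr1 (shift (- c) (- d))); rewrite !shiftD !addNr shift0 => /shift_free [].
by rewrite ![- _ + _]addrC => /eqP + /eqP; rewrite !subr_eq0 => /eqP -> /eqP ->.
Qed.

Definition translation g := forall Phi, exists a b, \val g Phi = shift a b Phi.

Lemma translation_id : translation (Mon_id M).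
Proof. by move=> Phi; exists 0, 0; rewrite shift0. Qed.

Lemma translation_mul g h : translation g -> translation h -> translation (mul g h).
Proof.
move=> tg th Phi; have [a [b e]] := tg Phi; have [c [d e']] := th Phi.
by exists (a + c), (b + d); rewrite mulE e shift_act e' shiftD.
Qed.

Lemma translation_inv g : translation g -> translation (inv g).
Proof.
move=> tg Phi; have [a [b e]] := tg Phi; exists (- a), (- b).
by rewrite -{2}(invK g Phi) e shift_act shiftD !addNr shift0.
Qed.

Lemma translationC g h Phi : translation g -> translation h ->
  \val g (\val h Phi) = \val h (\val g Phi).
Proof.
move=> tg th; have [a [b e]] := tg Phi; have [c [d e']] := th Phi.
by rewrite e e' !shift_act e e' !shiftD ![a + _]addrC ![b + _]addrC.
Qed.

Lemma cls_ex Phi : exists Psi : seq_sub (domain L), exists a b, Phi = shift a b (ssval Psi).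
Proof. by have [Psi hP ab] := domain_cover L Phi; exists (SeqSub hP). Qed.

Definition cls Phi : seq_sub (domain L) := projT1 (cid (cls_ex Phi)).

Lemma clsP Phi : exists a b, Phi = shift a b (ssval (cls Phi)).
Proof. exact: projT2 (cid (cls_ex Phi)). Qed.

(** The map induced on chosen orbit representatives. Its range is finite and elements of equal type
    differ by a translation, so translations have finite index. *)
Definition typ g : {ffun seq_sub (domain L) -> seq_sub (domain L)} :=
  [ffun x => cls (\val g (ssval x))].

Lemma typ_eq g h : typ g = typ h -> forall Phi, exists a b, \val g Phi = shift a b (\val h Phi).
Proof.
move=> gh Phi; have [Psi hP [a [b ->]]] := domain_cover L Phi.
have xy := congr1 (fun f : {ffun _ -> _} => f (SeqSub hP)) gh; rewrite !ffunE in xy.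
have [c [d e]] := clsP (\val g Psi); have [c' [d' e']] := clsP (\val h Psi).
exists (c - c'), (d - d'); rewrite !shift_act e e' xy !shiftD.
by congr shift; ring.
Qed.

(** One word per type suffices: it spells the inverse of a chosen element of that type. *)
Lemma translation_words : exists W : seq (seq 'I_3), forall g,
  exists2 w, w \in W & translation (act w g).
Proof.
pose wt (t : {ffun seq_sub (domain L) -> seq_sub (domain L)}) :=
  word (inv (xget (Mon_id M) [set g | typ g = t])).
exists [seq wt t | t <- enum {ffun seq_sub (domain L) -> seq_sub (domain L)}] => g.
exists (wt (typ g)); first by apply/mapP; exists (typ g); rewrite ?mem_enum.
rewrite /wt; case: xgetP => [h _ e|/(_ g)] //= Phi.
have [a [b e']] := typ_eq (esym e : typ g = typ h) Phi.
by exists a, b; rewrite -/(mul g (inv h)) mulE e' shift_act invK.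
Qed.

Hypothesis transitive : forall Phi Psi, exists g, \val g Phi = Psi.
Variable Phi0 : flags M.

Definition located g p q := \val g Phi0 = shift p q Phi0.

Lemma located_id : located (Mon_id M) 0 0.
Proof. by rewrite /located shift0. Qed.

Lemma located_mul g h p q p' q' : located g p q -> located h p' q' ->
  located (mul g h) (p + p') (q + q').
Proof. by rewrite /located mulE => -> e; rewrite shift_act e shiftD. Qed.

Lemma located_inv g p q : located g p q -> located (inv g) (- p) (- q).
Proof.
rewrite /located => e; rewrite -{2}(invK g Phi0) e shift_act shiftD.
by rewrite !addNr shift0.
Qed.

Definition times n h g : G := iter n (fun x => mul x h) g.

Lemma timesS n h g : times n.+1 h g = mul (times n h g) h.
Proof. by []. Qed.

Lemma timesK n h g : times n (inv h) (times n h g) = g.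
Proof. by elim: n => // n IH; rewrite {1}/times iterSr timesS mulK; exact: IH. Qed.

Lemma timesE n h g Phi : \val (times n h g) Phi = \val (times n h (Mon_id M)) (\val g Phi).
Proof. by elim: n => // n IH; rewrite !timesS !mulE IH. Qed.

Lemma times_located n h g p q p' q' : located g p q -> located h p' q' ->
  located (times n h g) (p + p' *+ n) (q + q' *+ n).
Proof.
move=> eg eh; elim: n => [|n IH]; first by rewrite !mulr0n !addr0.
by rewrite !mulrSr !addrA; exact: located_mul.
Qed.

Lemma times_translation n h g : translation g -> translation h -> translation (times n h g).
Proof. by move=> tg th; elim: n => //= n IH; exact: translation_mul. Qed.

(** Pigeonhole: among the powers of an element that moves [Phi0] by [(p, q)], two have the same
    type, and their quotient is a translation. *)
Lemma translation_ex p q : exists2 n, (0 < n)%N &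
  exists2 h, translation h & located h (p *+ n) (q *+ n).
Proof.
have [g eg] := transitive Phi0 (shift p q Phi0).
pose f (k : 'I_(#|{: {ffun seq_sub (domain L) -> seq_sub (domain L)}}|.+1)) :=
  typ (times k g (Mon_id M)).
have /injectivePn [k [k' kk' fk]] : ~~ injectiveb f.
  by apply/injectiveP => /leq_card; rewrite card_ord ltnn.
wlog lt : k k' kk' fk / (k < k')%N.
  move=> H; case: (ltngtP k k') => lt; first exact: (H k k').
    by apply: (H k' k) => //; rewrite eq_sym.
  by move: kk'; rewrite (val_inj lt) eqxx.
exists (k' - k)%N; first by rewrite subn_gt0.
exists (times (k' - k) g (Mon_id M)).
  move=> Phi; pose gk := times k g (Mon_id M).
  have [a [b e]] := typ_eq (esym fk) (\val (inv gk) Phi).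
  exists a, b; move: e; rewrite -/gk invVK => <-.
  rewrite -{2}(subnK (ltnW lt)) {2}/times iterD -/(times k g _) -/gk.
  by rewrite -[iter _ _ _]/(times (k' - k) g gk) [RHS]timesE invVK.
by have := times_located (k' - k) located_id eg; rewrite !add0r.
Qed.

Lemma located_bound F : exists P : nat, forall g, g \in F -> forall p q, located g p q ->
  (`|p| <= P%:Z) && (`|q| <= P%:Z).
Proof.
apply: seq_bound => [g n m nm H p q /H /andP[h1 h2]|g _].
  by rewrite (le_trans h1) ?(le_trans h2) // lez_nat.
case: (pselect (exists p q, located g p q)) => [[p [q e]]|no]; last first.
  by exists 0%N => p q e; case: no; exists p, q.
exists (maxn `|p| `|q|) => p' q'; rewrite /located e => /shift_inj [<- <-].
by rewrite -!abszE !lez_nat leq_maxl leq_maxr.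
Qed.

Lemma Mon_infinite F : exists g, g \notin F.
Proof.
have [n n0 [h th eh]] := translation_ex 1 0; have [P hP] := located_bound F.
exists (times P.+1 h (Mon_id M)); apply/negP => /hP /(_ _ _ (times_located P.+1 located_id eh)).
by rewrite add0r => /andP[+ _]; nia.
Qed.

(* The elements acting as a translation on every flag form an abelian subgroup
   of finite index, containing commuting [a], [b] that generate Z^2.  Outside a
   finite set, each of them starts a ray in direction [a] or [a^-1] that avoids
   [F]; by commutativity two parallel rays are joined far away by a fixed word,
   and [b] leads to a line in direction [a] that avoids [F] altogether. *)
Lemma cayley_one_ended : one_ended_graph r.
Proof.
move=> F.
have [n n0 [a ta ea]] := translation_ex 1 0; have [m m0 [b tb eb]] := translation_ex 0 1.
rewrite mul0rn natz in ea; rewrite mul0rn natz in eb.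
have nz : n%:Z != 0 by lia.
have nz' : - n%:Z != 0 by lia.
have [W hW] := translation_words.
have ea' := located_inv ea; rewrite oppr0 in ea'; have ta' := translation_inv ta.
pose F1 := back F (word a) ++ back F (word (inv a)).
have [P hP] := located_bound F1.
have far x p q : located x p q -> (P%:Z < `|p|) || (P%:Z < `|q|) -> x \notin F1.
  by move=> lx hpq; apply/negP => /hP /(_ _ _ lx); lia.
pose rgood x := forall k : nat, times k a x \notin F1.
pose lgood x := forall k : nat, times k (inv a) x \notin F1.
have rpath x (k : nat) : rgood x -> avoids r F x (times k a x).
  move=> gx; elim: k => [|k IH]; first exact: rst_refl.
  apply: rst_trans IH _; apply: back_avoids; have := gx k.
  by rewrite mem_cat negb_or => /andP[].
have lpath x (k : nat) : lgood x -> avoids r F x (times k (inv a) x).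
  move=> gx; elim: k => [|k IH]; first exact: rst_refl.
  apply: rst_trans IH _; apply: back_avoids; have := gx k.
  by rewrite mem_cat negb_or => /andP[].
have loc x : translation x -> exists p q, located x p q by move=> /(_ Phi0).
have jump c x y (e : int) : translation c -> located c e 0 -> e != 0 ->
    translation x -> translation y ->
    exists k : nat, avoids r F (times k c x) (times k c y).
  move=> tc ec e0 tx ty; pose w := word (mul (inv x) y).
  have [P' hP'] := located_bound (back F w); have [p [q lx]] := loc x tx.
  (* Both powers are joined by the word for the fixed quotient of [y] by [x]. This many steps carry
     [x] beyond every position at which that word could meet [F]. *)
  exists (P' + `|p| + 1)%N; set k := (P' + _ + _)%N.
  have -> : times k c y = act w (times k c x).
    have tk : translation (times k c (Mon_id M)).
      by apply: times_translation => //; exact: translation_id.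
    apply: Mon_eq => Phi; rewrite timesE val_act /w wordK !mulE (timesE k c x).
    rewrite translationC // [in RHS](translationC (g := inv x)) ?invK //.
    exact: translation_inv.
  apply: back_avoids; apply/negP => /hP' /(_ _ _ (times_located k lx ec)) /andP[+ _].
  rewrite /k; nia.
have rr x y : translation x -> translation y -> rgood x -> rgood y -> avoids r F x y.
  move=> tx ty gx gy; have [k H] := jump a x y _ ta ea nz tx ty.
  by apply: rst_trans (rpath x k gx) _; apply: rst_trans H _; apply: rst_sym; exact: rpath.
have ll x y : translation x -> translation y -> lgood x -> lgood y -> avoids r F x y.
  move=> tx ty gx gy; have [k H] := jump (inv a) x y _ ta' ea' nz' tx ty.
  by apply: rst_trans (lpath x k gx) _; apply: rst_trans H _; apply: rst_sym; exact: lpath.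
(* Its second position exceeds [P] and does not change along direction [a], so the whole line
   through [z] avoids [F1]. *)
pose z := times P.+1 b (Mon_id M).
have tz : translation z by apply: times_translation => //; exact: translation_id.
have lz := times_located P.+1 located_id eb; rewrite -/z mul0rn !add0r in lz.
have qz : P%:Z < `|m%:Z *+ P.+1| by rewrite -mulr_natr natz; nia.
have rz : rgood z.
  by move=> k; apply: (far _ _ _ (times_located k lz ea)); rewrite mul0rn addr0 qz orbT.
have lgz : lgood z.
  by move=> k; apply: (far _ _ _ (times_located k lz ea')); rewrite mul0rn addr0 qz orbT.
have good x : translation x -> rgood x \/ lgood x -> avoids r F x z.
  by move=> tx [gx|gx]; [exact: rr|exact: ll].
(* If both rays of [x] meet [F1], after [k] and [j] steps, then both hits have first position
   between [-P] and [P], so [k] is at most [2 * P] and only finitely many [x] occur. *)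
pose bad := [seq times k (inv a) f | f <- F1, k <- iota 0 (2 * P).+1].
have not_bad x : translation x -> x \notin bad -> rgood x \/ lgood x.
  move=> tx xb; apply: contrapT => /not_orP [/existsNP [k /negP/negPn hk] /existsNP [j /negP/negPn hj]].
  move/negP: xb; apply; apply/allpairsP; exists (times k a x, k).
  have [p [q lx]] := loc x tx.
  have /andP[h1 _] := hP _ hk _ _ (times_located k lx ea).
  have /andP[h2 _] := hP _ hj _ _ (times_located j lx ea').
  split; [by []| |]; rewrite /fst /snd.
    have ku : k%:Z <= n%:Z *+ k by rewrite -mulr_natr natz; clear - n0; nia.
    have ju : 0 <= n%:Z *+ j by rewrite mulrn_wge0.
    rewrite mem_iota add0n /=; move: h1 h2; rewrite mulNrn.
    move: (_ *+ k) (_ *+ j) ku ju => u v; clear; lia.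
  by rewrite timesK.
exists (F ++ flatten [seq back (F ++ bad) w | w <- W]); split.
  by move=> g gF; rewrite mem_cat gF.
suff to_z g : g \notin F ++ flatten [seq back (F ++ bad) w | w <- W] -> avoids r F g z.
  by move=> g h gF hF; apply: rst_trans (to_z g gF) _; apply: rst_sym; exact: to_z.
rewrite mem_cat negb_or => /andP[gF gW]; have [w wW tw] := hW g.
have gw : g \notin back (F ++ bad) w.
  by apply: contra gW => gw; apply/flattenP; exists (back (F ++ bad) w) => //; apply/mapP; exists w.
apply: (rst_trans _ _ _ (act w g)).
  by apply: avoids_sub (back_avoids gw) => x xF; rewrite mem_cat xF.
apply: good => //; apply: not_bad => //.
by have := back_end gw; rewrite mem_cat negb_or => /andP[].
Qed.

Fixpoint word_ball n : seq G :=
  if n is n'.+1 then undup (word_ball n' ++ [seq r l h | h <- word_ball n', l <- enum 'I_3])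
  else [:: Mon_id M].

Lemma ball_step n g l : g \in word_ball n -> r l g \in word_ball n.+1.
Proof.
move=> gn; rewrite /= mem_undup mem_cat; apply/orP; right.
by apply/allpairsP; exists (g, l); rewrite mem_enum.
Qed.

Lemma ball_sub n m : (n <= m)%N -> {subset word_ball n <= word_ball m}.
Proof.
move=> /subnK <-; elim: (m - n)%N => // k IH g /IH gk.
by rewrite addSn /= mem_undup mem_cat gk.
Qed.

Lemma ball_uniq n : uniq (word_ball n).
Proof. by case: n => //= n; exact: undup_uniq. Qed.

Lemma ball_ex g : exists n, g \in word_ball n.
Proof.
rewrite -(wordK g); elim: (word g) => [|l w [n IH]]; first by exists 0%N; rewrite mem_head.
by exists n.+1; exact: ball_step.
Qed.

Lemma ball_connected n g : g \in word_ball n -> clos_refl_sym_trans G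
  (fun h k => [/\ h \in word_ball n, k \in word_ball n & exists l, k = r l h]) (Mon_id M) g.
Proof.
elim: n g => [|n IH] g; first by rewrite inE => /eqP ->; exact: rst_refl.
have mono h : h \in word_ball n -> clos_refl_sym_trans G
    (fun h k => [/\ h \in word_ball n.+1, k \in word_ball n.+1 & exists l, k = r l h]) (Mon_id M) h.
  move=> /IH; elim=> {h} [h k [hn kn e]|h|h k _|h k l _ H1 _ H2].
  - by apply: rst_step; split; rewrite // (ball_sub (leqnSn n)).
  - exact: rst_refl.
  - exact: rst_sym.
  - exact: rst_trans H1 H2.
rewrite /= mem_undup mem_cat => /orP[/mono //|/allpairsP[[h l] /= [hn _ ->]]].
apply: rst_trans (mono h hn) _; apply: rst_step; split; last by exists l.
  exact: ball_sub hn.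
exact: ball_step.
Qed.

Lemma support_ball n : {subset support r (word_ball n) <= word_ball (n + \sum_i nsec r i)}.
Proof.
move=> h /supportP [i /meetsP [g gn hg]].
have [m mN ->] := (reach_coset r i g h).1 (rst_sym _ _ _ _ hg).
have : walk r i g m \in word_ball (n + m).
  by elim: m {mN} => [|m IH]; rewrite ?addn0 // addnS /=; exact: ball_step.
apply: ball_sub; rewrite leq_add2l; apply: leq_trans (ltnW mN) _.
by rewrite (bigD1 i) //= leq_addr.
Qed.

Lemma swap_bound : exists C : nat, forall Psi l, Psi \in domain L ->
  exists Psi' a b, [/\ Psi' \in domain L, flag_swap l Psi = shift a b Psi',
    (`|a| <= C)%N & (`|b| <= C)%N].
Proof.
have [|x _|C H] := @seq_bound _ (fun (x : flags M * 'I_3) C => exists Psi' a b,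
    [/\ Psi' \in domain L, flag_swap x.2 x.1 = shift a b Psi', (`|a| <= C)%N & (`|b| <= C)%N])
    [seq (Psi, l) | Psi <- domain L, l <- enum 'I_3].
- move=> x n m nm [Psi' [a [b [h1 h2 h3 h4]]]]; exists Psi', a, b.
  by split => //; [exact: leq_trans h3 nm|exact: leq_trans h4 nm].
- have [Psi' hP [a [b e]]] := domain_cover L (flag_swap x.2 x.1).
  exists (maxn `|a| `|b|), Psi', a, b.
  by split; rewrite ?leq_maxl ?leq_maxr.
by exists C => Psi l hP; apply: (H (Psi, l)); apply/allpairsP; exists (Psi, l); rewrite mem_enum.
Qed.

Lemma ball_growth : exists q d, forall n, (size (word_ball n) <= (q * n.+1) ^ d)%N.
Proof.
have [C HC] := swap_bound.
pose span n := [seq k%:Z - (C * n)%N%:Z | k <- iota 0 (2 * (C * n)).+1].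
have spanP n a : (`|a| <= C * n)%N -> a \in span n.
  move=> an; apply/mapP; exists `|(a + (C * n)%N%:Z)%R|%N; last by lia.
  by rewrite mem_iota; lia.
pose cand n := [seq shift t.1.1 t.1.2 t.2 | t <- [seq (ab, Psi) |
   ab <- [seq (a, b) | a <- span n, b <- span n], Psi <- domain L]].
have candP n g Psi : g \in word_ball n -> Psi \in domain L -> \val g Psi \in cand n.
  move=> gn hP; suff [Psi' [a [b [h1 -> h3 h4]]]] : exists Psi' a b,
      [/\ Psi' \in domain L, \val g Psi = shift a b Psi', (`|a| <= C * n)%N & (`|b| <= C * n)%N].
    apply/mapP; exists ((a, b), Psi') => //; apply/allpairsP; exists ((a, b), Psi').
    by split => //; apply/allpairsP; exists (a, b); rewrite !spanP.
  elim: n g gn => [|n IH] g.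
    by rewrite inE => /eqP ->; exists Psi, 0, 0; rewrite shift0.
  rewrite mem_undup mem_cat => /orP[/IH [Psi' [a [b [h1 h2 h3 h4]]]]|/allpairsP[[h l] /= [hn _ ->]]].
    by exists Psi', a, b; split => //; nia.
  have [Psi' [a [b [h1 h2 h3 h4]]]] := IH _ hn.
  have [Psi2 [c [d [k1 k2 k3 k4]]]] := HC Psi' l h1.
  exists Psi2, (a + c), (b + d); split; rewrite // ?crossE /= ?h2 ?shift_swap ?k2 ?shiftD //; nia.
(* In the exponent, 2 comes from the two shift coordinates and [size (domain L)] from having one
   value per representative. *)
exists (size (domain L) * (2 * C + 1))%N, (2 * size (domain L))%N => n.
pose D := seq_sub (domain L).
pose f (x : seq_sub (word_ball n)) : {ffun D -> seq_sub (cand n)} :=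
  [ffun y => SeqSub (candP n _ _ (ssvalP x) (ssvalP y))].
have f_inj : injective f.
  move=> x y xy; apply: val_inj; apply: Mon_eq => Phi.
  have [Psi hP [a [b ->]]] := domain_cover L Phi; rewrite !shift_act; congr shift.
  have := congr1 (fun t : {ffun D -> seq_sub (cand n)} => ssval (t (SeqSub hP))) xy.
  by rewrite !ffunE.
rewrite -(card_seq_sub (ball_uniq n)); apply: leq_trans (leq_card f f_inj) _.
rewrite card_ffun expnM.
have cc : (#|{: seq_sub (cand n)}| <= (size (domain L) * (2 * C + 1) * n.+1) ^ 2)%N.
  apply: (@leq_trans (size (cand n))).
    rewrite cardE -(size_map val); apply: uniq_leq_size.
      by rewrite map_inj_uniq ?enum_uniq //; exact: val_inj.
    by move=> y /mapP[x _ ->]; exact: ssvalP.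
  rewrite size_map !size_allpairs !size_map size_iota.
  have : ((2 * (C * n)).+1 <= (2 * C + 1) * n.+1)%N by nia.
  have aux e p t : (p <= t)%N -> (p * p * e <= (e * t) ^ 2)%N.
    move=> pt; apply: (@leq_trans (t * t * e)); first by rewrite leq_mul2r leq_mul ?orbT.
    rewrite -mulnn mulnACA [leqRHS]mulnC leq_mul2l; apply/orP; right.
    by case: e => // e; rewrite leq_pmulr.
  by rewrite -[(size _ * _ * n.+1)%N]mulnA; exact: aux.
have dd : (#|{: D}| <= size (domain L))%N.
  rewrite cardE -(size_map val); apply: uniq_leq_size.
    by rewrite map_inj_uniq ?enum_uniq //; exact: val_inj.
  by move=> y /mapP[x _ ->]; exact: ssvalP.
case: (posnP (size (domain L))) => [d0|d0].
  by move: dd; rewrite d0 leqn0 => /eqP ->.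
apply: (@leq_trans (((size (domain L) * (2 * C + 1) * n.+1) ^ 2) ^ #|{: D}|)).
  by move: #|{: D}| => [|e]; rewrite ?expn0 // leq_exp2r.
by rewrite leq_pexp2l // expn_gt0 !muln_gt0 d0 /= addn1.
Qed.

Lemma cayley_folner : folner_graph r.
Proof.
move=> c n0; have [q [d hg]] := ball_growth.
(* The support of a ball lies in the ball of radius larger by the sum of the fan sizes, so the
   isoperimetric condition becomes one on the growth function. *)
have [||n hn] := @poly_growth_folner (fun n => size (word_ball n)) q d (\sum_i nsec r i)%N c n0 _ hg.
- by move=> n m nm; apply: uniq_leq_size (ball_uniq n) (ball_sub nm).
- elim=> [|n [m hm]]; first by exists 0%N.
  have [g gm] := Mon_infinite (word_ball m); have [k gk] := ball_ex g.
  exists (maxn m k).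
  have : uniq (g :: word_ball m) by rewrite /= gm ball_uniq.
  move=> /uniq_leq_size H; apply: leq_trans (H (word_ball (maxn m k)) _); first by rewrite /= ltnS.
  move=> h; rewrite inE => /orP[/eqP ->|hm'].
    by apply: ball_sub gk; rewrite leq_maxr.
  by apply: ball_sub hm'; rewrite leq_maxl.
exists (word_ball n), (Mon_id M); split.
- exact: ball_uniq.
- by apply: (ball_sub (leq0n n)); rewrite mem_head.
- exact: ball_connected.
- apply: leq_trans hn; rewrite leq_add2r leq_mul2l; apply/orP; right.
  by rewrite leq_sub2r // uniq_leq_size ?undup_uniq //; exact: support_ball.
Qed.

End Cayley.

(** * Regular polygons *)

Section PlaneVectors.
Variable R : realType.
Implicit Types (x y z a b : plane R) (t : R).

Definition det x y : R := px x * py y - py x * px y.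
Definition quarter x : plane R := vec2 (- py x) (px x).
Definition turn t x : plane R :=
  vec2 (cos t * px x - sin t * py x) (sin t * px x + cos t * py x).
Definition left_of a b x : R := det (b - a) (x - a).

Lemma turn_polar rho s t : turn t (polar rho s) = polar rho (s + t).
Proof. by apply/plane_eqP; rewrite !pxy cosD sinD; split; ring. Qed.

Lemma turn_turn s t x : turn s (turn t x) = turn (s + t) x.
Proof. by apply/plane_eqP; rewrite !pxy cosD sinD; split; ring. Qed.

Lemma turn0 x : turn 0 x = x.
Proof. by apply/plane_eqP; rewrite !pxy cos0 sin0; split; ring. Qed.

Lemma turnD t x y : turn t (x + y) = turn t x + turn t y.
Proof. by apply/plane_eqP; rewrite !pxy; split; ring. Qed.

Lemma turnK t x : turn (- t) (turn t x) = x.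
Proof. by rewrite turn_turn addNr turn0. Qed.

Lemma turn_pi x : turn pi x = - x.
Proof. by apply/plane_eqP; rewrite !pxy cospi sinpi; split; ring. Qed.

Lemma turn_2pi t x : turn (t + 2 * pi) x = turn t x.
Proof. by rewrite mulr_natl -turn_turn (_ : pi *+ 2 = pi + pi) // -(turn_turn pi) !turn_pi opprK. Qed.

(** The identity minus the turn has determinant [2 - 2 * cos t], which is nonzero. *)
Lemma turn_fixed t x : cos t != 1 -> turn t x = x -> x = 0.
Proof.
move=> ct /plane_eqP[]; rewrite !pxy => e1 e2.
have c2 := cos2Dsin2 t; have k : 2 - 2 * cos t != 0.
  by apply: contra ct => /eqP h; apply/eqP; lra.
apply/plane_eqP; rewrite !pxy; split; apply: (mulfI k); rewrite mulr0.
- have : (1 - cos t) * (px x - (cos t * px x - sin t * py x)) +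
         sin t * (sin t * px x + cos t * py x - py x) = 0 by rewrite e1 e2 !subrr !mulr0 addr0.
  have -> : (1 - cos t) * (px x - (cos t * px x - sin t * py x)) +
         sin t * (sin t * px x + cos t * py x - py x) =
      (1 - 2 * cos t + (cos t ^+ 2 + sin t ^+ 2)) * px x by ring.
  by rewrite c2 => <-; congr (_ * _); ring.
- have : (1 - cos t) * (py x - (sin t * px x + cos t * py x)) -
         sin t * (cos t * px x - sin t * py x - px x) = 0 by rewrite e1 e2 !subrr !mulr0 subrr.
  have -> : (1 - cos t) * (py x - (sin t * px x + cos t * py x)) -
         sin t * (cos t * px x - sin t * py x - px x) =
      (1 - 2 * cos t + (cos t ^+ 2 + sin t ^+ 2)) * py x by ring.
  by rewrite c2 => <-; congr (_ * _); ring.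
Qed.

Definition affine_form (f : plane R -> R) : Prop :=
  exists a b d : R, forall x, f x = a * px x + b * py x + d.

Lemma left_of_affine a b : affine_form (left_of a b).
Proof.
exists (- py (b - a)), (px (b - a)), (py (b - a) * px a - px (b - a) * py a) => x.
by rewrite /left_of /det !pxy; ring.
Qed.

Lemma hull_affine n (p : 'I_n -> plane R) (w : 'I_n -> R) f : affine_form f ->
  \sum_i w i = 1 -> f (\sum_i w i *: p i) = \sum_i w i * f (p i).
Proof.
move=> [a [b [d fE]]] w1; rewrite fE.
have -> : px (\sum_i w i *: p i) = \sum_i w i * px (p i).
  by rewrite (big_morph (@px R) (@pxD R) (px0 R)); apply: eq_bigr => i _; rewrite pxZ.
have -> : py (\sum_i w i *: p i) = \sum_i w i * py (p i).
  by rewrite (big_morph (@py R) (@pyD R) (py0 R)); apply: eq_bigr => i _; rewrite pyZ.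
rewrite !mulr_sumr -[X in _ + X]mulr1 -w1 mulr_sumr -!big_split /=.
by apply: eq_bigr => i _; rewrite fE; ring.
Qed.

Lemma affine_segment f a b t : affine_form f ->
  f ((1 - t) *: a + t *: b) = (1 - t) * f a + t * f b.
Proof. by move=> [u [v [d fE]]]; rewrite !fE !pxy; ring. Qed.

Lemma left_ofl a b : left_of a b a = 0.
Proof. by rewrite /left_of /det subrr !pxy; ring. Qed.

Lemma left_ofr a b : left_of a b b = 0.
Proof. by rewrite /left_of /det; ring. Qed.

Lemma segmentP a b x : segment a b x <-> exists2 t, 0 <= t <= 1 & x = (1 - t) *: a + t *: b.
Proof.
by split=> [[t /=]|[t t01 ->]]; [rewrite in_itv /= => ? <-; exists t|exists t; rewrite /= ?in_itv].
Qed.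

Lemma segment_l a b : segment a b a.
Proof. by apply/segmentP; exists 0; rewrite ?lexx ?ler01 // subr0 scale1r scale0r addr0. Qed.

Lemma segment_r a b : segment a b b.
Proof. by apply/segmentP; exists 1; rewrite ?lexx ?ler01 // subrr scale1r scale0r add0r. Qed.

Lemma segmentC a b : segment a b = segment b a.
Proof.
suff H (u v : plane R) : segment u v `<=` segment v u by apply/seteqP.
move=> x /segmentP[t t01 ->]; apply/segmentP; exists (1 - t); first by lra.
by rewrite addrC subKr.
Qed.

Lemma segment_left_of a b x : segment a b x -> left_of a b x = 0.
Proof.
move=> /segmentP[t _ ->]; rewrite affine_segment; last exact: left_of_affine.
by rewrite left_ofl left_ofr !mulr0 addr0.
Qed.

Definition midpoint a b : plane R := 2^-1 *: (a + b).

Lemma segment_mid a b : segment a b (midpoint a b).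
Proof.
apply/segmentP; exists 2^-1; first by lra.
by rewrite /midpoint scalerDr; congr (_ *: _ + _); lra.
Qed.

Lemma left_of_mid a b s :
  left_of a b (midpoint a b + s *: quarter (b - a)) = s * (px (b - a) ^+ 2 + py (b - a) ^+ 2).
Proof. by rewrite /left_of /det !pxy; field. Qed.

Lemma sq_gt0 a b : a <> b -> 0 < px (b - a) ^+ 2 + py (b - a) ^+ 2.
Proof.
move=> ab; rewrite lt_neqAle addr_ge0 ?sqr_ge0 // andbT eq_sym paddr_eq0 ?sqr_ge0 // !sqrf_eq0.
apply/negP => /andP[/eqP h1 /eqP h2]; apply: ab; apply/plane_eqP.
by move: h1 h2; rewrite !pxy; lra.
Qed.

Section Hull.
Variables (n : nat) (p : 'I_n -> plane R).

Lemma hull_ge0 f x : affine_form f -> (forall i, 0 <= f (p i)) -> convex_hull p x -> 0 <= f x.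
Proof.
move=> af f0 [w [w0 w1 ->]]; rewrite hull_affine //.
by apply: sumr_ge0 => i _; exact: mulr_ge0.
Qed.

(** A nonnegative affine form that vanishes at [x] forces the weights to vanish off its zero set,
    which leaves only [a] and [b]. *)
Lemma hull_face f x a b : affine_form f -> (forall i, 0 <= f (p i)) ->
  (forall i, f (p i) = 0 -> p i = a \/ p i = b) ->
  convex_hull p x -> f x = 0 -> segment a b x.
Proof.
move=> af f0 fab [w [w0 w1 ->]]; rewrite hull_affine // => /eqP.
rewrite psumr_eq0; last by move=> i _; exact: mulr_ge0.
move=> /allP wf; have wz i : w i = 0 \/ p i = a \/ p i = b.
  have := wf i (mem_index_enum i); rewrite /= mulf_eq0 => /orP[/eqP ->|/eqP /fab]; first by left.
  by right.
pose t := \sum_(i | p i == b) w i.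
have t1 : 1 - t = \sum_(i | p i != b) w i by rewrite -w1 (bigID (fun i => p i == b)) /= addrAC subrr add0r.
apply/segmentP; exists t.
  have t0 : 0 <= t by apply: sumr_ge0.
  have : 0 <= 1 - t by rewrite t1; apply: sumr_ge0.
  lra.
rewrite (bigID (fun i => p i == b)) /= addrC t1; congr (_ + _).
  rewrite scaler_suml; apply: eq_bigr => i /eqP ib; case: (wz i) => [->|[->|//]] //.
  by rewrite !scale0r.
by rewrite /t scaler_suml; apply: eq_bigr => i /eqP ->.
Qed.

Lemma hull_in i : convex_hull p (p i).
Proof.
exists (fun j => (j == i)%:R); split => //; rewrite (bigD1 i) //= eqxx ?scale1r big1 ?addr0 //.
  by move=> j /negbTE ->.
by move=> j /negbTE ->; rewrite scale0r.
Qed.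

Lemma hull_convex t x y : 0 <= t <= 1 -> convex_hull p x -> convex_hull p y ->
  convex_hull p ((1 - t) *: x + t *: y).
Proof.
move=> t01 [w [w0 w1 ->]] [v [v0 v1 ->]].
exists (fun i => (1 - t) * w i + t * v i); split.
- by move=> i; rewrite addr_ge0 ?mulr_ge0 //; lra.
- by rewrite big_split /= -!mulr_sumr w1 v1; ring.
- by rewrite !scaler_sumr -big_split /=; apply: eq_bigr => i _; rewrite !scalerA -scalerDl.
Qed.

(** Defined from the set alone: this is how the corners are recovered from a polygon given as a
    point set. *)
Definition extreme (P : set (plane R)) x := P x /\
  forall y z, P y -> P z -> x = midpoint y z -> y = z.

Lemma hull_extreme x : extreme (convex_hull p) x -> exists i, x = p i.
Proof.
move=> [[w [w0 w1 xE]] H].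
have [i wi] : exists i, 0 < w i.
  apply: contrapT => /forallNP h; have : \sum_i w i = 0.
    by rewrite big1 // => i _; apply/eqP; rewrite eq_le w0 andbT leNgt; apply/negP.
  by rewrite w1 => /eqP; rewrite oner_eq0.
have wi1 : w i <= 1.
  by rewrite -w1 (bigD1 i) //= lerDl; apply: sumr_ge0.
exists i; have sum_d (j0 : 'I_n) : \sum_j (j == j0)%:R = 1 :> R.
  by rewrite (bigD1 j0) //= eqxx big1 ?addr0 // => j /negbTE ->.
have sum_p : \sum_j (j == i)%:R *: p j = p i.
  by rewrite (bigD1 i) //= eqxx scale1r big1 ?addr0 // => j /negbTE ->; rewrite scale0r.
have u_in : convex_hull p ((1 - w i) *: x + w i *: p i).
  apply: hull_convex; [lra| |exact: hull_in]; by exists w.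
have v_in : convex_hull p ((1 + w i) *: x - w i *: p i).
  exists (fun j => (1 + w i) * w j - w i * (j == i)%:R); split.
  - move=> j; have [->|_] := eqVneq j i; last by rewrite mulr0 subr0 mulr_ge0 //; lra.
    by rewrite mulr1 mulrDl mul1r addrAC subrr add0r mulr_ge0.
  - by rewrite sumrB -!mulr_sumr w1 sum_d; ring.
  - rewrite [X in X = _](_ : _ = (1 + w i) *: (\sum_j w j *: p j) - w i *: (\sum_j (j == i)%:R *: p j)); last by rewrite sum_p -xE.
    rewrite !scaler_sumr -sumrB; apply: eq_bigr => j _.
    by rewrite !scalerA scalerBl.
(* These are [x] plus and minus [w i *: (p i - x)]; the second stays in the hull because its weight
   at [i] is the square of [w i]. *)
have e : x = midpoint ((1 - w i) *: x + w i *: p i) ((1 + w i) *: x - w i *: p i).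
  by apply/plane_eqP; rewrite !pxy; split; field.
have /plane_eqP[] := H _ _ u_in v_in e; rewrite !pxy => h1 h2.
have wn : w i != 0 by rewrite gt_eqF.
by apply/plane_eqP; split; apply: (mulfI wn); lra.
Qed.

Lemma hull_compact : compact (convex_hull p).
Proof.
pose D : set 'rV[R]_n := [set w | (forall i, 0 <= w ord0 i) /\ \sum_i w ord0 i = 1].
have cD : compact D.
  have coord (i : 'I_n) : continuous (fun w : 'rV[R]_n => w ord0 i).
    by move=> w; exact: coord_continuous.
  have sumc : continuous (fun w : 'rV[R]_n => \sum_i w ord0 i) by apply: cont_sum => i; exact: coord.
  apply: bounded_closed_compact.
    exists 1; split; first exact: num_real.
    move=> B B1 v [v0 v1] /=; apply: le_trans (ltW B1).
    rewrite /Num.norm /= mx_normrE; apply: bigmax_le; first exact: ler01.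
    move=> [a b] _ /=; rewrite (ord1 a) ger0_norm // -v1 (bigD1 b) //= lerDl.
    exact: sumr_ge0.
  rewrite (_ : D = (\bigcap_(i in [set: 'I_n]) [set v | 0 <= v ord0 i]) `&`
    [set v | \sum_i v ord0 i = 1]).
    apply: closedI.
      by apply: closed_bigI => i _; apply: (closed_comp _ (@closed_ge R 0)) => v _; exact: coord.
    apply: (closed_comp _ (@closed_eq R 1)) => v _.
    exact: sumc.
  by apply/seteqP; split => v [h1 h2]; split => // i; [move=> _; exact: h1|exact: h1].
rewrite (_ : convex_hull p = (fun w : 'rV[R]_n => \sum_i w ord0 i *: p i) @` D).
  apply: continuous_compact cD; apply: continuous_subspaceT.
  apply: row_continuous => j; rewrite (_ : (fun _ => _) = fun w : 'rV[R]_n => \sum_i w ord0 i * p i ord0 j).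
    apply: cont_sum => i; apply: contM; last exact: contC.
    by move=> w; exact: coord_continuous.
  by apply/funext => w; rewrite summxE; apply: eq_bigr => i _; rewrite mxE.
apply/seteqP; split => x.
  move=> [w [w0 w1 ->]]; exists (\row_i w i).
    by split=> [i|]; [rewrite mxE|rewrite -[RHS]w1; apply: eq_bigr => i _; rewrite mxE].
  by apply: eq_bigr => i _; rewrite mxE.
by case=> w [w0 w1] <-; exists (fun i => w ord0 i).
Qed.

End Hull.

End PlaneVectors.

(** * Corners, sides and centre of a regular polygon *)

Section Ngon.
Variables (R : realType) (n : nat) (c : plane R) (rho theta : R).
Hypotheses (n3 : (3 <= n)%N) (rho0 : 0 < rho).
Local Notation z := (ngon_corner n c rho theta).
Local Notation P := (ngon n c rho theta).
Implicit Types (x y : plane R) (i j k m : nat).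

Let n0 : n%:R != 0 :> R. Proof. by rewrite pnatr_eq0; lia. Qed.
Let step : R := 2 * pi / n%:R.

Lemma corner_turn k m : z (k + m) = c + turn (step * m%:R) (z k - c).
Proof.
rewrite /ngon_corner addrAC subrr add0r turn_polar; congr (_ + polar _ _).
by rewrite natrD /step mulrDr mulrDl -addrA; congr (_ + (_ + _)); rewrite mulrAC.
Qed.

Lemma corner_per k m : z (k + m * n) = z k.
Proof.
rewrite corner_turn; suff -> : turn (step * (m * n)%:R) (z k - c) = z k - c by rewrite addrC subrK.
rewrite natrM [m%:R * _]mulrC mulrA /step divfK //.
by elim: m => [|m IH]; [rewrite mulr0 turn0|rewrite -[m.+1%:R]natr1 mulrDr mulr1 turn_2pi].
Qed.

Lemma corner_mod k : z (k %% n) = z k.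
Proof. by rewrite [in RHS](divn_eq k n) addnC corner_per. Qed.

Lemma corner_next k : z k.+2 - z k.+1 = turn step (z k.+1 - z k).
Proof.
rewrite -(addn1 k.+1) -[in RHS](addn1 k) -(addn1 k) !corner_turn mulr1.
by move: (z k) => v; apply/plane_eqP; rewrite !pxy; split; ring.
Qed.

Lemma corner_relative k j : exists2 m, (m < n)%N & z j = z (k + m).
Proof.
(* Modulo [n], adding [k * n.-1] is subtracting [k]. *)
exists ((j + k * n.-1) %% n)%N; first by rewrite ltn_mod; lia.
rewrite -corner_mod -[in RHS]corner_mod modnDmr (_ : (k + (j + k * n.-1) = j + k * n)%N); last by nia.
by rewrite addnC modnMDl.
Qed.

Lemma corner_inj k j : (k < n)%N -> (j < n)%N -> z k = z j -> k = j.
Proof.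
move=> kn jn /addrI; rewrite ![theta + _]addrC -!turn_polar => /(congr1 (turn (- theta))).
rewrite !turnK => e.
have eE i : 2 * pi * i%:R / n%:R = ang n i 0 by rewrite /ang addr0.
rewrite !eE in e; have t0 : 0 <= (0 : R) <= 1 by rewrite lexx ler01.
have [_ [r0|[] //|[_ /eqP]|[_ _ /eqP]]] := sector_inj kn jn (ltW rho0) (ltW rho0) t0 t0 e.
- by move: rho0; rewrite r0 ltxx.
- by rewrite eq_sym oner_eq0.
- by rewrite eq_sym oner_eq0.
Qed.

Let angle k : R := theta + 2 * pi * k%:R / n%:R.
Let half : R := pi / n%:R.

Lemma half_bounds : 0 < half < pi / 2.
Proof.
have p0 := pi_gt0 R; have nR : 3 <= n%:R :> R by rewrite ler_nat.
rewrite /half divr_gt0 ?ltr0n //=; last by lia.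
rewrite ltr_pdivrMr; last by lra.
by rewrite -mulrA ltr_pMr //; lra.
Qed.

Lemma angleD k m : angle (k + m) = angle k + half * m%:R *+ 2.
Proof.
rewrite /angle natrD mulrDr mulrDl addrA; congr (_ + _).
by rewrite /half -mulr_natr; move: (pi : R) => p; field.
Qed.

Lemma sin_half m : (0 < m < n)%N -> 0 < sin (half * m%:R).
Proof.
move=> /andP[m0 mn]; have [h1 h2] := andP half_bounds.
apply: sin_gt0_pi; rewrite mulr_gt0 ?ltr0n //=.
rewrite /half mulrAC ltr_pdivrMr ?ltr0n; last by lia.
by rewrite ltr_pM2l ?pi_gt0 // ltr_nat.
Qed.

(** A chord that spans the angle [2 * t] has length [2 * rho * sin t] and is perpendicular to the
    radius bisecting it. The product form exhibits the sign of the area. *)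
Lemma corner_left_of k m :
  left_of (z k) (z k.+1) (z (k + m)) =
  4 * rho ^+ 2 * sin half * sin (half * m%:R) * sin (half * m%:R - half).
Proof.
have key (a p q : R) : det (polar rho (a + p *+ 2) - polar rho a) (polar rho (a + q *+ 2) - polar rho a) =
    4 * rho ^+ 2 * sin p * sin q * sin (q - p).
  have e (t : R) : polar rho (a + t *+ 2) - polar rho a =
      (2 * rho * sin t) *: quarter (polar 1 (a + t)).
    rewrite {1}(_ : a + t *+ 2 = a + t + t); last by rewrite mulr2n; ring.
    rewrite {2}(_ : a = a + t - t); last by ring.
    move: (a + t) => u; apply/plane_eqP.
    by rewrite !pxy !cosB !sinB !cosD !sinD; split; ring.
  rewrite !e {1}(_ : sin (q - p) = sin ((a + q) - (a + p))); last by congr sin; ring.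
  by rewrite sinB /det !pxy; ring.
have zB j : z j - z k = polar rho (angle j) - polar rho (angle k).
  by rewrite /ngon_corner opprD addrACA subrr add0r.
by rewrite /left_of !zB -(addn1 k) !angleD mulr1 key.
Qed.

Lemma corner_left_ge0 k j : 0 <= left_of (z k) (z k.+1) (z j).
Proof.
have [m mn ->] := corner_relative k j; rewrite corner_left_of.
have [->|m0] := posnP m; first by rewrite mulr0 sin0 mulr0 mul0r.
have := sin_half (m := 1); rewrite mulr1 => /(_ _) s1.
have [->|m1] := eqVneq m 1%N; first by rewrite mulr1 subrr sin0 mulr0.
rewrite !mulr_ge0 ?sqr_ge0 ?ltW ?s1 //; [lia|by apply: sin_half; rewrite m0|].
have -> : half * m%:R - half = half * m.-1%:R.
  by rewrite -[in LHS](prednK m0) -natr1 mulrDr mulr1 addrK.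
by apply: sin_half; lia.
Qed.

Lemma corner_left_eq0 k j : left_of (z k) (z k.+1) (z j) = 0 -> z j = z k \/ z j = z k.+1.
Proof.
have [m mn ->] := corner_relative k j; rewrite corner_left_of.
have [->|m0] := posnP m; first by rewrite addn0; left.
have [->|m1] := eqVneq m 1%N; first by rewrite addn1; right.
have s1 : 0 < sin half by have := sin_half (m := 1); rewrite mulr1; apply; lia.
have s2 : 0 < sin (half * m%:R) by apply: sin_half; rewrite m0.
have s3 : 0 < sin (half * m%:R - half).
  have -> : half * m%:R - half = half * m.-1%:R.
    by rewrite -[in LHS](prednK m0) -natr1 mulrDr mulr1 addrK.
  by apply: sin_half; lia.
move=> /eqP; rewrite gt_eqF // !mulr_gt0 // exprn_gt0 //.
Qed.

Lemma ngon_left_ge0 k x : P x -> 0 <= left_of (z k) (z k.+1) x.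
Proof.
apply: hull_ge0 => [|i]; first exact: left_of_affine.
exact: corner_left_ge0.
Qed.

Lemma corner_in k : P (z k).
Proof.
rewrite -corner_mod; have kn : (k %% n < n)%N by rewrite ltn_mod; lia.
exact: (hull_in (fun i : 'I_n => z i) (Ordinal kn)).
Qed.

Lemma corner_neq k : z k <> z k.+1.
Proof.
rewrite -(corner_mod k) -(corner_mod k.+1) => /corner_inj; rewrite !ltn_mod => /(_ _ _) h.
have : (k %% n = k.+1 %% n)%N by apply: h; lia.
move/eqP; rewrite -addn1 -{1}(addn0 k) eqn_modDl !modn_small //; lia.
Qed.

Lemma corner_neq2 k : z k <> z k.+2.
Proof.
rewrite -(corner_mod k) -(corner_mod k.+2) => /corner_inj; rewrite !ltn_mod => /(_ _ _) h.
have : (k %% n = k.+2 %% n)%N by apply: h; lia.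
move/eqP; rewrite -addn2 -{1}(addn0 k) eqn_modDl !modn_small //; lia.
Qed.

Lemma ngon_convex t x y : 0 <= t <= 1 -> P x -> P y -> P ((1 - t) *: x + t *: y).
Proof. exact: hull_convex. Qed.

Lemma ngon_side_in k : segment (z k) (z k.+1) `<=` P.
Proof.
move=> x /segmentP[t t01 ->]; apply: ngon_convex => //; exact: corner_in.
Qed.

Lemma cos_step_lt1 m : (0 < m < n)%N -> cos (step * m%:R) < 1.
Proof.
move=> mn; have s := sin_half mn.
have -> : step * m%:R = (half * m%:R) *+ 2.
  by rewrite /step /half -mulr_natr; move: (pi : R) => p; field.
rewrite cos_mulr2n cos2sin2 mulr2n; have := exprn_gt0 2 s; lra.
Qed.

(** The turn by one step permutes the summands, so it fixes the sum, and only 0 is fixed. *)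
Lemma corner_sum : \sum_(i < n) (z i - c) = 0.
Proof.
apply: (@turn_fixed _ step).
  by rewrite lt_eqF //; have := @cos_step_lt1 1; rewrite mulr1; apply; lia.
have tsum : turn step (\sum_(i < n) (z i - c)) = \sum_(i < n) (z i.+1 - c).
  rewrite (big_morph (turn step) (turnD step) (_ : turn step 0 = 0)); last first.
    by apply/plane_eqP; rewrite !pxy; split; ring.
  by apply: eq_bigr => i _; rewrite -[in RHS](addn1 i) corner_turn mulr1 [RHS]addrAC subrr add0r.
rewrite tsum -(big_mkord xpredT (fun i => z i.+1 - c)) -(big_mkord xpredT (fun i => z i - c)).
have np : n = n.-1.+1 by lia.
rewrite np big_nat_recr //= [RHS]big_nat_recl //= addrC -np; congr (_ - _ + _).
by have := corner_per 0 1; rewrite mul1n add0n.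
Qed.

Lemma center_sum : c = n%:R^-1 *: \sum_(i < n) z i.
Proof.
apply/esym/eqP; rewrite -subr_eq0; apply/eqP.
have := corner_sum; rewrite sumrB sumr_const card_ord => /(congr1 (fun v => n%:R^-1 *: v)).
by rewrite scaler0 scalerBr -(scaler_nat n c) scalerA mulVf // scale1r.
Qed.

Lemma center_in : P c.
Proof.
exists (fun _ => n%:R^-1); split.
- by move=> _; rewrite invr_ge0.
- by rewrite sumr_const card_ord -[_^-1 *+ _]mulr_natr mulVf.
- by rewrite {1}center_sum scaler_sumr.
Qed.

(** The centre lies over the midpoint of each side, strictly to its left; this supplies interior
    points next to a side. *)
Lemma center_mid k : exists2 h, 0 < h &
  c = midpoint (z k) (z k.+1) + h *: quarter (z k.+1 - z k).
Proof.
have [h0 h1] := andP half_bounds.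
have s0 : 0 < sin half by have := sin_half (m := 1); rewrite mulr1; apply; lia.
have c0 : 0 < cos half by apply: cos_gt0_pihalf; lra.
exists (cos half / (2 * sin half)); first by rewrite divr_gt0 // mulr_gt0.
have sn : sin half != 0 by rewrite gt_eqF.
rewrite /ngon_corner -/(angle k) -/(angle k.+1) -(addn1 k) angleD mulr1.
rewrite -[X in polar _ X](addrK half) {2}mulr2n addrA; move: (angle k + half) => a.
by apply/plane_eqP; rewrite !pxy !cosB !sinB !cosD !sinD; split; field.
Qed.

Lemma ngon_extreme x : extreme P x <-> exists2 k, (k < n)%N & x = z k.
Proof.
split=> [/hull_extreme [i ->]|[k kn ->]]; first by exists i.
(* The tangent to the circumscribed circle at [z k] supports the polygon and touches it only
   there. *)
pose f x := rho ^+ 2 - (px (z k - c) * px (x - c) + py (z k - c) * py (x - c)).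
have af : affine_form f.
  exists (- px (z k - c)), (- py (z k - c)), (rho ^+ 2 + (px (z k - c) * px c + py (z k - c) * py c)) => x'.
  by rewrite /f !(pxD x') !(pyD x') pxN pyN; ring.
have fE m : f (z (k + m)) = rho ^+ 2 * (1 - cos (step * m%:R)).
  have rE : px (z k - c) ^+ 2 + py (z k - c) ^+ 2 = rho ^+ 2.
    by rewrite -enorm_sq /ngon_corner addrAC subrr add0r enorm_polar real_normK ?num_real.
  have e : z (k + m) - c = turn (step * m%:R) (z k - c).
    by rewrite corner_turn addrAC subrr add0r.
  by rewrite /f e !px_vec2 !py_vec2 -rE; ring.
have f0 j : 0 <= f (z j).
  have [m mn ->] := corner_relative k j; by rewrite fE mulr_ge0 ?sqr_ge0 // subr_ge0 cos_le1.
have feq j : f (z j) = 0 -> z j = z k.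
  have [m mn ->] := corner_relative k j; have [->|m0] := posnP m; first by rewrite addn0.
  rewrite fE => /eqP; rewrite gt_eqF // mulr_gt0 ?exprn_gt0 // subr_gt0.
  by apply: cos_step_lt1; rewrite m0.
have fP y : P y -> 0 <= f y by apply: hull_ge0.
have fPeq y : P y -> f y = 0 -> y = z k.
  move=> Py fy; have : segment (z k) (z k) y.
    by apply: hull_face af _ _ Py fy => [i|i /feq ->]; [exact: f0|left].
  by move=> /segmentP[t _ ->]; rewrite -scalerDl subrK scale1r.
split; first exact: corner_in.
move=> y y' Py Py' e; have fk : f (z k) = 0.
  by have := fE 0%N; rewrite addn0 mulr0 cos0 subrr mulr0.
have fm : f (midpoint y y') = (f y + f y') / 2.
  by have [a [b [d fd]]] := af; rewrite !fd !pxy; field.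
have h1 := fP _ Py; have h2 := fP _ Py'; rewrite -e fk in fm.
have e1 : f y = 0 by lra.
have e2 : f y' = 0 by lra.
by rewrite (fPeq _ Py e1) (fPeq _ Py' e2).
Qed.

Lemma ngon_closed : closed P.
Proof.
apply: compact_closed; [exact: plane_hausdorff|exact: hull_compact].
Qed.

End Ngon.

(** Corners are the extreme points; their number and mean give [n] and the centre, and matching one
    corner matches all. So facts about [corner], [side] and [regular_polygon] do not depend on the
    parametrization chosen in them. *)
Lemma ngon_unique (R : realType) n n' (c c' : plane R) rho rho' theta theta' :
  (3 <= n)%N -> (3 <= n')%N -> 0 < rho -> 0 < rho' ->
  ngon n c rho theta = ngon n' c' rho' theta' ->
  [/\ n = n', c = c' & exists k0, forall k,
    ngon_corner n' c' rho' theta' k = ngon_corner n c rho theta (k0 + k)].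
Proof.
move=> n3 n3' r0 r0' e.
pose Z := [seq ngon_corner n c rho theta i | i <- iota 0 n].
pose Z' := [seq ngon_corner n' c' rho' theta' i | i <- iota 0 n'].
have zP x : x \in Z <-> extreme (ngon n c rho theta) x.
  rewrite ngon_extreme //; split=> [/mapP[k]|[k kn ->]].
    by rewrite mem_iota => /andP[_ kn] ->; exists k.
  by apply/mapP; exists k; rewrite ?mem_iota.
have zP' x : x \in Z' <-> extreme (ngon n' c' rho' theta') x.
  rewrite ngon_extreme //; split=> [/mapP[k]|[k kn ->]].
    by rewrite mem_iota => /andP[_ kn] ->; exists k.
  by apply/mapP; exists k; rewrite ?mem_iota.
have uZ : uniq Z.
  rewrite map_inj_in_uniq ?iota_uniq // => i j; rewrite !mem_iota !add0n => /andP[_ ?] /andP[_ ?].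
  exact: corner_inj.
have uZ' : uniq Z'.
  rewrite map_inj_in_uniq ?iota_uniq // => i j; rewrite !mem_iota !add0n => /andP[_ ?] /andP[_ ?].
  exact: corner_inj.
have pZ : perm_eq Z Z'.
  apply: uniq_perm => // x; apply/idP/idP => [/zP|/zP'].
    by rewrite e => /zP'.
  by rewrite -e => /zP.
have nn : n = n' by have := perm_size pZ; rewrite !size_map !size_iota.
subst n'; have cc : c = c'.
  rewrite (center_sum c theta n3 r0) (center_sum c' theta' n3 r0'); congr (_ *: _).
  have sumZ (d : plane R) s t : \sum_(i < n) ngon_corner n d s t i =
      \sum_(x <- [seq ngon_corner n d s t i | i <- iota 0 n]) x.
    by rewrite big_map -(big_mkord xpredT (fun i => ngon_corner n d s t i)) /index_iota subn0.
  by rewrite !sumZ; exact: perm_big.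
subst c'; split => //.
have : ngon_corner n c rho' theta' 0 \in Z.
  by rewrite (perm_mem pZ); apply/mapP; exists 0%N; rewrite // mem_iota; lia.
move=> /mapP[k0 _ e0]; exists k0 => k.
by rewrite -(add0n k) !corner_turn e0 add0n.
Qed.

(** * Tilings by regular polygons *)

Section Polygons.
Variable R : realType.
Implicit Types (P Q e : set (plane R)) (a b x v : plane R).

(** A directed side with the polygon on its left; it carries the orientation that [side] forgets. *)
Definition ccw P a b : Prop := exists n c rho theta k,
  [/\ (3 <= n)%N, 0 < rho, P = ngon n c rho theta,
      a = ngon_corner n c rho theta k & b = ngon_corner n c rho theta k.+1].

Lemma sideP P e : side P e <-> exists a b, ccw P a b /\ e = segment a b.
Proof.
split=> [[n [c [s [t [k [n3 s0 -> ->]]]]]]|[a [b [[n [c [s [t [k [n3 s0 -> -> ->]]]]]] ->]]]].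
  by exists (ngon_corner n c s t k), (ngon_corner n c s t k.+1); split => //; exists n, c, s, t, k.
by exists n, c, s, t, k.
Qed.

Lemma cornerP P v : corner P v <-> exists b, ccw P v b.
Proof.
split=> [[n [c [s [t [k [n3 s0 -> ->]]]]]]|[b [n [c [s [t [k [n3 s0 -> -> _]]]]]]]].
  by exists (ngon_corner n c s t k.+1), n, c, s, t, k.
by exists n, c, s, t, k.
Qed.

Section Representation.
Variables (n : nat) (c : plane R) (rho theta : R).
Hypotheses (n3 : (3 <= n)%N) (rho0 : 0 < rho).
Local Notation z := (ngon_corner n c rho theta).

Lemma ccw_rep a b : ccw (ngon n c rho theta) a b <-> exists k, a = z k /\ b = z k.+1.
Proof.
split=> [[n' [c' [s' [t' [k [n3' s0' e -> ->]]]]]]|[k [-> ->]]]; last by exists n, c, rho, theta, k.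
have [_ _ [k0 kE]] := ngon_unique n3 n3' rho0 s0' e.
by exists (k0 + k)%N; rewrite !kE addnS.
Qed.

Lemma corner_eq_add k j m : z k = z j -> z (k + m) = z (j + m).
Proof. by move=> e; rewrite !corner_turn e. Qed.

Lemma corner_eq_pred k j : z k.+1 = z j.+1 -> z k = z j.
Proof.
have per i : z (i + n) = z i by rewrite -[X in (i + X)%N]mul1n corner_per.
by move=> /(corner_eq_add n.-1); rewrite !addSnnS prednK ?per //; lia.
Qed.

End Representation.

Lemma ccw_fun P a b b' : ccw P a b -> ccw P a b' -> b = b'.
Proof.
move=> [n [c [s [t [k [n3 s0 -> -> ->]]]]]] /(ccw_rep _ _ n3 s0) [j [e ->]].
by have := corner_eq_add 1 e; rewrite !addn1.
Qed.

Lemma ccw_inj P a a' b : ccw P a b -> ccw P a' b -> a = a'.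
Proof.
move=> [n [c [s [t [k [n3 s0 -> -> ->]]]]]] /(ccw_rep _ _ n3 s0) [j [-> e]].
exact: corner_eq_pred e.
Qed.

Lemma ccw_neq P a b : ccw P a b -> a <> b.
Proof. by move=> [n [c [s [t [k [n3 s0 _ -> ->]]]]]]; exact: corner_neq. Qed.

Lemma ccw_asym P a b : ccw P a b -> ~ ccw P b a.
Proof.
move=> [n [c [s [t [k [n3 s0 -> -> ->]]]]]] /(ccw_rep _ _ n3 s0) [j [e1 e2]].
have := corner_eq_add 1 e1; rewrite !addn1 -e2 => /esym.
exact: corner_neq2.
Qed.

Lemma ccw_next P a b : ccw P a b -> exists c, ccw P b c.
Proof.
move=> [n [c [s [t [k [n3 s0 -> _ ->]]]]]]; exists (ngon_corner n c s t k.+2).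
by exists n, c, s, t, k.+1.
Qed.

Lemma ccw_prev P a b : ccw P a b -> exists c, ccw P c a.
Proof.
move=> [n [c [s [t [k [n3 s0 -> -> _]]]]]]; exists (ngon_corner n c s t (k + n.-1)).
exists n, c, s, t, (k + n.-1)%N; split => //.
by rewrite -addnS prednK; [rewrite -{3}(mul1n n) corner_per|lia].
Qed.

Lemma ccw_turn P a b c n : ccw P a b -> ccw P b c -> regular_polygon n P ->
  c = b + turn (2 * pi / n%:R) (b - a).
Proof.
move=> + + [d [s [t [n3 s0 PE]]]]; rewrite PE => /(ccw_rep _ _ n3 s0) [k [-> ->]].
move=> /(ccw_rep _ _ n3 s0) [j [e ->]].
have := corner_eq_add 1 e; rewrite !addn1 => <-.
by rewrite -corner_next // addrC subrK.
Qed.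

Lemma regular_polygon_unique P n m : regular_polygon n P -> regular_polygon m P -> n = m.
Proof.
move=> [c [s [t [n3 s0 ->]]]] [c' [s' [t' [m3 s0' e]]]].
by have [] := ngon_unique n3 m3 s0 s0' e.
Qed.

Lemma ccw_left_ge0 P a b x : ccw P a b -> P x -> 0 <= left_of a b x.
Proof. by move=> [n [c [s [t [k [n3 s0 -> -> ->]]]]]]; exact: ngon_left_ge0. Qed.

Lemma ccw_segment P a b : ccw P a b -> segment a b `<=` P.
Proof. by move=> [n [c [s [t [k [n3 s0 -> -> ->]]]]]]; exact: ngon_side_in. Qed.

Lemma corner_sub P v : corner P v -> P v.
Proof. by move=> [n [c [s [t [k [n3 s0 -> ->]]]]]]; exact: corner_in. Qed.

Lemma ccw_corner_l P a b : ccw P a b -> corner P a.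
Proof. by move=> h; apply/cornerP; exists b. Qed.

Lemma ccw_corner_r P a b : ccw P a b -> corner P b.
Proof. by move=> /ccw_next [c h]; apply/cornerP; exists c. Qed.

Lemma corner_endpoint P a b v : ccw P a b -> corner P v -> left_of a b v = 0 -> v = a \/ v = b.
Proof.
move=> [n [c [s [t [k [n3 s0 -> -> ->]]]]]] /cornerP [w /(ccw_rep _ _ n3 s0) [j [-> _]]].
exact: corner_left_eq0.
Qed.

Lemma unit_combination (s p q : R) : 0 <= s <= 1 -> 0 <= p <= 1 -> 0 <= q <= 1 ->
  (1 - s) * p + s * q = 0 -> p = 0 \/ q = 0.
Proof.
move=> s01 p01 q01 z0; have [s0|s0] := eqVneq s 0; [left|right].
  by rewrite s0 in z0; lra.
have h1 : 0 <= (1 - s) * p by rewrite mulr_ge0; lra.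
have h2 : 0 <= s * q by rewrite mulr_ge0; lra.
by apply: (mulfI s0); lra.
Qed.

(** With the endpoints of each segment placed on the other one, a vanishing convex combination of
    parameters shows that an endpoint is not interior. *)
Lemma segment_eq a b a' b' : a <> b -> segment a b = segment a' b' ->
  (a = a' /\ b = b') \/ (a = b' /\ b = a').
Proof.
move=> ab e.
have key u v u' v' : segment u v = segment u' v' -> u = u' \/ u = v'.
  move=> uv; have [s s01 hu] : exists2 s, 0 <= s <= 1 & u = (1 - s) *: u' + s *: v'.
    by apply/segmentP; rewrite -uv; exact: segment_l.
  have [p p01 hp] : exists2 s, 0 <= s <= 1 & u' = (1 - s) *: u + s *: v.
    by apply/segmentP; rewrite uv; exact: segment_l.
  have [q q01 hq] : exists2 s, 0 <= s <= 1 & v' = (1 - s) *: u + s *: v.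
    by apply/segmentP; rewrite uv; exact: segment_r.
  have [uv0|uv'] := eqVneq u v.
    by left; rewrite hp -uv0 -scalerDl subrK scale1r.
  have z0 : (1 - s) * p + s * q = 0.
    have : ((1 - s) * p + s * q) *: (v - u) = 0.
      by apply/eqP; rewrite -[X in X == _](addKr u) addrC subr_eq0; apply/eqP; rewrite [in RHS]hu hp hq;
         apply/plane_eqP; rewrite !pxy; split; ring.
    by move/eqP; rewrite scaler_eq0 subr_eq0 [v == u]eq_sym (negbTE uv') orbF => /eqP.
  have [p0|q0] := unit_combination s01 p01 q01 z0.
    by left; rewrite hp p0 subr0 scale1r scale0r addr0.
  by right; rewrite hq q0 subr0 scale1r scale0r addr0.
have e' : segment b a = segment b' a' by rewrite segmentC e segmentC.
have e2 := segmentC a' b'; rewrite -e in e2.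
case: (key _ _ _ _ e) => ha; case: (key _ _ _ _ e') => hb.
- by left.
- by case: ab; rewrite ha hb.
- by case: ab; rewrite ha hb.
- by right.
Qed.

(** At an inner point of one side the form [left_of] of the other vanishes. It is nonnegative on the
    polygon, so it vanishes at both ends, and only the ends of the second side allow that. *)
Lemma side_cross P a b a' b' x : ccw P a b -> ccw P a' b' ->
  segment a b x -> segment a' b' x -> (a = a' /\ b = b') \/ corner P x.
Proof.
move=> h h' /segmentP[t t01 xE] x'.
have [t0|t0] := eqVneq t 0.
  by right; rewrite xE t0 subr0 scale1r scale0r addr0; exact: ccw_corner_l h.
have [t1|t1] := eqVneq t 1.
  by right; rewrite xE t1 subrr scale1r scale0r add0r; exact: ccw_corner_r h.
left; have := segment_left_of x'; rewrite xE affine_segment; last exact: left_of_affine.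
have ha := ccw_left_ge0 h' (corner_sub (ccw_corner_l h)).
have hb := ccw_left_ge0 h' (corner_sub (ccw_corner_r h)).
have ka : 0 <= (1 - t) * left_of a' b' a by rewrite mulr_ge0 //; lra.
have kb : 0 <= t * left_of a' b' b by rewrite mulr_ge0 //; lra.
move=> s; have /eqP : (1 - t) * left_of a' b' a = 0 by lra.
have /eqP : t * left_of a' b' b = 0 by lra.
rewrite !mulf_eq0 (negbTE t0) /= [1 - t == 0]subr_eq0 [1 == t]eq_sym (negbTE t1) /= => /eqP b0 /eqP a0.
have ab := ccw_neq h.
case: (corner_endpoint h' (ccw_corner_l h) a0) => [e1|e1];
  case: (corner_endpoint h' (ccw_corner_r h) b0) => [e2|e2].
- by case: ab; rewrite e1 e2.
- by [].
- by case: (ccw_asym h'); rewrite -e1 -e2.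
- by case: ab; rewrite e1 e2.
Qed.

(** Both polygons contain a short perpendicular from the midpoint of the side towards their centres,
    on the same side. *)
Lemma ccw_overlap P Q a b : ccw P a b -> ccw Q a b ->
  exists x, [/\ P x, Q x & 0 < left_of a b x].
Proof.
have key P' : ccw P' a b -> exists2 h, 0 < h & forall s, 0 <= s <= h ->
    P' (midpoint a b + s *: quarter (b - a)).
  move=> [n [c [s [t [k [n3 s0 -> -> ->]]]]]].
  have [h h0 cE] := center_mid c t n3 s0 k; exists h => // u u01.
  set m := midpoint _ _ in cE *; set q := quarter _ in cE *.
  have -> : m + u *: q = (1 - u / h) *: m + (u / h) *: c.
    have hn : h != 0 by rewrite gt_eqF.
    by rewrite cE; apply/plane_eqP; rewrite !pxy; split; field.
  apply: ngon_convex; [|apply: ngon_side_in => //; exact: segment_mid|exact: center_in].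
  by rewrite divr_ge0 ?ler_pdivrMr //=; lra.
move=> hP hQ; have [h h0 H] := key P hP; have [h' h0' H'] := key Q hQ.
have m0 : 0 < Num.min h h' by rewrite lt_min h0.
exists (midpoint a b + Num.min h h' *: quarter (b - a)); split.
- by apply: H; rewrite (ltW m0) ge_min lexx.
- by apply: H'; rewrite (ltW m0) ge_min lexx orbT.
- rewrite left_of_mid mulr_gt0 //; apply: sq_gt0; exact: ccw_neq hP.
Qed.

End Polygons.

(** * Incidence of tiles in an edge-to-edge tessellation *)

Section Tessellation.
Variables (R : realType) (T : set (set (plane R))).
Hypothesis hT : tessellation T.
Implicit Types (P Q e : set (plane R)) (a b x v : plane R).
Local Notation M := (tiling_map T).

Lemma tile_regular P : T P -> exists n, regular_polygon n P.
Proof. by have [H _ _ _] := hT; exact: H. Qed.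

Lemma tile_ccw P : T P -> exists a b, ccw P a b.
Proof.
move=> /tile_regular [n [c [s [t [n3 s0 ->]]]]].
by exists (ngon_corner n c s t 0), (ngon_corner n c s t 1), n, c, s, t, 0%N.
Qed.

Lemma tile_closed P : T P -> closed P.
Proof. by move=> /tile_regular [n [c [s [t [n3 s0 ->]]]]]; exact: ngon_closed. Qed.

Lemma tile_cover x : exists2 P, T P & P x.
Proof. by have [_ H _ _] := hT; have : setT x by []; rewrite -H => -[P TP Px]; exists P. Qed.

Lemma tile_locally_finite x : exists2 U, nbhs x U & finite_set [set P | T P /\ P `&` U !=set0].
Proof. by have [_ _ H _] := hT; exact: H. Qed.

Lemma tile_meet P Q x : T P -> T Q -> P <> Q -> P x -> Q x ->
  (corner P x /\ corner Q x /\ P `&` Q = [set x]) \/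
  (side P (P `&` Q) /\ side Q (P `&` Q)).
Proof.
move=> TP TQ PQ Px Qx; have [_ _ _ H] := hT; have [e|[v [h1 h2 e]]|h] := H P Q TP TQ PQ.
- have : (P `&` Q) x by []; by rewrite e.
- have : (P `&` Q) x by []; by rewrite e => ->; left.
- by right.
Qed.

(** Distinct tiles with both points [a] and [b] in common would meet exactly in a segment, but they
    overlap strictly to the left of the side. *)
Lemma ccw_tile P Q a b : T P -> T Q -> ccw P a b -> ccw Q a b -> P = Q.
Proof.
move=> TP TQ hP hQ; apply: contrapT => PQ.
have Pa := corner_sub (ccw_corner_l hP); have Qa := corner_sub (ccw_corner_l hQ).
have Pb := corner_sub (ccw_corner_r hP); have Qb := corner_sub (ccw_corner_r hQ).
have [[_ [_ e]]|[sP _]] := tile_meet TP TQ PQ Pa Qa.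
  have : (P `&` Q) b by []; rewrite e => /= ba.
  by apply: (ccw_neq hP).
have [a' [b' [h e]]] := (sideP P _).1 sP.
have ina x : P x -> Q x -> segment a' b' x by move=> Px Qx; rewrite -e.
have [x [Px Qx lx]] := ccw_overlap hP hQ.
have la := segment_left_of (ina _ Pa Qa); have lb := segment_left_of (ina _ Pb Qb).
have ab := ccw_neq hP.
have se : segment a b = segment a' b'.
  case: (corner_endpoint h (ccw_corner_l hP) la) => ea;
    case: (corner_endpoint h (ccw_corner_r hP) lb) => eb; rewrite ea eb //.
  - by case: ab; rewrite ea eb.
  - exact: segmentC.
  - by case: ab; rewrite ea eb.
by move: lx; rewrite (@segment_left_of _ a b) ?ltxx // se; exact: ina.
Qed.

Lemma side_meet P Q a b x : T P -> T Q -> P <> Q -> ccw P a b ->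
  segment a b x -> ~ corner P x -> Q x -> P `&` Q = segment a b /\ (ccw Q b a).
Proof.
move=> TP TQ PQ h sx nc Qx; have Px := ccw_segment h sx.
have [[c _]|[/sideP [a' [b' [h' e]]] sQ]] := tile_meet TP TQ PQ Px Qx; first by [].
have sx' : segment a' b' x by rewrite -e.
have [[ea eb]|//] := side_cross h h' sx sx'.
rewrite -ea -eb in e; split => //; move: sQ; rewrite e => /sideP [a2 [b2 [h2 e2]]].
have [[ea2 eb2]|[ea2 eb2]] := segment_eq (ccw_neq h) e2.
  by case: PQ; apply: (ccw_tile TP TQ h); rewrite ea2 eb2.
by rewrite ea2 eb2.
Qed.

Lemma mid_corner P a b : ccw P a b -> ~ corner P (midpoint a b).
Proof.
move=> h cm; have ab := ccw_neq h.
have := corner_endpoint h cm (segment_left_of (segment_mid a b)).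
have key u v : midpoint u v = u -> u = v.
  by move=> /plane_eqP[]; rewrite !pxy => e1 e2; apply/plane_eqP; split; lra.
have mC : midpoint a b = midpoint b a by rewrite /midpoint addrC.
by case=> [/key //|]; rewrite mC => /key /esym.
Qed.

(** Near any point only finitely many closed tiles matter, by local finiteness. *)
Lemma tiles_closed (D : set (set (plane R))) : D `<=` T -> closed (\bigcup_(P in D) P).
Proof.
move=> DT; rewrite -[X in closed X]setCK; apply: open_closedC.
rewrite openE => x nx; have [U nU fU] := tile_locally_finite x.
pose F := [set Q | T Q /\ Q `&` U !=set0] `&` D.
have cF : closed (\bigcup_(Q in F) Q).
  by apply: closed_bigcup => [|Q [[TQ _] _]]; [exact: finite_setIl|exact: tile_closed].
have nF : nbhs x (~` \bigcup_(Q in F) Q).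
  apply: open_nbhs_nbhs; split; first by rewrite openC.
  by move=> [Q [_ DQ] Qx]; apply: nx; exists Q.
apply: filterS (filterI nU nF) => y [Uy ny] [Q DQ Qy]; apply: ny.
by exists Q => //; split => //; split; [exact: DT|exists y].
Qed.

(** If no other tile contained the midpoint, [P] would be a neighbourhood of it, whereas [P] lies to
    the left of its side. *)
Lemma ccw_across P a b : T P -> ccw P a b -> exists2 Q, T Q & ccw Q b a.
Proof.
move=> TP h; pose m := midpoint a b.
suff [Q [TQ PQ Qm]] : exists Q, [/\ T Q, P <> Q & Q m].
  by exists Q => //; have [] := side_meet TP TQ PQ h (segment_mid a b) (mid_corner h) Qm.
apply: contrapT => no.
have nP : nbhs m P.
  have : nbhs m (~` \bigcup_(Q in T `&` [set Q | Q <> P]) Q).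
    apply: open_nbhs_nbhs; split; first by rewrite openC; apply: tiles_closed => Q [].
    by move=> [Q [TQ QP] Qm]; apply: no; exists Q; split => // /esym.
  apply: filterS => x nx; have [Q TQ Qx] := tile_cover x.
  by have [<- //|QP] := pselect (Q = P); case: nx; exists Q.
have ab := ccw_neq h.
pose f (s : R) := m + s *: quarter (b - a).
have cf : continuous f.
  rewrite (_ : f = fun s => vec2 (px m + s * px (quarter (b - a))) (py m + s * py (quarter (b - a)))); last first.
    by apply/funext => s; apply/plane_eqP; rewrite !pxy.
  by apply: vec2_continuous; apply: contD; [exact: contC|apply: contM; [move=> ?; exact: cvg_id|exact: contC]
    |exact: contC|apply: contM; [move=> ?; exact: cvg_id|exact: contC]].
have f0 : f 0 = m by rewrite /f scale0r addr0.
have : nbhs (0 : R) (f @^-1` P) by apply: (cf 0); rewrite f0.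
move=> /nbhs_ballP[e /= e0 /(_ (- (e / 2)))].
have he : ball (0 : R) e (- (e / 2)).
  by rewrite /ball /= sub0r opprK ger0_norm; lra.
move=> /(_ he) /(ccw_left_ge0 h); rewrite left_of_mid.
have := sq_gt0 ab; set q := _ + _ => q0; have : 0 < e / 2 * q by rewrite mulr_gt0 //; lra.
lra.
Qed.

Lemma ccw_within P Q a b : T P -> T Q -> ccw Q a b -> segment a b `<=` P ->
  ccw P a b \/ ccw P b a.
Proof.
move=> TP TQ h s; have [->|PQ] := pselect (P = Q); first by left.
right; have Pm := s _ (segment_mid a b).
by have [] := side_meet TQ TP (fun E => PQ (esym E)) h (segment_mid a b) (mid_corner h) Pm.
Qed.

Lemma vertex_corner P v : vertices M v -> T P -> P v -> corner P v.
Proof.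
move=> [Q TQ cQ] TP Pv; have [->//|PQ] := pselect (P = Q).
have [[]//|[/sideP[a [b [h e]]] /sideP[a' [b' [h' e']]]]] := tile_meet TP TQ PQ Pv (corner_sub cQ).
have sv : segment a' b' v by rewrite -e'; split => //; exact: corner_sub.
have ss : segment a b = segment a' b' by rewrite -e -e'.
have vab : v = a \/ v = b.
  have [[-> ->]|[-> ->]] := segment_eq (ccw_neq h) ss; first exact: (corner_endpoint h' cQ (segment_left_of sv)).
  by case: (corner_endpoint h' cQ (segment_left_of sv)); [right|left].
by case: vab => ->; [exact: ccw_corner_l h|exact: ccw_corner_r h].
Qed.

Lemma vertex_endpoint P a b v : vertices M v -> T P -> ccw P a b -> segment a b v -> v = a \/ v = b.
Proof.
move=> vv TP h sv; have Pv := ccw_segment h sv.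
exact: corner_endpoint h (vertex_corner vv TP Pv) (segment_left_of sv).
Qed.

Lemma ccw_vertex_l P a b : T P -> ccw P a b -> vertices M a.
Proof. by move=> TP h; exists P => //; exact: ccw_corner_l h. Qed.

Lemma ccw_vertex_r P a b : T P -> ccw P a b -> vertices M b.
Proof. by move=> TP h; exists P => //; exact: ccw_corner_r h. Qed.

(** A point that is not a corner lies inside a side, and across a side there is a single tile. *)
Lemma three_tiles P1 P2 P3 x : T P1 -> T P2 -> T P3 -> P1 <> P2 -> P1 <> P3 -> P2 <> P3 ->
  P1 x -> P2 x -> P3 x -> vertices M x.
Proof.
move=> T1 T2 T3 n12 n13 n23 x1 x2 x3.
have [c|nc] := pselect (corner P1 x); first by exists P1.
have [[c _]|[/sideP[a [b [h e]]] _]] := tile_meet T1 T2 n12 x1 x2; first by exists P1.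
have sx : segment a b x by rewrite -e.
have [_ h2] := side_meet T1 T2 n12 h sx nc x2.
have [_ h3] := side_meet T1 T3 n13 h sx nc x3.
by case: n23; exact: ccw_tile T2 T3 h2 h3.
Qed.

Lemma three_share P1 P2 P3 e : T P1 -> T P2 -> T P3 -> P1 <> P2 -> P1 <> P3 -> P2 <> P3 ->
  side P1 e -> side P2 e -> side P3 e -> False.
Proof.
move=> T1 T2 T3 n12 n13 n23 /sideP[a [b [h ->]]].
have key Q : T Q -> P1 <> Q -> side Q (segment a b) -> ccw Q b a.
  move=> TQ nQ /sideP[a' [b' [h' e']]].
  have s : segment a b `<=` Q by rewrite e'; exact: ccw_segment.
  by case: (ccw_within TQ T1 h s) => // hQ; case: nQ; exact: ccw_tile T1 TQ h hQ.
move=> s2 s3; apply: n23.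
exact: ccw_tile T2 T3 (key _ T2 n12 s2) (key _ T3 n13 s3).
Qed.

End Tessellation.

(** * Flags of a tiling and rotations about its cells *)

Section TilingFlags.
Variables (R : realType) (T : set (set (plane R))).
Hypothesis hT : tessellation T.
Local Notation M := (tiling_map T).
Implicit Types (P Q e : set (plane R)) (a b x v : plane R) (Phi Psi : flags M) (sg : bool).

(* A flag is a side [a -> b] of a tile [P] directed counterclockwise, together
   with the choice of its initial ([sg = true]) or terminal vertex. *)
Definition flag_data sg a b P : plane R * set (plane R) * set (plane R) :=
  ((if sg then a else b), segment a b, P).

Lemma flag_dataP sg a b P : T P -> ccw P a b -> flags M (flag_data sg a b P).
Proof.
move=> TP h; split => /=.
- by case: sg; [exact: ccw_vertex_l TP h|exact: ccw_vertex_r TP h].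
- by exists P => //; apply/sideP; exists a, b.
- by [].
- by case: sg; [exact: segment_l|exact: segment_r].
- exact: ccw_segment.
Qed.

Definition mkflag sg a b P (TP : T P) (h : ccw P a b) : flags M :=
  SigSub (mem_set (flag_dataP sg TP h)).

Definition is_flag Phi sg a b P := [/\ T P, ccw P a b & \val Phi = flag_data sg a b P].

Lemma mkflagP sg a b P (TP : T P) (h : ccw P a b) : is_flag (mkflag sg TP h) sg a b P.
Proof. by split. Qed.

Lemma flagP Phi : exists sg a b P, is_flag Phi sg a b P.
Proof.
have [] := set_valP Phi; rewrite /is_flag; case: (\val Phi) => -[v e] F /= vv [Q TQ /sideP[a [b [h eE]]]] TF ev eF.
rewrite eE in ev eF *.
case: (vertex_endpoint hT vv TQ h ev) => ->; case: (ccw_within hT TF TQ h eF) => hF.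
- by exists true, a, b, F; split.
- by exists false, b, a, F; split => //; rewrite /flag_data segmentC.
- by exists false, a, b, F; split.
- by exists true, b, a, F; split => //; rewrite /flag_data segmentC.
Qed.

Lemma is_flag_inj Phi sg a b P sg' a' b' P' : is_flag Phi sg a b P -> is_flag Phi sg' a' b' P' ->
  [/\ sg = sg', a = a', b = b' & P = P'].
Proof.
move=> [TP h e] [TP' h']; rewrite e => -[e1 e2 e3]; subst P'.
have ab := ccw_neq h; have [[ea eb]|[ea eb]] := segment_eq ab e2.
  subst a' b'; split => //; clear e; by case: sg sg' e1 => -[] //= e1; case: ab; rewrite e1.
by exfalso; apply: (ccw_asym h); rewrite ea eb.
Qed.

Lemma is_flag_eq Phi Psi sg a b P : is_flag Phi sg a b P -> is_flag Psi sg a b P -> Phi = Psi.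
Proof. by move=> [_ _ e] [_ _ e']; apply: val_inj; rewrite e e'. Qed.

Definition flag_step (i : nat) (sg : bool) a b P (sg' : bool) a' b' P' : Prop :=
  sg' = ~~ sg /\ match i with
  | 0 => [/\ a' = a, b' = b & P' = P]
  | 1 => P' = P /\ if sg then b' = a else a' = b
  | _ => a' = b /\ b' = a
  end.

(** Adjacency is stated by equalities of point sets; here it becomes a rule for directed sides, from
    which the swaps can be computed. *)
Lemma adjacentE (i : 'I_3) Phi Psi sg a b P sg' a' b' P' :
  is_flag Phi sg a b P -> is_flag Psi sg' a' b' P' ->
  flag_adjacent i Phi Psi <-> flag_step i sg a b P sg' a' b' P'.
Proof.
move=> [TP h eP] [TP' h' eP'].
have ab := ccw_neq h; have ab' := ccw_neq h'.
have -> : flag_adjacent i Phi Psi <->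
    [/\ (if sg' then a' else b') = (if sg then a else b) <-> i <> 0%N :> nat,
        segment a' b' = segment a b <-> i <> 1%N :> nat & P' = P <-> i <> 2%N :> nat].
  by rewrite /flag_adjacent eP eP'.
rewrite /flag_step; clear eP eP'; case: i => [[|[|[|//]]] hi] /=.
- split=> [[[v0 _] [_ e1] [_ f1]]|[-> [-> -> ->]]].
    have eE : segment a' b' = segment a b by exact: e1.
    have fE : P' = P by exact: f1.
    have {}v0 : (if sg' then a' else b') <> (if sg then a else b) by move=> /v0.
    subst P'; have [[ea eb]|[ea eb]] := segment_eq ab' eE.
      by subst a' b'; split => //; case: sg sg' v0 => -[].
    by exfalso; apply: (ccw_asym h); rewrite -ea -eb.
  split; [split=> [e|]|by []|by []]; last by [].
  by case: ab; case: (sg) e.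
- split=> [[[_ v1] [e0 _] [_ f1]]|[sE [PE vE]]].
    have vE : (if sg' then a' else b') = (if sg then a else b) by exact: v1.
    have fE : P' = P by exact: f1.
    have ne : segment a' b' <> segment a b by move=> /e0.
    clear v1 e0 f1.
    subst P'; case: sg sg' vE => -[] /= vE; try (split; [by []|by split]).
      by case: ne; rewrite vE in h' *; rewrite (ccw_fun h' h).
    by case: ne; rewrite vE in h' *; rewrite (ccw_inj h' h).
  subst sg' P'; split; [split=> [//|_]|split=> // e|by []].
    by case: (sg) vE.
  have [[ea eb]|[ea eb]] := segment_eq ab' e; subst; case: (sg) vE => vE; subst;
    by [case: ab|case: ab'|case: (ccw_asym h)].
- split=> [[[_ v1] [_ e1] [f0 _]]|[-> [ea eb]]].
    have vE : (if sg' then a' else b') = (if sg then a else b) by exact: v1.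
    have eE : segment a' b' = segment a b by exact: e1.
    have {}f0 : P' <> P by move=> /f0.
    have [[ea eb]|[ea eb]] := segment_eq ab' eE.
      by subst a' b'; case: f0; exact: (ccw_tile hT TP' TP h' h).
    by subst a' b'; split => //; clear v1; case: sg sg' vE => -[] //= vE; case: ab; rewrite vE.
  subst a' b'; split; [by split=> // _; case: (sg)|by split=> // _; rewrite segmentC|].
  split=> // e; by case: (ccw_asym h); rewrite -e.
Qed.

Lemma flag_swap_eq (i : 'I_3) Phi Psi sg a b P sg' a' b' P' :
  is_flag Phi sg a b P -> is_flag Psi sg' a' b' P' ->
  flag_step i sg a b P sg' a' b' P' -> flag_swap i Phi = Psi.
Proof.
move=> hPhi hPsi /(adjacentE _ hPhi hPsi) hs; rewrite /flag_swap.
case: xgetP => [X _ hX|/(_ Psi) //]; have [sg2 [a2 [b2 [P2 h2]]]] := flagP X.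
move: hs hX => /(adjacentE _ hPhi hPsi) hs /(adjacentE _ hPhi h2) hX.
suff [e1 e2 e3 e4] : [/\ sg2 = sg', a2 = a', b2 = b' & P2 = P'].
  by subst; exact: is_flag_eq h2 hPsi.
have [T' h' _] := hPsi; have [T2 c2 _] := h2.
case: hs hX => -> + [->]; case: (i : nat) => [[-> -> ->] [-> -> ->] //|[|_]].
  move=> [e1 e2] [e3 e4]; subst P' P2; case: (sg) e2 e4 => e2 e4; subst; split => //.
    exact: ccw_inj c2 h'.
  exact: ccw_fun c2 h'.
move=> [e1 e2] [e3 e4]; subst; split => //; exact: (ccw_tile hT T2 T' c2 h').
Qed.

Lemma swap0P (i : 'I_3) Phi sg a b P : i = 0%N :> nat ->
  is_flag Phi sg a b P -> is_flag (flag_swap i Phi) (~~ sg) a b P.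
Proof.
move=> i0 h; have [TP c _] := h; have h' := mkflagP (~~ sg) TP c.
by rewrite (flag_swap_eq h h') // /flag_step i0.
Qed.

Lemma swap1P_true (i : 'I_3) Phi a b c P : i = 1%N :> nat -> ccw P c a ->
  is_flag Phi true a b P -> is_flag (flag_swap i Phi) false c a P.
Proof.
move=> i1 ca h; have [TP _ _] := h; have h' := mkflagP false TP ca.
by rewrite (flag_swap_eq h h') // /flag_step i1.
Qed.

Lemma swap1P_false (i : 'I_3) Phi a b c P : i = 1%N :> nat -> ccw P b c ->
  is_flag Phi false a b P -> is_flag (flag_swap i Phi) true b c P.
Proof.
move=> i1 bc h; have [TP _ _] := h; have h' := mkflagP true TP bc.
by rewrite (flag_swap_eq h h') // /flag_step i1.
Qed.

Lemma swap2P (i : 'I_3) Phi sg a b P Q : i = 2%N :> nat -> T Q -> ccw Q b a ->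
  is_flag Phi sg a b P -> is_flag (flag_swap i Phi) (~~ sg) b a Q.
Proof.
move=> i2 TQ ba h; have h' := mkflagP (~~ sg) TQ ba.
by rewrite (flag_swap_eq h h') // /flag_step i2.
Qed.

Lemma flag_swapP (i : 'I_3) Phi sg a b P : is_flag Phi sg a b P ->
  exists a' b' P', is_flag (flag_swap i Phi) (~~ sg) a' b' P' /\
    flag_step i sg a b P (~~ sg) a' b' P'.
Proof.
move=> h; have [TP c _] := h; case: (i) (erefl (i : nat)) => -[|[|[|//]]] hi iE.
- by exists a, b, P; split; [exact: swap0P|].
- case: sg h => h.
    have [d hd] := ccw_prev c; exists d, a, P; split; last by [].
    exact: swap1P_true hd h.
  have [d hd] := ccw_next c; exists b, d, P; split; last by [].
  exact: swap1P_false hd h.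
- have [Q TQ hQ] := ccw_across hT TP c; exists b, a, Q; split; last by [].
  exact: (swap2P _ TQ hQ h).
Qed.

Lemma flag_swapK (i : 'I_3) : involutive (@flag_swap _ M i).
Proof.
move=> Phi; have [sg [a [b [P h]]]] := flagP Phi.
have [a' [b' [P' [h' s]]]] := flag_swapP i h.
apply: (flag_swap_eq h' h); move: s => [_]; rewrite /flag_step negbK.
case: (i : nat) => [[-> -> ->]|[[-> e]|_ [-> ->]]] //.
by split => //; case: (sg) e.
Qed.

Lemma flag_adjacent_swap (i : 'I_3) Phi : flag_adjacent i Phi (flag_swap i Phi).
Proof.
have [sg [a [b [P h]]]] := flagP Phi; have [a' [b' [P' [h' s]]]] := flag_swapP i h.
exact/(adjacentE i h h').
Qed.

Lemma flag_swap_unique (i : 'I_3) Phi Psi : flag_adjacent i Phi Psi -> flag_swap i Phi = Psi.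
Proof.
have [sg [a [b [P h]]]] := flagP Phi; have [sg' [a' [b' [P' h']]]] := flagP Psi.
by move=> /(adjacentE i h h'); exact: flag_swap_eq.
Qed.

(** The orientation of the flag in the plane; every swap reverses it. *)
Definition flag_sign Phi : bool := `[< exists a b P, is_flag Phi true a b P >].

Lemma flag_signE Phi sg a b P : is_flag Phi sg a b P -> flag_sign Phi = sg.
Proof.
move=> h; apply/idP/idP => [/asboolP[a' [b' [P' h']]]|sE].
  by have [] := is_flag_inj h h'.
by apply/asboolP; exists a, b, P; move: h; rewrite sE.
Qed.

Lemma flag_sign_swap (i : 'I_3) Phi : flag_sign (flag_swap i Phi) = ~~ flag_sign Phi.
Proof.
have [sg [a [b [P h]]]] := flagP Phi; have [a' [b' [P' [h' _]]]] := flag_swapP i h.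
by rewrite (flag_signE h) (flag_signE h').
Qed.

Lemma flag_face Phi sg a b P : is_flag Phi sg a b P -> (\val Phi).2 = P.
Proof. by move=> [_ _ ->]. Qed.

Definition rotate (i : 'I_3) Phi : flags M := flag_swap (side2 i) (flag_swap (side1 i) Phi).

(** Conjugation by [A] turns [B] after [A] into its inverse, so a power fixes [A x] exactly when it
    fixes [x]. It lets orders be computed at one of two adjacent flags. *)
Lemma iter_conj (X : Type) (A B : X -> X) m (x : X) : involutive A -> involutive B ->
  iter m (fun y => B (A y)) (A x) = A x <-> iter m (fun y => B (A y)) x = x.
Proof.
move=> AK BK.
have e1 n y : iter n (fun y => B (A y)) (A y) = A (iter n (fun y => A (B y)) y).
  by elim: n => //= n ->; rewrite AK.
have e2 n y : iter n (fun y => A (B y)) (iter n (fun y => B (A y)) y) = y.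
  by elim: n y => // n IH y; rewrite iterSr [X in A (B X)]iterS BK AK.
have e3 n y : iter n (fun y => B (A y)) (iter n (fun y => A (B y)) y) = y.
  by elim: n y => // n IH y; rewrite iterSr [X in B (A X)]iterS AK BK.
rewrite e1; split=> [/(can_inj AK) h|h]; first by rewrite -{1}h e3.
by rewrite -[in LHS]h e2.
Qed.

Lemma rotate_swap (i : 'I_3) m Phi :
  iter m (rotate i) (flag_swap (side1 i) Phi) = flag_swap (side1 i) Phi <-> iter m (rotate i) Phi = Phi.
Proof. by apply: iter_conj; exact: flag_swapK. Qed.

Lemma face_order (i : 'I_3) Phi n m : i = 2%N :> nat -> regular_polygon n (\val Phi).2 ->
  iter m (rotate i) Phi = Phi <-> (n %| m)%N.
Proof.
move=> i2; have s1 : side1 i = 0%N :> nat by rewrite (_ : i = ord_max) //; exact: val_inj.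
have s2 : side2 i = 1%N :> nat by rewrite (_ : i = ord_max) //; exact: val_inj.
have main Psi a b P : is_flag Psi true a b P -> regular_polygon n P ->
    iter m (rotate i) Psi = Psi <-> (n %| m)%N.
  move=> h [c [s [t [n3 s0 PE]]]]; have [TP hc _] := h; rewrite PE in hc h.
  have [k [ea eb]] := (ccw_rep c t n3 s0 a b).1 hc; pose z := ngon_corner n c s t.
  have it j : is_flag (iter j (rotate i) Psi) true (z (k + j)%N) (z (k + j).+1) (ngon n c s t).
    elim: j => [|j IH]; first by rewrite addn0 /z -ea -eb.
    rewrite /= addnS /rotate; apply: (swap1P_false s2 _ (swap0P s1 IH)).
    by apply/(ccw_rep _ _ n3 s0); exists (k + j).+1.
  have modP : z (k + m)%N = z k <-> (n %| m)%N.
    split=> [|/dvdnP[q ->]]; last by rewrite /z corner_per.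
    rewrite /z -(corner_mod c t n3 s0 k) -(corner_mod c t n3 s0 (k + m)) => /(corner_inj s0).
    rewrite !ltn_mod => /(_ _ _) h'; have : (k + m = k %[mod n])%N by apply: h'; lia.
    by rewrite -{2}(addn0 k) => /eqP; rewrite eqn_modDl mod0n.
  rewrite -modP; split=> [e|e].
    by have := it m; rewrite e => /is_flag_inj /(_ h) [_ -> _ _]; exact: ea.
  apply: (is_flag_eq (it m)); rewrite e /z.
  have := corner_eq_add 1 e; rewrite !addn1 => ->; move: h; by rewrite ea eb.
move=> reg; have [[] [a [b [P h]]]] := flagP Phi; rewrite (flag_face h) in reg.
  exact: main h reg.
by rewrite -rotate_swap; apply: main reg; exact: swap0P s1 h.
Qed.

Lemma edge_order (i : 'I_3) Phi m : i = 1%N :> nat -> iter m (rotate i) Phi = Phi <-> (2 %| m)%N.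
Proof.
move=> i1; have s1 : side1 i = 2%N :> nat.
  by rewrite (_ : i = Ordinal (isT : (1 < 3)%N)) //; exact: val_inj.
have s2 : side2 i = 0%N :> nat.
  by rewrite (_ : i = Ordinal (isT : (1 < 3)%N)) //; exact: val_inj.
have step Psi sg a b P : is_flag Psi sg a b P -> exists Q, is_flag (rotate i Psi) sg b a Q.
  move=> h; have [TP hc _] := h; have [Q TQ hQ] := ccw_across hT TP hc; exists Q.
  by rewrite -{1}(negbK sg); apply: swap0P => //; exact: (swap2P s1 TQ hQ h).
have two Psi : rotate i (rotate i Psi) = Psi.
  have [sg [a [b [P h]]]] := flagP Psi; have [Q hQ] := step _ _ _ _ _ h.
  have [P' hP] := step _ _ _ _ _ hQ; have [TP' c' _] := hP; have [TP c _] := h.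
  by rewrite (ccw_tile hT TP' TP c' c) in hP; exact: is_flag_eq hP h.
have even : iter m (rotate i) Phi = if odd m then rotate i Phi else Phi.
  by elim: m => //= m ->; case: odd.
rewrite even dvdn2; case: odd => //=; split => // e.
have [sg [a [b [P h]]]] := flagP Phi; have [Q hQ] := step _ _ _ _ _ h.
rewrite e in hQ; have [_ _ ab _] := is_flag_inj h hQ.
by have [_ c _] := h; case: (ccw_neq c).
Qed.

Section VertexCycle.
Variables (v : plane R) (s : seq nat).
Hypotheses (vv : vertices M v) (vs : vertex_symbol T v s) (s3 : (3 <= size s)%N).

Lemma iter_ordS n (j : 'I_n) m : val (iter m (@ordS n) j) = ((j + m) %% n)%N.
Proof.
elim: m => [|m IH]; first by rewrite addn0 modn_small.
by rewrite iterS /= IH -addn1 modnDml addn1 addnS.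
Qed.

Lemma iter_ordS_fixed n (j : 'I_n) m : iter m (@ordS n) j = j <-> (n %| m)%N.
Proof.
have h : iter m (@ordS n) j = j <-> ((j + m) %% n = j)%N.
  by rewrite -iter_ordS; split=> [->//|e]; exact: val_inj.
rewrite h; split=> [e|/dvdnP[q ->]]; last by rewrite addnC modnMDl modn_small.
have : (j + m = j + 0 %[mod n])%N by rewrite e addn0 modn_small.
by move=> /eqP; rewrite eqn_modDl mod0n.
Qed.

(** The cyclic order of the vertex symbol is the rotation about [v]: flag [j] pairs tile [j] with
    the edge shared with its predecessor. *)
Lemma vertex_cycle (i : 'I_3) : i = 0%N :> nat -> exists (P : 'I_(size s) -> set (plane R))
    (F : 'I_(size s) -> flags M),
  [/\ forall j, T (P j) /\ regular_polygon (nth 0%N s j) (P j),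
      forall Q, T Q -> Q v -> exists j, Q = P j,
      forall j, (\val (F j)).2 = P j,
      injective F /\ forall j, rotate i (F j) = F (ordS j)
    & forall Phi, (\val Phi).1.1 = v -> exists j, Phi = F j \/ Phi = flag_swap (side1 i) (F j)].
Proof.
move=> i0; have s1 : side1 i = 1%N :> nat by rewrite (_ : i = ord0) //; exact: val_inj.
have s2 : side2 i = 2%N :> nat by rewrite (_ : i = ord0) //; exact: val_inj.
have [P [Pinj Prange Preg Pe]] := vs.
have TPv j : T (P j) /\ P j v.
  by have : range P (P j) by []; rewrite Prange.
have [e He] := choice Pe.
have size0 : (0 < size s)%N by lia.
have ne1 (j : 'I_(size s)) : ordS j <> j.
  by move=> h; have := (iter_ordS_fixed j 1).1 h; rewrite dvdn1; lia.
have ne2 (j : 'I_(size s)) : ordS (ordS j) <> j.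
  by move=> h; have := (iter_ordS_fixed j 2).1 h => /dvdn_leq; lia.
(* Otherwise three consecutive tiles, distinct because there are at least three of them, would share
   one side. *)
have eS j : e (ordS j) <> e j.
  move=> h; have [h1 h2 _] := He j; have [h3 h4 _] := He (ordS j); rewrite h in h3 h4.
  apply: (three_share hT (TPv j).1 (TPv (ordS j)).1 (TPv (ordS (ordS j))).1 _ _ _ h1 h2 h4).
  - by move=> /Pinj /esym; exact: ne1.
  - by move=> /Pinj /esym; exact: ne2.
  - by move=> /Pinj /esym; exact: ne1.
have flF j : flags M (v, e (ord_pred j), P j).
  have [h1 h2 h3] := He (ord_pred j); rewrite ord_predK in h2.
  split=> //=; first by exists (P (ord_pred j)); [exact: (TPv _).1|].
    exact: (TPv j).1.
  by move: h2 => /sideP[a [b [hc ->]]]; exact: ccw_segment.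
pose F j : flags M := SigSub (mem_set (flF j)).
have flG j : flags M (v, e j, P j).
  have [h1 h2 h3] := He j.
  split=> //=; first by exists (P j); [exact: (TPv _).1|].
    exact: (TPv j).1.
  by move: h1 => /sideP[a [b [hc ->]]]; exact: ccw_segment.
pose G j : flags M := SigSub (mem_set (flG j)).
have FG j : flag_swap (side1 i) (F j) = G j.
  apply: flag_swap_unique; rewrite /flag_adjacent s1 /=; split => //.
  by split=> // h; case: (eS (ord_pred j)); rewrite ord_predK.
have GF j : flag_swap (side2 i) (G j) = F (ordS j).
  apply: flag_swap_unique; rewrite /flag_adjacent s2 /= ordSK; split => //.
  by split=> // /Pinj; move=> h; case: (ne1 j).
exists P, F; split.
- by move=> j; split; [exact: (TPv j).1|exact: Preg].
- move=> Q TQ Qv; have : [set Q | T Q /\ Q v] Q by []; rewrite -Prange => -[j _ <-].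
  by exists j.
- by [].
- split; last by move=> j; rewrite /rotate FG GF.
  by move=> j k /(congr1 (fun Phi : flags M => (\val Phi).2)) /Pinj.
- move=> Phi; have [] := set_valP Phi; case E : (\val Phi) => [[w d] Q] /= _ _ TQ dw dQ wv.
  rewrite wv in dw E; have : [set Q | T Q /\ Q v] Q by split => //; exact: dQ.
  rewrite -Prange => -[j _ Qj]; exists j.
  have [de|dn] := pselect (d = e (ord_pred j)); [left|right].
    by apply: val_inj; rewrite E de -Qj.
  apply/esym; apply: flag_swap_unique; rewrite /flag_adjacent E s1 /= -Qj; split => //.
Qed.

Lemma vertex_order (i : 'I_3) Phi m : i = 0%N :> nat -> (\val Phi).1.1 = v ->
  iter m (rotate i) Phi = Phi <-> (size s %| m)%N.
Proof.
move=> i0 hv; have [P [F [_ _ _ [Finj rF] cov]]] := vertex_cycle i0.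
have it j k : iter k (rotate i) (F j) = F (iter k (@ordS _) j) by elim: k => //= k ->.
have main j : iter m (rotate i) (F j) = F j <-> (size s %| m)%N.
  by rewrite it -(iter_ordS_fixed j); split=> [/Finj|->].
by have [j [->|->]] := cov _ hv; rewrite ?rotate_swap; exact: main.
Qed.

End VertexCycle.

End TilingFlags.

Lemma lcm_seq_dvd (s : seq nat) m :
  (\big[lcmn/1]_(n <- s) n %| m)%N = all (fun n => n %| m)%N s.
Proof. by elim: s => [|n s IH]; rewrite ?big_nil ?dvd1n // big_cons dvdn_lcm IH. Qed.

(** * Monodromy group of a tiling as a flag graph *)

Section UniformTiling.
Variables (R : realType) (T : set (set (plane R))) (s : seq nat).
Hypotheses (hT : tessellation T) (s3 : (3 <= size s)%N).
Hypothesis hTs : forall v, vertices (tiling_map T) v -> vertex_symbol T v s.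
Local Notation M := (tiling_map T).
Local Notation G := (Mon M).
Implicit Types (P Q e : set (plane R)) (a b x v : plane R) (Phi Psi : flags M) (sg : bool).
Implicit Types (g h : G) (i l : 'I_3) (w : seq 'I_3).

Definition swaps w Phi : flags M := foldr (fun l X => flag_swap l X) Phi w.

Lemma swaps_rev w Phi : swaps (rev w) (swaps w Phi) = Phi.
Proof.
elim: w => //= l w IH; rewrite rev_cons -cats1 /swaps foldr_cat /= flag_swapK //; exact: IH.
Qed.

Lemma swaps_cat w w' Phi : swaps (w ++ w') Phi = swaps w (swaps w' Phi).
Proof. by rewrite /swaps foldr_cat. Qed.

Definition linked Phi Psi := exists w, swaps w Phi = Psi.

Lemma linked_refl Phi : linked Phi Phi. Proof. by exists [::]. Qed.

Lemma linked_swap i Phi : linked Phi (flag_swap i Phi). Proof. by exists [:: i]. Qed.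

Lemma linked_trans Phi Psi X : linked Phi Psi -> linked Psi X -> linked Phi X.
Proof. by move=> [w <-] [w' <-]; exists (w' ++ w); rewrite swaps_cat. Qed.

Lemma linked_sym Phi Psi : linked Phi Psi -> linked Psi Phi.
Proof. by move=> [w <-]; exists (rev w); exact: swaps_rev. Qed.

Lemma linked_rotate i m Phi : linked Phi (iter m (rotate i) Phi).
Proof.
elim: m => [|m IH]; first exact: linked_refl.
by apply: linked_trans IH _; exists [:: side2 i; side1 i].
Qed.

Let i0 : 'I_3 := ord0.
Let i2 : 'I_3 := ord_max.

Lemma plane_connected : connected [set: plane R].
Proof.
suff H x : connected_component [set: plane R] (0 : plane R) x.
  rewrite (_ : [set: plane R] = connected_component [set: plane R] (0 : plane R)); first exact: component_connected.
  by apply/seteqP; split => x _ //; exact: H.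
pose f (t : R) : plane R := t *: x.
exists (f @` `[0, 1]).
  split; [by exists 0; rewrite /f ?scale0r //= in_itv /= lexx ler01|by []|].
  apply: connected_continuous_connected; first exact: segment_connected.
  apply: continuous_subspaceT.
  rewrite (_ : f = fun t => vec2 (t * px x) (t * py x)); last first.
    by apply/funext => t; apply/plane_eqP; rewrite !pxy.
  by apply: vec2_continuous; apply: contM; [move=> ?; exact: cvg_id|exact: contC
    |move=> ?; exact: cvg_id|exact: contC].
by exists 1; rewrite /f ?scale1r //= in_itv /= lexx ler01.
Qed.

Lemma face_flags n P a b a' b' Phi Psi : regular_polygon n P ->
  is_flag Phi true a b P -> is_flag Psi true a' b' P ->
  exists2 m, (m < n)%N & Psi = iter m (rotate i2) Phi.
Proof.
move=> [d [t [u [n3 t0 ->]]]] h h'; have [TP c _] := h; have [_ c' _] := h'.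
have [k [ea eb]] := (ccw_rep d u n3 t0 a b).1 c.
have [k' [ea' eb']] := (ccw_rep d u n3 t0 a' b').1 c'.
pose z := ngon_corner n d t u.
have it j : is_flag (iter j (rotate i2) Phi) true (z (k + j)%N) (z (k + j).+1) (ngon n d t u).
  elim: j => [|j IH]; first by rewrite addn0 /z -ea -eb.
  rewrite /= addnS /rotate; apply: (swap1P_false hT _ _ (swap0P hT _ IH)) => //.
  by apply/(ccw_rep _ _ n3 t0); exists (k + j).+1.
have [m mn zm] := corner_relative d u n3 t0 k k'; exists m => //.
apply: is_flag_eq h' _; have := it m; rewrite /z -zm.
by have := corner_eq_add 1 zm; rewrite !addn1 => <-; rewrite ea' eb'.
Qed.

Lemma positive_flag Phi : exists Psi a b,
  [/\ (Psi = Phi \/ Phi = flag_swap i0 Psi), linked Phi Psi & is_flag Psi true a b (\val Phi).2].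
Proof.
have [sg [a [b [P h]]]] := flagP hT Phi; rewrite (flag_face h).
case: sg h => h.
  by exists Phi, a, b; split; [left|exact: linked_refl|].
exists (flag_swap i0 Phi), a, b; split; [by right; rewrite flag_swapK|exact: linked_swap|].
exact: (swap0P hT (erefl : i0 = 0%N :> nat) h).
Qed.

Lemma linked_face Phi Psi : (\val Phi).2 = (\val Psi).2 -> linked Phi Psi.
Proof.
move=> e; have [Y [a [b [_ lY hY]]]] := positive_flag Phi.
have [Y' [a' [b' [_ lY' hY']]]] := positive_flag Psi; rewrite -e in hY'.
have [_ _ TF _ _] := set_valP Phi; have [n reg] := tile_regular hT TF.
have [m _ Y'E] := face_flags reg hY hY'.
apply: linked_trans lY _; apply: linked_trans (linked_sym lY').
by rewrite Y'E; exact: linked_rotate.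
Qed.

Lemma linked_vertex Phi Psi : (\val Phi).1.1 = (\val Psi).1.1 -> linked Phi Psi.
Proof.
move=> e; have [vv _ _ _ _] := set_valP Phi.
have [P [F [_ _ _ [_ rF] cov]]] := vertex_cycle hT vv (hTs vv) s3 (erefl : i0 = 0%N :> nat).
have FF j k : linked (F j) (F k).
  have [m ->] : exists m, k = iter m (@ordS _) j.
    (* The difference of [k] and [j] modulo [size s], kept nonnegative. *)
    exists (k + (size s - j))%N; apply: val_inj; rewrite iter_ordS.
    rewrite addnCA subnKC; last exact: ltnW.
    by rewrite modnDr modn_small.
  elim: m => [|m IH]; first exact: linked_refl.
  by apply: linked_trans IH _; rewrite iterS -rF; exact: (linked_rotate i0 1).
have lF X : (\val X).1.1 = (\val Phi).1.1 -> exists j, linked (F j) X.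
  move=> /cov [j [->|->]]; exists j; [exact: linked_refl|exact: linked_swap].
have [j hj] := lF Phi erefl; have [k hk] := lF Psi (esym e).
by apply: linked_trans (linked_sym hj) _; apply: linked_trans (FF j k) hk.
Qed.

(** Tiles that meet share a vertex or a side, so they carry linked flags. The union of the tiles
    linked to [Phi] and the union of the others are therefore disjoint closed sets covering the
    connected plane. *)
Lemma linked_all Phi Psi : linked Phi Psi.
Proof.
pose O : set (set (plane R)) := [set P | exists2 X, linked Phi X & (\val X).2 = P].
have OT : O `<=` T by move=> P [X _ <-]; have [_ _ TF _ _] := set_valP X.
have meet P Q x : O P -> T Q -> P x -> Q x -> O Q.
  move=> OP TQ Px Qx; have TP := OT P OP.
  have [<- //|PQ] := pselect (P = Q).
  have [X lX XP] := OP.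
  have [[cP [cQ _]]|[/sideP[a [b [h e]]] /sideP[a' [b' [h' e']]]]] := tile_meet hT TP TQ PQ Px Qx.
    have [c hc] := (cornerP _ _).1 cP; have [c' hc'] := (cornerP _ _).1 cQ.
    pose Y := mkflag true TP hc; pose Z := mkflag true TQ hc'.
    exists Z => //; apply: linked_trans lX _; apply: (linked_trans (Psi := Y)).
      by apply: linked_face; rewrite XP.
    exact: linked_vertex.
  have hba : ccw Q b a.
    have ss : segment a b `<=` Q by rewrite -e => y [].
    by case: (ccw_within hT TQ TP h ss) => // hQ; case: PQ; exact: (ccw_tile hT TP TQ h hQ).
  pose Y := mkflag true TP h; have hY := mkflagP true TP h.
  exists (flag_swap i2 Y); last by have [_ _ ->] := swap2P hT (erefl : i2 = 2%N :> nat) TQ hba hY.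
  apply: linked_trans lX _; apply: linked_trans (linked_swap i2 Y).
  by apply: linked_face; rewrite XP.
pose A := \bigcup_(P in O) P; pose B := \bigcup_(P in T `\` O) P.
have cA : closed A by exact: (tiles_closed hT OT).
have cB : closed B by apply: (tiles_closed hT) => P [].
have AB : A = ~` B.
  apply/seteqP; split => x.
    by move=> [P OP Px] [Q [TQ nQ] Qx]; apply: nQ; exact: meet OP TQ Px Qx.
  move=> nB; have [P TP Px] := tile_cover hT x; exists P => //.
  by apply: contrapT => nO; apply: nB; exists P.
have AT : A = setT.
  apply: plane_connected.
  - have [_ _ TF _ _] := set_valP Phi; have [a [b h]] := tile_ccw hT TF.
    exists a, (\val Phi).2; first by exists Phi => //; exact: linked_refl.
    exact: corner_sub (ccw_corner_l h).
  - by exists (~` B); [rewrite openC|rewrite setTI].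
  - by exists A; rewrite ?setTI.
have [_ _ TF _ _] := set_valP Psi; have [a [b h]] := tile_ccw hT TF.
have Pa := corner_sub (ccw_corner_l h).
have [P OP Px] : A a by rewrite AT.
have [X lX XP] := meet _ _ _ OP TF Px Pa.
by apply: linked_trans lX _; exact: linked_face.
Qed.

Lemma Mon_swaps w : Mon M (swaps w).
Proof.
move=> A [[A1 Ac _] Ar]; elim: w => [//|l w IH].
by apply: (Ac _ _ IH); apply: Ar; exists l.
Qed.

(** Words of swaps already form a group, as reversing a word inverts it, and [Mon] is the smallest
    one. *)
Lemma Mon_word g : exists w, \val g = swaps w.
Proof.
have : Mon M (\val g) by exact: set_valP.
move=> /(_ [set f | exists w, f = swaps w]); apply; split; last first.
  by move=> _ [l _ <-]; exists [:: l]; apply/funext.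
split.
- by exists [::]; apply/funext.
- by move=> _ _ [w ->] [w' ->]; exists (w' ++ w); apply/funext => Phi; rewrite swaps_cat.
- move=> _ [w ->]; exists (swaps (rev w)); first by exists (rev w).
  by split=> Phi; rewrite ?swaps_rev // -{1}(revK w) swaps_rev.
Qed.

Lemma Mon_crossP i g : Mon M (flag_swap i \o \val g).
Proof. by have [w ->] := Mon_word g; exact: (Mon_swaps (i :: w)). Qed.

Definition tiling_cross i g : G := SigSub (mem_set (Mon_crossP i g)).

Lemma tiling_crossE i g : \val (tiling_cross i g) = flag_swap i \o \val g.
Proof. by []. Qed.

Lemma tiling_crossK i : involutive (tiling_cross i).
Proof. by move=> g; apply: val_inj; apply/funext => Phi; rewrite /= flag_swapK. Qed.

Lemma some_flag : exists Phi : flags M, True.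
Proof.
have [P TP _] := tile_cover hT 0; have [a [b h]] := tile_ccw hT TP.
by exists (mkflag true TP h).
Qed.

Definition origin : flags M := projT1 (cid some_flag).

Definition tiling_parity g : bool := flag_sign (\val g origin).

Lemma tiling_parity_cross i g : tiling_parity (tiling_cross i g) = ~~ tiling_parity g.
Proof. by rewrite /tiling_parity /= flag_sign_swap. Qed.

Definition tiling_valence (i : 'I_3) : nat :=
  match val i with 0 => size s | 1 => 2 | _ => \big[lcmn/1]_(n <- s) n end.

Lemma face_size P : T P -> exists2 n, n \in s & regular_polygon n P.
Proof.
move=> TP; have [a [b h]] := tile_ccw hT TP; have va := ccw_vertex_l TP h.
have [F [_ [HF cov _ _ _]]] := vertex_cycle hT va (hTs va) s3 (erefl : i0 = 0%N :> nat).
have [j ->] := cov P TP (corner_sub (ccw_corner_l h)).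
by exists (nth 0%N s j); [exact: mem_nth|exact: (HF j).2].
Qed.

Lemma face_size_all n : n \in s -> exists2 P, T P & regular_polygon n P.
Proof.
move=> /(nthP 0%N) [j js <-].
have [P TP _] := tile_cover hT 0; have [a [b h]] := tile_ccw hT TP.
have va := ccw_vertex_l TP h.
have [F [_ [HF _ _ _ _]]] := vertex_cycle hT va (hTs va) s3 (erefl : i0 = 0%N :> nat).
by exists (F (Ordinal js)); have [] := HF (Ordinal js).
Qed.

(** A relation in the monodromy group has to hold at all flags. Every face size of the symbol
    occurs, hence the least common multiple. *)
Lemma rotate_order i m : (forall Phi, iter m (rotate i) Phi = Phi) <-> (tiling_valence i %| m)%N.
Proof.
rewrite /tiling_valence; case E : (val i) => [|[|k]].
- split=> [H|d Phi].
    have [vv _ _ _ _] := set_valP origin.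
    by apply/(vertex_order hT vv (hTs vv) s3 m E erefl).
  have [vv _ _ _ _] := set_valP Phi.
  by apply/(vertex_order hT vv (hTs vv) s3 m E erefl).
- by split=> [H|d Phi]; [apply/(edge_order hT origin m E)|apply/(edge_order hT Phi m E)].
have i2E : i = 2%N :> nat.
  by move: E (ltn_ord i); rewrite /=; case: (nat_of_ord i) => [|[|[|//]]].
split=> [H|d Phi].
  rewrite lcm_seq_dvd; apply/allP => n ns; have [P TP reg] := face_size_all ns.
  have [a [b h]] := tile_ccw hT TP.
  by apply/(face_order hT (Phi := mkflag true TP h) m i2E reg).
have [_ _ TF _ _] := set_valP Phi; have [n ns reg] := face_size TF.
apply/(face_order hT m i2E reg); move: d; rewrite lcm_seq_dvd => /allP; exact.
Qed.

Lemma walk_val i g n Phi : \val (walk tiling_cross i g n) Phi =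
  let X := iter n./2 (rotate i) (\val g Phi) in if odd n then flag_swap (side1 i) X else X.
Proof.
elim: n => [//|n IH]; rewrite [walk _ _ _ _]/= tiling_crossE /= IH /= /crossing uphalf_half.
by case: odd; rewrite ?add1n ?add0n.
Qed.

Lemma Mon_surj g Phi : exists Psi, \val g Psi = Phi.
Proof. by have [w ->] := Mon_word g; exists (swaps (rev w) Phi); rewrite -{1}(revK w) swaps_rev. Qed.

Lemma tiling_walk_period i g : walk tiling_cross i g (2 * tiling_valence i) = g.
Proof.
apply: val_inj; apply/funext => Phi; rewrite walk_val mul2n odd_double doubleK /=.
by have /rotate_order := dvdnn (tiling_valence i).
Qed.

(** Parity separates even from odd positions; at equal parity two positions differ by a power of the
    rotation, whose order is the valence. *)
Lemma tiling_walk_inj i g n n' : (n < 2 * tiling_valence i)%N -> (n' < 2 * tiling_valence i)%N ->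
  walk tiling_cross i g n = walk tiling_cross i g n' -> n = n'.
Proof.
wlog le : n n' / (n <= n')%N.
  by move=> H h h' e; case: (leqP n n') => [|/ltnW] le; [exact: H|apply/esym; exact: H].
move=> nN nN' e.
have par k : tiling_parity (walk tiling_cross i g k) = tiling_parity g (+) odd k.
  elim: k => [|k IH]; first by rewrite addbF.
  by rewrite [walk _ _ _ _]/= tiling_parity_cross IH /= addbN.
have oo : odd n = odd n' by have := congr1 tiling_parity e; rewrite !par => /addbI.
have half : n./2 = n'./2.
  have hl : (n./2 <= n'./2)%N by exact: half_leq.
  have : (tiling_valence i %| n'./2 - n./2)%N.
    apply/rotate_order => Phi.
    have [Psi <-] : exists Psi, iter n./2 (rotate i) (\val g Psi) = Phi.
      have [X XP] : exists X, iter n./2 (rotate i) X = Phi.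
        elim: n./2 Phi => [|k IH] Phi; first by exists Phi.
        have [X hX] := IH (flag_swap (side1 i) (flag_swap (side2 i) Phi)).
        by exists X; rewrite iterS hX /rotate !flag_swapK.
      by have [Psi hPsi] := Mon_surj g X; exists Psi; rewrite hPsi.
    rewrite -iterD subnK //; have := congr1 (fun h => \val h Psi) e.
    rewrite !walk_val /= oo; case: odd => // /(can_inj (flag_swapK hT _)) -> //.
  move=> /dvdnP[[|q] qE]; first by lia.
  have : (n'./2 < tiling_valence i)%N by have := odd_double_half n'; rewrite -mul2n; lia.
  by move: qE; rewrite mulSn; lia.
by rewrite -(odd_double_half n) oo half odd_double_half.
Qed.

Lemma tiling_reach g h : reach tiling_cross xpredT g h.
Proof.
have base k : reach tiling_cross xpredT (Mon_id M) k.
  have [w kw] := Mon_word k; elim: w k kw => [|l w IH] k kw.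
    by rewrite (_ : k = Mon_id M); [exact: rst_refl|exact: val_inj].
  have h' := IH (SigSub (mem_set (Mon_swaps w))) erefl.
  apply: rst_trans h' _; apply: rst_step; exists l => //.
  by apply: val_inj; rewrite kw.
by apply: (rst_trans _ _ _ (Mon_id M)); [apply: rst_sym|]; exact: base.
Qed.

Lemma face_size_ge3 n : n \in s -> (3 <= n)%N.
Proof. by move=> /face_size_all [P _ [c [t [u [n3 _ _]]]]]. Qed.

Lemma tiling_valence_gt1 i : (1 < tiling_valence i)%N.
Proof.
rewrite /tiling_valence; case: (val i) => [|[|_]] //; first by exact: ltnW.
have pos : (0 < \big[lcmn/1]_(n <- s) n)%N.
  rewrite big_seq; elim/big_rec: _ => // n m /face_size_ge3 n3 m0.
  by rewrite lcmn_gt0 m0 andbT; lia.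
have hs : nth 0%N s 0 \in s by apply: mem_nth; apply: leq_trans s3.
have : (nth 0%N s 0 %| \big[lcmn/1]_(n <- s) n)%N.
  by have := dvdnn (\big[lcmn/1]_(n <- s) n)%N; rewrite {1}lcm_seq_dvd => /allP; apply.
by move=> /(dvdn_leq pos); apply: leq_trans; apply: ltnW; exact: face_size_ge3 hs.
Qed.

Definition tiling_graph : flag_graph M := FlagGraph tiling_crossE tiling_crossK
  tiling_parity_cross tiling_valence_gt1 tiling_walk_period tiling_walk_inj tiling_reach.

Lemma tiling_transitive Phi Psi : exists g, \val g Phi = Psi.
Proof.
have [w e] := linked_all Phi Psi.
by exists (SigSub (mem_set (Mon_swaps w))).
Qed.

End UniformTiling.

(** * Periodicity *)

Section Symmetries.
Variables (R : realType) (T : set (set (plane R))) (s : seq nat).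
Hypotheses (hT : tessellation T) (s3 : (3 <= size s)%N).
Hypothesis hTs : forall v, vertices (tiling_map T) v -> vertex_symbol T v s.
Local Notation M := (tiling_map T).
Implicit Types (P Q e : set (plane R)) (a b x v t u : plane R) (Phi Psi : flags M) (sg : bool).
Implicit Types (i l : 'I_3) (w : seq 'I_3).

Lemma image_eq (f : plane R -> plane R) (A B : set (plane R)) : injective f ->
  f @` A = f @` B -> A = B.
Proof.
move=> fi e; apply/seteqP; split => x Ax.
  have : (f @` A) (f x) by exists x.
  by rewrite e => -[y By /fi <-].
have : (f @` B) (f x) by exists x.
by rewrite -e => -[y By /fi <-].
Qed.

(* Of a symmetry we only use that it is injective and permutes tiles: vertices
   are the points in three tiles, edges the intersections of two tiles. *)
Section Image.
Variable f : plane R -> plane R.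
Hypotheses (fi : injective f) (fT : forall P, T P -> T (f @` P)).

Lemma image_vertex v : vertices M v -> vertices M (f v).
Proof.
move=> /hTs [P [Pi Pr _ _]].
have TP j : T (P j) /\ P j v by have : range P (P j) by []; rewrite Pr.
pose j (k : nat) (ks : (k < size s)%N) : 'I_(size s) := Ordinal ks.
have h0 : (0 < size s)%N by lia.
have h1 : (1 < size s)%N by lia.
have ne (k k' : nat) (hk : (k < size s)%N) (hk' : (k' < size s)%N) : k != k' ->
    f @` P (j k hk) <> f @` P (j k' hk').
  by move=> /eqP kl /(image_eq fi) /Pi [].
apply: (three_tiles hT (fT (TP (j _ h0)).1) (fT (TP (j _ h1)).1) (fT (TP (j _ s3)).1)
  (ne _ _ h0 h1 isT) (ne _ _ h0 s3 isT) (ne _ _ h1 s3 isT)); by exists v => //; exact: (TP _).2.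
Qed.

Lemma image_edge e : edges M e -> edges M (f @` e).
Proof.
move=> [P TP /sideP[a [b [h ->]]]]; have [Q TQ hQ] := ccw_across hT TP h.
have PQ : P <> Q by move=> e'; apply: (ccw_asym h); rewrite e'.
have Qm : Q (midpoint a b) by apply: (ccw_segment hQ); rewrite segmentC; exact: segment_mid.
have [E _] := side_meet hT TP TQ PQ h (segment_mid a b) (mid_corner h) Qm.
have fE : f @` segment a b = f @` P `&` f @` Q.
  rewrite -E; apply/seteqP; split => x.
    by move=> [y [Py Qy] <-]; split; exists y.
  by move=> [[y Py <-] [z Qz /fi zy]]; exists y => //; split => //; rewrite -zy.
have fPQ : f @` P <> f @` Q by move=> /(image_eq fi).
have Pa : P a by apply: corner_sub; exact: ccw_corner_l h.
have Qa : Q a by apply: corner_sub; exact: ccw_corner_r hQ.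
have [[_ [_ e']]|[sP _]] := tile_meet hT (fT TP) (fT TQ) fPQ (imageP f Pa) (imageP f Qa).
  have : (f @` segment a b) (f b) by exists b => //; exact: segment_r.
  by rewrite fE e' => /= /fi ba; case: (ccw_neq h).
by exists (f @` P); [exact: fT|rewrite fE].
Qed.

Lemma image_flagP Phi : flags M ((f (\val Phi).1.1, f @` (\val Phi).1.2), f @` (\val Phi).2).
Proof.
have [vv ee TF ve eF] := set_valP Phi; split => /=.
- exact: image_vertex.
- exact: image_edge.
- exact: fT.
- by exists (\val Phi).1.1.
- exact: image_subset.
Qed.

Definition image_flag Phi : flags M := SigSub (mem_set (image_flagP Phi)).

Lemma image_flag_inj : injective image_flag.
Proof.
move=> Phi Psi /(congr1 (fun X : flags M => \val X)) /= [/fi e1 /(image_eq fi) e2 /(image_eq fi) e3].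
apply: val_inj => /=; move: e1 e2 e3; case: (\val Phi) => -[? ?] ?; case: (\val Psi) => -[? ?] ? /=.
by move=> -> -> ->.
Qed.

Lemma image_flag_swap i Phi : image_flag (flag_swap i Phi) = flag_swap i (image_flag Phi).
Proof.
apply/esym; apply: flag_swap_unique hT _ _ _ _.
have := flag_adjacent_swap hT i Phi; rewrite /flag_adjacent /=.
case: (\val Phi) => -[v e] F; case: (\val (flag_swap i Phi)) => -[v' e'] F' /= [h1 h2 h3].
split.
- by rewrite -h1; split=> [/fi|->].
- by rewrite -h2; split=> [/(image_eq fi)|->].
- by rewrite -h3; split=> [/(image_eq fi)|->].
Qed.

Lemma image_flag_swaps w Phi : image_flag (swaps w Phi) = swaps w (image_flag Phi).
Proof. by elim: w => //= l w <-; exact: image_flag_swap. Qed.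

(** The number of sides is the order of the rotation about the face, and the induced map on flags
    commutes with the swaps. *)
Lemma image_flag_face n Phi : regular_polygon n (\val Phi).2 ->
  regular_polygon n (\val (image_flag Phi)).2.
Proof.
move=> reg; have [_ _ TF _ _] := set_valP (image_flag Phi).
have [m reg'] := tile_regular hT TF.
have it k : iter k (rotate ord_max) (image_flag Phi) = image_flag (iter k (rotate ord_max) Phi).
  by elim: k => //= k ->; rewrite /rotate !image_flag_swap.
have key k : (n %| k)%N <-> (m %| k)%N.
  rewrite -(face_order hT k (erefl : (ord_max : 'I_3) = 2%N :> nat) reg).
  rewrite -(face_order hT k (erefl : (ord_max : 'I_3) = 2%N :> nat) reg') it.
  by split=> [->//|/image_flag_inj].
suff -> : n = m by [].
by apply/eqP; rewrite eqn_dvd; apply/andP; split; [apply/key|apply/key].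
Qed.

End Image.

(** The face sizes are compared as well, because the next side of a regular polygon is determined by
    one side and the number of sides. *)
Definition translate t Phi Psi : Prop := exists sg a b P P' n,
  [/\ is_flag Phi sg a b P, is_flag Psi sg (a + t) (b + t) P',
      regular_polygon n P & regular_polygon n P'].

Lemma translate_refl Phi : translate 0 Phi Phi.
Proof.
have [sg [a [b [P h]]]] := flagP hT Phi; have [TP _ _] := h; have [n reg] := tile_regular hT TP.
by exists sg, a, b, P, P, n; rewrite !addr0; split.
Qed.

Lemma translate_trans t u Phi Psi X : translate t Phi Psi -> translate u Psi X -> translate (t + u) Phi X.
Proof.
move=> [sg [a [b [P [P' [n [h h' r r']]]]]]] [sg2 [a2 [b2 [P2 [P2' [n2 [h2 h2' r2 r2']]]]]]].
have [es ea eb eP] := is_flag_inj h' h2; subst sg2 a2 b2 P2.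
have nn := regular_polygon_unique r' r2; subst n2.
by exists sg, a, b, P, P2', n; rewrite !addrA; split.
Qed.

Lemma translate_unique t Phi Psi Psi' : translate t Phi Psi -> translate t Phi Psi' -> Psi = Psi'.
Proof.
move=> [sg [a [b [P [P' [n [h h' r r']]]]]]] [sg2 [a2 [b2 [P2 [P2' [n2 [h2 h2' r2 r2']]]]]]].
have [es ea eb eP] := is_flag_inj h h2; subst sg2 a2 b2 P2.
have [T1 c1 _] := h'; have [T2 c2 _] := h2'.
by rewrite (ccw_tile hT T1 T2 c1 c2) in h'; exact: is_flag_eq h' h2'.
Qed.

Lemma translate_sym t Phi Psi : translate t Phi Psi -> translate (- t) Psi Phi.
Proof.
move=> [sg [a [b [P [P' [n [h h' r r']]]]]]].
by exists sg, (a + t), (b + t), P', P, n; rewrite !addrK; split.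
Qed.

(** Crossing a side may lead to a face of another size; its agreement has to be supplied, and it
    comes from symmetries in [images_translate]. *)
Lemma translate_swap t i Phi Psi n : translate t Phi Psi ->
  regular_polygon n (\val (flag_swap i Phi)).2 -> regular_polygon n (\val (flag_swap i Psi)).2 ->
  translate t (flag_swap i Phi) (flag_swap i Psi).
Proof.
move=> [sg [a [b [P [P' [m [h h' r r']]]]]]].
have [TP c _] := h; have [TP' c' _] := h'.
case E : (val i) => [|[|k]] n1 n2.
- by exists (~~ sg), a, b, P, P', m; split=> //; exact: (swap0P hT E).
- case: sg h h' => h h'.
    have [d hd] := ccw_prev c; have [d' hd'] := ccw_prev c'.
    have dE : d' = d + t.
      have e1 := ccw_turn hd c r; have e2 := ccw_turn hd' c' r'.
      have : turn (2 * pi / m%:R) (a - d) = turn (2 * pi / m%:R) (a + t - d').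
        by apply: (addrI (a + t)); rewrite -e2 [in RHS]e1 addrAC.
      move=> /(congr1 (turn (- (2 * pi / m%:R)))); rewrite !turnK => e.
      by apply/plane_eqP; move/plane_eqP: e; rewrite !pxy; lra.
    exists false, d, a, P, P', m; split=> //; first exact: (swap1P_true hT E hd h).
    by rewrite -dE; exact: (swap1P_true hT E hd' h').
  have [d hd] := ccw_next c; have [d' hd'] := ccw_next c'.
  have dE : d' = d + t.
    rewrite (ccw_turn c hd r) (ccw_turn c' hd' r').
    have -> : b + t - (a + t) = b - a by rewrite opprD addrACA subrr addr0.
    by rewrite addrAC.
  exists true, b, d, P, P', m; split=> //; first exact: (swap1P_false hT E hd h).
  by rewrite -dE; exact: (swap1P_false hT E hd' h').
have iE : i = 2%N :> nat.
  by move: E (ltn_ord i); rewrite /=; case: (nat_of_ord i) => [|[|[|//]]].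
have [Q TQ hQ] := ccw_across hT TP c; have [Q' TQ' hQ'] := ccw_across hT TP' c'.
have hs := swap2P hT iE TQ hQ h; have hs' := swap2P hT iE TQ' hQ' h'.
exists (~~ sg), b, a, Q, Q', n; rewrite (flag_face hs) in n1; rewrite (flag_face hs') in n2.
by split.
Qed.

Hypothesis transitive : vertex_transitive T.
Hypothesis s24 : forall n, n \in s -> (n %| 24)%N.
Local Notation origin := (origin hT).

Definition unit_turn (k : nat) (x : plane R) : plane R := turn (2 * pi * k%:R / 24) x.

Lemma unit_turnD k k' x : unit_turn k (unit_turn k' x) = unit_turn (k + k') x.
Proof. by rewrite /unit_turn turn_turn -mulrDl -mulrDr -natrD. Qed.

Lemma unit_turn24 x : unit_turn 24 x = x.
Proof.
rewrite /unit_turn (_ : 2 * pi * 24 / 24 = 0 + 2 * pi); first by rewrite turn_2pi turn0.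
by rewrite mulfK ?pnatr_eq0 // add0r.
Qed.

Lemma unit_turn_mod k x : unit_turn (k %% 24) x = unit_turn k x.
Proof.
rewrite [in RHS](divn_eq k 24) addnC; elim: (k %/ 24)%N => [|q IH]; first by rewrite mul0n addn0.
by rewrite mulSn addnCA -unit_turnD unit_turn24.
Qed.

Lemma unit_turn_step n : n \in s -> exists k, forall x, turn (2 * pi / n%:R) x = unit_turn k x.
Proof.
move=> ns; have [q e] := dvdnP (s24 ns).
have n0 : n%:R != 0 :> R by rewrite pnatr_eq0; apply/eqP => z; move: e; rewrite z muln0.
have q0 : q%:R != 0 :> R by rewrite pnatr_eq0; apply/eqP => z; move: e; rewrite z.
have e24 : 24 = q%:R * n%:R :> R by rewrite -natrM -e.
exists q => x; rewrite /unit_turn e24; congr turn.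
by move: (pi : R) => p; field; rewrite n0 q0.
Qed.

(** Passing to the next side of an [n]-gon turns the side vector by a full turn over [n], and
    changing the face reverses it; both are multiples of a 24th of a full turn. *)
Lemma origin_vec : exists d : plane R, forall Phi sg a b P, is_flag Phi sg a b P ->
  exists k, b - a = unit_turn k d.
Proof.
have [sg0 [a0 [b0 [P0 h0]]]] := flagP hT origin; exists (b0 - a0) => Phi.
have [w <-] := linked_all hT s3 hTs origin Phi.
elim: w => [|l w IH] sg a b P h.
  have [_ -> -> _] := is_flag_inj h h0; exists 0%N.
  by rewrite /unit_turn mulr0 mul0r turn0.
have [sg1 [a1 [b1 [P1 h1]]]] := flagP hT (swaps w origin).
have [a' [b' [P' [h' st]]]] := flag_swapP hT l h1.
have [_ ea eb eP] := is_flag_inj h h'; subst a b P.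
have [k hk] := IH _ _ _ _ h1; have [TP1 c1 _] := h1; have [_ c' _] := h'.
have [n ns reg] := face_size hT s3 hTs TP1; have [q hq] := unit_turn_step ns.
case: st => _; rewrite /flag_step; case: (nat_of_ord l) => [[-> -> _]|[[PE st]|_ [-> ->]]].
- by exists k.
- rewrite PE in c'; case: (sg1) st => st; subst.
    (* Going to the preceding side turns backwards; [23 * q] is [-q] modulo 24. *)
    have e := ccw_turn c' c1 reg; exists (k + 23 * q)%N.
    have e2 : b1 - a1 = unit_turn q (a1 - a') by rewrite -hq {1}e addrC addKr.
    rewrite addnC -unit_turnD -hk e2 unit_turnD -mulSnr -unit_turn_mod modnMr.
    by rewrite /unit_turn mulr0 mul0r turn0.
  exists (q + k)%N; rewrite -unit_turnD -hk -hq.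
  by rewrite {1}(ccw_turn c1 c' reg) addrC addKr.
(* A half turn is 12 of the 24 steps. *)
- exists (12 + k)%N; rewrite -unit_turnD -hk /unit_turn (_ : 2 * pi * 12 / 24 = pi).
    by rewrite turn_pi opprB.
  by move: (pi : R) => p; field.
Qed.

Lemma isometry_inj (f : plane R -> plane R) : plane_isometry f -> injective f.
Proof.
move=> iso x y e; have := iso x y; rewrite e subrr enormE !pxy expr0n addr0 sqrtr0 => /esym /enorm0_eq0.
by move/eqP; rewrite subr_eq0 => /eqP.
Qed.

(** Both flags are images of one flag under symmetries and follow the same word, so their face sizes
    agree at every step and the displacement persists. *)
Lemma images_translate f g (fi : injective f) (fT : forall P, T P -> T (f @` P))
    (gi : injective g) (gT : forall P, T P -> T (g @` P)) sg a b P a' b' P' w :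
  is_flag (image_flag fi fT origin) sg a b P -> is_flag (image_flag gi gT origin) sg a' b' P' ->
  b - a = b' - a' ->
  translate (a' - a) (swaps w (image_flag fi fT origin)) (swaps w (image_flag gi gT origin)).
Proof.
move=> h h' e; elim: w => [|l w IH].
  have [_ _ TF _ _] := set_valP origin; have [n reg] := tile_regular hT TF.
  have r1 := image_flag_face fi fT reg; have r2 := image_flag_face gi gT reg.
  rewrite (flag_face h) in r1; rewrite (flag_face h') in r2.
  exists sg, a, b, P, P', n; split => //.
  have -> : a + (a' - a) = a' by rewrite addrC subrK.
  by have -> : b + (a' - a) = b' by rewrite addrCA e addrC subrK.
have [_ _ TF _ _] := set_valP (swaps (l :: w) origin); have [n reg] := tile_regular hT TF.
by apply: (translate_swap (n := n) IH); rewrite -image_flag_swaps -image_flag_swap; exact: image_flag_face.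
Qed.

(** Both directions are demanded so that the periods form a group. *)
Definition period t : Prop :=
  (forall Phi, exists Psi, translate t Phi Psi) /\ (forall Phi, exists Psi, translate (- t) Phi Psi).

Lemma period0 : period 0.
Proof. by split=> Phi; exists Phi; rewrite ?oppr0; exact: translate_refl. Qed.

Lemma periodN t : period t -> period (- t).
Proof. by move=> [h1 h2]; split => //; rewrite opprK. Qed.

Lemma periodD t u : period t -> period u -> period (t + u).
Proof.
move=> [t1 t2] [u1 u2]; split=> Phi.
  by have [Psi h] := t1 Phi; have [X h'] := u1 Psi; exists X; exact: translate_trans h h'.
have [Psi h] := t2 Phi; have [X h'] := u2 Psi; exists X; rewrite opprD.
exact: translate_trans h h'.
Qed.

Lemma periodMz t (k : int) : period t -> period (t *~ k).
Proof.
have H n u : period u -> period (u *+ n).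
  by move=> pu; elim: n => [|n IH]; [exact: period0|rewrite mulrS; exact: periodD].
by move=> pt; case: k => n; [exact: H|rewrite NegzE mulrNz; apply: periodN; exact: H].
Qed.

(* Two symmetries carrying the base flag to flags with parallel edges and the
   same orientation differ by a translation; edges have only 24 directions. *)
Lemma vertex_classes : exists (c : plane R -> bool * 'I_24), forall v u,
  vertices M v -> vertices M u -> c v = c u -> period (u - v).
Proof.
have [d hd] := origin_vec; have [vo _ _ _ _] := set_valP origin.
pose good v (dat : bool * 'I_24) := exists f (fi : injective f) (fT : forall P, T P -> T (f @` P)) a b P,
  [/\ is_flag (image_flag fi fT origin) dat.1 a b P, b - a = unit_turn dat.2 d
    & v = if dat.1 then a else b].
have H v : exists dat, vertices M v -> good v dat.
  have [vv|nv] := pselect (vertices M v); last by exists (true, ord0).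
  have [f [iso fT0] fv] := transitive vo vv.
  have fi := isometry_inj iso; have fT P : T P -> T (f @` P) by move/fT0.
  have [sg [a [b [P h]]]] := flagP hT (image_flag fi fT origin).
  have [k hk] := hd _ _ _ _ _ h.
  have k24 : (k %% 24 < 24)%N by rewrite ltn_mod.
  exists (sg, Ordinal k24) => _; exists f, fi, fT, a, b, P; split => //.
    by rewrite /= unit_turn_mod.
  by have [_ _ e] := h; move: (congr1 (fun X => X.1.1) e); rewrite /= fv.
have [c hc] := choice H; exists c => v u vv uu e.
have [f [fi [fT [a [b [P [h hb va]]]]]]] := hc v vv.
have [g [gi [gT [a' [b' [P' [h' hb' ua]]]]]]] := hc u uu.
rewrite -e in h' hb' ua; have ee : b - a = b' - a' by rewrite hb hb'.
(* The side vectors agree, so initial and terminal vertices are displaced by the same amount. *)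
have -> : u - v = a' - a.
  rewrite va ua; case: (c v).1 => //; move: ee => /plane_eqP; rewrite !pxy => -[e1 e2].
  by apply/plane_eqP; rewrite !pxy; split; lra.
split=> Phi.
  have [w <-] := linked_all hT s3 hTs (image_flag fi fT origin) Phi.
  by exists (swaps w (image_flag gi gT origin)); exact: images_translate h h' ee.
have [w <-] := linked_all hT s3 hTs (image_flag gi gT origin) Phi.
by exists (swaps w (image_flag fi fT origin)); apply: translate_sym; exact: images_translate h h' ee.
Qed.

Lemma det_affine u : affine_form (det u).
Proof. by exists (- py u), (px u), 0 => x; rewrite /det; ring. Qed.

Lemma vertex_bound (f : plane R -> R) (B : R) : affine_form f ->
  (forall v, vertices M v -> f v <= B) -> forall x, f x <= B.
Proof.
move=> [a [b [d fE]]] fB x; have [P TP Px] := tile_cover hT x.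
have [n [c [r [t [n3 r0 PE]]]]] := tile_regular hT TP.
have af : affine_form (fun y => B - f y).
  by exists (- a), (- b), (B - d) => y; rewrite fE; ring.
rewrite PE in Px; suff : 0 <= B - f x by rewrite subr_ge0.
apply: (hull_ge0 af _ Px) => i; rewrite subr_ge0; apply: fB.
by exists P => //; exists n, c, r, t, i.
Qed.

(** If all periods lay on one line, the linear form [det u] would be constant on each of the 48
    vertex classes, hence bounded on vertices and, by convexity of tiles, on the whole plane. *)
Lemma independent_periods : exists t u, [/\ period t, period u & det t u != 0].
Proof.
have [c hc] := vertex_classes; apply: contrapT => no.
have dep t u : period t -> period u -> det t u = 0.
  by move=> pt pu; apply/eqP; apply: contrapT => /negP h; apply: no; exists t, u.
have [u u0 hu] : exists2 u : plane R, u <> 0 & forall t, period t -> det u t = 0.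
  have [[u [pu u0]]|nz] := pselect (exists u, period u /\ u <> 0).
    by exists u => // t; exact: dep.
  (* If 0 is the only period, any direction will do. *)
  exists (vec2 1 0) => [/plane_eqP[]|t pt].
    by rewrite !pxy => /eqP; rewrite oner_eq0.
  have -> : t = 0 by apply: contrapT => t0; apply: nz; exists t.
  by rewrite /det !pxy; ring.
pose rep (x : bool * 'I_24) := xget (0 : plane R) [set v | vertices M v /\ c v = x].
pose B := \sum_x `|det u (rep x)|.
have bound v : vertices M v -> det u v <= B.
  move=> vv; have [vr cr] : vertices M (rep (c v)) /\ c (rep (c v)) = c v.
    by rewrite /rep; case: xgetP => [w _ //|/(_ v)] [].
  have := hu _ (hc _ _ vr vv cr); rewrite /det !pxy => e.
  have -> : px u * py v - py u * px v = det u (rep (c v)) by rewrite /det; lra.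
  apply: le_trans (ler_norm _) _; rewrite /B (bigD1 (c v)) //= lerDl.
  by apply: sumr_ge0 => x _; exact: normr_ge0.
have := sq_gt0 (fun e : 0 = u => u0 (esym e)); rewrite subr0; set q := _ + _ => q0.
have := vertex_bound (det_affine u) bound (((B + 1) / q) *: quarter u).
have -> : det u (((B + 1) / q) *: quarter u) = B + 1.
  have qn : q != 0 by rewrite gt_eqF.
  rewrite /det !pxy (_ : _ - _ = (B + 1) / q * q); last by rewrite /q; ring.
  by rewrite divfK.
lra.
Qed.

End Symmetries.

(** * The lattice of periods acting on flags *)

Section TilingLattice.
Variables (R : realType) (T : set (set (plane R))) (s : seq nat).
Hypotheses (hT : tessellation T) (s3 : (3 <= size s)%N).
Hypothesis hTs : forall v, vertices (tiling_map T) v -> vertex_symbol T v s.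
Local Notation M := (tiling_map T).
Implicit Types (P Q : set (plane R)) (a b x v t u : plane R) (Phi Psi : flags M).
Implicit Types (k l m n : int).

Definition flag_source Phi : plane R := (\val Phi).1.1.

Lemma translate_source t Phi Psi : translate t Phi Psi -> flag_source Psi = flag_source Phi + t.
Proof.
by move=> [sg [a [b [P [P' [n [[_ _ e] [_ _ e'] _ _]]]]]]]; rewrite /flag_source e e' /=; case: (sg).
Qed.

Lemma tiles_meet_compact (K : set (plane R)) : compact K -> finite_set [set P | T P /\ P `&` K !=set0].
Proof.
move=> /compact_near_coveringP cK.
pose FF : set_system (seq (set (plane R))) := 
    filter_from setT (fun F : seq (set (plane R)) => [set F' : seq (set (plane R)) | {subset F <= F'}]).
have FFf : Filter FF.
  apply: filter_from_filter; first by exists [::].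
  move=> F F' _ _; exists (F ++ F') => //.
  by move=> F'' /= H; split => x xF; apply: H; rewrite mem_cat xF ?orbT.
have : \forall F \near FF, K `<=` (fun x => forall P, T P -> P x -> P \in F).
  apply: cK => x Kx; have [U nU /finite_seqP [F FE]] := tile_locally_finite hT x.
  exists (U, [set F' : seq (set (plane R)) | {subset F <= F'}]); first by split => //; exists F.
  move=> [y F'] /= [Uy FF'] P TP Py; apply: FF'.
  have : [set P | T P /\ P `&` U !=set0] P by split => //; exists y.
  by rewrite FE.
case=> F _ FK; apply: (sub_finite_set (B := [set` F])); last exact: finite_seq.
by move=> P [TP [x [Px Kx]]]; exact: (FK F _ x Kx).
Qed.

Lemma face_flags_finite P : T P -> finite_set [set Phi : flags M | (\val Phi).2 = P].
Proof.
move=> TP; have [n reg] := tile_regular hT TP; have [a [b h]] := tile_ccw hT TP.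
pose Y := mkflag true TP h; have hY := mkflagP true TP h.
pose f (x : 'I_n * bool) : flags M := let X := iter x.1 (rotate ord_max) Y in
  if x.2 then X else flag_swap ord0 X.
apply: (sub_finite_set (B := range f)); last exact: finite_image.
move=> Phi hP; have [Psi [a' [b' [e _ hPsi]]]] := positive_flag hT Phi.
rewrite hP in hPsi; have [m mn mE] := face_flags hT reg hY hPsi.
case: e => e; [exists (Ordinal mn, true)|exists (Ordinal mn, false)] => //=.
  by rewrite /f /= -mE.
by rewrite /f /= -mE.
Qed.

Lemma source_flags_finite (K : set (plane R)) : compact K ->
  finite_set [set Phi : flags M | K (flag_source Phi)].
Proof.
move=> /tiles_meet_compact fK.
apply: (sub_finite_set (B := \bigcup_(P in [set P | T P /\ P `&` K !=set0])
  [set Phi : flags M | (\val Phi).2 = P])).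
  move=> Phi KPhi; have [_ _ TF ve eF] := set_valP Phi.
  by exists (\val Phi).2 => //; split => //; exists (flag_source Phi); split => //; exact: eF.
by apply: bigcup_finite => // P [TP _]; exact: face_flags_finite.
Qed.

Variables t1 t2 : plane R.
Hypotheses (p1 : period T t1) (p2 : period T t2) (t12 : det t1 t2 != 0).

Definition lattice_vec k l : plane R := t1 *~ k + t2 *~ l.

Lemma lattice_vecE k l : lattice_vec k l = k%:~R *: t1 + l%:~R *: t2.
Proof. by rewrite /lattice_vec !scaler_int. Qed.

Lemma lattice_period k l : period T (lattice_vec k l).
Proof. by apply: periodD; exact: periodMz. Qed.

Definition flag_shift k l Phi : flags M := projT1 (cid ((lattice_period k l).1 Phi)).

Lemma flag_shiftP k l Phi : translate (lattice_vec k l) Phi (flag_shift k l Phi).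
Proof. exact: projT2 (cid ((lattice_period k l).1 Phi)). Qed.

Lemma lattice_vec0 : lattice_vec 0 0 = 0.
Proof. by rewrite /lattice_vec !mulr0z addr0. Qed.

Lemma lattice_vecD k l k' l' : lattice_vec (k + k') (l + l') = lattice_vec k l + lattice_vec k' l'.
Proof. by rewrite /lattice_vec !mulrzDr addrACA. Qed.

Lemma flag_shift0 Phi : flag_shift 0 0 Phi = Phi.
Proof.
have := flag_shiftP 0 0 Phi; rewrite lattice_vec0 => h.
exact: (translate_unique hT h (translate_refl hT Phi)).
Qed.

Lemma flag_shiftD k l k' l' Phi :
  flag_shift k l (flag_shift k' l' Phi) = flag_shift (k + k') (l + l') Phi.
Proof.
have h := translate_trans (flag_shiftP k' l' Phi) (flag_shiftP k l _).
apply: (translate_unique hT h); rewrite -lattice_vecD ![k' + _]addrC ![l' + _]addrC.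
exact: flag_shiftP.
Qed.

(** For swaps that keep the face, the sizes agree by definition. For the swap across a side, the
    shift of the swapped flag has the same directed side as the swap of the shifted flag, and that
    side determines the tile. *)
Lemma flag_shift_swap k l i Phi :
  flag_swap i (flag_shift k l Phi) = flag_shift k l (flag_swap i Phi).
Proof.
have [sg [a [b [P [P' [n [h h' r r']]]]]]] := flag_shiftP k l Phi.
have hs := flag_shiftP k l (flag_swap i Phi).
have face (X : flags M) : i <> 2%N :> nat -> (\val (flag_swap i X)).2 = (\val X).2.
  move=> i2; have := flag_adjacent_swap hT i X; rewrite /flag_adjacent.
  by case: (\val X) (\val (flag_swap i X)) => -[? ?] ? [[? ?] ?] [_ _ [_ ->]].
have [i2|i2] := pselect (i = 2%N :> nat); last first.
  apply: (translate_unique hT _ hs); apply: (translate_swap hT (n := n) (flag_shiftP k l Phi)).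
    by rewrite face // (flag_face h).
  by rewrite face // (flag_face h').
have [TP c _] := h; have [TP' c' _] := h'.
have [Q TQ hQ] := ccw_across hT TP c; have [Q' TQ' hQ'] := ccw_across hT TP' c'.
have h1 := swap2P hT i2 TQ hQ h; have h1' := swap2P hT i2 TQ' hQ' h'.
have [sg2 [a2 [b2 [P2 [P2' [n2 [h2 h2' _ _]]]]]]] := hs.
have [es ea eb _] := is_flag_inj h1 h2; subst sg2 a2 b2.
have [T2 c2 _] := h2'; rewrite (ccw_tile hT T2 TQ' c2 hQ') in h2'.
exact: is_flag_eq h1' h2'.
Qed.

(** A fixed flag has a fixed vertex, so the lattice vector is 0; its determinants with [t1] and [t2]
    isolate the two coefficients. *)
Lemma flag_shift_free k l Phi : flag_shift k l Phi = Phi -> k = 0 /\ l = 0.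
Proof.
move=> e; have := translate_source (flag_shiftP k l Phi); rewrite e => /esym/eqP.
rewrite -subr_eq0 addrAC subrr add0r => /eqP h.
have d1 : det (lattice_vec k l) t2 = k%:~R * det t1 t2.
  by rewrite lattice_vecE /det !pxy; ring.
have d2 : det t1 (lattice_vec k l) = l%:~R * det t1 t2.
  by rewrite lattice_vecE /det !pxy; ring.
have z1 : det 0 t2 = 0 by rewrite /det !pxy; ring.
have z2 : det t1 0 = 0 by rewrite /det !pxy; ring.
move: d1 d2; rewrite h z1 z2 => /esym/eqP + /esym/eqP.
by rewrite !mulf_eq0 (negbTE t12) !orbF !intr_eq0 => /eqP -> /eqP ->.
Qed.

Definition cell : set (plane R) :=
  (fun p : R * R => p.1 *: t1 + p.2 *: t2) @` (`[0, 1] `*` `[0, 1]).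

Lemma cell_compact : compact cell.
Proof.
apply: continuous_compact.
  apply: continuous_subspaceT; rewrite (_ : (fun _ => _) = fun p : R * R =>
    vec2 (p.1 * px t1 + p.2 * px t2) (p.1 * py t1 + p.2 * py t2)); last first.
    by apply/funext => p; apply/plane_eqP; rewrite !pxy.
  have c1 : continuous (fun p : R * R => p.1) by move=> p; exact: cvg_fst.
  have c2 : continuous (fun p : R * R => p.2) by move=> p; exact: cvg_snd.
  by apply: vec2_continuous; apply: contD; apply: contM => //; exact: contC.
by apply: compact_setX; exact: segment_compact.
Qed.

Lemma cell_reduce x : exists k l, cell (x + lattice_vec k l).
Proof.
pose al := det x t2 / det t1 t2; pose be := det t1 x / det t1 t2.
have xE : x = al *: t1 + be *: t2.
  have d : det t1 t2 != 0 := t12; rewrite /al /be; move: d; rewrite /det => d.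
  by apply/plane_eqP; rewrite !pxy; split; field.
exists (- Num.floor al), (- Num.floor be).
exists (al - (Num.floor al)%:~R, be - (Num.floor be)%:~R).
  have h (y : R) : 0 <= y - (Num.floor y)%:~R <= 1.
    by have := floor_itv y; rewrite intrD; lra.
  by split; rewrite /= in_itv /=; exact: h.
rewrite lattice_vecE [in RHS]xE /fst /snd !mulrNz.
move: (_%:~R) (_%:~R) => c d; by apply/plane_eqP; rewrite !pxy; split; ring.
Qed.

(** Every flag can be shifted so that its vertex lies in the fundamental parallelogram, which is
    compact and so contains the vertices of finitely many flags only. *)
Lemma tiling_lattice : exists L : flag_lattice M, True.
Proof.
have /finite_seqP [D DE] := source_flags_finite cell_compact.
have cov Phi : exists2 Psi, Psi \in D & exists k l, Phi = flag_shift k l Psi.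
  have [k [l h]] := cell_reduce (flag_source Phi); exists (flag_shift k l Phi).
    have : [set Phi : flags M | cell (flag_source Phi)] (flag_shift k l Phi).
      by rewrite /= (translate_source (flag_shiftP k l Phi)).
    by rewrite DE.
  by exists (- k), (- l); rewrite flag_shiftD !addNr flag_shift0.
by exists (FlagLattice flag_shift0 flag_shiftD flag_shift_swap flag_shift_free cov).
Qed.

End TilingLattice.

Lemma archimedean_symbolP (s : seq nat) : s \in archimedean_symbols ->
  [/\ (3 <= size s)%N, forall n, n \in s -> (n %| 24)%N
    & (size s)%:R^-1 + 2^-1 + (\big[lcmn/1]_(n <- s) n)%:R^-1 < 1 :> rat].
Proof.
move=> hs; have lcmE : (\big[lcmn/1]_(n <- s) n = foldr lcmn 1 s)%N.
  by elim: (s) => [|n s' IH]; rewrite ?big_nil // big_cons IH.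
(* The list contains the pairs of valence and least common multiple that occur for the eight
   symbols, so the inequality is checked in six cases. *)
have /allP H : all (fun s => [&& 3 <= size s, all (fun n => n %| 24) s &
    (size s, foldr lcmn 1 s) \in [:: (5, 6); (5, 12); (4, 6); (3, 12); (3, 8); (4, 12)]])%N
  archimedean_symbols by vm_compute.
have /and3P[s3 /allP s24 sl] := H s hs; split=> //; rewrite lcmE; move: sl.
move: (size s) (foldr lcmn 1%N s) => x y; rewrite !inE !xpair_eqE.
by do ?[case/orP]; move=> /andP[/eqP -> /eqP ->]; lra.
Qed.

Theorem corollary4p6 (R : realType) (T : set (set (plane R))) (s : seq nat)
    (hT : archimedean_tiling T)
    (hs : s \in archimedean_symbols)
    (hTs : forall v, vertices (tiling_map T) v -> vertex_symbol T v s) :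
  homeomorphic_to_loch_ness_monster R (minimal_regular_cover R (tiling_map T)).
Proof.
have [tess trans _] := hT; have [s3 s24 hyp] := archimedean_symbolP hs.
pose r := tiling_graph tess s3 hTs.
have [t1 [t2 [p1 p2 t12]]] := independent_periods tess s3 hTs trans s24.
have [L _] := tiling_lattice tess p1 p2 t12.
have tr := tiling_transitive tess s3 hTs.
have Phi0 := origin tess.
(* The cover is its own model of the Loch Ness monster, with the identity as homeomorphism. *)
exists (minimal_regular_cover R (tiling_map T)); last first.
  by exists id, id; split => //; move=> x; exact: cvg_id.
split.
- exact: (@cover_surface R _ _ r).
- apply: (@cover_infinite_genus R _ _ r); last exact: (cayley_folner r L tr Phi0).
  by rewrite big_ord_recl big_ord_recl big_ord1 /= addrA.
- exact: (@cover_one_end R _ _ r (Mon_infinite r L tr Phi0) (cayley_one_ended r L tr Phi0)).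
Qed.
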